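(* Let $T^{\mathrm{slow}} = \{n^{o(1)}\} \cup \{o(n^{1/k}) : k \in \mathbb{N}^+\}$. For $k \ge 1$ let $f(o(n^{1/k})) := O(n^{1/(k+1)})$, and let $f(n^{o(1)}) := O(\log n)$. Let $T \in T^{\mathrm{slow}}$ and let $\Pi$ be any LCL problem on trees that can be solved by a randomized LOCAL algorithm running in $T$ rounds and succeeding with probability at least $1-1/n$ on every graph with at most $n$ nodes. Then $\Pi$ can be solved by a deterministic CONGEST algorithm running in $f(T)$ rounds. Moreover, given the description of $\Pi$, it is decidable whether there exists a deterministic CONGEST algorithm solving $\Pi$ in $f(T)$ rounds, and if so such an algorithm can be obtained from the description of $\Pi$.
   Context: An LCL (locally checkable labeling) problem is a tuple $\Pi=(\Sigma_{\mathrm{in}},\Sigma_{\mathrm{out}},C,r)$ where $\Sigma_{\mathrm{in}},\Sigma_{\mathrm{out}}$ are finite label sets, $r$ is a constant (checkability radius), and $C$ is a finite set of pairs $(H,v)$ where $H$ is a graph, $v$ a node of $H$ of radius at most $r$ in $H$, and every node-edge pair (half-edge) of $H$ carries a label from $\Sigma_{\mathrm{in}}$ and one from $\Sigma_{\mathrm{out}}$. Input graphs have maximum degree bounded by a constant $\Delta$. Solving $\Pi$: given a graph whose half-edges carry input labels from $\Sigma_{\mathrm{in}}$, assign output labels from $\Sigma_{\mathrm{out}}$ to all half-edges such that the labeled radius-$r$ ball around every node is isomorphic to a labeled graph in $C$. LOCAL model: the $n$-node connected input graph is the communication network; nodes communicate in synchronous rounds, sending arbitrarily large messages to neighbors. CONGEST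 model: identical but messages have $O(\log n)$ bits. A randomized algorithm $\mathcal{A}(n)$ receives an upper bound $n$ on the number of nodes, always terminates within its stated round bound (Monte Carlo), has no unique IDs, and each node uses a finite number $h_{\mathcal{A}}(n)$ of random bits. A deterministic algorithm receives unique IDs from an ID space of size polynomial in $n$ (an ID fits in a CONGEST message) and must always be correct on all graphs with at most $n$ nodes. *)

(* Defs.v *)
From Stdlib Require Import Reals.
From mathcomp Require Import all_boot all_order all_algebra.
Unset Printing Implicit Defensive.

(* Graphs.  Nodes are 'I_N; gadj G v is the list of neighbours of v; the    *)
(* position of a neighbour in this list is its port number at v.           *)
(* A half-edge (node-edge pair) is identified with an ordered pair (v,w),   *)
(* w a neighbour of v.                                                      *)
Record graph := Graph { gN : nat; gadj : 'I_gN -> seq 'I_gN }.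

Definition adjb (G : graph) : rel 'I_(gN G) := fun u v => v \in gadj G u.

Definition simple_graph (G : graph) : Prop :=
  forall u : 'I_(gN G),
    [/\ uniq (gadj G u), u \notin gadj G u &
        forall v, v \in gadj G u -> u \in gadj G v].

Definition connected (G : graph) : Prop :=
  forall u v : 'I_(gN G), connect (adjb G) u v.

Definition acyclic (G : graph) : Prop :=
  ~ exists c : seq 'I_(gN G), [/\ uniq c, 3 <= size c & cycle (adjb G) c].

Definition is_tree (G : graph) : Prop :=
  [/\ 0 < gN G, simple_graph G, connected G & acyclic G].

Definition max_deg_le (G : graph) (D : nat) : Prop :=
  forall u, size (gadj G u) <= D.

(* labels on half-edges: lab v w = label of half-edge (v, {v,w}) *)
Definition labeling (G : graph) := 'I_(gN G) -> 'I_(gN G) -> nat.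

Inductive within {T : Type} (e : T -> T -> bool) : nat -> T -> T -> Prop :=
| within0 r x : within e r x x
| withinS r x y z : within e r x y -> e y z -> within e r.+1 x z.

(* A centered labeled graph (H, c): nodes 0..csize-1, center ccenter, and   *)
(* edge list; an entry (a,b,ia,oa,ib,ob) is the edge {a,b} whose half-edge *)
(* at a carries (input ia, output oa) and at b carries (ib, ob).           *)
Record cgraph := CGraph {
  csize : nat;
  cedges : seq (nat * nat * nat * nat * nat * nat);
  ccenter : nat }.

Definition hlab (H : cgraph) (a b : nat) : option (nat * nat) :=
  (fix go (es : seq (nat * nat * nat * nat * nat * nat)) :=
     match es with
     | [::] => None
     | (a', b', ia, oa, ib, ob) :: es' =>
         if (a' == a) && (b' == b) then Some (ia, oa)
         else if (a' == b) && (b' == a) then Some (ib, ob)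
         else go es'
     end) (cedges H).

Definition hadjb (H : cgraph) : rel nat := fun a b => hlab H a b != None.

(* Pi = (Sigma_in = {0..nin-1}, Sigma_out = {0..nout-1}, C, r), for graphs of
   maximum degree <= Delta *)
Record LCL := MkLCL {
  lDelta : nat; lnin : nat; lnout : nat; lrad : nat; lC : seq cgraph }.

Definition wf_cgraph (P : LCL) (H : cgraph) : Prop :=
  [/\ ccenter H < csize H,
      (forall a b ia oa ib ob, List.In (a, b, ia, oa, ib, ob) (cedges H) ->
         [/\ a < csize H, b < csize H, a != b,
             (ia < lnin P) && (ib < lnin P) & (oa < lnout P) && (ob < lnout P)]) &
      forall j, j < csize H -> within (hadjb H) (lrad P) (ccenter H) j].

Definition wf_lcl (P : LCL) : Prop := forall H, List.In H (lC P) -> wf_cgraph P H.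

Definition ball_iso (P : LCL) (G : graph) (inp out : labeling G)
    (v : 'I_(gN G)) (H : cgraph) : Prop :=
  let ball := within (adjb G) (lrad P) v in
  exists f : 'I_(gN G) -> nat,
   [/\ f v = ccenter H,
       (forall w w', ball w -> ball w' -> f w = f w' -> w = w'),
       (forall w, ball w -> f w < csize H),
       (forall j, j < csize H -> exists2 w, ball w & f w = j) &
       (forall w w', ball w -> ball w' ->
          hlab H (f w) (f w') =
            if adjb G w w' then Some (inp w w', out w w') else None)].

Definition valid_instance (P : LCL) (G : graph) (inp : labeling G) : Prop :=
  [/\ is_tree G, max_deg_le G (lDelta P) &
      forall u v, adjb G u v -> inp u v < lnin P].

Definition valid_output (P : LCL) (G : graph) (inp out : labeling G) : Prop :=
  (forall u v, adjb G u v -> out u v < lnout P) /\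
  forall v, exists2 H, List.In H (lC P) & ball_iso P G inp out v H.

(* Synchronous message passing.  I = initial knowledge of a node,           *)
(* S = local states, M = messages.  In each round every node sends a_send s i *)
(* on port i, then updates its state with the list of received messages     *)
(* (indexed by port).  After t rounds node v outputs a_out s i on port i.  *)
Record mp_alg (I S M : Type) := MPAlg {
  a_init : I -> S;
  a_send : S -> nat -> M;
  a_recv : S -> seq M -> S;
  a_out  : S -> nat -> nat }.
Arguments MPAlg {I S M}.
Arguments a_init {I S M}.
Arguments a_send {I S M}.
Arguments a_recv {I S M}.
Arguments a_out {I S M}.

Fixpoint run {I S M : Type} (A : mp_alg I S M) (G : graph) (info : 'I_(gN G) -> I)
    (t : nat) : 'I_(gN G) -> S :=
  match t with
  | 0 => fun v => a_init A (info v)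
  | t'.+1 =>
      fun v =>
        a_recv A (run A G info t' v)
          [seq a_send A (run A G info t' u) (index v (gadj G u)) | u <- gadj G v]
  end.

Definition output {I S M : Type} (A : mp_alg I S M) (G : graph) (info : 'I_(gN G) -> I)
    (t : nat) : labeling G :=
  fun v w => a_out A (run A G info t v) (index w (gadj G v)).

Definition inputs_of (G : graph) (inp : labeling G) (v : 'I_(gN G)) : seq nat :=
  [seq inp v u | u <- gadj G v].

(* ---- randomized LOCAL (no IDs; node knows n, its port inputs, and h(n)
   private random bits; messages unbounded; Monte Carlo, t(n) rounds) ---- *)
Definition rand_local_solves (P : LCL) (t : nat -> nat) : Prop :=
  exists (S M : nat -> Type) (h : nat -> nat)
         (A : forall n, mp_alg (seq bool * seq nat) (S n) (M n)),
  forall n (G : graph) (inp : labeling G),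
    gN G <= n -> valid_instance P G inp ->
    exists E : {set {ffun 'I_(gN G) -> (h n).-tuple bool}},
      (forall rb, rb \in E <->
         valid_output P G inp
           (output (A n) G (fun v => (val (rb v), inputs_of G inp v)) (t n))) /\
      (1 - n%:R^-1 <=
         #|E|%:R / #|{ffun 'I_(gN G) -> (h n).-tuple bool}|%:R :> rat)%R.

(* ---- deterministic CONGEST with ID space {0,..,n^c - 1}: a node knows n,
   its ID and its port inputs; messages are numbers < 2^(B*(log n + 1)),
   i.e. O(log n)-bit strings; must be correct on every admissible graph with
   at most n nodes and every unique ID assignment ---- *)
Definition det_congest_with (P : LCL) (c : nat) (t : nat -> nat) (S : nat -> Type)
    (A : forall n, mp_alg (nat * seq nat) (S n) nat) : Prop :=
  exists B : nat,
  forall n (G : graph) (inp : labeling G) (id : 'I_(gN G) -> nat),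
    gN G <= n -> valid_instance P G inp ->
    injective id -> (forall v, id v < n ^ c) ->
    let info := fun v => (id v, inputs_of G inp v) in
    (forall s v i, s < t n -> i < size (gadj G v) ->
       a_send (A n) (run (A n) G info s v) i < 2 ^ (B * (trunc_log 2 n).+1)) /\
    valid_output P G inp (output (A n) G info (t n)).

Definition det_congest_solves (P : LCL) (c : nat) (t : nat -> nat) : Prop :=
  exists (S : nat -> Type) (A : forall n, mp_alg (nat * seq nat) (S n) nat),
    det_congest_with P c t S A.

Definition rpowk (n k : nat) : R := Rpower (INR n) (Rinv (INR k)).

Definition little_o_root (k : nat) (t : nat -> nat) : Prop :=
  forall eps : R, Rlt 0 eps ->
    exists n0, forall n, n0 <= n -> Rle (INR (t n)) (Rmult eps (rpowk n k)).

Definition subpoly (t : nat -> nat) : Prop :=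
  forall eps : R, Rlt 0 eps ->
    exists n0, forall n, n0 <= n -> Rle (INR (t n)) (Rpower (INR n) eps).

Definition big_O_root (k : nat) (t : nat -> nat) : Prop :=
  exists (K : R) (n0 : nat), forall n, n0 <= n -> Rle (INR (t n)) (Rmult K (rpowk n k)).

Definition big_O_log (t : nat -> nat) : Prop :=
  exists (K : R) (n0 : nat), forall n, n0 <= n -> Rle (INR (t n)) (Rmult K (ln (INR n))).

Inductive slow_class := SubPoly | LittleORoot of nat.

Definition slow_class_ok (T : slow_class) : Prop :=
  match T with SubPoly => True | LittleORoot k => 0 < k end.

Definition in_class (T : slow_class) (t : nat -> nat) : Prop :=
  match T with SubPoly => subpoly t | LittleORoot k => little_o_root k t end.

Definition in_f_class (T : slow_class) (t : nat -> nat) : Prop :=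
  match T with SubPoly => big_O_log t | LittleORoot k => big_O_root k.+1 t end.

Definition det_congest_fT (T : slow_class) (P : LCL) : Prop :=
  forall c, 0 < c -> exists t, in_f_class T t /\ det_congest_solves P c t.

Inductive code :=
| CZero
| CSucc
| CProj of nat
| CComp of code & seq code
| CPrim of code & code
| CMu of code.

Fixpoint ev (fuel : nat) (c : code) (xs : seq nat) : option nat :=
  match fuel with
  | 0 => None
  | fu.+1 =>
    match c with
    | CZero => Some 0
    | CSucc => Some (head 0 xs).+1
    | CProj i => Some (nth 0 xs i)
    | CComp f gs =>
        let ys := [seq ev fu g xs | g <- gs] in
        if all (fun o => o != None) ys then ev fu f [seq odflt 0 o | o <- ys]
        else None
    | CPrim f g =>
        match xs with
        | [::] => None
        | x :: rest =>
            (fix pr (i : nat) : option nat :=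
               match i with
               | 0 => ev fu f rest
               | i'.+1 => match pr i' with
                          | None => None
                          | Some a => ev fu g (i' :: a :: rest)
                          end
               end) x
        end
    | CMu f =>
        (fix search (k y : nat) : option nat :=
           match k with
           | 0 => None
           | k'.+1 => match ev fu f (y :: xs) with
                      | None => None
                      | Some 0 => Some y
                      | Some _ => search k' y.+1
                      end
           end) fu 0
    end
  end.

Definition computes (p : code) (xs : seq nat) (y : nat) : Prop :=
  exists fuel, ev fuel p xs = Some y.

Definition npair (a b : nat) : nat := (a + b) * (a + b).+1 %/ 2 + a.

Fixpoint enc_list (s : seq nat) : nat :=
  match s with [::] => 0 | x :: s' => (npair x (enc_list s')).+1 end.

Definition enc_edge (e : nat * nat * nat * nat * nat * nat) : nat :=
  let: (a, b, ia, oa, ib, ob) := e in enc_list [:: a; b; ia; oa; ib; ob].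

Definition enc_cgraph (H : cgraph) : nat :=
  enc_list [:: csize H; enc_list (map enc_edge (cedges H)); ccenter H].

Definition enc_lcl (P : LCL) : nat :=
  enc_list [:: lDelta P; lnin P; lnout P; lrad P; enc_list (map enc_cgraph (lC P))].

(* the deterministic CONGEST algorithm (states and messages are numbers)
   given by a total computable function g, for ID exponent c and bound n:
   g [c; n; 0; id; inputs]   = initial state
   g [c; n; 1; state; port]  = message sent on port
   g [c; n; 2; state; msgs]  = new state after receiving msgs
   g [c; n; 3; state; port]  = output label on port
   g [c; n; 4]               = number of rounds *)
Definition prog_alg (g : seq nat -> nat) (c n : nat) : mp_alg (nat * seq nat) nat nat :=
  MPAlg (fun i => g [:: c; n; 0; i.1; enc_list i.2])
        (fun s i => g [:: c; n; 1; s; i])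
        (fun s ms => g [:: c; n; 2; s; enc_list ms])
        (fun s i => g [:: c; n; 3; s; i]).

Definition prog_rounds (g : seq nat -> nat) (c : nat) : nat -> nat :=
  fun n => g [:: c; n; 4].

(* Main.v *)
Require Import Defs.
From Stdlib Require Import Reals Lia Lra FunctionalExtensionality.
From mathcomp Require Import all_boot all_order all_algebra.
From mathcomp Require Import zify.
Set Implicit Arguments.
Unset Strict Implicit.
Unset Printing Implicit Defensive.

(** Every LCL is first rewritten as a labelling problem for half-edges whose constraints live at single nodes: a label records
    inputs, outputs and the views to depth r of the two subtrees behind the edge.  A subtree then acts on the rest of the tree only
    through its class, the set of labels it allows on the edge by which it hangs.

    A certificate is a chain X_0 <= ... <= X_k of sets of classes such that each X_i is closed under joining subtrees at a node, the
    relation between the two ends of a long path carrying subtrees from X_i contains a product of two classes of X_(i+1), and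
    subtrees from X_k can be joined at a root.

    From an o(n^(1/k)) randomized algorithm one obtains a certificate: its classes are realized by finite trees in which some half-edges,
    pairwise far apart, are pinned to labels produced with probability at least 1/q.  The bits near different pins are independent, so
    conditioning on all pins multiplies the failure probability of a node by at most q, and a union bound still yields a solution.
    For the product property, the path is pumped until its middle edge is far from both ends, and this edge is pinned to its most likely
    label.  A subpolynomial algorithm gives certificates for all k, and by pigeonhole one whose layer can be cut into itself.

    From a certificate one obtains a rake-and-compress algorithm: leaves and inner nodes of paths are removed, subtrees being replaced
    by their classes and long paths being cut by the product property, and labels are assigned in the reverse order.  The existence of
    a certificate is a finite search and the algorithm is computable from it; drawing identifiers at random turns the deterministic
    algorithm into a randomized one, so that all three properties are equivalent. *)

(** * Computable functions on codes *)

(** The number of layers is tied to the running time [t] through tree sizes. A class of the next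
    layer is realized by a path whose pinned middle edge is at distance of order [t] from both ends,
    so each layer costs a factor O(t) and [k] layers fit into [n] nodes once t^k is small against
    [n]; a single such [n] suffices to extract a certificate. Within a layer, closure under joins
    may cost only a constant factor: a layer consists of all classes realizable within a size at
    which one more join adds none, and such a size comes early because there are finitely many
    classes. Pins are needed because a randomized algorithm has no single output that could be fixed
    at an edge in advance. In the other direction, [k] layers permit [k] rounds of cutting paths.
    Each is preceded by about n^(1/(k+1)) leaf removals and shrinks the tree by a factor of that
    order, which gives the exponent of [f(T)]. Messages stay short because a removed subtree
    survives only as a class. Since [f(T)] lies within [T], the circle of implications closes and
    the search for a certificate decides the question. *)

Lemma ev_map_mono fu fu' xs gs :
  (forall c y, ev fu c xs = Some y -> ev fu' c xs = Some y) ->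
  all (fun o => o != None) [seq ev fu g xs | g <- gs] ->
  [seq ev fu' g xs | g <- gs] = [seq ev fu g xs | g <- gs].
Proof.
move=> H; elim: gs => //= g gs IH /andP[Hg Hgs]; rewrite IH //.
by case E: (ev fu g xs) Hg => [y|] // _; rewrite (H _ _ E).
Qed.

(** This lets the composition rules below run all subterms with the maximum of their fuels. *)
Lemma ev_mono f f' c xs y : f <= f' -> ev f c xs = Some y -> ev f' c xs = Some y.
Proof.
elim: f f' c xs y => [//|fu IH] [//|fu'] c xs y le; case: c => //=.
- move=> c gs; case: ifP => // Ha.
  rewrite (ev_map_mono (fu := fu)) // ?Ha; [exact: IH | move=> ? ?; exact: IH].
- move=> c d; case: xs => // x rest.
  elim: x y => [|x IHx] y /=; first exact: IH.
  set p := (fix pr (i : nat) : option nat := _); case E: (p x) => [a|] //.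
  rewrite (IHx _ E); exact: IH.
- move=> c.
  (* [CMu] uses its fuel twice, as length of the search and inside [ev]; the two roles are
     generalized separately. *)
  suff S k k' : k <= k' -> forall y0, 
    (fix search (k y : nat) : option nat := match k with
      | 0 => None | k'.+1 => match ev fu c (y :: xs) with
         | None => None | Some 0 => Some y | Some _ => search k' y.+1 end end) k y0 = Some y ->
    (fix search (k y : nat) : option nat := match k with
      | 0 => None | k'.+1 => match ev fu' c (y :: xs) with
         | None => None | Some 0 => Some y | Some _ => search k' y.+1 end end) k' y0 = Some y.
    by apply: S.
  elim: k k' => [//|k IHk] [//|k'] lek y0.
  case E: (ev fu c (y0 :: xs)) => [a|] //; rewrite (IH fu' _ _ _ le E).
  by case: a {E} => // a; apply: IHk.
Qed.

Lemma cp_zero xs : computes CZero xs 0. Proof. by exists 1. Qed.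
Lemma cp_succ x xs : computes CSucc (x :: xs) x.+1. Proof. by exists 1. Qed.
Lemma cp_proj i xs : computes (CProj i) xs (nth 0 xs i). Proof. by exists 1. Qed.

Lemma cp_comp1 f g xs a z : computes g xs a -> computes f [:: a] z ->
  computes (CComp f [:: g]) xs z.
Proof.
move=> [f1 H1] [f2 H2]; exists (maxn f1 f2).+1 => /=.
by rewrite (ev_mono _ H1) ?leq_maxl //= (ev_mono _ H2) ?leq_maxr.
Qed.

Lemma cp_comp2 f g h xs a b z : computes g xs a -> computes h xs b ->
  computes f [:: a; b] z -> computes (CComp f [:: g; h]) xs z.
Proof.
move=> [f1 H1] [f2 H2] [f3 H3]; exists (maxn f1 (maxn f2 f3)).+1 => /=.
rewrite (ev_mono _ H1) ?leq_maxl //= (ev_mono _ H2) /=; last by lia.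
by apply: ev_mono H3; lia.
Qed.

Lemma cp_comp3 f g h k xs a b c z : computes g xs a -> computes h xs b -> computes k xs c ->
  computes f [:: a; b; c] z -> computes (CComp f [:: g; h; k]) xs z.
Proof.
move=> [f1 H1] [f2 H2] [f3 H3] [f4 H4]; exists (maxn (maxn f1 f4) (maxn f2 f3)).+1 => /=.
rewrite (ev_mono _ H1) /=; last by lia. rewrite (ev_mono _ H2) /=; last by lia.
rewrite (ev_mono _ H3) /=; last by lia. by apply: ev_mono H4; lia.
Qed.

Lemma cp_prim f g rest (h : nat -> nat) x : computes f rest (h 0) ->
  (forall i, computes g (i :: h i :: rest) (h i.+1)) -> computes (CPrim f g) (x :: rest) (h x).
Proof.
move=> [f0 H0] H.
elim: x => [|x [fx IHx]]; first by exists f0.+1.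
have [f1 H1] := H x.
case: fx IHx => [//|fx] IHx.
exists (maxn f1 fx).+1 => /=.
have := @ev_mono fx.+1 (maxn f1 fx).+1 _ _ _ _ IHx; rewrite ltnS leq_maxr => /(_ isT) /= ->.
by apply: ev_mono H1; lia.
Qed.

Definition cadd := CPrim (CProj 0) (CComp CSucc [:: CProj 1]).
Lemma cp_add x y : computes cadd [:: x; y] (x + y).
Proof.
apply: (@cp_prim _ _ _ (fun i => i + y)) => [|i]; first exact: (cp_proj 0).
by apply: cp_comp1 (cp_proj 1 _) _; exact: cp_succ.
Qed.

Definition cpred := CPrim CZero (CProj 0).
Lemma cp_pred x : computes cpred [:: x] x.-1.
Proof. by apply: (@cp_prim _ _ _ predn) => [|i]; [exact: cp_zero | exact: (cp_proj 0)]. Qed.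

Definition csub := CPrim (CProj 0) (CComp cpred [:: CProj 1]).
Lemma cp_sub y x : computes csub [:: y; x] (x - y).
Proof.
apply: (@cp_prim _ _ _ (fun i => x - i)) => [|i]; first by rewrite subn0; exact: (cp_proj 0).
by apply: cp_comp1 (cp_proj 1 _) _; rewrite subnS; exact: cp_pred.
Qed.

Definition tri s := s * s.+1 %/ 2.
Lemma triS s : tri s.+1 = tri s + s.+1.
Proof.
have E : s.+1 * s.+2 = s.+1 * 2 + s * s.+1 by rewrite [s * _]mulnC -mulnDr add2n.
by rewrite /tri E divnMDl // addnC.
Qed.

Definition ctri := CPrim CZero (CComp cadd [:: CProj 1; CComp CSucc [:: CProj 0]]).
Lemma cp_tri s : computes ctri [:: s] (tri s).
Proof.
apply: (@cp_prim _ _ _ tri) => [|i]; first exact: cp_zero.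
rewrite triS; apply: cp_comp2 (cp_proj 1 _) _ (cp_add _ _).
by apply: cp_comp1 (cp_proj 0 _) (cp_succ _ _).
Qed.

Lemma npairE a b : npair a b = tri (a + b) + a. Proof. by []. Qed.

Definition cpair := CComp cadd [:: CComp ctri [:: cadd]; CProj 0].
Lemma cp_pair a b : computes cpair [:: a; b] (npair a b).
Proof.
rewrite npairE; apply: cp_comp2 _ (cp_proj 0 _) (cp_add _ _).
by apply: cp_comp1 (cp_add _ _) (cp_tri _).
Qed.

(** The largest [s] with [tri s <= m]. In the recursion the summand is 1 exactly if the next
    triangular number is already reached, because truncated subtraction then gives 0. *)
Fixpoint sroot m := if m is m'.+1 then sroot m' + (1 - (tri (sroot m').+1 - m'.+1)) else 0.
Definition csroot := CPrim CZero (CComp cadd [:: CProj 1; CComp csub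
   [:: CComp csub [:: CComp CSucc [:: CProj 0]; CComp ctri [:: CComp CSucc [:: CProj 1]]]; CComp CSucc [:: CZero]]]).
Lemma cp_sroot m : computes csroot [:: m] (sroot m).
Proof.
apply: (@cp_prim _ _ _ sroot) => [|i]; first exact: cp_zero.
apply: cp_comp2 (cp_proj 1 _) _ (cp_add _ _).
apply: cp_comp2 _ _ (cp_sub _ _); last by apply: cp_comp1 (cp_zero _) (cp_succ _ _).
apply: cp_comp2 _ _ (cp_sub _ _); first by apply: cp_comp1 (cp_proj 0 _) (cp_succ _ _).
by apply: cp_comp1 _ (cp_tri _); apply: cp_comp1 (cp_proj 1 _) (cp_succ _ _).
Qed.

Lemma tri_mono a b : a <= b -> tri a <= tri b.
Proof. by move=> /subnK <-; elim: (b - a) => //= d IH; rewrite addSn triS; lia. Qed.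

Lemma srootP m : tri (sroot m) <= m < tri (sroot m).+1.
Proof.
elim: m => [//|m /andP[IH1 IH2]] /=.
case: (ltnP m.+1 (tri (sroot m).+1)) => H.
  rewrite (_ : 1 - _ = 0) ?addn0; [by rewrite H andbT; lia | lia].
rewrite (_ : 1 - _ = 1) ?addn1 ?H /=; last by lia.
by rewrite triS; lia.
Qed.

Definition np1 m := m - tri (sroot m).
Definition np2 m := sroot m - np1 m.

Lemma sroot_npair a b : sroot (npair a b) = a + b.
Proof.
have /andP[H1 H2] := srootP (npair a b); move: H1 H2; rewrite npairE.
case: (ltngtP (sroot (tri (a + b) + a)) (a + b)) => // H H1 H2.
  by have := tri_mono H; lia.
by have := tri_mono H; rewrite triS; lia.
Qed.
Lemma np1K a b : np1 (npair a b) = a. Proof. by rewrite /np1 sroot_npair npairE addKn. Qed.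
Lemma np2K a b : np2 (npair a b) = b. Proof. by rewrite /np2 np1K sroot_npair addKn. Qed.
Lemma npK m : npair (np1 m) (np2 m) = m.
Proof.
have /andP[H1 H2] := srootP m; rewrite triS in H2.
by rewrite npairE /np2 /np1 subnKC; lia.
Qed.

Definition cnp1 := CComp csub [:: CComp ctri [:: csroot]; CProj 0].
Lemma cp_np1 m : computes cnp1 [:: m] (np1 m).
Proof.
apply: cp_comp2 _ (cp_proj 0 _) (cp_sub _ _).
by apply: cp_comp1 (cp_sroot _) (cp_tri _).
Qed.
Definition cnp2 := CComp csub [:: cnp1; csroot].
Lemma cp_np2 m : computes cnp2 [:: m] (np2 m).
Proof. exact: cp_comp2 (cp_np1 _) (cp_sroot _) (cp_sub _ _). Qed.

Lemma np2_le m : np2 m <= m.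
Proof. rewrite -{2}(npK m) npairE; have := @leq_addr (np1 m) (tri (np1 m + np2 m)).
have : np2 m <= tri (np1 m + np2 m); last lia.
elim: (np1 m) => [|a IH]; last by rewrite addSn triS; lia.
by rewrite add0n; elim: (np2 m) => // b IH; rewrite triS; lia. Qed.

(** The code itself is enough fuel: a cons code is a successor and [np2] never increases its
    argument. *)
Fixpoint unlf k m := if k is k'.+1 then
  if m is m'.+1 then np1 m' :: unlf k' (np2 m') else [::] else [::].
Definition unl m := unlf m m.

Lemma enc_unlf k m : m <= k -> enc_list (unlf k m) = m.
Proof.
elim: k m => [|k IH] [|m] //= le; rewrite IH ?npK //.
exact: leq_trans (np2_le m) le.
Qed.
Lemma unlK m : enc_list (unl m) = m. Proof. exact: enc_unlf. Qed.
Lemma enc_list_inj : injective enc_list.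
Proof.
elim=> [|x s IH] [|y t] //= [] E; have := congr1 np1 E; have := congr1 np2 E.
by rewrite !np1K !np2K => /IH -> ->.
Qed.
Lemma encK s : unl (enc_list s) = s. Proof. by apply: enc_list_inj; rewrite unlK. Qed.

(** * Computability of functions between encoded types *)

Class Enc (A : Type) := enc : A -> nat.
#[export] Instance Enc_nat : Enc nat := id.
#[export] Instance Enc_bool : Enc bool := nat_of_bool.
#[export] Instance Enc_seq : Enc (seq nat) := enc_list.
#[export] Instance Enc_prod A B (EA : Enc A) (EB : Enc B) : Enc (A * B) :=
  fun p => npair (enc p.1) (enc p.2).

(** Contexts are nested pairs, so all codes are unary and the closure rules mirror the syntax of
    functions, with [p.1] as weakening. *)
Definition Comp A B {EA : Enc A} {EB : Enc B} (f : A -> B) : Prop :=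
  exists c, forall a, computes c [:: enc a] (enc (f a)).
Arguments Comp {A B EA EB} f.

Section Rules.
Context {A : Type} {EA : Enc A}.

Lemma comp_ext B {EB : Enc B} (f g : A -> B) : f =1 g -> Comp f -> Comp g.
Proof. by move=> E [c H]; exists c => a; rewrite -E. Qed.

Lemma c_id : Comp (fun a : A => a).
Proof. by exists (CProj 0) => a; apply: (cp_proj 0). Qed.

Lemma c_const B {EB : Enc B} (b : B) : Comp (fun _ : A => b).
Proof.
exists (iter (enc b) (fun c => CComp CSucc [:: c]) CZero) => a.
elim: (enc b) => [|n IH] /=; [exact: cp_zero | exact: cp_comp1 IH (cp_succ _ _)].
Qed.

Lemma c_comp B C {EB : Enc B} {EC : Enc C} (f : B -> C) (g : A -> B) :
  Comp f -> Comp g -> Comp (fun a => f (g a)).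
Proof. by move=> [c H] [d K]; exists (CComp c [:: d]) => a; apply: cp_comp1 (K a) (H _). Qed.

Lemma c_pair B C {EB : Enc B} {EC : Enc C} (f : A -> B) (g : A -> C) :
  Comp f -> Comp g -> Comp (fun a => (f a, g a)).
Proof. by move=> [c H] [d K]; exists (CComp cpair [:: c; d]) => a; apply: cp_comp2 (H a) (K a) (cp_pair _ _). Qed.

Lemma c_raw1 B C {EB : Enc B} {EC : Enc C} (h : B -> C) (c : code) (f : A -> B) :
  (forall x, computes c [:: enc x] (enc (h x))) -> Comp f -> Comp (fun a => h (f a)).
Proof. by move=> H; apply: c_comp; exists c. Qed.

Lemma c_raw2 B C D {EB : Enc B} {EC : Enc C} {ED : Enc D} (h : B -> C -> D) (c : code)
    (f : A -> B) (g : A -> C) :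
  (forall x y, computes c [:: enc x; enc y] (enc (h x y))) -> Comp f -> Comp g ->
  Comp (fun a => h (f a) (g a)).
Proof. by move=> H [d K] [e L]; exists (CComp c [:: d; e]) => a; apply: cp_comp2 (K a) (L a) (H _ _). Qed.

Lemma c_fst B C {EB : Enc B} {EC : Enc C} (f : A -> B * C) : Comp f -> Comp (fun a => (f a).1).
Proof. by apply: (c_raw1 (h := fun p : B * C => p.1) (c := cnp1)) => x; rewrite -[X in computes _ _ X](np1K (@enc _ EB x.1) (@enc _ EC x.2)); exact: cp_np1. Qed.
Lemma c_snd B C {EB : Enc B} {EC : Enc C} (f : A -> B * C) : Comp f -> Comp (fun a => (f a).2).
Proof. by apply: (c_raw1 (h := fun p : B * C => p.2) (c := cnp2)) => x; rewrite -[X in computes _ _ X](np2K (@enc _ EB x.1) (@enc _ EC x.2)); exact: cp_np2. Qed.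

Lemma c_S (f : A -> nat) : Comp f -> Comp (fun a => (f a).+1).
Proof. by apply: (c_raw1 (c := CSucc)) => x; exact: cp_succ. Qed.
Lemma c_pred (f : A -> nat) : Comp f -> Comp (fun a => (f a).-1).
Proof. by apply: (c_raw1 (c := cpred)) => x; exact: cp_pred. Qed.
Lemma c_np1 (f : A -> nat) : Comp f -> Comp (fun a => np1 (f a)).
Proof. by apply: (c_raw1 (c := cnp1)) => x; exact: cp_np1. Qed.
Lemma c_np2 (f : A -> nat) : Comp f -> Comp (fun a => np2 (f a)).
Proof. by apply: (c_raw1 (c := cnp2)) => x; exact: cp_np2. Qed.
Lemma c_npair (f g : A -> nat) : Comp f -> Comp g -> Comp (fun a => npair (f a) (g a)).
Proof. by apply: (c_raw2 (c := cpair)) => x y; exact: cp_pair. Qed.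
Lemma c_addn (f g : A -> nat) : Comp f -> Comp g -> Comp (fun a => f a + g a).
Proof. by apply: (c_raw2 (c := cadd)) => x y; exact: cp_add. Qed.
Lemma c_subn (f g : A -> nat) : Comp f -> Comp g -> Comp (fun a => f a - g a).
Proof.
apply: (c_raw2 (c := CComp csub [:: CProj 1; CProj 0])) => x y.
by apply: cp_comp2 (cp_proj 1 _) (cp_proj 0 _) (cp_sub _ _).
Qed.
(** Types may change freely as long as the codes agree: booleans are computed as 0 or 1, and
    [enc_list] and [unl] cost nothing. *)
Lemma c_recast B C {EB : Enc B} {EC : Enc C} (f : A -> B) (g : A -> C) :
  (forall a, enc (f a) = enc (g a)) -> Comp f -> Comp g.
Proof. by move=> E [c H]; exists c => a; rewrite -E. Qed.
Lemma c_leq (f g : A -> nat) : Comp f -> Comp g -> Comp (fun a => f a <= g a).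
Proof.
move=> Hf Hg; apply: (@c_recast _ _ _ _ (fun a => 1 - (f a - g a))).
  by move=> a; rewrite /enc /Enc_nat /Enc_bool -subn_eq0; case: (f a - g a).
exact: c_subn (c_const _) (c_subn Hf Hg).
Qed.
Lemma c_eqn (f g : A -> nat) : Comp f -> Comp g -> Comp (fun a => f a == g a).
Proof.
move=> Hf Hg; apply: (@c_recast _ _ _ _ (fun a => 1 - ((f a - g a) + (g a - f a)))).
  by move=> a; rewrite /enc /Enc_nat /Enc_bool eqn_leq -!subn_eq0; case: (f a - g a) => [|?]; case: (g a - f a).
exact: c_subn (c_const _) (c_addn (c_subn Hf Hg) (c_subn Hg Hf)).
Qed.
Lemma c_if B {EB : Enc B} (b : A -> bool) (f g : A -> B) : Comp b -> Comp f -> Comp g ->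
  Comp (fun a => if b a then f a else g a).
Proof.
move=> [c H] [d K] [e L]; exists (CComp (CPrim (CProj 0) (CProj 3)) [:: c; e; d]) => a.
apply: cp_comp3 (H a) (L a) (K a) _.
have -> : enc (if b a then f a else g a) =
  (fun i => if i is _.+1 then enc (f a) else enc (g a)) (enc (b a)) by case: (b a).
apply: (@cp_prim _ _ _ (fun i => if i is _.+1 then enc (f a) else enc (g a))) => [|i].
  exact: (cp_proj 0).
exact: (cp_proj 3).
Qed.
Lemma c_negb (f : A -> bool) : Comp f -> Comp (fun a => ~~ f a).
Proof. move=> Hf; apply: (@comp_ext _ _ (fun a => if f a then false else true)); first by move=> a; case: (f a).
exact: c_if Hf (c_const _) (c_const _). Qed.
Lemma c_andb (f g : A -> bool) : Comp f -> Comp g -> Comp (fun a => f a && g a).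
Proof. move=> Hf Hg; exact: c_if Hf Hg (c_const _). Qed.
Lemma c_orb (f g : A -> bool) : Comp f -> Comp g -> Comp (fun a => f a || g a).
Proof. move=> Hf Hg; exact: c_if Hf (c_const _) Hg. Qed.

Lemma c_iter B {EB : Enc B} (n : A -> nat) (h : A -> B -> B) (z : A -> B) :
  Comp n -> Comp (fun p : A * B => h p.1 p.2) -> Comp z ->
  Comp (fun a => iter (n a) (h a) (z a)).
Proof.
move=> [cn Hn] [ch Hh] [cz Hz].
exists (CComp (CPrim (CProj 0) (CComp ch [:: CComp cpair [:: CProj 3; CProj 1]])) [:: cn; cz; CProj 0]) => a.
apply: cp_comp3 (Hn a) (Hz a) (cp_proj 0 _) _.
apply: (@cp_prim _ _ _ (fun i => enc (iter i (h a) (z a)))) => [|i]; first exact: (cp_proj 0).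
apply: cp_comp1 _ (Hh (a, iter i (h a) (z a))).
by apply: cp_comp2 (cp_proj 3 _) (cp_proj 1 _) (cp_pair _ _).
Qed.

Lemma c_unl (f : A -> nat) : Comp f -> Comp (fun a => unl (f a)).
Proof. by apply: c_recast => a; rewrite /enc /Enc_seq unlK. Qed.
Lemma c_encl (f : A -> seq nat) : Comp f -> Comp (fun a => enc_list (f a)).
Proof. by apply: c_recast. Qed.
Lemma c_cons (f : A -> nat) (s : A -> seq nat) : Comp f -> Comp s -> Comp (fun a => f a :: s a).
Proof. by move=> Hf Hs; apply: (@c_recast _ _ _ _ (fun a => (npair (f a) (enc_list (s a))).+1)) => //;
  exact: c_S (c_npair Hf (c_encl Hs)). Qed.

(** The state is the code of the remaining list with the accumulator. The code of the list serves as
    number of iterations: it is at least the length, and the state is stationary once the rest is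
    0. *)
Lemma foldl_iter B (h : B -> nat -> B) z l :
  foldl h z l = (iter (enc_list l) (fun q : nat * B => if q.1 == 0 then q
      else (np2 q.1.-1, h q.2 (np1 q.1.-1))) (enc_list l, z)).2.
Proof.
set st := (fun q : nat * B => _).
suff G n : forall z, n >= enc_list l -> (iter n st (enc_list l, z)).2 = foldl h z l by rewrite G.
elim: l n => [|x l IH] n z0 /=.
  by move=> _; rewrite (_ : iter n st (0, z0) = (0, z0)) //; elim: n => //= n ->.
case: n => // n; rewrite ltnS => le.
rewrite iterSr /st /= np1K np2K -/st IH //.
apply: leq_trans le; rewrite -{1}(np2K x (enc_list l)); exact: np2_le.
Qed.

End Rules.

Section Rules2.
Context {A : Type} {EA : Enc A}.

Lemma c_foldl B {EB : Enc B} (h : A -> B -> nat -> B) (z : A -> B) (l : A -> seq nat) :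
  Comp (fun p : A * B * nat => h p.1.1 p.1.2 p.2) -> Comp z -> Comp l ->
  Comp (fun a => foldl (h a) (z a) (l a)).
Proof.
move=> Hh Hz Hl.
apply: (comp_ext (fun a => esym (foldl_iter (h a) (z a) (l a)))).
apply: c_snd; apply: (c_iter (h := fun a q => if q.1 == 0 then q else (np2 q.1.-1, h a q.2 (np1 q.1.-1)))).
- exact: c_encl.
- have Hq : Comp (fun p : A * (nat * B) => p.2.1) by apply: c_fst; apply: c_snd; apply: c_id.
  apply: c_if; [by apply: c_eqn Hq (c_const _) | by apply: c_snd; apply: c_id|].
  apply: c_pair; first by apply: c_np2; apply: c_pred.
  apply: (c_comp Hh (g := fun p : A * (nat * B) => (p.1, p.2.2, np1 p.2.1.-1))).
  apply: c_pair; last by apply: c_np1; apply: c_pred.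
  by apply: c_pair; [apply: c_fst; apply: c_id | apply: c_snd; apply: c_snd; apply: c_id].
- by apply: c_pair; [exact: c_encl|].
Qed.

Lemma c_rev (l : A -> seq nat) : Comp l -> Comp (fun a => rev (l a)).
Proof.
move=> Hl; apply: (@comp_ext _ _ _ _ (fun a => foldl (fun s x => x :: s) [::] (l a))).
  by move=> a; rewrite /rev; elim: (l a) [::] => /= [|x s IH] acc //; rewrite IH.
apply: (c_foldl (h := fun _ s x => x :: s)) Hl; last exact: c_const.
by apply: c_cons; [apply: c_snd; apply: c_id | apply: c_snd; apply: c_fst; apply: c_id].
Qed.

Lemma c_foldr B {EB : Enc B} (h : A -> nat -> B -> B) (z : A -> B) (l : A -> seq nat) :
  Comp (fun p : A * nat * B => h p.1.1 p.1.2 p.2) -> Comp z -> Comp l ->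
  Comp (fun a => foldr (h a) (z a) (l a)).
Proof.
move=> Hh Hz Hl; apply: (@comp_ext _ _ _ _ (fun a => foldl (fun s x => h a x s) (z a) (rev (l a)))).
  by move=> a; rewrite foldl_rev.
apply: (c_foldl (h := fun a s x => h a x s)) => //; last exact: c_rev.
apply: (c_comp Hh (g := fun p : A * B * nat => (p.1.1, p.2, p.1.2))).
apply: c_pair; last by apply: c_snd; apply: c_fst; apply: c_id.
by apply: c_pair; [apply: c_fst; apply: c_fst; apply: c_id | apply: c_snd; apply: c_id].
Qed.

End Rules2.

Ltac c_var := lazymatch goal with
 | |- Comp (fun a => a) => exact: c_id
 | |- Comp fst => apply: (@c_fst _ _ _ _ _ _ (fun a => a))
 | |- Comp snd => apply: (@c_snd _ _ _ _ _ _ (fun a => a))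
 | |- Comp (fun a => fst (@?f a)) => apply: (@c_fst _ _ _ _ _ _ f)
 | |- Comp (fun a => snd (@?f a)) => apply: (@c_snd _ _ _ _ _ _ f)
 | |- Comp (fun a => ?x) => exact: c_const
 end.

Section Rules3.
Context {A : Type} {EA : Enc A}.
Lemma c_map (F : A -> nat -> nat) (l : A -> seq nat) :
  Comp (fun p : A * nat => F p.1 p.2) -> Comp l -> Comp (fun a => map (F a) (l a)).
Proof.
move=> HF Hl; apply: (c_foldr (h := fun a x s => F a x :: s)) => //; last exact: c_const.
apply: c_cons; last by repeat c_var.
by apply: (c_comp HF (g := fun p : A * nat * seq nat => (p.1.1, p.1.2))); apply: c_pair; repeat c_var.
Qed.
Lemma c_filter (F : A -> nat -> bool) (l : A -> seq nat) :
  Comp (fun p : A * nat => F p.1 p.2) -> Comp l -> Comp (fun a => filter (F a) (l a)).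
Proof.
move=> HF Hl; apply: (c_foldr (h := fun a x s => if F a x then x :: s else s)) => //; last exact: c_const.
apply: c_if; [|by apply: c_cons; repeat c_var|by repeat c_var].
by apply: (c_comp HF (g := fun p : A * nat * seq nat => (p.1.1, p.1.2))); apply: c_pair; repeat c_var.
Qed.
Lemma c_has (F : A -> nat -> bool) (l : A -> seq nat) :
  Comp (fun p : A * nat => F p.1 p.2) -> Comp l -> Comp (fun a => has (F a) (l a)).
Proof.
move=> HF Hl; apply: (c_foldr (h := fun a x s => F a x || s)) => //; last exact: c_const.
apply: c_orb; last by repeat c_var.
by apply: (c_comp HF (g := fun p : A * nat * bool => (p.1.1, p.1.2))); apply: c_pair; repeat c_var.
Qed.
Lemma c_all (F : A -> nat -> bool) (l : A -> seq nat) :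
  Comp (fun p : A * nat => F p.1 p.2) -> Comp l -> Comp (fun a => all (F a) (l a)).
Proof.
move=> HF Hl; apply: (c_foldr (h := fun a x s => F a x && s)) => //; last exact: c_const.
apply: c_andb; last by repeat c_var.
by apply: (c_comp HF (g := fun p : A * nat * bool => (p.1.1, p.1.2))); apply: c_pair; repeat c_var.
Qed.
Lemma c_find (F : A -> nat -> bool) (l : A -> seq nat) :
  Comp (fun p : A * nat => F p.1 p.2) -> Comp l -> Comp (fun a => find (F a) (l a)).
Proof.
move=> HF Hl; apply: (@comp_ext _ _ _ _ (fun a => foldr (fun x n => if F a x then 0 else n.+1) 0 (l a))).
  by move=> a; elim: (l a) => //= x s ->.
apply: (c_foldr (h := fun a x s => if F a x then 0 else s.+1)) => //; last exact: c_const.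
apply: c_if; [|exact: c_const|by apply: c_S; repeat c_var].
by apply: (c_comp HF (g := fun p : A * nat * nat => (p.1.1, p.1.2))); apply: c_pair; repeat c_var.
Qed.
Lemma c_size (l : A -> seq nat) : Comp l -> Comp (fun a => size (l a)).
Proof.
move=> Hl; apply: (@comp_ext _ _ _ _ (fun a => foldr (fun x n => n.+1) 0 (l a))).
  by move=> a; elim: (l a) => //= x s ->.
apply: (c_foldr (h := fun a x s => s.+1)) => //; last exact: c_const.
by apply: c_S; repeat c_var.
Qed.
Lemma c_cat (l m : A -> seq nat) : Comp l -> Comp m -> Comp (fun a => l a ++ m a).
Proof.
move=> Hl Hm; apply: (@comp_ext _ _ _ _ (fun a => foldr cons (m a) (l a))).
  by move=> a; elim: (l a) => //= x s ->.
apply: (c_foldr (h := fun _ x s => x :: s)) => //; by apply: c_cons; repeat c_var.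
Qed.
Lemma c_behead (l : A -> seq nat) : Comp l -> Comp (fun a => behead (l a)).
Proof.
move=> Hl; apply: (@c_recast _ _ _ _ _ _ (fun a => np2 (enc_list (l a)).-1)).
  by move=> a; case: (l a) => //= x s; rewrite /enc /Enc_seq /Enc_nat np2K.
by apply: c_np2; apply: c_pred; apply: c_encl.
Qed.
End Rules3.
Section Rules4.
Context {A : Type} {EA : Enc A}.
Lemma c_nth (l : A -> seq nat) (n : A -> nat) : Comp l -> Comp n -> Comp (fun a => nth 0 (l a) (n a)).
Proof.
move=> Hl Hn.
have Hd : Comp (fun a => iter (n a) (fun s : seq nat => behead s) (l a)).
  apply: (c_iter (h := fun _ s => behead s)) => //; apply: c_behead; by repeat c_var.
apply: (@comp_ext _ _ _ _ (fun a => np1 (enc_list (iter (n a) (fun s : seq nat => behead s) (l a))).-1)).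
  move=> a; elim: (n a) (l a) => [|k IH] s; first by case: s => //= x s; rewrite np1K.
  by rewrite iterSr IH; case: s => //=; rewrite nth_nil.
by apply: c_np1; apply: c_pred; apply: c_encl.
Qed.
Lemma c_muln (f g : A -> nat) : Comp f -> Comp g -> Comp (fun a => f a * g a).
Proof.
move=> Hf Hg; apply: (@comp_ext _ _ _ _ (fun a => iter (f a) (addn (g a)) 0)).
  by move=> a; rewrite iter_addn_0 mulnC.
apply: (c_iter (h := fun a x => g a + x)) => //; last exact: c_const.
by apply: c_addn; last (by repeat c_var); apply: (c_comp Hg); repeat c_var.
Qed.
End Rules4.
Section Rules5.
Context {A : Type} {EA : Enc A}.
Lemma c_expn (f g : A -> nat) : Comp f -> Comp g -> Comp (fun a => f a ^ g a).
Proof.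
move=> Hf Hg; apply: (@comp_ext _ _ _ _ (fun a => iter (g a) (muln (f a)) 1)).
  by move=> a; rewrite iter_muln_1.
apply: (c_iter (h := fun a x => f a * x)) => //; last exact: c_const.
by apply: c_muln; last (by repeat c_var); apply: (c_comp Hf); repeat c_var.
Qed.
Lemma c_iota (f g : A -> nat) : Comp f -> Comp g -> Comp (fun a => iota (f a) (g a)).
Proof.
move=> Hf Hg; apply: (@comp_ext _ _ _ _ (fun a => map (addn (f a)) (iter (g a) (fun s => s ++ [:: size s]) [::]))).
  have E n : iter n (fun s => s ++ [:: size s]) [::] = iota 0 n.
    by elim: n => // n IH; rewrite iterS IH size_iota -addn1 iotaD.
  by move=> a; rewrite E -iotaDl addn0.
apply: (c_map (F := fun a => addn (f a))).
  by apply: c_addn; last (by repeat c_var); apply: (c_comp Hf); repeat c_var.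
apply: (c_iter (h := fun _ (s : seq nat) => s ++ [:: size s])) => //; last exact: c_const.
by apply: c_cat; [repeat c_var | apply: c_cons; [apply: c_size; repeat c_var | exact: c_const]].
Qed.
Lemma c_mem (f : A -> nat) (l : A -> seq nat) : Comp f -> Comp l -> Comp (fun a => f a \in l a).
Proof.
move=> Hf Hl; apply: (@comp_ext _ _ _ _ (fun a => has (fun y => y == f a) (l a))).
  by move=> a; rewrite -has_pred1.
apply: (c_has (F := fun a y => y == f a)) => //.
by apply: c_eqn; [repeat c_var | apply: (c_comp Hf); repeat c_var].
Qed.
Lemma c_eqseq (f g : A -> seq nat) : Comp f -> Comp g -> Comp (fun a => f a == g a).
Proof.
move=> Hf Hg; apply: (@comp_ext _ _ _ _ (fun a => enc_list (f a) == enc_list (g a))).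
  by move=> a; rewrite (inj_eq enc_list_inj).
by apply: c_eqn; apply: c_encl.
Qed.
End Rules5.

(** Extension hook: every later batch of rules redefines the current hook and ends in a fresh
    one. *)
Ltac comp_user := fail.
Ltac comp1 := cbv beta; lazymatch goal with
 | |- Comp (fun a => a) => exact: c_id
 | |- Comp fst => apply (@c_fst _ _ _ _ _ _ (fun a => a))
 | |- Comp snd => apply (@c_snd _ _ _ _ _ _ (fun a => a))
 | |- Comp (fun a => fst (@?f a)) => apply (@c_fst _ _ _ _ _ _ f)
 | |- Comp (fun a => snd (@?f a)) => apply (@c_snd _ _ _ _ _ _ f)
 | |- Comp (fun a => (@?f a, @?g a)) => apply (@c_pair _ _ _ _ _ _ f g)
 | |- Comp (fun a => S (@?f a)) => apply (@c_S _ _ f)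
 | |- Comp (fun a => predn (@?f a)) => apply (@c_pred _ _ f)
 | |- Comp (fun a => np1 (@?f a)) => apply (@c_np1 _ _ f)
 | |- Comp (fun a => np2 (@?f a)) => apply (@c_np2 _ _ f)
 | |- Comp (fun a => npair (@?f a) (@?g a)) => apply (@c_npair _ _ f g)
 | |- Comp (fun a => addn (@?f a) (@?g a)) => apply (@c_addn _ _ f g)
 | |- Comp (fun a => subn (@?f a) (@?g a)) => apply (@c_subn _ _ f g)
 | |- Comp (fun a => muln (@?f a) (@?g a)) => apply (@c_muln _ _ f g)
 | |- Comp (fun a => expn (@?f a) (@?g a)) => apply (@c_expn _ _ f g)
 | |- Comp (fun a => leq (@?f a) (@?g a)) => apply (@c_leq _ _ f g)
 | |- Comp (fun a => @eq_op _ (@?f a) (@?g a)) => first [apply (@c_eqn _ _ f g) | apply (@c_eqseq _ _ f g)]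
 | |- Comp (fun a => negb (@?f a)) => apply (@c_negb _ _ f)
 | |- Comp (fun a => andb (@?f a) (@?g a)) => apply (@c_andb _ _ f g)
 | |- Comp (fun a => orb (@?f a) (@?g a)) => apply (@c_orb _ _ f g)
 | |- Comp (fun a => iter (@?n a) (@?h a) (@?z a)) => apply (@c_iter _ _ _ _ n h z)
 | |- Comp (fun a => foldl (@?h a) (@?z a) (@?l a)) => apply (@c_foldl _ _ _ _ h z l)
 | |- Comp (fun a => foldr (@?h a) (@?z a) (@?l a)) => apply (@c_foldr _ _ _ _ h z l)
 | |- Comp (fun a => map (@?F a) (@?l a)) => apply (@c_map _ _ F l)
 | |- Comp (fun a => filter (@?F a) (@?l a)) => apply (@c_filter _ _ F l)
 | |- Comp (fun a => has (@?F a) (@?l a)) => apply (@c_has _ _ F l)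
 | |- Comp (fun a => all (@?F a) (@?l a)) => apply (@c_all _ _ F l)
 | |- Comp (fun a => find (@?F a) (@?l a)) => apply (@c_find _ _ F l)
 | |- Comp (fun a => size (@?l a)) => apply (@c_size _ _ l)
 | |- Comp (fun a => cat (@?l a) (@?m a)) => apply (@c_cat _ _ l m)
 | |- Comp (fun a => cons (@?l a) (@?m a)) => apply (@c_cons _ _ l m)
 | |- Comp (fun a => behead (@?l a)) => apply (@c_behead _ _ l)
 | |- Comp (fun a => nth 0 (@?l a) (@?m a)) => apply (@c_nth _ _ l m)
 | |- Comp (fun a => iota (@?l a) (@?m a)) => apply (@c_iota _ _ l m)
 | |- Comp (fun a => rev (@?l a)) => apply (@c_rev _ _ l)
 | |- Comp (fun a => unl (@?l a)) => apply (@c_unl _ _ l)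
 | |- Comp (fun a => enc_list (@?l a)) => apply (@c_encl _ _ l)
 | |- Comp (fun a => in_mem (@?f a) (@mem _ _ (@?l a))) => apply (@c_mem _ _ f l)
 | |- _ => first [assumption | comp_user | exact: c_const | apply c_if]
 end.
Ltac comp := repeat comp1.

(** * Enumerations and arithmetic by bounded search *)

Definition flatu (l : seq nat) : seq nat := foldr (fun x acc => unl x ++ acc) [::] l.
Definition pairsu (l m : seq nat) := foldr (fun x acc => map (fun y => enc_list [:: x; y]) m ++ acc) [::] l.
Definition listsn (n : nat) (l : seq nat) : seq nat :=
  iter n (fun acc => foldr (fun x r => map (fun s => enc_list (x :: unl s)) acc ++ r) [::] l) [:: 0].
Definition lists_le (n : nat) (l : seq nat) : seq nat :=
  foldr (fun k acc => listsn k l ++ acc) [::] (iota 0 n.+1).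
Definition sublists (l : seq nat) : seq nat :=
  foldr (fun x acc => acc ++ map (fun s => enc_list (x :: unl s)) acc) [:: 0] l.
Definition cnt (P : nat -> bool) n := size [seq q <- iota 0 n | P q].
Definition indexn (x : nat) (s : seq nat) := find (fun y => y == x) s.
(** [n - (n - size s)] is the minimum of [n] and [size s]. *)
Definition takeu (n : nat) (s : seq nat) := map (fun i => nth 0 s i) (iota 0 (n - (n - size s))).
Definition uniqu (s : seq nat) := all (fun i => indexn (nth 0 s i) s == i) (iota 0 (size s)).
Definition divu m d := if d == 0 then 0 else cnt (fun q => q.+1 * d <= m) m.
Definition modu m d := m - divu m d * d.
Definition logu n := (cnt (fun q => 2 ^ q.+1 <= n) n).

Lemma mem_flatu x l : (x \in flatu l) = has (fun y => x \in unl y) l.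
Proof. by elim: l => //= y l IH; rewrite mem_cat IH. Qed.
Lemma flatuE l : flatu l = flatten (map unl l).
Proof. by elim: l => //= x l ->. Qed.

Lemma pairsuP l m z : reflect (exists x y, [/\ x \in l, y \in m & z = enc_list [:: x; y]]) (z \in pairsu l m).
Proof.
elim: l => [|a l IH] /=; first by constructor => -[x [y []]].
rewrite mem_cat; apply: (iffP orP) => [[/mapP[y ym ->]|/IH[x [y [xl ym ->]]]]|[x [y [+ ym E]]]].
- by exists a, y; rewrite mem_head.
- by exists x, y; rewrite inE xl orbT.
- rewrite inE => /orP[/eqP xa|xl]; first by left; apply/mapP; exists y; rewrite // E xa.
  by right; apply/IH; exists x, y.
Qed.

Lemma listsnP n l z : reflect (exists s, [/\ size s = n, {subset s <= l} & z = enc_list s]) (z \in listsn n l).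
Proof.
elim: n z => [|n IH] z.
  rewrite inE; apply: (iffP eqP) => [->|[s [/size0nil-> _ ->]]] //; by exists [::].
rewrite /listsn iterS -/(listsn n l).
have H m : reflect (exists x s, [/\ x \in m, size s = n, {subset s <= l} & z = enc_list (x :: s)])
  (z \in foldr (fun x r => map (fun s => enc_list (x :: unl s)) (listsn n l) ++ r) [::] m).
  elim: m => [|a m IHm] /=; first by constructor => -[x [s []]].
  rewrite mem_cat; apply: (iffP orP) => [[/mapP[y /IH[s [h1 h2 ->]] ->]|/IHm[x [s [h1 h2 h3 h4]]]]|[x [s [+ h2 h3 E]]]].
  - by exists a, s; rewrite mem_head /= encK.
  - by exists x, s; rewrite inE h1 orbT.
  - rewrite inE => /orP[/eqP xa|xl]; last by right; apply/IHm; exists x, s.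
    left; rewrite E xa; apply/mapP; exists (enc_list s); last by rewrite encK.
    by apply/IH; exists s.
apply: (iffP (H l)) => [[x [s [h1 h2 h3 ->]]]|[[|x s] [//= [h1] h2 ->]]].
  exists (x :: s); split=> //=; first by rewrite h2.
  by move=> y; rewrite inE => /orP[/eqP->|/h3].
exists x, s; split=> //; first by rewrite h2 ?mem_head.
by move=> y ys; rewrite h2 // inE ys orbT.
Qed.

Lemma lists_leP n l z : reflect (exists s, [/\ size s <= n, {subset s <= l} & z = enc_list s]) (z \in lists_le n l).
Proof.
have H m : (z \in foldr (fun k acc => listsn k l ++ acc) [::] m) = has (fun k => z \in listsn k l) m.
  by elim: m => //= k m IH; rewrite mem_cat IH.
rewrite /lists_le H; apply: (iffP hasP) => [[k]|[s [h1 h2 h3]]].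
  by rewrite mem_iota => /andP[_ lk] /listsnP[s [h1 h2 h3]]; exists s; rewrite h1; split=> //; lia.
exists (size s); first by rewrite mem_iota; lia.
by apply/listsnP; exists s.
Qed.

(** Filters are all that is needed: classes, relations and layers are always written as filters of a
    fixed list, so that equal sets have equal codes. *)
Lemma mem_sublists p l : enc_list (filter p l) \in sublists l.
Proof.
elim: l => [|x l IH] //=; rewrite mem_cat; case: (p x) => /=; last by rewrite IH.
by apply/orP; right; apply/mapP; exists (enc_list (filter p l)); rewrite // encK.
Qed.
Lemma cntE (P : nat -> bool) n k : k <= n -> (forall q, q < n -> P q = (q < k)) -> cnt P n = k.
Proof.
move=> le H; rewrite /cnt -(subnKC le) iotaD filter_cat add0n.
rewrite (@eq_in_filter _ P predT) ?filter_predT; last first.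
  by move=> q; rewrite mem_iota => /andP[_ lt]; rewrite H /=; lia.
rewrite (@eq_in_filter _ P pred0) ?filter_pred0 ?cats0 ?size_iota //.
by move=> q; rewrite mem_iota => /andP[h1 h2]; rewrite H /=; lia.
Qed.

Lemma divuE m d : divu m d = m %/ d.
Proof.
rewrite /divu; case: eqP => [->|/eqP d0]; first by rewrite divn0.
have dg : 0 < d by rewrite lt0n.
apply: cntE => [|q _]; first exact: leq_div.
by rewrite -leq_divRL.
Qed.
Lemma moduE m d : modu m d = m %% d.
Proof. by rewrite /modu divuE {1}(divn_eq m d) addKn. Qed.
Lemma loguE n : logu n = trunc_log 2 n.
Proof.
case: n => [|n]; first by rewrite trunc_log0.
rewrite /logu; apply: cntE => [|q _].
  by apply: leq_trans (trunc_logP (isT : 1 < 2) (ltn0Sn n)); apply: ltnW; apply: ltn_expl.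
apply/idP/idP => [H|H]; first by apply: trunc_log_max.
by apply: leq_trans (trunc_logP (isT : 1 < 2) (ltn0Sn n)); rewrite leq_exp2l.
Qed.
Lemma indexnE x s : indexn x s = index x s. Proof. by []. Qed.
Lemma takeuE n s : takeu n s = take n s.
Proof.
apply: (@eq_from_nth _ 0) => [|i]; rewrite size_map size_iota ?size_take.
  by case: ltnP; lia.
by move=> h; rewrite (nth_map 0) ?size_iota // nth_iota // nth_take ?add0n //; lia.
Qed.
Lemma uniquE s : uniqu s = uniq s.
Proof.
apply/allP/idP => [H|U i]; last by rewrite mem_iota => /andP[_ h]; rewrite indexnE index_uniq.
apply/(uniqP 0) => i j hi hj E; have K k : k < size s -> index (nth 0 s k) s = k.
  by move=> h; apply/eqP; apply: H; rewrite mem_iota.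
by rewrite -(K _ hi) -(K _ hj) E.
Qed.

Section Rules6.
Context {A : Type} {EA : Enc A}.
Lemma c_flatu (f : A -> seq nat) : Comp f -> Comp (fun a => flatu (f a)).
Proof. by move=> H; rewrite /flatu; comp. Qed.
Lemma c_pairsu (f g : A -> seq nat) : Comp f -> Comp g -> Comp (fun a => pairsu (f a) (g a)).
Proof. by move=> H K; rewrite /pairsu; comp => //; apply: (c_comp K); comp. Qed.
Lemma c_listsn (n : A -> nat) (f : A -> seq nat) : Comp n -> Comp f -> Comp (fun a => listsn (n a) (f a)).
Proof. by move=> H K; rewrite /listsn; comp => //; apply: (c_comp K); comp. Qed.
Lemma c_sublists (f : A -> seq nat) : Comp f -> Comp (fun a => sublists (f a)).
Proof. by move=> H; rewrite /sublists; comp. Qed.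
Lemma c_cnt (P : A -> nat -> bool) (n : A -> nat) : Comp (fun p : A * nat => P p.1 p.2) -> Comp n ->
  Comp (fun a => cnt (P a) (n a)).
Proof. by move=> H K; rewrite /cnt; comp. Qed.
Lemma c_indexn (f : A -> nat) (s : A -> seq nat) : Comp f -> Comp s -> Comp (fun a => indexn (f a) (s a)).
Proof. by move=> H K; rewrite /indexn; comp => //; apply: (c_comp H); comp. Qed.
Lemma c_take (n : A -> nat) (s : A -> seq nat) : Comp n -> Comp s -> Comp (fun a => take (n a) (s a)).
Proof.
move=> H K; apply: (comp_ext (fun a => takeuE (n a) (s a))).
by rewrite /takeu; comp => //; apply: (c_comp K); comp.
Qed.
End Rules6.
Section Rules7.
Context {A : Type} {EA : Enc A}.
Lemma c_lists_le (n : A -> nat) (f : A -> seq nat) : Comp n -> Comp f -> Comp (fun a => lists_le (n a) (f a)).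
Proof. by move=> H K; rewrite /lists_le; comp => //; apply: c_listsn; comp; apply: (c_comp K); comp. Qed.
Lemma c_uniq (s : A -> seq nat) : Comp s -> Comp (fun a => uniq (s a)).
Proof.
move=> K; apply: (comp_ext (fun a => uniquE (s a))).
by rewrite /uniqu; comp => //; apply: c_indexn; comp; apply: (c_comp K); comp.
Qed.
Lemma c_divu (f g : A -> nat) : Comp f -> Comp g -> Comp (fun a => divu (f a) (g a)).
Proof.
move=> H K; rewrite /divu; apply: c_if; [by comp|by comp|]; apply: c_cnt => //; comp.
  by apply: (c_comp K); comp.
by apply: (c_comp H); comp.
Qed.
Lemma c_divn (f g : A -> nat) : Comp f -> Comp g -> Comp (fun a => f a %/ g a).
Proof. by move=> H K; apply: (comp_ext (fun a => divuE (f a) (g a))); apply: c_divu. Qed.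
Lemma c_trunc_log2 (f : A -> nat) : Comp f -> Comp (fun a => trunc_log 2 (f a)).
Proof.
move=> H; apply: (comp_ext (fun a => loguE (f a))).
by rewrite /logu; apply: c_cnt => //; comp; apply: (c_comp H); comp.
Qed.
End Rules7.
Section Rules8.
Context {A : Type} {EA : Enc A}.
Lemma c_modn (f g : A -> nat) : Comp f -> Comp g -> Comp (fun a => f a %% g a).
Proof.
move=> H K; apply: (comp_ext (fun a => moduE (f a) (g a))).
by apply: c_subn => //; apply: c_muln => //; apply: c_divu.
Qed.
End Rules8.

Ltac comp_user1 := fail.
Ltac comp_user ::= lazymatch goal with
 | |- Comp (fun a => flatu (@?f a)) => apply (@c_flatu _ _ f)
 | |- Comp (fun a => pairsu (@?f a) (@?g a)) => apply (@c_pairsu _ _ f g)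
 | |- Comp (fun a => listsn (@?f a) (@?g a)) => apply (@c_listsn _ _ f g)
 | |- Comp (fun a => lists_le (@?f a) (@?g a)) => apply (@c_lists_le _ _ f g)
 | |- Comp (fun a => sublists (@?f a)) => apply (@c_sublists _ _ f)
 | |- Comp (fun a => cnt (@?f a) (@?g a)) => apply (@c_cnt _ _ f g)
 | |- Comp (fun a => indexn (@?f a) (@?g a)) => apply (@c_indexn _ _ f g)
 | |- Comp (fun a => take (@?f a) (@?g a)) => apply (@c_take _ _ f g)
 | |- Comp (fun a => uniq (@?g a)) => apply (@c_uniq _ _ g)
 | |- Comp (fun a => divn (@?f a) (@?g a)) => apply (@c_divn _ _ f g)
 | |- Comp (fun a => modn (@?f a) (@?g a)) => apply (@c_modn _ _ f g)
 | |- Comp (fun a => trunc_log 2 (@?f a)) => apply (@c_trunc_log2 _ _ f)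
 | _ => comp_user1
 end.
Arguments enc_list : simpl never.
Arguments listsn : simpl never.
Arguments lists_le : simpl never.
Arguments sublists : simpl never.
Arguments pairsu : simpl never.
Arguments flatu : simpl never.
Arguments unl : simpl never.

(** * Node-edge normal form *)

Definition fld r k := nth 0 (unl r) k.
Definition mD m := fld m 0.
Definition mIn m := fld m 1.
Definition mOut m := fld m 2.
Definition mR m := fld m 3.
Definition mC m := unl (fld m 4).

(* The label of a half-edge (v, w) is the code of [:: input vw; output vw; input wv; output wv; views behind w; views behind v],
   where the views behind w are the codes of the rooted trees seen from w away from v to depths 0, ..., r - 1.
   A rooted tree is the list of its children, each carrying the four labels of its edge and its own subtree. *)
Definition roses m : seq nat :=
  iter (mR m) (fun B => B ++ lists_le (mD m) (listsn 5 (iota 0 (mIn m + mOut m) ++ B))) [:: 0].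
Definition nfL m : seq nat :=
  [seq z <- listsn 6 (iota 0 (mIn m + mOut m) ++ lists_le (mR m) (roses m)) |
    [&& fld z 0 < mIn m, fld z 1 < mOut m, fld z 2 < mIn m & fld z 3 < mOut m]].
Definition flip z := enc_list [:: fld z 2; fld z 3; fld z 0; fld z 1; fld z 5; fld z 4].

(* Nodes of a rooted tree are addressed by lists of child indices; [0] is returned for an invalid address, [t.+1] for the subtree [t]. *)
Definition descend t (p : seq nat) : nat :=
  foldl (fun acc i => if acc == 0 then 0 else
           if i < size (unl acc.-1) then (fld (nth 0 (unl acc.-1) i) 4).+1 else 0) t.+1 p.
Definition adrs m t := undup [seq p <- lists_le (mR m) (iota 0 (mD m)) | descend t (unl p) != 0].
Definition entry t (q : seq nat) := nth 0 (unl (descend t (take (size q).-1 q)).-1) (nth 0 q (size q).-1).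
Definition ischild (p q : seq nat) := (q != [::]) && (take (size q).-1 q == p).
Definition labpq t (p q : seq nat) : seq nat :=
  if ischild p q then [:: fld (entry t q) 0; fld (entry t q) 1]
  else if ischild q p then [:: fld (entry t p) 2; fld (entry t p) 3] else [::].
Definition hl H a b : seq nat :=
  foldr (fun e acc => if (fld e 0 == a) && (fld e 1 == b) then [:: fld e 2; fld e 3]
     else if (fld e 0 == b) && (fld e 1 == a) then [:: fld e 4; fld e 5] else acc) [::] (unl (fld H 1)).
(** The list [g] assigns a node of [H] to every address. Being duplicate free and of the size of [H]
    it is a bijection, and agreement of [hl] with [labpq] on all pairs makes it an isomorphism of
    labelled graphs. The address with code 0 is empty and denotes the center. *)
Definition matchH m t H : bool :=
  (size (adrs m t) == fld H 0) &&
  has (fun g => [&& uniq (unl g), nth 0 (unl g) (indexn 0 (adrs m t)) == fld H 2 &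
       all (fun i => all (fun j => hl H (nth 0 (unl g) i) (nth 0 (unl g) j) ==
              labpq t (unl (nth 0 (adrs m t) i)) (unl (nth 0 (adrs m t) j)))
         (iota 0 (fld H 0))) (iota 0 (fld H 0))])
    (listsn (fld H 0) (iota 0 (fld H 0))).

Definition ent (es : seq nat) j k := enc_list [:: fld (nth 0 es k) 0; fld (nth 0 es k) 1;
   fld (nth 0 es k) 2; fld (nth 0 es k) 3; nth 0 (unl (fld (nth 0 es k) 4)) j].
Definition rose (es : seq nat) j skip :=
  enc_list (map (ent es j) [seq k <- iota 0 (size es) | k != skip]).
(** The view to depth [j] away from port [i]; the index [size es] skips no port and gives the whole
    ball. *)
Definition vspec es i j := if j == 0 then 0 else rose es j.-1 i.
(** A view to depth [j + 1] away from a port is determined by the views to depth [j] behind the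
    other ports. Comparing them at every node forces all stored views to be true by induction on the
    depth, although each check concerns the half-edges of one node only. *)
Definition nfN m (ins es : seq nat) : bool :=
  [&& size es == size ins,
     all (fun k => fld (nth 0 es k) 0 == nth 0 ins k) (iota 0 (size ins)),
     all (fun i => fld (nth 0 es i) 5 == enc_list (map (vspec es i) (iota 0 (mR m)))) (iota 0 (size ins)) &
     has (matchH m (vspec es (size es) (mR m))) (mC m)].

Section R1.
Context {A : Type} {EA : Enc A}.
Lemma c_fld (f g : A -> nat) : Comp f -> Comp g -> Comp (fun a => fld (f a) (g a)).
Proof. by move=> H K; rewrite /fld; comp. Qed.
End R1.
Ltac comp_user2 := fail.
Ltac comp_user1 ::= lazymatch goal with
 | |- Comp (fun a => fld (@?f a) (@?g a)) => apply (@c_fld _ _ f g)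
 | _ => comp_user2
 end.
Ltac compu X := match goal with |- Comp (fun a => @?h a) => unfold X end; comp.
Ltac weak H := apply: (c_comp H); comp.

Section R2.
Context {A : Type} {EA : Enc A}.
Lemma c_undup (f : A -> seq nat) : Comp f -> Comp (fun a => undup (f a)).
Proof.
move=> H; apply: (@comp_ext _ _ _ _ (fun a => foldr (fun x s => if x \in s then s else x :: s) [::] (f a))).
  by move=> a; elim: (f a) => //= x s ->; rewrite mem_undup.
by comp => //; apply: c_if; comp.
Qed.
Lemma c_mD (f : A -> nat) : Comp f -> Comp (fun a => mD (f a)). Proof. by move=> H; compu mD. Qed.
Lemma c_mIn (f : A -> nat) : Comp f -> Comp (fun a => mIn (f a)). Proof. by move=> H; compu mIn. Qed.
Lemma c_mOut (f : A -> nat) : Comp f -> Comp (fun a => mOut (f a)). Proof. by move=> H; compu mOut. Qed.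
Lemma c_mR (f : A -> nat) : Comp f -> Comp (fun a => mR (f a)). Proof. by move=> H; compu mR. Qed.
Lemma c_mC (f : A -> nat) : Comp f -> Comp (fun a => mC (f a)). Proof. by move=> H; compu mC. Qed.
Lemma c_flip (f : A -> nat) : Comp f -> Comp (fun a => flip (f a)). Proof. by move=> H; compu flip. Qed.
Lemma c_descend (t : A -> nat) (p : A -> seq nat) : Comp t -> Comp p -> Comp (fun a => descend (t a) (p a)).
Proof. by move=> H K; compu descend. Qed.
Lemma c_hl (t a b : A -> nat) : Comp t -> Comp a -> Comp b -> Comp (fun x => hl (t x) (a x) (b x)).
Proof. move=> H K K2; compu hl; by [|weak K|weak K2]. Qed.
Lemma c_ischild (p q : A -> seq nat) : Comp p -> Comp q -> Comp (fun x => ischild (p x) (q x)).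
Proof. by move=> H K; compu ischild. Qed.
Lemma c_ent (es : A -> seq nat) (j k : A -> nat) : Comp es -> Comp j -> Comp k -> Comp (fun a => ent (es a) (j a) (k a)).
Proof. by move=> H K K2; compu ent. Qed.
End R2.
Ltac comp_user3 := fail.
Ltac comp_user2 ::= lazymatch goal with
 | |- Comp (fun a => undup (@?f a)) => apply (@c_undup _ _ f)
 | |- Comp (fun a => mD (@?f a)) => apply (@c_mD _ _ f)
 | |- Comp (fun a => mIn (@?f a)) => apply (@c_mIn _ _ f)
 | |- Comp (fun a => mOut (@?f a)) => apply (@c_mOut _ _ f)
 | |- Comp (fun a => mR (@?f a)) => apply (@c_mR _ _ f)
 | |- Comp (fun a => mC (@?f a)) => apply (@c_mC _ _ f)
 | |- Comp (fun a => flip (@?f a)) => apply (@c_flip _ _ f)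
 | |- Comp (fun a => descend (@?f a) (@?g a)) => apply (@c_descend _ _ f g)
 | |- Comp (fun a => hl (@?f a) (@?g a) (@?h a)) => apply (@c_hl _ _ f g h)
 | |- Comp (fun a => ischild (@?f a) (@?g a)) => apply (@c_ischild _ _ f g)
 | |- Comp (fun a => ent (@?f a) (@?g a) (@?h a)) => apply (@c_ent _ _ f g h)
 | _ => comp_user3
 end.
Section R3.
Context {A : Type} {EA : Enc A}.
Lemma c_roses (f : A -> nat) : Comp f -> Comp (fun a => roses (f a)).
Proof. move=> H; compu roses => //; weak H. Qed.
Lemma c_entry (t : A -> nat) (p : A -> seq nat) : Comp t -> Comp p -> Comp (fun a => entry (t a) (p a)).
Proof. by move=> H K; compu entry. Qed.
Lemma c_adrs (m t : A -> nat) : Comp m -> Comp t -> Comp (fun a => adrs (m a) (t a)).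
Proof. by move=> H K; compu adrs => //; weak K. Qed.
Lemma c_rose (es : A -> seq nat) (j k : A -> nat) : Comp es -> Comp j -> Comp k -> Comp (fun a => rose (es a) (j a) (k a)).
Proof. move=> H K K2; compu rose => //; by [weak H|weak K|weak K2]. Qed.
End R3.
Ltac comp_user4 := fail.
Ltac comp_user3 ::= lazymatch goal with
 | |- Comp (fun a => roses (@?f a)) => apply (@c_roses _ _ f)
 | |- Comp (fun a => entry (@?f a) (@?g a)) => apply (@c_entry _ _ f g)
 | |- Comp (fun a => adrs (@?f a) (@?g a)) => apply (@c_adrs _ _ f g)
 | |- Comp (fun a => rose (@?f a) (@?g a) (@?h a)) => apply (@c_rose _ _ f g h)
 | _ => comp_user4
 end.
Section R4.
Context {A : Type} {EA : Enc A}.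
Lemma c_nfL (f : A -> nat) : Comp f -> Comp (fun a => nfL (f a)).
Proof. by move=> H; compu nfL => //; weak H. Qed.
Lemma c_labpq (t : A -> nat) (p q : A -> seq nat) : Comp t -> Comp p -> Comp q -> Comp (fun a => labpq (t a) (p a) (q a)).
Proof. by move=> H K K2; rewrite /labpq; apply: c_if; [| |apply: c_if]; comp. Qed.
Lemma c_vspec (es : A -> seq nat) (j k : A -> nat) : Comp es -> Comp j -> Comp k -> Comp (fun a => vspec (es a) (j a) (k a)).
Proof. by move=> H K K2; rewrite /vspec; apply: c_if; comp. Qed.
End R4.
Ltac comp_user5 := fail.
Ltac comp_user4 ::= lazymatch goal with
 | |- Comp (fun a => nfL (@?f a)) => apply (@c_nfL _ _ f)
 | |- Comp (fun a => labpq (@?f a) (@?g a) (@?h a)) => apply (@c_labpq _ _ f g h)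
 | |- Comp (fun a => vspec (@?f a) (@?g a) (@?h a)) => apply (@c_vspec _ _ f g h)
 | _ => comp_user5
 end.
Section R5.
Context {A : Type} {EA : Enc A}.
Lemma c_matchH (m t h : A -> nat) : Comp m -> Comp t -> Comp h -> Comp (fun a => matchH (m a) (t a) (h a)).
Proof. move=> H K K2; compu matchH => //; by [weak H|weak K|weak K2]. Qed.
End R5.
Ltac comp_user6 := fail.
Ltac comp_user5 ::= lazymatch goal with
 | |- Comp (fun a => matchH (@?f a) (@?g a) (@?h a)) => apply (@c_matchH _ _ f g h)
 | _ => comp_user6
 end.
Section R6.
Context {A : Type} {EA : Enc A}.
Lemma c_nfN (m : A -> nat) (i e : A -> seq nat) : Comp m -> Comp i -> Comp e -> Comp (fun a => nfN (m a) (i a) (e a)).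
Proof. move=> H K K2; compu nfN => //; by [weak H|weak K|weak K2]. Qed.
End R6.
Ltac comp_user7 := fail.
Ltac comp_user6 ::= lazymatch goal with
 | |- Comp (fun a => nfN (@?f a) (@?g a) (@?h a)) => apply (@c_nfN _ _ f g h)
 | _ => comp_user7
 end.

(** * Certificates *)

(* A class is a list of labels: those that the half-edge pointing into a subtree may carry.  [X] is a set of codes of classes,
   [Ss] gives a class for each port, and [fr] lists the ports behind which there is no subtree. *)
Definition rin (r : seq nat) x y := enc_list [:: x; y] \in r.
Definition relof m (p : nat -> nat -> bool) := [seq z <- pairsu (nfL m) (nfL m) | p (fld z 0) (fld z 1)].
(** The two half-edges of one edge: the relation of a path without inner nodes. *)
Definition rel0 m := relof m (fun x y => y == flip x).
Definition rcomp m r s := relof m (fun x z => has (fun y => rin r x y && rin s y z) (nfL m)).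
Definition rtr m r := relof m (fun x y => rin r y x).
Definition allc m := enc_list (nfL m).
Definition choice m ins Ss := [seq e <- listsn (size ins) (nfL m) | nfN m ins (unl e) &&
   all (fun k => nth 0 (unl e) k \in unl (nth 0 Ss k)) (iota 0 (size ins))].
Definition noderel m ins Ss i1 i2 := relof m (fun y1 y2 =>
   has (fun e => (nth 0 (unl e) i1 == y1) && (nth 0 (unl e) i2 == y2)) (choice m ins Ss)).
(** The flip passes from the label at the node's own port to that of the half-edge pointing to the
    node, which is what a class collects. *)
Definition nodecls m ins Ss i1 := [seq x <- nfL m | has (fun e => nth 0 (unl e) i1 == flip x) (choice m ins Ss)].
Definition vnode m (X : seq nat) (ins : seq nat) Ss (fr : seq nat) := [&& size ins <= mD m, all (fun i => i < mIn m) ins,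
   size Ss == size ins & all (fun k => if k \in fr then nth 0 Ss k == allc m else nth 0 Ss k \in X) (iota 0 (size ins))].
Definition inss m := lists_le (mD m) (iota 0 (mIn m)).
Definition Sss m X (ins : seq nat) := listsn (size ins) (allc m :: X).
Definition closedX m (X : seq nat) := all (fun ic => all (fun sc => all (fun i =>
   ~~ vnode m X (unl ic) (unl sc) [:: i] || (enc_list (nodecls m (unl ic) (unl sc) i) \in X))
   (iota 0 (size (unl ic)))) (Sss m X (unl ic))) (inss m).
Definition rootokX m (X : seq nat) := all (fun ic => all (fun sc =>
   ~~ vnode m X (unl ic) (unl sc) [::] || (choice m (unl ic) (unl sc) != [::])) (Sss m X (unl ic))) (inss m).
Definition nrels m X := flatu (map (fun ic => enc_list (flatu (map (fun sc => enc_list (flatu (map (fun i1 =>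
   enc_list (map (fun i2 => enc_list (noderel m (unl ic) (unl sc) i1 i2))
     [seq i2 <- iota 0 (size (unl ic)) | (i2 != i1) && vnode m X (unl ic) (unl sc) [:: i1; i2]]))
   (iota 0 (size (unl ic)))))) (Sss m X (unl ic))))) (inss m)).
(** A word begins and ends with an edge and alternates edges with nodes; [k] counts the nodes. *)
Definition words m X k := iter k (fun W => flatu (map (fun a =>
   enc_list (map (fun r => enc_list (rcomp m (rel0 m) (rcomp m (unl a) (unl r)))) W)) (nrels m X))) [:: enc_list (rel0 m)].
(** Exceeds the number of relations on the labels, so that two prefixes of a word of this length
    have the same product. *)
Definition ellm m := (2 ^ (size (nfL m) * size (nfL m))).+1.
Definition rect S1 S2 r := all (fun x => all (fun y => rin r x y) S2) S1.
(** These are the lengths at which the algorithm cuts: two links shorter than [ellm m] joined at a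
    node give a length below [2 * ellm m], and a join that reaches [ellm m] is cut at once. *)
Definition cutX m (X X' : seq nat) : bool := all (fun k => all (fun r =>
   has (fun s1 => has (fun s2 => rect (unl s1) (unl s2) (unl r)) X') X') (words m X k)) (iota (ellm m) (ellm m)).
(* The chain of layers is constant from index [k] on; [lp = 1] asks that the last layer can be cut into itself. *)
Definition lay Xs k i := unl (nth 0 Xs (if i < k then i else k)).
Definition goodc m k lp Xs := [&& all (fun i => closedX m (lay Xs k i)) (iota 0 k.+1),
   all (fun i => cutX m (lay Xs k i) (lay Xs k i.+1)) (iota 0 (k + lp)),
   all (fun i => all (fun s => s \in lay Xs k i.+1) (lay Xs k i)) (iota 0 k) & rootokX m (lay Xs k k)].
Definition certs m k := listsn k.+1 (sublists (sublists (nfL m))).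
Definition good m k lp := has (fun c => goodc m k lp (unl c)) (certs m k).
Definition thecert m k lp := unl (nth 0 (certs m k) (find (fun c => goodc m k lp (unl c)) (certs m k))).

Section R1.
Context {A : Type} {EA : Enc A}.
Lemma c_relof (m : A -> nat) (p : A -> nat -> nat -> bool) : Comp m ->
  Comp (fun q : A * nat * nat => p q.1.1 q.1.2 q.2) -> Comp (fun a => relof (m a) (p a)).
Proof.
move=> H K; compu relof; apply: (c_comp K (g := fun q : A * nat => (q.1, fld q.2 0, fld q.2 1))); comp.
Qed.
Lemma c_rin (r : A -> seq nat) (x y : A -> nat) : Comp r -> Comp x -> Comp y -> Comp (fun a => rin (r a) (x a) (y a)).
Proof. by move=> H K K2; compu rin. Qed.
Lemma c_allc (m : A -> nat) : Comp m -> Comp (fun a => allc (m a)). Proof. by move=> H; compu allc. Qed.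
Lemma c_inss (m : A -> nat) : Comp m -> Comp (fun a => inss (m a)). Proof. by move=> H; compu inss. Qed.
Lemma c_ellm (m : A -> nat) : Comp m -> Comp (fun a => ellm (m a)). Proof. by move=> H; compu ellm. Qed.
Lemma c_choice (m : A -> nat) (i S : A -> seq nat) : Comp m -> Comp i -> Comp S -> Comp (fun a => choice (m a) (i a) (S a)).
Proof. move=> H K K2; compu choice; by [|weak H|weak K|weak K2]. Qed.
Lemma c_lay (m : A -> seq nat) (i S : A -> nat) : Comp m -> Comp i -> Comp S -> Comp (fun a => lay (m a) (i a) (S a)).
Proof. move=> H K K2; compu lay; apply: c_if; comp. Qed.
End R1.
Ltac comp_user8 := fail.
Ltac comp_user7 ::= lazymatch goal with
 | |- Comp (fun a => relof (@?f a) (@?g a)) => apply (@c_relof _ _ f g)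
 | |- Comp (fun a => rin (@?f a) (@?g a) (@?h a)) => apply (@c_rin _ _ f g h)
 | |- Comp (fun a => allc (@?f a)) => apply (@c_allc _ _ f)
 | |- Comp (fun a => inss (@?f a)) => apply (@c_inss _ _ f)
 | |- Comp (fun a => ellm (@?f a)) => apply (@c_ellm _ _ f)
 | |- Comp (fun a => choice (@?f a) (@?g a) (@?h a)) => apply (@c_choice _ _ f g h)
 | |- Comp (fun a => lay (@?f a) (@?g a) (@?h a)) => apply (@c_lay _ _ f g h)
 | _ => comp_user8
 end.
Section R2.
Context {A : Type} {EA : Enc A}.
Lemma c_rel0 (m : A -> nat) : Comp m -> Comp (fun a => rel0 (m a)). Proof. by move=> H; compu rel0. Qed.
Lemma c_rcomp (m : A -> nat) (r s : A -> seq nat) : Comp m -> Comp r -> Comp s -> Comp (fun a => rcomp (m a) (r a) (s a)).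
Proof. move=> H K K2; compu rcomp; by [|weak H|weak K|weak K2]. Qed.
Lemma c_rtr (m : A -> nat) (r : A -> seq nat) : Comp m -> Comp r -> Comp (fun a => rtr (m a) (r a)).
Proof. move=> H K; compu rtr; by [|weak K]. Qed.
Lemma c_noderel (m : A -> nat) (i S : A -> seq nat) (j k : A -> nat) : Comp m -> Comp i -> Comp S -> Comp j -> Comp k ->
  Comp (fun a => noderel (m a) (i a) (S a) (j a) (k a)).
Proof. move=> H K K2 K3 K4; compu noderel; by [|weak H|weak K|weak K2|weak K3|weak K4]. Qed.
Lemma c_nodecls (m : A -> nat) (i S : A -> seq nat) (j : A -> nat) : Comp m -> Comp i -> Comp S -> Comp j ->
  Comp (fun a => nodecls (m a) (i a) (S a) (j a)).
Proof. move=> H K K2 K3; compu nodecls; by [|weak H|weak K|weak K2|weak K3]. Qed.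
Lemma c_vnode (m : A -> nat) (X i S fr : A -> seq nat) : Comp m -> Comp X -> Comp i -> Comp S -> Comp fr ->
  Comp (fun a => vnode (m a) (X a) (i a) (S a) (fr a)).
Proof.
move=> H K K2 K3 K4; compu vnode; by [|weak H|weak K|weak K2|weak K3|weak K4].
Qed.
Lemma c_Sss (m : A -> nat) (X i : A -> seq nat) : Comp m -> Comp X -> Comp i -> Comp (fun a => Sss (m a) (X a) (i a)).
Proof. by move=> H K K2; compu Sss. Qed.
Lemma c_rect (r s t : A -> seq nat) : Comp r -> Comp s -> Comp t -> Comp (fun a => rect (r a) (s a) (t a)).
Proof. move=> H K K2; compu rect; by [|weak K|weak K2]. Qed.
Lemma c_certs (m i : A -> nat) : Comp m -> Comp i -> Comp (fun a => certs (m a) (i a)).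
Proof. by move=> H K; compu certs. Qed.
End R2.
Ltac comp_user9 := fail.
Ltac comp_user8 ::= lazymatch goal with
 | |- Comp (fun a => rel0 (@?f a)) => apply (@c_rel0 _ _ f)
 | |- Comp (fun a => rcomp (@?f a) (@?g a) (@?h a)) => apply (@c_rcomp _ _ f g h)
 | |- Comp (fun a => rtr (@?f a) (@?g a)) => apply (@c_rtr _ _ f g)
 | |- Comp (fun a => noderel (@?f a) (@?g a) (@?h a) (@?i a) (@?j a)) => apply (@c_noderel _ _ f g h i j)
 | |- Comp (fun a => nodecls (@?f a) (@?g a) (@?h a) (@?i a)) => apply (@c_nodecls _ _ f g h i)
 | |- Comp (fun a => vnode (@?f a) (@?g a) (@?h a) (@?i a) (@?j a)) => apply (@c_vnode _ _ f g h i j)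
 | |- Comp (fun a => Sss (@?f a) (@?g a) (@?h a)) => apply (@c_Sss _ _ f g h)
 | |- Comp (fun a => rect (@?f a) (@?g a) (@?h a)) => apply (@c_rect _ _ f g h)
 | |- Comp (fun a => certs (@?f a) (@?g a)) => apply (@c_certs _ _ f g)
 | _ => comp_user9
 end.
Section R3.
Context {A : Type} {EA : Enc A}.
Lemma c_closedX (m : A -> nat) (X : A -> seq nat) : Comp m -> Comp X -> Comp (fun a => closedX (m a) (X a)).
Proof. move=> H K; compu closedX; by [|weak H|weak K]. Qed.
Lemma c_rootokX (m : A -> nat) (X : A -> seq nat) : Comp m -> Comp X -> Comp (fun a => rootokX (m a) (X a)).
Proof. move=> H K; compu rootokX; by [|weak H|weak K]. Qed.
Lemma c_nrels (m : A -> nat) (X : A -> seq nat) : Comp m -> Comp X -> Comp (fun a => nrels (m a) (X a)).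
Proof. move=> H K; compu nrels; by [|weak H|weak K]. Qed.
End R3.
Ltac comp_user10 := fail.
Ltac comp_user9 ::= lazymatch goal with
 | |- Comp (fun a => closedX (@?f a) (@?g a)) => apply (@c_closedX _ _ f g)
 | |- Comp (fun a => rootokX (@?f a) (@?g a)) => apply (@c_rootokX _ _ f g)
 | |- Comp (fun a => nrels (@?f a) (@?g a)) => apply (@c_nrels _ _ f g)
 | _ => comp_user10
 end.
Section R4.
Context {A : Type} {EA : Enc A}.
Lemma c_words (m : A -> nat) (X : A -> seq nat) (k : A -> nat) : Comp m -> Comp X -> Comp k -> Comp (fun a => words (m a) (X a) (k a)).
Proof. move=> H K K2; compu words; by [|weak H|weak K]. Qed.
End R4.
Ltac comp_user11 := fail.
Ltac comp_user10 ::= lazymatch goal with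
 | |- Comp (fun a => words (@?f a) (@?g a) (@?h a)) => apply (@c_words _ _ f g h)
 | _ => comp_user11
 end.
Section R5.
Context {A : Type} {EA : Enc A}.
Lemma c_cutX (m : A -> nat) (X Y : A -> seq nat) : Comp m -> Comp X -> Comp Y -> Comp (fun a => cutX (m a) (X a) (Y a)).
Proof. move=> H K K2; compu cutX; by [|weak H|weak K|weak K2]. Qed.
End R5.
Ltac comp_user12 := fail.
Ltac comp_user11 ::= lazymatch goal with
 | |- Comp (fun a => cutX (@?f a) (@?g a) (@?h a)) => apply (@c_cutX _ _ f g h)
 | _ => comp_user12
 end.
Section R6.
Context {A : Type} {EA : Enc A}.
Lemma c_goodc (m k lp : A -> nat) (X : A -> seq nat) : Comp m -> Comp k -> Comp lp -> Comp X ->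
  Comp (fun a => goodc (m a) (k a) (lp a) (X a)).
Proof. move=> H K K2 K3; compu goodc; by [|weak H|weak K|weak K2|weak K3]. Qed.
End R6.
Ltac comp_user13 := fail.
Ltac comp_user12 ::= lazymatch goal with
 | |- Comp (fun a => goodc (@?f a) (@?g a) (@?h a) (@?i a)) => apply (@c_goodc _ _ f g h i)
 | _ => comp_user13
 end.
Section R7.
Context {A : Type} {EA : Enc A}.
Lemma c_good (m k lp : A -> nat) : Comp m -> Comp k -> Comp lp -> Comp (fun a => good (m a) (k a) (lp a)).
Proof. move=> H K K2; compu good; by [|weak H|weak K|weak K2]. Qed.
Lemma c_thecert (m k lp : A -> nat) : Comp m -> Comp k -> Comp lp -> Comp (fun a => thecert (m a) (k a) (lp a)).
Proof. move=> H K K2; compu thecert; by [|weak H|weak K|weak K2]. Qed.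
End R7.
Ltac comp_user14 := fail.
Ltac comp_user13 ::= lazymatch goal with
 | |- Comp (fun a => good (@?f a) (@?g a) (@?h a)) => apply (@c_good _ _ f g h)
 | |- Comp (fun a => thecert (@?f a) (@?g a) (@?h a)) => apply (@c_thecert _ _ f g h)
 | _ => comp_user14
 end.

(** * The rake-and-compress algorithm *)

(* node records: [id; inputs; colour; removal step + 1 (0 = alive); ports; labels] *)
Definition r_id r := fld r 0.
Definition r_inp r := unl (fld r 1).
Definition r_col r := fld r 2.
Definition r_time r := fld r 3.
Definition r_ports r := unl (fld r 4).
Definition r_labs r := unl (fld r 5).
Definition set_col r c := enc_list [:: fld r 0; fld r 1; c; fld r 3; fld r 4; fld r 5].
Definition set_time r t := enc_list [:: fld r 0; fld r 1; fld r 2; t; fld r 4; fld r 5].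
Definition set_ports r ps := enc_list [:: fld r 0; fld r 1; fld r 2; fld r 3; enc_list ps; fld r 5].
Definition set_labs r e := enc_list [:: fld r 0; fld r 1; fld r 2; fld r 3; fld r 4; e].

(* ports: [0; class; level] once the other side is cut off, else
   [1; relation; length; id of the virtual neighbour; its port] *)
Definition p_virt p := fld p 0 == 1.
Definition p_rel p := unl (fld p 1).
Definition p_lev p := fld p 2.
Definition p_len p := fld p 2.
Definition p_id p := fld p 3.
Definition p_port p := fld p 4.
Definition virtp r l u j := enc_list [:: 1; enc_list r; l; u; j].
Definition deadp s l := enc_list [:: 0; s; l].

Definition vports r := [seq k <- iota 0 (size (r_ports r)) | p_virt (nth 0 (r_ports r) k)].
Definition rlev r := foldr (fun p a => if p_virt p then a else if p_lev p < a then a else p_lev p) 0 (r_ports r).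
Definition hang m r := map (fun p => if p_virt p then allc m else fld p 1) (r_ports r).
(** A node of degree two is compressed only if its hanging subtrees have level at most [i]: its
    relation then comes from layer [i], and a cut produces classes of layer [i + 1]. *)
Definition removable s kap i r := [&& r_time r == 0, r_col r == s &
   (size (vports r) <= 1) || [&& kap, size (vports r) == 2 & rlev r <= i]].
Definition raked m rho r j := [seq x <- nfL m |
   has (fun e => rin rho x (nth 0 (unl e) j)) (choice m (r_inp r) (hang m r))].
Definition pickrect (X : seq nat) (rho : seq nat) :=
  nth 0 [seq z <- pairsu X X | rect (unl (fld z 0)) (unl (fld z 1)) rho]
    0.
Definition oport r j := if nth 0 (vports r) 0 == j then nth 0 (vports r) 1 else nth 0 (vports r) 0.
Definition joinrel m p rb := rcomp m (p_rel p) (rcomp m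
   (noderel m (r_inp rb) (hang m rb) (p_port p) (oport rb (p_port p)))
   (p_rel (nth 0 (r_ports rb) (oport rb (p_port p))))).
(** Both ends of a path being cut evaluate this independently. Comparing the two ports of the
    removed node makes them choose the same orientation, hence the same rectangle, of which each end
    takes its own side. *)
Definition newport m Xs k i p rb :=
  if size (vports rb) <= 1 then
    deadp (enc_list (raked m (p_rel p) rb (p_port p))) (if rlev rb < i then i else rlev rb)
  else if (p_len p + p_len (nth 0 (r_ports rb) (oport rb (p_port p)))).+1 < ellm m then
    virtp (joinrel m p rb) (p_len p + p_len (nth 0 (r_ports rb) (oport rb (p_port p)))).+1
      (p_id (nth 0 (r_ports rb) (oport rb (p_port p)))) (p_port (nth 0 (r_ports rb) (oport rb (p_port p))))
  else if p_port p < oport rb (p_port p) then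
    deadp (fld (pickrect (lay Xs k i.+1) (joinrel m p rb)) 0) i.+1
  else deadp (fld (pickrect (lay Xs k i.+1) (rtr m (joinrel m p rb))) 1) i.+1.
Definition lookup (B : seq nat) u := nth 0 B (find (fun r => r_id r == u) B).
Definition upstep m Xs k s kap i t r B :=
  if r_time r != 0 then r else if removable s kap i r then set_time r t else
  set_ports r (map (fun p => if p_virt p && removable s kap i (lookup B (p_id p))
     then newport m Xs k i p (lookup B (p_id p)) else p) (r_ports r)).
Definition downok r B e := all (fun j => ~~ p_virt (nth 0 (r_ports r) j) ||
   rin (p_rel (nth 0 (r_ports r) j)) (nth 0 (unl e) j)
     (nth 0 (r_labs (lookup B (p_id (nth 0 (r_ports r) j)))) (p_port (nth 0 (r_ports r) j))))
   (iota 0 (size (r_ports r))).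
Definition downstep m t r B :=
  if r_time r != t then r else
  set_labs r (nth 0 [seq e <- choice m (r_inp r) (hang m r) | downok r B e] 0).

(** Bounds the size of a ball of radius [ellm m], as in [bl_size]. *)
Definition palette m := (mD m).+1 ^ (ellm m).
(** Identifiers are grouped into blocks of [2 ^ j] consecutive numbers. Round [b] of the colouring
    merges blocks in pairs and keeps the colouring proper inside each block. *)
Definition sameblock j u v := u %/ 2 ^ j == v %/ 2 ^ j.
Definition mex d (l : seq nat) := find (fun q => ~~ (q \in l)) (iota 0 d).
(** Step 0 shifts the colours in the upper half of each new block by [d]. Each later step frees one
    of the extra colours: its nodes are pairwise far apart inside a block, so all of them may take
    the least free colour at once. *)
Definition colstep d b sub r B :=
  if sub == 0 then set_col r (if ((r_id r %/ 2 ^ b) %% 2 == 1) && (r_col r < d) then r_col r + d else r_col r)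
  else if r_col r == (d + sub).-1 then
    set_col r (mex d (map r_col [seq u <- B | (r_id u != r_id r) && sameblock b.+1 (r_id u) (r_id r)]))
  else r.

Definition tcol m c n := c * (trunc_log 2 n).+1 * (palette m).+1.
(** [K] phases of [gam] rake passes and one compress pass, then [gam] last rake passes; a pass runs
    through all colours. *)
Definition tup m gam K := (K * gam.+1 + gam) * palette m.
Definition upat m Xs k gam s r B :=
  upstep m Xs k (s %% palette m) ((s %/ palette m) %% gam.+1 == gam) ((s %/ palette m) %/ gam.+1) s.+1 r B.
(* Schedule: bitwise colouring by identifiers, then the peeling steps, then the same steps backwards. *)
Definition phi m Xs k gam K c n tau r B :=
  if tau < tcol m c n then
    colstep (palette m) (tau %/ (palette m).+1) (tau %% (palette m).+1) r B
  else if tau < tcol m c n + tup m gam K then upat m Xs k gam (tau - tcol m c n) r B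
  else downstep m (tcol m c n + 2 * tup m gam K - tau) r B.

(** A state is a round counter, the own record and the records collected so far. The first round
    exchanges identifiers and port numbers; after that, every [ellm m] rounds flood the records to
    distance [ellm m] and carry out one step of the schedule. *)
Definition ainit u ins := enc_list [:: 0; enc_list [:: u; ins]; 0].
Definition asend st i := if fld st 0 == 0 then enc_list [:: fld (fld st 1) 0; i] else fld st 2.
Definition firstrec m w ms := enc_list [:: fld w 0; fld w 1; 0; 0;
   enc_list (map (fun x => virtp (rel0 m) 0 (fld x 0) (fld x 1)) (unl ms)); 0].
Definition arecv m Xs k gam K c n st ms :=
  if fld st 0 == 0 then enc_list [:: 1; firstrec m (fld st 1) ms; enc_list [:: firstrec m (fld st 1) ms]]
  else if fld st 0 %% ellm m == 0 then
    enc_list [:: (fld st 0).+1;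
      phi m Xs k gam K c n (fld st 0 %/ ellm m).-1 (fld st 1) (fld st 1 :: flatu (unl ms));
      enc_list [:: phi m Xs k gam K c n (fld st 0 %/ ellm m).-1 (fld st 1) (fld st 1 :: flatu (unl ms))]]
  else enc_list [:: (fld st 0).+1; fld st 1; enc_list (fld st 1 :: flatu (unl ms))].
Definition aout st i := fld (nth 0 (r_labs (fld st 1)) i) 1.
Definition rounds m gam K c n := (ellm m * (tcol m c n + 2 * tup m gam K)).+1.

Section R1.
Context {A : Type} {EA : Enc A}.
Lemma c_r_id (f : A -> nat) : Comp f -> Comp (fun a => r_id (f a)). Proof. by move=> H; compu r_id. Qed.
Lemma c_r_inp (f : A -> nat) : Comp f -> Comp (fun a => r_inp (f a)). Proof. by move=> H; compu r_inp. Qed.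
Lemma c_r_col (f : A -> nat) : Comp f -> Comp (fun a => r_col (f a)). Proof. by move=> H; compu r_col. Qed.
Lemma c_r_time (f : A -> nat) : Comp f -> Comp (fun a => r_time (f a)). Proof. by move=> H; compu r_time. Qed.
Lemma c_r_ports (f : A -> nat) : Comp f -> Comp (fun a => r_ports (f a)). Proof. by move=> H; compu r_ports. Qed.
Lemma c_r_labs (f : A -> nat) : Comp f -> Comp (fun a => r_labs (f a)). Proof. by move=> H; compu r_labs. Qed.
Lemma c_p_virt (f : A -> nat) : Comp f -> Comp (fun a => p_virt (f a)). Proof. by move=> H; compu p_virt. Qed.
Lemma c_p_rel (f : A -> nat) : Comp f -> Comp (fun a => p_rel (f a)). Proof. by move=> H; compu p_rel. Qed.
Lemma c_p_lev (f : A -> nat) : Comp f -> Comp (fun a => p_lev (f a)). Proof. by move=> H; compu p_lev. Qed.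
Lemma c_p_len (f : A -> nat) : Comp f -> Comp (fun a => p_len (f a)). Proof. by move=> H; compu p_len. Qed.
Lemma c_p_id (f : A -> nat) : Comp f -> Comp (fun a => p_id (f a)). Proof. by move=> H; compu p_id. Qed.
Lemma c_p_port (f : A -> nat) : Comp f -> Comp (fun a => p_port (f a)). Proof. by move=> H; compu p_port. Qed.
Lemma c_palette (f : A -> nat) : Comp f -> Comp (fun a => palette (f a)). Proof. by move=> H; compu palette. Qed.
Lemma c_set_col (f g : A -> nat) : Comp f -> Comp g -> Comp (fun a => set_col (f a) (g a)). Proof. by move=> H K; compu set_col. Qed.
Lemma c_set_time (f g : A -> nat) : Comp f -> Comp g -> Comp (fun a => set_time (f a) (g a)). Proof. by move=> H K; compu set_time. Qed.
Lemma c_set_labs (f g : A -> nat) : Comp f -> Comp g -> Comp (fun a => set_labs (f a) (g a)). Proof. by move=> H K; compu set_labs. Qed.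
Lemma c_set_ports (f : A -> nat) (g : A -> seq nat) : Comp f -> Comp g -> Comp (fun a => set_ports (f a) (g a)). Proof. by move=> H K; compu set_ports. Qed.
Lemma c_deadp (f g : A -> nat) : Comp f -> Comp g -> Comp (fun a => deadp (f a) (g a)). Proof. by move=> H K; compu deadp. Qed.
Lemma c_virtp (r : A -> seq nat) (f g h : A -> nat) : Comp r -> Comp f -> Comp g -> Comp h ->
  Comp (fun a => virtp (r a) (f a) (g a) (h a)). Proof. by move=> H K H2 K2; compu virtp. Qed.
Lemma c_pickrect (f g : A -> seq nat) : Comp f -> Comp g -> Comp (fun a => pickrect (f a) (g a)).
Proof. by move=> H K; compu pickrect; weak K. Qed.
Lemma c_sameblock (f g h : A -> nat) : Comp f -> Comp g -> Comp h -> Comp (fun a => sameblock (f a) (g a) (h a)).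
Proof. by move=> H K K2; compu sameblock. Qed.
Lemma c_mex (f : A -> nat) (g : A -> seq nat) : Comp f -> Comp g -> Comp (fun a => mex (f a) (g a)).
Proof. by move=> H K; compu mex; weak K. Qed.
End R1.
Ltac comp_user15 := fail.
Ltac comp_user14 ::= lazymatch goal with
 | |- Comp (fun a => r_id (@?f a)) => apply (@c_r_id _ _ f)
 | |- Comp (fun a => r_inp (@?f a)) => apply (@c_r_inp _ _ f)
 | |- Comp (fun a => r_col (@?f a)) => apply (@c_r_col _ _ f)
 | |- Comp (fun a => r_time (@?f a)) => apply (@c_r_time _ _ f)
 | |- Comp (fun a => r_ports (@?f a)) => apply (@c_r_ports _ _ f)
 | |- Comp (fun a => r_labs (@?f a)) => apply (@c_r_labs _ _ f)
 | |- Comp (fun a => p_virt (@?f a)) => apply (@c_p_virt _ _ f)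
 | |- Comp (fun a => p_rel (@?f a)) => apply (@c_p_rel _ _ f)
 | |- Comp (fun a => p_lev (@?f a)) => apply (@c_p_lev _ _ f)
 | |- Comp (fun a => p_len (@?f a)) => apply (@c_p_len _ _ f)
 | |- Comp (fun a => p_id (@?f a)) => apply (@c_p_id _ _ f)
 | |- Comp (fun a => p_port (@?f a)) => apply (@c_p_port _ _ f)
 | |- Comp (fun a => palette (@?f a)) => apply (@c_palette _ _ f)
 | |- Comp (fun a => set_col (@?f a) (@?g a)) => apply (@c_set_col _ _ f g)
 | |- Comp (fun a => set_time (@?f a) (@?g a)) => apply (@c_set_time _ _ f g)
 | |- Comp (fun a => set_labs (@?f a) (@?g a)) => apply (@c_set_labs _ _ f g)
 | |- Comp (fun a => set_ports (@?f a) (@?g a)) => apply (@c_set_ports _ _ f g)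
 | |- Comp (fun a => deadp (@?f a) (@?g a)) => apply (@c_deadp _ _ f g)
 | |- Comp (fun a => virtp (@?f a) (@?g a) (@?h a) (@?i a)) => apply (@c_virtp _ _ f g h i)
 | |- Comp (fun a => pickrect (@?f a) (@?g a)) => apply (@c_pickrect _ _ f g)
 | |- Comp (fun a => mex (@?f a) (@?g a)) => apply (@c_mex _ _ f g)
 | |- Comp (fun a => sameblock (@?f a) (@?g a) (@?h a)) => apply (@c_sameblock _ _ f g h)
 | _ => comp_user15
 end.
Section R2.
Context {A : Type} {EA : Enc A}.
Lemma c_vports (f : A -> nat) : Comp f -> Comp (fun a => vports (f a)).
Proof. by move=> H; compu vports => //; weak H. Qed.
Lemma c_rlev (f : A -> nat) : Comp f -> Comp (fun a => rlev (f a)).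
Proof. by move=> H; compu rlev. Qed.
Lemma c_hang (m f : A -> nat) : Comp m -> Comp f -> Comp (fun a => hang (m a) (f a)).
Proof. by move=> H K; compu hang => //; weak H. Qed.
Lemma c_lookup (B : A -> seq nat) (u : A -> nat) : Comp B -> Comp u -> Comp (fun a => lookup (B a) (u a)).
Proof. by move=> H K; compu lookup => //; weak K. Qed.
End R2.
Ltac comp_user16 := fail.
Ltac comp_user15 ::= lazymatch goal with
 | |- Comp (fun a => vports (@?f a)) => apply (@c_vports _ _ f)
 | |- Comp (fun a => rlev (@?f a)) => apply (@c_rlev _ _ f)
 | |- Comp (fun a => hang (@?f a) (@?g a)) => apply (@c_hang _ _ f g)
 | |- Comp (fun a => lookup (@?f a) (@?g a)) => apply (@c_lookup _ _ f g)
 | _ => comp_user16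
 end.
Section R3.
Context {A : Type} {EA : Enc A}.
Lemma c_removable (s : A -> nat) (kap : A -> bool) (i r : A -> nat) : Comp s -> Comp kap -> Comp i -> Comp r ->
  Comp (fun a => removable (s a) (kap a) (i a) (r a)).
Proof. by move=> H K K2 K3; compu removable. Qed.
Lemma c_oport (f g : A -> nat) : Comp f -> Comp g -> Comp (fun a => oport (f a) (g a)).
Proof. by move=> H K; compu oport. Qed.
Lemma c_raked (m : A -> nat) (rho : A -> seq nat) (r j : A -> nat) : Comp m -> Comp rho -> Comp r -> Comp j ->
  Comp (fun a => raked (m a) (rho a) (r a) (j a)).
Proof. move=> H K K2 K3; compu raked; by [|weak H|weak K|weak K2|weak K3]. Qed.
Lemma c_downok (r : A -> nat) (B : A -> seq nat) (e : A -> nat) : Comp r -> Comp B -> Comp e ->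
  Comp (fun a => downok (r a) (B a) (e a)).
Proof. move=> H K K2; compu downok; by [|weak H|weak K|weak K2]. Qed.
Lemma c_colstep (d b s r : A -> nat) (B : A -> seq nat) : Comp d -> Comp b -> Comp s -> Comp r -> Comp B ->
  Comp (fun a => colstep (d a) (b a) (s a) (r a) (B a)).
Proof. move=> H K K2 K3 K4; compu colstep; by [|weak H|weak K|weak K2|weak K3]. Qed.
End R3.
Ltac comp_user17 := fail.
Ltac comp_user16 ::= lazymatch goal with
 | |- Comp (fun a => removable (@?f a) (@?g a) (@?h a) (@?i a)) => apply (@c_removable _ _ f g h i)
 | |- Comp (fun a => oport (@?f a) (@?g a)) => apply (@c_oport _ _ f g)
 | |- Comp (fun a => raked (@?f a) (@?g a) (@?h a) (@?i a)) => apply (@c_raked _ _ f g h i)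
 | |- Comp (fun a => downok (@?f a) (@?g a) (@?h a)) => apply (@c_downok _ _ f g h)
 | |- Comp (fun a => colstep (@?f a) (@?g a) (@?h a) (@?i a) (@?j a)) => apply (@c_colstep _ _ f g h i j)
 | _ => comp_user17
 end.
Section R4.
Context {A : Type} {EA : Enc A}.
Lemma c_joinrel (m p r : A -> nat) : Comp m -> Comp p -> Comp r -> Comp (fun a => joinrel (m a) (p a) (r a)).
Proof. by move=> H K K2; compu joinrel. Qed.
Lemma c_downstep (m t r : A -> nat) (B : A -> seq nat) : Comp m -> Comp t -> Comp r -> Comp B ->
  Comp (fun a => downstep (m a) (t a) (r a) (B a)).
Proof. move=> H K K2 K3; compu downstep; by [|weak K2|weak K3]. Qed.
End R4.
Ltac comp_user18 := fail.
Ltac comp_user17 ::= lazymatch goal with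
 | |- Comp (fun a => joinrel (@?f a) (@?g a) (@?h a)) => apply (@c_joinrel _ _ f g h)
 | |- Comp (fun a => downstep (@?f a) (@?g a) (@?h a) (@?i a)) => apply (@c_downstep _ _ f g h i)
 | _ => comp_user18
 end.
Section R5.
Context {A : Type} {EA : Enc A}.
Lemma c_newport (m : A -> nat) (Xs : A -> seq nat) (k i p r : A -> nat) : Comp m -> Comp Xs -> Comp k -> Comp i ->
  Comp p -> Comp r -> Comp (fun a => newport (m a) (Xs a) (k a) (i a) (p a) (r a)).
Proof. by move=> H K K2 K3 K4 K5; compu newport. Qed.
End R5.
Ltac comp_user19 := fail.
Ltac comp_user18 ::= lazymatch goal with
 | |- Comp (fun a => newport (@?f a) (@?g a) (@?h a) (@?i a) (@?j a) (@?k a)) => apply (@c_newport _ _ f g h i j k)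
 | _ => comp_user19
 end.
Section R6.
Context {A : Type} {EA : Enc A}.
Lemma c_upstep (m : A -> nat) (Xs : A -> seq nat) (k s : A -> nat) (kap : A -> bool) (i t r : A -> nat) (B : A -> seq nat) :
  Comp m -> Comp Xs -> Comp k -> Comp s -> Comp kap -> Comp i -> Comp t -> Comp r -> Comp B ->
  Comp (fun a => upstep (m a) (Xs a) (k a) (s a) (kap a) (i a) (t a) (r a) (B a)).
Proof.
move=> H K K2 K3 K4 K5 K6 K7 K8; compu upstep;
  by [|weak H|weak K|weak K2|weak K3|weak K4|weak K5|weak K6|weak K8].
Qed.
End R6.
Ltac comp_user20 := fail.
Ltac comp_user19 ::= lazymatch goal with
 | |- Comp (fun a => upstep (@?f a) (@?g a) (@?h a) (@?i a) (@?j a) (@?k a) (@?l a) (@?m a) (@?n a)) =>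
   apply (@c_upstep _ _ f g h i j k l m n)
 | _ => comp_user20
 end.

(** * Relation algebra on labels *)

Lemma fldE s k : fld (enc_list s) k = nth 0 s k. Proof. by rewrite /fld encK. Qed.
Lemma enc_inj_unl z w : unl z = unl w -> z = w. Proof. by move=> E; rewrite -(unlK z) E unlK. Qed.

Section Algebra.
Variable m : nat.
Local Notation L := (nfL m).

Lemma nfL_size z : z \in L -> size (unl z) = 6.
Proof. by rewrite mem_filter => /andP[_ /listsnP[s [h _ ->]]]; rewrite encK. Qed.

Lemma flipK z : z \in L -> flip (flip z) = z.
Proof.
move=> /nfL_size h; apply: enc_inj_unl; rewrite /flip !fldE !encK /fld.
by move: (unl z) h => [|a [|b [|c [|d [|e [|f []]]]]]].
Qed.

Lemma flipL z : z \in L -> flip z \in L.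
Proof.
rewrite !mem_filter => /andP[h0 /listsnP[s [h sub E]]]; subst z; move: h0.
rewrite /flip !fldE /= => /and4P[h0 h1 h2 h3]; apply/andP; split; first by rewrite h0 h1 h2 h3.
apply/listsnP; clear h0 h1 h2 h3; move: s h sub => [|a [|b [|c [|d [|e [|f []]]]]]] // _ sub.
exists [:: c; d; a; b; f; e]; split=> // y; rewrite !inE => H; apply: sub; rewrite !inE.
by move: H; do ![case/orP | move=> ->; rewrite ?orbT //].
Qed.

Lemma rin_relof p x y : rin (relof m p) x y = [&& x \in L, y \in L & p x y].
Proof.
rewrite /rin mem_filter !fldE /= [RHS]andbA andbC; congr andb.
apply/pairsuP/andP => [[x' [y' [h1 h2 /enc_list_inj [-> ->]]]]//|[h1 h2]]; by exists x, y.
Qed.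

Lemma relof_ext p q : (forall x y, x \in L -> y \in L -> p x y = q x y) -> relof m p = relof m q.
Proof.
by move=> H; apply: eq_in_filter => z /pairsuP[x [y [h1 h2 ->]]]; rewrite !fldE /= H.
Qed.

(** Relations in the normal form of [relof] are equal as lists as soon as they are equal as
    relations, so algebraic laws become equations. *)
Definition isrel r := r = relof m (rin r).
Lemma isrel_relof p : isrel (relof m p).
Proof. by apply: relof_ext => x y h1 h2; rewrite rin_relof h1 h2. Qed.
Lemma isrel_eq r s : isrel r -> isrel s -> (forall x y, x \in L -> y \in L -> rin r x y = rin s x y) -> r = s.
Proof. by move=> Hr Hs H; rewrite Hr Hs; apply: relof_ext => x y h1 h2; apply: H. Qed.
Lemma rinL r x y : isrel r -> rin r x y -> x \in L /\ y \in L.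
Proof. by move=> ->; rewrite rin_relof => /and3P[]. Qed.

Lemma rcompP r s x z : reflect (exists y, [/\ x \in L, y \in L, z \in L, rin r x y & rin s y z]) (rin (rcomp m r s) x z).
Proof.
rewrite rin_relof; apply: (iffP and3P) => [[h1 h2 /hasP[y h3 /andP[h4 h5]]]|[y [h1 h3 h2 h4 h5]]].
  by exists y.
by split=> //; apply/hasP; exists y; rewrite // h4 h5.
Qed.

Lemma rcompA r s t : rcomp m r (rcomp m s t) = rcomp m (rcomp m r s) t.
Proof.
apply: isrel_eq; [exact: isrel_relof|exact: isrel_relof|] => x z h1 h2.
apply/rcompP/rcompP => [[y [_ h3 _ h4 /rcompP[u [_ h5 _ h6 h7]]]]|[u [_ h5 _ /rcompP[y [_ h3 _ h4 h6]] h7]]].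
  by exists u; split=> //; apply/rcompP; exists y.
by exists y; split=> //; apply/rcompP; exists u.
Qed.

Lemma rin_rtr r x y : rin (rtr m r) x y = [&& x \in L, y \in L & rin r y x].
Proof. exact: rin_relof. Qed.

Lemma rtrK r : isrel r -> rtr m (rtr m r) = r.
Proof.
move=> H; apply: isrel_eq => //; first exact: isrel_relof.
by move=> x y h1 h2; rewrite !rin_rtr h1 h2.
Qed.

Lemma rtr_comp r s : rtr m (rcomp m r s) = rcomp m (rtr m s) (rtr m r).
Proof.
apply: isrel_eq; [exact: isrel_relof|exact: isrel_relof|] => x z h1 h2.
rewrite rin_rtr h1 h2 /=.
apply/rcompP/rcompP => [[y [_ h3 _ h4 h5]]|[y [_ h3 _ ]]].
  by exists y; rewrite !rin_rtr h1 h2 h3.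
by rewrite !rin_rtr h1 h2 h3 /= => h4 h5; exists y.
Qed.

Lemma rtr_rel0 : rtr m (rel0 m) = rel0 m.
Proof.
apply: relof_ext => x y h1 h2; rewrite rin_relof h1 h2 /=.
by apply/eqP/eqP => ->; rewrite flipK.
Qed.

Lemma rtr_noderel ins Ss i j : rtr m (noderel m ins Ss i j) = noderel m ins Ss j i.
Proof.
apply: relof_ext => x y h1 h2; rewrite rin_relof h1 h2 /=.
by apply: eq_has => e; rewrite andbC.
Qed.

Definition prodrel (l : seq (seq nat)) := foldr (fun a acc => rcomp m (rel0 m) (rcomp m a acc)) (rel0 m) l.
Lemma isrel_prod l : isrel (prodrel l).
Proof. by case: l => [|a l]; apply: isrel_relof. Qed.

Lemma prodrel_cat l1 a l2 : prodrel (l1 ++ a :: l2) = rcomp m (prodrel l1) (rcomp m a (prodrel l2)).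
Proof. by elim: l1 => //= b l1 ->; rewrite !rcompA. Qed.

Lemma rtr_prod l : rtr m (prodrel l) = prodrel (rev (map (rtr m) l)).
Proof.
elim: l => [|a l IH] /=; first exact: rtr_rel0.
by rewrite rev_cons -cats1 prodrel_cat !rtr_comp rtr_rel0 IH /= rcompA.
Qed.

Lemma vnodeP X ins Ss fr : reflect
  [/\ size ins <= mD m, (forall i, i \in ins -> i < mIn m), size Ss = size ins &
   forall k, k < size ins -> if k \in fr then nth 0 Ss k = allc m else nth 0 Ss k \in X]
  (vnode m X ins Ss fr).
Proof.
apply: (iffP and4P) => [[h1 /allP h2 /eqP h3 /allP h4]|[h1 h2 h3 h4]]; split=> //.
- by move=> k kl; move: (h4 k); rewrite mem_iota kl => /(_ isT); case: ifP => // _ /eqP.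
- exact/allP.
- exact/eqP.
- by apply/allP => k; rewrite mem_iota => /h4; case: ifP => // _ /eqP.
Qed.

Lemma vnode_in X ins Ss fr : vnode m X ins Ss fr -> enc_list ins \in inss m /\ enc_list Ss \in Sss m X ins.
Proof.
move=> /vnodeP[h1 h2 h3 h4]; split.
  by apply/lists_leP; exists ins; split=> // i /h2 h; rewrite mem_iota.
apply/listsnP; exists Ss; split=> // s /(nthP 0)[k]; rewrite h3 => kl <-.
by move: (h4 k kl); case: ifP => _ => [->|h]; rewrite inE ?eqxx // h orbT.
Qed.

Lemma closedX_elim X ins Ss i : closedX m X -> vnode m X ins Ss [:: i] -> i < size ins ->
  enc_list (nodecls m ins Ss i) \in X.
Proof.
move=> H V il; have [h1 h2] := vnode_in V.
have /allP/(_ _ h1)/allP := H; rewrite encK => /(_ _ h2); rewrite encK => /allP/(_ i).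
by rewrite mem_iota il V => /(_ isT).
Qed.

Lemma rootokX_elim X ins Ss : rootokX m X -> vnode m X ins Ss [::] -> choice m ins Ss != [::].
Proof.
move=> H V; have [h1 h2] := vnode_in V.
have /allP/(_ _ h1)/allP := H; rewrite encK => /(_ _ h2); by rewrite encK V.
Qed.

Definition isnode (X : seq nat) a := exists ins Ss i j,
  [/\ vnode m X ins Ss [:: i; j], i != j, i < size ins, j < size ins & a = noderel m ins Ss i j].

Lemma nrelsP X z : reflect (exists a, isnode X a /\ z = enc_list a) (z \in nrels m X).
Proof.
rewrite /nrels mem_flatu; apply: (iffP hasP) => [[y /mapP[ic h1 ->]]|[a [[ins [Ss [i [j [V ij il jl ->]]]]] ->]]].
  rewrite encK mem_flatu => /hasP[y' /mapP[sc h2 ->]].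
  rewrite encK mem_flatu => /hasP[y'' /mapP[i1 h3 ->]].
  rewrite encK => /mapP[i2]; rewrite mem_filter => /andP[/andP[h4 h5] h6] ->.
  exists (noderel m (unl ic) (unl sc) i1 i2); split=> //.
  move: h3 h6; rewrite !mem_iota /= => h3 h6.
  by exists (unl ic), (unl sc), i1, i2; split=> //; rewrite eq_sym.
have [h1 h2] := vnode_in V.
eexists; first by apply/mapP; exists (enc_list ins). rewrite !encK mem_flatu; apply/hasP.
eexists; first by apply/mapP; exists (enc_list Ss). rewrite !encK mem_flatu; apply/hasP.
eexists; first by apply/mapP; exists i => //; rewrite mem_iota.
by rewrite encK; apply/mapP; exists j; rewrite // mem_filter mem_iota eq_sym ij V.
Qed.

Lemma isnode_rtr X a : isnode X a -> isnode X (rtr m a).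
Proof.
move=> [ins [Ss [i [j [/vnodeP[h1 h2 h3 h4] ij il jl ->]]]]].
exists ins, Ss, j, i; split; rewrite ?rtr_noderel // 1?eq_sym //.
by apply/vnodeP; split=> // k kl; move: (h4 k kl); rewrite !inE orbC.
Qed.

Definition isword X n r := exists l, [/\ size l = n, (forall a, a \in l -> isnode X a) & r = prodrel l].

Lemma isword_rtr X n r : isword X n r -> isword X n (rtr m r).
Proof.
move=> [l [h1 h2 ->]]; exists (rev (map (rtr m) l)); rewrite size_rev size_map rtr_prod; split=> // a.
by rewrite mem_rev => /mapP[b /h2 hb ->]; apply: isnode_rtr.
Qed.

Lemma isword_cat X n1 n2 r1 r2 a : isword X n1 r1 -> isnode X a -> isword X n2 r2 ->
  isword X (n1 + n2).+1 (rcomp m r1 (rcomp m a r2)).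
Proof.
move=> [l1 [h1 h2 ->]] ha [l2 [k1 k2 ->]]; exists (l1 ++ a :: l2); rewrite size_cat /= h1 k1 addnS prodrel_cat.
split=> // b; rewrite mem_cat inE => /or3P[/h2|/eqP->|/k2] //.
Qed.

Lemma isword0 X : isword X 0 (rel0 m). Proof. by exists [::]. Qed.
Lemma isword_rel X n r : isword X n r -> isrel r.
Proof. by move=> [l [_ _ ->]]; apply: isrel_prod. Qed.

Lemma wordsP X k z : reflect (exists r, isword X k r /\ z = enc_list r) (z \in words m X k).
Proof.
elim: k z => [|k IH] z.
  rewrite inE; apply: (iffP eqP) => [->|[r [[l [/size0nil -> _ ->]] ->]]] //.
  by exists (rel0 m); split=> //; exact: isword0.
rewrite /words iterS -/(words m X k) mem_flatu.
apply: (iffP hasP) => [[y /mapP[a /nrelsP[b [hb ->]] ->]]|[r [[[|a l] [//= [h1] h2 ->]] ->]]].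
  rewrite encK => /mapP[s /IH[r [hr ->]] ->]; rewrite !encK.
  exists (rcomp m (rel0 m) (rcomp m b r)); split=> //.
  by have := isword_cat (isword0 X) hb hr.
eexists; first by apply/mapP; exists (enc_list a); rewrite //; apply/nrelsP; exists a; split=> //; apply: h2; rewrite mem_head.
rewrite encK; apply/mapP; exists (enc_list (prodrel l)); rewrite ?encK //.
by apply/IH; exists (prodrel l); split=> //; exists l; split=> // b hb; apply: h2; rewrite inE hb orbT.
Qed.

Lemma cutX_elim X X' n r : cutX m X X' -> isword X n r -> ellm m <= n < 2 * ellm m ->
  exists s1 s2, [/\ s1 \in X', s2 \in X' & rect (unl s1) (unl s2) r].
Proof.
move=> /allP/(_ n) H W /andP[h1 h2]; have : n \in iota (ellm m) (ellm m) by rewrite mem_iota; lia.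
move=> /H/allP/(_ (enc_list r)).
have -> : enc_list r \in words m X n by apply/wordsP; exists r.
by rewrite encK => /(_ isT)/hasP[s1 h3 /hasP[s2 h4 h5]]; exists s1, s2.
Qed.

Lemma choiceP ins Ss e : reflect (exists s, [/\ size s = size ins, {subset s <= L}, nfN m ins s,
    forall k, k < size ins -> nth 0 s k \in unl (nth 0 Ss k) & e = enc_list s]) (e \in choice m ins Ss).
Proof.
rewrite mem_filter; apply: (iffP andP) => [[/andP[h1 /allP h2] /listsnP[s [h3 h4 E]]]|[s [h1 h2 h3 h4 ->]]].
  subst e; exists s; move: h1 h2; rewrite encK => h1 h2; split=> // k kl; apply: h2; by rewrite mem_iota.
rewrite !encK h3; split; last by apply/listsnP; exists s.
by apply/allP => k; rewrite mem_iota => /h4.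
Qed.

Definition rakedl rho ins Ss j := [seq x <- L | has (fun e => rin rho x (nth 0 (unl e) j)) (choice m ins Ss)].

(** Raking a leaf through a virtual edge does not leave [X]: the nodes of the path behind the edge
    are absorbed one at a time, beginning next to the leaf, and each absorption is a join covered by
    [closedX]. *)
Lemma raked_closed X l ins Ss j : closedX m X -> (forall a, a \in l -> isnode X a) ->
  vnode m X ins Ss [:: j] -> j < size ins -> enc_list (rakedl (prodrel l) ins Ss j) \in X.
Proof.
move=> HX; elim: l => [|a l IH] Hl V jl.
  have := closedX_elim HX V jl; congr (enc_list _ \in X); apply: eq_in_filter => x xL.
  apply: eq_in_has => e /choiceP[s [h1 h2 h3 h4 ->]]; rewrite encK rin_relof xL /=.
  by rewrite h2 // mem_nth // h1.
have {IH} IH : enc_list (rakedl (prodrel l) ins Ss j) \in X.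
  by apply: IH => // b hb; apply: Hl; rewrite inE hb orbT.
have [ins' [Ss' [i1 [i2 [/vnodeP[h1 h2 h3 h4] ij il1 il2 E]]]]] := Hl a (mem_head _ _).
(* The first node of the path sees, at its port [i2], the class of everything behind it. *)
set T := set_nth 0 Ss' i2 (enc_list (rakedl (prodrel l) ins Ss j)).
have sT : size T = size ins' by rewrite size_set_nth h3; apply/maxn_idPr.
have V' : vnode m X ins' T [:: i1].
  apply/vnodeP; split=> // k kl; rewrite inE nth_set_nth /=; move: (h4 k kl); rewrite !inE.
  case: (k =P i1) => [->|_] /=; first by rewrite (negbTE ij).
  by case: (k =P i2).
have := closedX_elim HX V' il1; congr (enc_list _ \in X); apply: eq_in_filter => x xL.
apply/hasP/hasP => -[e /choiceP[s [k1 k2 k3 k4 ->]]]; rewrite encK.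
  move=> /eqP E1; have := k4 i2 il2; rewrite nth_set_nth /= eqxx encK mem_filter => /andP[/hasP[e' he' he'' _]].
  have M := @mem_nth _ 0 s; rewrite k1 in M.
  exists e' => //; have [y0 yL] := rinL (isrel_prod l) he''.
  apply/rcompP; exists (flip x); split=> //; try exact: flipL; first by rewrite rin_relof xL flipL ?eqxx.
  apply/rcompP; exists (nth 0 s i2); split=> //; first exact: flipL.
  rewrite E rin_relof flipL // k2 ?M //=; apply/hasP; exists (enc_list s); rewrite ?encK ?E1 ?eqxx //.
  apply/choiceP; exists s; split=> // k kl; move: (k4 k kl); rewrite nth_set_nth /=.
  case: (k =P i2) => [->|//] _; move: (h4 i2 il2); rewrite !inE eqxx orbT => ->.
  by rewrite encK k2 ?M.
move=> /rcompP[y1 [_ y1L _ h5 /rcompP[y2 [_ y2L _ h6 h7]]]].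
move: h5; rewrite rin_relof => /and3P[_ _ /eqP Ey1].
move: h6; rewrite E rin_relof => /and3P[_ _ /hasP[e' /choiceP[s' [k1' k2' k3' k4' ->]]]].
rewrite encK => /andP[/eqP e1 /eqP e2].
exists (enc_list s'); last by rewrite encK e1 Ey1.
apply/choiceP; exists s'; split=> // k kl; rewrite nth_set_nth /=; case: (k =P i2) => [->|_]; last exact: k4'.
rewrite encK mem_filter e2 y2L andbT; apply/hasP; exists (enc_list s); last by rewrite encK.
by apply/choiceP; exists s.
Qed.

End Algebra.

(** * Non-backtracking walks *)

Section Walks.
Variable G : graph.
Local Notation V := 'I_(gN G).
Local Notation nb := (gadj G).

(** Non-backtracking walks are easier to extend, cut and reverse than duplicate-free paths, and in a
    forest both notions coincide. The node visited before [x] is [p]. *)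
Fixpoint nbw (p : option V) (x : V) (s : seq V) : bool :=
  if s is y :: s' then [&& y \in nb x, Some y != p & nbw (Some x) y s'] else true.
Fixpoint prv (p : option V) (x : V) (s : seq V) : option V :=
  if s is y :: s' then prv (Some x) y s' else p.

Lemma nbw_cat p x s t : nbw p x (s ++ t) = nbw p x s && nbw (prv p x s) (last x s) t.
Proof. by elim: s p x => //= y s IH p x; rewrite IH !andbA. Qed.
Lemma nbw_rcons p x s y : nbw p x (rcons s y) = [&& nbw p x s, y \in nb (last x s) & Some y != prv p x s].
Proof. by rewrite -cats1 nbw_cat /= andbT. Qed.
Lemma prv_cat p x s t : prv p x (s ++ t) = prv (prv p x s) (last x s) t.
Proof. by elim: s p x => //=. Qed.
Lemma prv_rcons p x s y : prv p x (rcons s y) = Some (last x s).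
Proof. by rewrite -cats1 prv_cat. Qed.
Lemma nbw_None p x s : nbw p x s -> nbw None x s.
Proof. by case: s => //= y s /and3P[-> _ ->]. Qed.

Hypothesis HS : simple_graph G.
Hypothesis HA : acyclic G.

Lemma adj_sym u v : v \in nb u -> u \in nb v. Proof. by case: (HS u) => _ _; apply. Qed.
Lemma adj_irr u : u \notin nb u. Proof. by case: (HS u). Qed.
Lemma adj_uniq u : uniq (nb u). Proof. by case: (HS u). Qed.

Lemma nbw_path p x s : nbw p x s -> path (adjb G) x s.
Proof. by elim: s p x => //= y s IH p x /and3P[h _ /IH ->]; rewrite /adjb h. Qed.

Lemma nbw_uniq x s : nbw None x s -> uniq (x :: s).
Proof.
elim: s x => // y s IH x /= /andP[h1 h2].
have U := IH _ (nbw_None h2); rewrite -[(y \notin s) && uniq s]/(uniq (y :: s)) U andbT inE negb_or.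
have xy : x != y by apply/eqP => E; move: h1; rewrite E (negbTE (adj_irr y)).
rewrite xy /=; apply/negP => xs; apply: HA.
move: U h2; case/splitPr: xs => s1 s2 U h2.
move: h2; rewrite nbw_cat => /andP[h2 /= /and3P[h3 h4 _]].
exists (x :: y :: s1); split.
- move: U; rewrite cons_uniq mem_cat in_cons cat_uniq !negb_or /= -/(uniq (y :: s1)) negb_or.
  by move=> /andP[/and3P[h5 _ _] /and3P[h8 /andP[h9 _] _]]; rewrite /= ?inE ?negb_or ?xy ?h9 ?h5 ?h8.
- by case: s1 h4 {U h2 h3} => //=; rewrite eqxx.
- by rewrite /= /adjb h1 rcons_path (nbw_path h2) /adjb h3.
Qed.

Lemma nbw_rev x s : nbw None x s -> nbw None (last x s) (behead (rev (x :: s))).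
Proof.
have P y t : prv None (last y t) (behead (rev (y :: t))) = ohead t.
  case: t => //= a t; rewrite !rev_cons; case/lastP: t => [|t b] //=.
  by rewrite rev_rcons /= prv_rcons last_rcons.
elim: s x => // y s IH x /= /andP[h1 h2].
have E : behead (rev [:: x, y & s]) = rcons (behead (rev (y :: s))) x.
  by rewrite [in LHS]rev_cons; case: (rev (y :: s)) (size_rev (y :: s)).
rewrite E nbw_rcons (IH _ (nbw_None h2)) P /=; apply/andP; split.
  suff -> : last (last y s) (behead (rev (y :: s))) = y by apply: adj_sym.
  by case/lastP: s {IH h2 E} => // s z; rewrite last_rcons rev_cons rev_rcons /= last_rcons.
by case: s {IH E} h2 => //= a s /and3P[_ + _]; rewrite eq_sym.
Qed.

(** If the last steps differ, the first walk followed by the reverse of the second one does not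
    backtrack and returns to its start, against [nbw_uniq]. *)
Lemma nbw_inj x s t : nbw None x s -> nbw None x t -> last x s = last x t -> s = t.
Proof.
elim/last_ind: s t => [|s a IH] t hs ht.
  by have := nbw_uniq ht; case: t ht => //= y t _ /andP[+ _] E; rewrite E mem_last.
case/lastP: t ht => [|t b] ht.
  rewrite last_rcons /= => E; have := nbw_uniq hs; rewrite /= E => /andP[].
  by rewrite mem_rcons mem_head.
rewrite !last_rcons => E; subst b.
have [h1 h2 h3] : [/\ nbw None x s, a \in nb (last x s) & Some a != prv None x s] by move: hs; rewrite nbw_rcons => /and3P[].
have [k1 k2 k3] : [/\ nbw None x t, a \in nb (last x t) & Some a != prv None x t] by move: ht; rewrite nbw_rcons => /and3P[].
have [E|ne] := eqVneq (last x s) (last x t); first by rewrite (IH t).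
have R := nbw_rev ht.
have W : nbw None x (rcons s a ++ rev (x :: t)).
  rewrite nbw_cat hs prv_rcons last_rcons /=.
  move: R; rewrite last_rcons -rcons_cons rev_rcons /=.
  have -> : rev (x :: t) = last x t :: behead (rev (x :: t)).
    by case/lastP: t {ht k1 k2 k3 ne IH} => // t z; rewrite last_rcons rev_cons rev_rcons.
  by move=> /= /andP[-> ->]; rewrite andbT /= (inj_eq (@Some_inj _)) eq_sym.
have := nbw_uniq W; rewrite /= mem_cat mem_rev mem_head orbT //.
Qed.

Lemma uniq_nbw x s : path (adjb G) x s -> uniq (x :: s) -> nbw None x s.
Proof.
have K : forall t p y, path (adjb G) y t -> uniq (p :: y :: t) -> nbw (Some p) y t.
  elim=> // z t IH p y /andP[h1 h2] U.
  have zp : p != z by move: U; rewrite cons_uniq !in_cons !negb_or => /andP[/and3P[]].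
  apply/and3P; split=> //; first by rewrite (inj_eq (@Some_inj _)) eq_sym.
  by apply: IH => //; case/andP: U.
case: s => //= y s /andP[h1 h2] h3; rewrite -/(adjb G x y) h1 /=; exact: K.
Qed.

Hypothesis HC : connected G.
Hypothesis HN : 0 < gN G.

(** The parent is recorded by its port because a virtual edge keeps its end ports while the nodes
    inside it disappear. At the root [up] is not a port. *)
Lemma rooted : exists (dp : V -> nat) (up : V -> nat), forall u w, w \in nb u ->
  (index w (nb u) = up u /\ dp u = (dp w).+1 /\ index u (nb w) <> up w) \/
  (index u (nb w) = up w /\ dp w = (dp u).+1 /\ index w (nb u) <> up u).
Proof.
pose r0 : V := Ordinal HN.
have /fin_all_exists[wk Hwk] : forall v : V, exists s, nbw None r0 s /\ last r0 s = v.
  move=> v; have /connectP[p hp ->] := HC r0 v.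
  by case/shortenP: hp => q hq Uq _; exists q; split=> //; apply: uniq_nbw.
pose up v := if prv None r0 (wk v) is Some q then index q (nb v) else size (nb v).
have Hup u w : w \in nb u -> prv None r0 (wk u) = Some w ->
    [/\ index w (nb u) = up u, wk u = rcons (wk w) u & index u (nb w) <> up w].
  move=> h E; have [h1 h2] := Hwk u.
  have Eu : wk u = rcons (wk w) u.
    case/lastP: (wk u) E h1 h2 => // s z; rewrite prv_rcons nbw_rcons last_rcons => -[E] /and3P[h1 _ _] ->.
    by congr rcons; have [k1 k2] := Hwk w; apply: (nbw_inj h1 k1); rewrite k2.
  split=> //; first by rewrite /up E.
  move=> K; have [k1 k2] := Hwk w; move: K; rewrite /up.
  move: h1; rewrite Eu nbw_rcons => /and3P[_ _].
  case E2: (prv None r0 (wk w)) => [q|] h3; last first.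
    by move=> K; have := adj_sym h; rewrite -index_mem K ltnn.
  move=> K; case/negP: h3; apply/eqP; congr Some; have uin := adj_sym h.
  rewrite -(nth_index u uin) K nth_index //.
  by rewrite -index_mem -K index_mem.
exists (fun v => size (wk v)), up => u w h.
have [E|NE] := eqVneq (prv None r0 (wk u)) (Some w).
  by left; have [-> -> h3] := Hup u w h E; rewrite size_rcons.
right; have [h1 h2] := Hwk u; have [k1 k2] := Hwk w.
have Ew : wk w = rcons (wk u) w.
  apply: (nbw_inj k1); last by rewrite k2 last_rcons.
  by rewrite nbw_rcons h1 h2 h eq_sym.
have := Hup w u (adj_sym h); rewrite {1}Ew prv_rcons h2 => /(_ erefl)[-> _ h3].
by rewrite Ew size_rcons.
Qed.

(** After a step down the only way up is the edge just used, so a non-backtracking walk keeps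
    descending. *)
Lemma dp_walk (dp up : V -> nat) : (forall u w, w \in nb u ->
  (index w (nb u) = up u /\ dp u = (dp w).+1 /\ index u (nb w) <> up w) \/
  (index u (nb w) = up w /\ dp w = (dp u).+1 /\ index w (nb u) <> up u)) ->
  forall s x y, y \in nb x -> dp y = (dp x).+1 -> nbw (Some x) y s -> dp y <= dp (last y s).
Proof.
move=> H; elim=> //= z s IH x y h E /and3P[h1 h2 h3].
case: (H y z h1) => [[K1 [K2 _]]|[K1 [K2 K3]]]; last by apply: leq_trans (IH y z h1 K2 h3); rewrite K2.
case: (H x y h) => [[_ [K3 _]]|[K3 [_ _]]]; first by move: E; lia.
case/negP: h2; apply/eqP; congr Some; rewrite -(nth_index z h1) K1 -K3 nth_index //; exact: adj_sym.
Qed.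
End Walks.

(** * Balls, flooding and colouring *)

Section Ball.
Variable G : graph.
Local Notation V := 'I_(gN G).
Local Notation nb := (gadj G).

(** Nodes are repeated on purpose: the list has the order and the multiplicities in which flooding
    delivers the records. *)
Fixpoint bl (j : nat) (v : V) : seq V :=
  if j is j'.+1 then v :: flatten (map (bl j') (nb v)) else [:: v].

Lemma blP j v u : reflect (exists s, [/\ path (adjb G) v s, last v s = u & size s <= j]) (u \in bl j v).
Proof.
elim: j v => [|j IH] v /=.
  rewrite inE; apply: (iffP eqP) => [->|[[|? ?] [//= _ ->]]] //; by exists [::].
rewrite inE; apply: (iffP orP) => [[/eqP->|/flattenP[l /mapP[w wv ->] /IH[s [h1 h2 h3]]]]|[[|w s] [/= + E hs]]].
- by exists [::].
- by exists (w :: s); rewrite /= /adjb wv.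
- by left; rewrite E.
- move=> /andP[h1 h2]; right; apply/flattenP; exists (bl j w); first by apply: map_f.
  by apply/IH; exists s.
Qed.

Lemma bl_refl j v : v \in bl j v. Proof. by apply/blP; exists [::]. Qed.
Lemma bl_mono i j v u : i <= j -> u \in bl i v -> u \in bl j v.
Proof. by move=> le /blP[s [h1 h2 h3]]; apply/blP; exists s; split=> //; apply: leq_trans le. Qed.
Lemma bl_trans i j v u w : u \in bl i v -> w \in bl j u -> w \in bl (i + j) v.
Proof.
move=> /blP[s [h1 h2 h3]] /blP[t [k1 k2 k3]]; apply/blP; exists (s ++ t).
by rewrite cat_path h1 h2 k1 last_cat h2 k2 size_cat leq_add.
Qed.
Hypothesis HS : simple_graph G.
Lemma bl_sym j v u : u \in bl j v -> v \in bl j u.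
Proof.
move=> /blP[s [h1 <- h3]]; apply/blP; exists (rev (belast v s)); rewrite size_rev size_belast.
split=> //; last by case: s {h1 h3} => //= w s; rewrite rev_cons last_rcons.
rewrite rev_path; apply: sub_path h1 => x y; exact: adj_sym.
Qed.

Lemma bl_size D j v : max_deg_le G D -> 0 < size (bl j v) <= D.+1 ^ j.
Proof.
move=> HD; elim: j v => [//|j IH] v /=.
rewrite size_flatten /shape -map_comp expnS mulSn.
have E : forall l, sumn (map (size \o bl j) l) <= size l * D.+1 ^ j.
  by elim=> //= w l IHl; rewrite mulSn leq_add //; case/andP: (IH w).
have := E (nb v); have : size (nb v) * D.+1 ^ j <= D * D.+1 ^ j by rewrite leq_mul2r HD orbT.
have : 0 < D.+1 ^ j by rewrite expn_gt0.
by lia.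
Qed.

Definition flood j (recs : V -> nat) v := map recs (bl j v).

Lemma lookupE j recs v u : injective (fun w => r_id (recs w)) -> u \in bl j v ->
  lookup (flood j recs v) (r_id (recs u)) = recs u.
Proof.
move=> I h; have H : has (fun r => r_id r == r_id (recs u)) (flood j recs v).
  by apply/hasP; exists (recs u); rewrite ?map_f //.
have := nth_find 0 H; rewrite /lookup; set k := find _ _ => /eqP E.
have : nth 0 (flood j recs v) k \in flood j recs v by rewrite mem_nth // -has_find.
by move=> /mapP[w _ E2]; move: E; rewrite E2 => /I ->.
Qed.
End Ball.

Lemma set_colE r c : [/\ r_id (set_col r c) = r_id r, r_inp (set_col r c) = r_inp r,
  r_col (set_col r c) = c, r_time (set_col r c) = r_time r & r_ports (set_col r c) = r_ports r /\ r_labs (set_col r c) = r_labs r].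
Proof. by rewrite /r_id /r_inp /r_col /r_time /r_ports /r_labs !fldE. Qed.
Lemma set_timeE r c : [/\ r_id (set_time r c) = r_id r, r_inp (set_time r c) = r_inp r,
  r_col (set_time r c) = r_col r, r_time (set_time r c) = c & r_ports (set_time r c) = r_ports r /\ r_labs (set_time r c) = r_labs r].
Proof. by rewrite /r_id /r_inp /r_col /r_time /r_ports /r_labs !fldE. Qed.
Lemma set_portsE r c : [/\ r_id (set_ports r c) = r_id r, r_inp (set_ports r c) = r_inp r,
  r_col (set_ports r c) = r_col r, r_time (set_ports r c) = r_time r & r_ports (set_ports r c) = c /\ r_labs (set_ports r c) = r_labs r].
Proof. by rewrite /r_id /r_inp /r_col /r_time /r_ports /r_labs !fldE encK. Qed.
Lemma set_labsE r c : [/\ r_id (set_labs r c) = r_id r, r_inp (set_labs r c) = r_inp r,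
  r_col (set_labs r c) = r_col r, r_time (set_labs r c) = r_time r & r_ports (set_labs r c) = r_ports r /\ r_labs (set_labs r c) = unl c].
Proof. by rewrite /r_id /r_inp /r_col /r_time /r_ports /r_labs !fldE. Qed.

Lemma mexP d l : size l < d -> mex d l < d /\ mex d l \notin l.
Proof.
move=> h; have H : has (fun q => ~~ (q \in l)) (iota 0 d).
  apply/negP => /negP/hasPn K.
  have := @uniq_leq_size _ (iota 0 d) l (iota_uniq 0 d); rewrite size_iota => H.
  by have : d <= size l; [apply: H => q /K; rewrite negbK | lia].
have := nth_find 0 H; rewrite /mex; set k := find _ _ => Hk.
have kd : k < d by rewrite -(size_iota 0 d) -has_find.
by move: Hk; rewrite nth_iota // add0n.
Qed.

Section Colour.
Variables (G : graph) (D R : nat) (id : 'I_(gN G) -> nat).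
Local Notation V := 'I_(gN G).
Hypothesis HS : simple_graph G.
Hypothesis HD : max_deg_le G D.
Hypothesis Hid : injective id.
Let d := D.+1 ^ R.

Definition cstep b sub (recs : V -> nat) v := colstep d b sub (recs v) (flood R recs v).
Definition same_but_col (r r' : V -> nat) := forall v, [/\ r_id (r' v) = r_id (r v), r_inp (r' v) = r_inp (r v),
   r_time (r' v) = r_time (r v), r_ports (r' v) = r_ports (r v) & r_labs (r' v) = r_labs (r v)].
Lemma cstep_same b sub recs : same_but_col recs (cstep b sub recs).
Proof.
move=> v; rewrite /cstep /colstep; case: ifP => _; first by have [? ? ? ? []] := set_colE (recs v)
  (if ((r_id (recs v) %/ 2 ^ b) %% 2 == 1) && (r_col (recs v) < d) then r_col (recs v) + d else r_col (recs v)).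
by case: ifP => // _; have [? ? ? ? []] := set_colE (recs v) (mex d (map r_col [seq u <- flood R recs v |
   (r_id u != r_id (recs v)) && sameblock b.+1 (r_id u) (r_id (recs v))])).
Qed.
Lemma same_trans r1 r2 r3 : same_but_col r1 r2 -> same_but_col r2 r3 -> same_but_col r1 r3.
Proof. by move=> H K v; have [-> -> -> -> ->] := K v; exact: H. Qed.

Definition proper b (recs : V -> nat) := forall u v, u != v -> u \in bl R v ->
  sameblock b (id u) (id v) -> r_col (recs u) <> r_col (recs v).

Lemma cstep0 b recs : (forall v, r_id (recs v) = id v) -> (forall v, r_col (recs v) < d) -> proper b recs ->
  proper b.+1 (cstep b 0 recs) /\
  (forall v, let x := r_col (cstep b 0 recs v) in x < 2 * d /\ (x < d \/ d + 0 <= x)).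
Proof.
move=> E Hd P.
have C v : r_col (cstep b 0 recs v) = if (id v %/ 2 ^ b) %% 2 == 1 then r_col (recs v) + d else r_col (recs v).
  by rewrite /cstep /colstep eqxx; have [_ _ -> _ _] := set_colE (recs v)
   (if ((r_id (recs v) %/ 2 ^ b) %% 2 == 1) && (r_col (recs v) < d) then r_col (recs v) + d else r_col (recs v)); rewrite E Hd andbT.
split; last by move=> v /=; rewrite C; have := Hd v; case: ifP => _; lia.
move=> u v uv un; rewrite /sameblock expnSr !divnMA => /eqP S; rewrite !C.
have Hu := Hd u; have Hv := Hd v.
case: eqP => E1; case: eqP => E2; try lia.
  move=> K; apply: (P u v) => //; last by lia.
  by rewrite /sameblock (divn_eq (id u %/ 2 ^ b) 2) (divn_eq (id v %/ 2 ^ b) 2) S E1 E2.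
apply: (P u v) => //; rewrite /sameblock (divn_eq (id u %/ 2 ^ b) 2) (divn_eq (id v %/ 2 ^ b) 2) S.
by rewrite (_ : (id u %/ 2 ^ b) %% 2 = (id v %/ 2 ^ b) %% 2) //; lia.
Qed.

(** After step [s] the colours from [d] to [d + s - 1] are free; nodes of one extra colour never
    interfere when recoloured together, since the colouring was proper. *)
Lemma cstepS b s recs : (forall v, r_id (recs v) = id v) -> proper b.+1 recs ->
  (forall v, let x := r_col (recs v) in x < 2 * d /\ (x < d \/ d + s <= x)) ->
  proper b.+1 (cstep b s.+1 recs) /\
  (forall v, let x := r_col (cstep b s.+1 recs v) in x < 2 * d /\ (x < d \/ d + s.+1 <= x)).
Proof.
move=> E P H.
pose l v := map r_col [seq u <- flood R recs v | (r_id u != r_id (recs v)) && sameblock b.+1 (r_id u) (r_id (recs v))].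
have C v : r_col (cstep b s.+1 recs v) = if r_col (recs v) == d + s then mex d (l v) else r_col (recs v).
  rewrite /cstep /colstep /= addnS /=; case: ifP => // _.
  by have [_ _ -> _ _] := set_colE (recs v) (mex d (l v)).
(* The ball contains the node itself, which forbids nothing. *)
have Hl v : size (l v) < d.
  rewrite /l size_map size_filter; have /andP[_ h2] := bl_size R v HD.
  apply: leq_trans h2; rewrite /flood -[size (bl R v)](size_map recs) -(count_predC (fun u => (r_id u != r_id (recs v)) && sameblock b.+1 (r_id u) (r_id (recs v)))).
  rewrite -addn1 leq_add2l -has_count; apply/hasP; exists (recs v); last by rewrite /= eqxx.
  by apply: map_f; exact: bl_refl.
have Hm u v : u != v -> u \in bl R v -> sameblock b.+1 (id u) (id v) -> mex d (l v) <> r_col (recs u).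
  move=> uv un S K; have [_ /negP] := mexP (Hl v); apply; rewrite K.
  apply: map_f; rewrite mem_filter !E S (inj_eq Hid) uv /=; exact: map_f.
split.
  move=> u v uv un S; rewrite !C; case: eqP => E1; case: eqP => E2.
  - by have := P u v uv un S; rewrite E1 E2.
  - apply: Hm; rewrite 1?eq_sym //; [exact: bl_sym|by rewrite /sameblock eq_sym].
  - by move=> K; apply: (Hm u v) => //.
  - exact: P.
move=> v /=; rewrite C; case: eqP => E1.
  by have [h _] := mexP (Hl v); split; [lia | left].
by have [h1 h2] := H v; split=> //; lia.
Qed.

Variable step : nat -> (V -> nat) -> V -> nat.
Fixpoint iters (recs : V -> nat) t : V -> nat := if t is t'.+1 then step t' (iters recs t') else recs.
Hypothesis stepE : forall b sub recs v, sub <= d -> step (b * d.+1 + sub) recs v = cstep b sub recs v.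

Lemma colour_round b recs t : t = b * d.+1 ->
  (forall v, r_id (iters recs t v) = id v) ->
  (forall v, r_col (iters recs t v) < d) -> proper b (iters recs t) ->
  [/\ (forall v, r_id (iters recs (t + d.+1) v) = id v), (forall v, r_col (iters recs (t + d.+1) v) < d),
     proper b.+1 (iters recs (t + d.+1)) & same_but_col (iters recs t) (iters recs (t + d.+1))].
Proof.
move=> Et E Hd P.
suff K s : s <= d -> [/\ (forall v, r_id (iters recs (t + s.+1) v) = id v), proper b.+1 (iters recs (t + s.+1)),
   (forall v, let x := r_col (iters recs (t + s.+1) v) in x < 2 * d /\ (x < d \/ d + s <= x)) &
   same_but_col (iters recs t) (iters recs (t + s.+1))].
  have [h1 h2 h3 h4] := K d (leqnn d); split=> // v; by have := h3 v; rewrite /=; lia.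
elim: s => [|s IH] sd.
  rewrite addn1 /=; have Q v : step t (iters recs t) v = cstep b 0 (iters recs t) v by rewrite -stepE // addn0 Et.
  have [h1 h2] := cstep0 E Hd P; have h3 := @cstep_same b 0 (iters recs t); split.
  - by move=> v; rewrite Q; have [-> _ _ _ _] := h3 v.
  - by move=> u v; rewrite !Q; apply: h1.
  - by move=> v; rewrite Q; apply: h2.
  - by move=> v; rewrite Q.
have [k1 k2 k3 k4] := IH (ltnW sd); rewrite addnS /=.
have Q v : step (t + s.+1) (iters recs (t + s.+1)) v = cstep b s.+1 (iters recs (t + s.+1)) v by rewrite Et stepE.
have [h1 h2] := cstepS k1 k2 k3; have h3 := @cstep_same b s.+1 (iters recs (t + s.+1)); split.
- by move=> v; rewrite Q; have [-> _ _ _ _] := h3 v.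
- by move=> u v; rewrite !Q; apply: h1.
- by move=> v; rewrite Q; apply: h2.
- by apply: same_trans k4 _ => v; rewrite Q.
Qed.

Lemma colouring recs J : (forall v, r_id (recs v) = id v) -> (forall v, r_col (recs v) = 0) ->
  (forall v, id v < 2 ^ J) ->
  [/\ (forall v, r_col (iters recs (J * d.+1) v) < d), same_but_col recs (iters recs (J * d.+1)) &
    forall u v, u != v -> u \in bl R v -> r_col (iters recs (J * d.+1) u) <> r_col (iters recs (J * d.+1) v)].
Proof.
move=> E C HJ.
suff K b : [/\ (forall v, r_id (iters recs (b * d.+1) v) = id v), (forall v, r_col (iters recs (b * d.+1) v) < d),
     proper b (iters recs (b * d.+1)) & same_but_col recs (iters recs (b * d.+1))].
  have [h1 h2 h3 h4] := K J; split=> // u v uv un; apply: h3 => //.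
  by rewrite /sameblock !divn_small.
elim: b => [|b [h1 h2 h3 h4]].
  rewrite mul0n /=; split=> // [v|u v uv _]; first by rewrite C expn_gt0.
  by rewrite /sameblock expn0 !divn1 (inj_eq Hid) (negbTE uv).
have [k1 k2 k3 k4] := colour_round erefl h1 h2 h3.
rewrite mulSnr; split=> //; exact: same_trans h4 k4.
Qed.
End Colour.

(** * Peeling phase *)

Lemma virtpE r l u j : [/\ p_virt (virtp r l u j) = true, p_rel (virtp r l u j) = r, p_len (virtp r l u j) = l,
  p_id (virtp r l u j) = u & p_port (virtp r l u j) = j].
Proof. by rewrite /p_virt /p_rel /p_len /p_id /p_port !fldE /= encK. Qed.
Lemma deadpE s l : [/\ p_virt (deadp s l) = false, fld (deadp s l) 1 = s & p_lev (deadp s l) = l].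
Proof. by rewrite /p_virt /p_lev !fldE. Qed.
Lemma virtp_inj r l u j r' l' u' j' : virtp r l u j = virtp r' l' u' j' -> [/\ r = r', l = l', u = u' & j = j'].
Proof.
move=> E; have [_ h1 h2 h3 h4] := virtpE r l u j; have [_ k1 k2 k3 k4] := virtpE r' l' u' j'.
by move: h1 h2 h3 h4; rewrite E k1 k2 k3 k4 => -> -> -> ->.
Qed.

Lemma isnode_mono m (X Y : seq nat) a : {subset X <= Y} -> isnode m X a -> isnode m Y a.
Proof.
move=> S [ins [Ss [i [j [/vnodeP[h1 h2 h3 h4] ij il jl ->]]]]]; exists ins, Ss, i, j; split=> //.
by apply/vnodeP; split=> // k kl; move: (h4 k kl); case: ifP => // _ /S.
Qed.
Lemma isword_mono m (X Y : seq nat) n r : {subset X <= Y} -> isword m X n r -> isword m Y n r.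
Proof. by move=> S [l [h1 h2 h3]]; exists l; split=> // a /h2; apply: isnode_mono. Qed.

Lemma nth_vports0 r q : size (vports r) <= 1 -> q \in vports r -> vports r = [:: q].
Proof. by case: (vports r) => [|x [|y l]] //= _; rewrite inE => /eqP->. Qed.
Lemma vports_uniq r : uniq (vports r). Proof. by rewrite filter_uniq ?iota_uniq. Qed.
Lemma mem_vports r q : (q \in vports r) = (q < size (r_ports r)) && p_virt (nth 0 (r_ports r) q).
Proof. by rewrite mem_filter mem_iota /= andbC. Qed.
Lemma oportP r q : size (vports r) = 2 -> q \in vports r ->
  [/\ oport r q \in vports r, oport r q != q, oport r (oport r q) = q &
      forall x, (x \in vports r) = (x == q) || (x == oport r q)].
Proof.
move=> S; have := vports_uniq r; rewrite /oport; case: (vports r) S => [|x [|y [|]]] //= _.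
rewrite inE andbT => xy; rewrite !inE => /orP[/eqP->|/eqP->]; rewrite ?eqxx /= ?(negbTE xy).
  by rewrite orbT eq_sym xy; split=> // z; rewrite !inE.
by rewrite eqxx; split=> // z; rewrite !inE orbC.
Qed.
Lemma rlevP r p : p \in r_ports r -> ~~ p_virt p -> p_lev p <= rlev r.
Proof.
rewrite /rlev; elim: (r_ports r) => //= q l IH; rewrite inE => /orP[/eqP->|pl] np.
  by rewrite (negbTE np); case: ltnP => // /ltnW.
have := IH pl np; case: (p_virt q) => //; case: ltnP => //; lia.
Qed.

Section Up.
Variables (m k K : nat) (Xs : seq nat) (G : graph) (id col : 'I_(gN G) -> nat) (inp : 'I_(gN G) -> seq nat).
Variable up : 'I_(gN G) -> nat.
Local Notation V := 'I_(gN G).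
Local Notation nb := (gadj G).
Local Notation X i := (lay Xs k i).
Hypothesis Xcl : forall i, closedX m (X i).
Hypothesis Xmono : forall i j, i <= j -> {subset X i <= X j}.
Hypothesis Xcut : forall i, i < K -> cutX m (X i) (X i.+1).
Hypothesis HS : simple_graph G.
Hypothesis HA : acyclic G.
Hypothesis HD : max_deg_le G (mD m).
Hypothesis Hid : injective id.
Hypothesis Hinp : forall v, size (inp v) = size (nb v) /\ (forall x, x \in inp v -> x < mIn m).
Hypothesis Hcol : forall u v, u != v -> u \in bl (ellm m) v -> col u <> col v.

Definition alive (recs : V -> nat) v := r_time (recs v) == 0.
Definition pt (recs : V -> nat) v j := nth 0 (r_ports (recs v)) j.
Definition stat (recs : V -> nat) := forall v, [/\ r_id (recs v) = id v, r_inp (recs v) = inp v,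
  r_col (recs v) = col v & size (r_ports (recs v)) = size (nb v)].
Definition walk v j u q n := exists s, [/\ nbw None v s, size s = n, last v s = u &
  ohead s = Some (nth v (nb v) j) /\ prv None v s = Some (nth u (nb u) q)].
(** A virtual edge stands for a path of the tree and is stored at both ends, with transposed
    relations. The walk keeps the ends within distance [ellm m], inside the radius of flooding and
    colouring. At least one end uses its parent port, which is what limits the number of links in
    [handshake]. *)
Definition link recs i v j u q rho len := [/\ pt recs v j = virtp rho len (id u) q /\
   pt recs u q = virtp (rtr m rho) len (id v) j, isword m (X i) len rho /\ len < ellm m,
   alive recs u, q < size (nb u) & walk v j u q len.+1 /\ (j = up v \/ q = up u)].
(** A dead port carries the layer [l] of its own class, which exceeds [i] after a cut. *)
Definition struct recs i := stat recs /\ forall v, alive recs v -> forall j, j < size (nb v) ->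
  (exists u q rho len, link recs i v j u q rho len) \/
  (exists S l, pt recs v j = deadp S l /\ S \in X l).

Lemma link_virt recs i v j u q rho len : link recs i v j u q rho len -> p_virt (pt recs v j).
Proof. by case=> -[-> _] _ _ _ _; have [] := virtpE rho len (id u) q. Qed.

Lemma struct_virt recs i v j : struct recs i -> alive recs v -> j < size (nb v) -> p_virt (pt recs v j) ->
  exists u q rho len, link recs i v j u q rho len.
Proof. by move=> [_ H] av jl pv; case: (H v av j jl) => // -[S [l [E _]]]; move: pv; rewrite E; have [->] := deadpE S l. Qed.

Lemma link_sym recs i v j u q rho len : struct recs i -> alive recs v -> j < size (nb v) ->
  link recs i v j u q rho len -> link recs i u q v j (rtr m rho) len.
Proof.
move=> H av jl L; have [[E1 E2] [W1 W2] au ql [_ o]] := L.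
have pv : p_virt (pt recs u q) by rewrite E2; have [] := virtpE (rtr m rho) len (id v) j.
have [u' [q' [rho' [len' [[F1 F2] [W1' W2'] au' ql' [wk o']]]]]] := struct_virt H au ql pv.
move: F1; rewrite E2 => /virtp_inj[R1 R2 /Hid R3 R4]; subst u' q' len' rho'.
by split=> //; split=> //; case: o; auto.
Qed.

Lemma walk_bl v j u q n : walk v j u q n -> u \in bl n v.
Proof. by move=> [s [h1 h2 h3 _]]; apply/blP; exists s; rewrite h2; split=> //; apply: nbw_path h1. Qed.

Lemma walk_neq v j u q n : 0 < n -> walk v j u q n -> u != v.
Proof.
move=> n0 [s [h1 h2 h3 _]]; have := nbw_uniq HS HA h1; case: s h2 h3 {h1} => [|y s]; first by move=> /= E; rewrite -E in n0.
by move=> _ <- /= /andP[+ _]; apply: contra => /eqP E; rewrite -{1}E mem_last.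
Qed.

Lemma link_near recs i v j u q rho len : link recs i v j u q rho len -> u \in bl (ellm m) v /\ u != v.
Proof.
case=> _ [_ h] _ _ [w _]; split; last exact: walk_neq w.
by apply: bl_mono (walk_bl w).
Qed.

Lemma link_col recs i v j u q rho len : link recs i v j u q rho len -> col u <> col v.
Proof. by move=> /link_near[h1 h2]; apply: Hcol. Qed.

Section Step.
Variables (s t i : nat) (kap : bool) (recs : V -> nat).
Hypothesis t0 : t != 0.
Hypothesis HK : kap -> i < K.
Hypothesis HI : struct recs i.
Definition recs' v := upstep m Xs k s kap i t (recs v) (flood (ellm m) recs v).
Definition rmv v := removable s kap i (recs v).

Lemma stat_inj : injective (fun w => r_id (recs w)).
Proof. by move=> x y /=; have [-> _ _ _] := HI.1 x; have [-> _ _ _] := HI.1 y; apply: Hid. Qed.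

Lemma lookup_link v j u q rho len : link recs i v j u q rho len ->
  lookup (flood (ellm m) recs v) (id u) = recs u.
Proof.
move=> /link_near[h _]; have [<- _ _ _] := HI.1 u.
by apply: lookupE => //; exact: stat_inj.
Qed.

Lemma rem_col v : rmv v -> col v = s /\ alive recs v.
Proof. by move=> /and3P[h1 /eqP h2 _]; have [_ _ <- _] := HI.1 v. Qed.

Lemma alive' v : alive recs' v = alive recs v && ~~ rmv v.
Proof.
rewrite /alive /recs' /upstep -/(rmv v); case h: (r_time (recs v) == 0) => /=; last by rewrite h.
case: ifP => _; first by have [_ _ _ ->] := set_timeE (recs v) t; rewrite (negbTE t0).
by set ps := map _ _; have [_ _ _ -> _] := set_portsE (recs v) ps; rewrite h.
Qed.

Lemma stat' : stat recs'.
Proof.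
move=> v; have [h1 h2 h3 h4] := HI.1 v; rewrite /recs' /upstep.
case: ifP => // _; case: ifP => _.
  by have [-> -> -> _ [-> _]] := set_timeE (recs v) t.
by set ps := map _ _; have [-> -> -> _ [-> _]] := set_portsE (recs v) ps; rewrite size_map.
Qed.

Lemma pt'E v j : alive recs' v -> j < size (nb v) ->
  pt recs' v j = if p_virt (pt recs v j) && removable s kap i (lookup (flood (ellm m) recs v) (p_id (pt recs v j)))
    then newport m Xs k i (pt recs v j) (lookup (flood (ellm m) recs v) (p_id (pt recs v j))) else pt recs v j.
Proof.
rewrite alive' => /andP[av nr] jl; rewrite /pt /recs' /upstep -/(rmv v) (negbTE nr).
move: av; rewrite /alive => /eqP -> /=; set ps := map _ _.
have [_ _ _ _ [-> _]] := set_portsE (recs v) ps.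
by rewrite (nth_map 0) //; have [_ _ _ ->] := HI.1 v.
Qed.
Lemma pt'_link v j u q rho len : alive recs' v -> j < size (nb v) -> link recs i v j u q rho len ->
  pt recs' v j = if rmv u then newport m Xs k i (virtp rho len (id u) q) (recs u) else virtp rho len (id u) q.
Proof.
move=> av jl L; rewrite pt'E // (link_virt L) /=; have [[E _] _ _ _ _] := L.
by rewrite E; have [_ _ _ -> _] := virtpE rho len (id u) q; rewrite (lookup_link L).
Qed.

Lemma vnode_rem u fr l : alive recs u -> i <= l -> rlev (recs u) <= l -> (forall x, (x \in vports (recs u)) = (x \in fr)) ->
  vnode m (X l) (inp u) (hang m (recs u)) fr.
Proof.
move=> au il rl F; have [h1 h2 h3 h4] := HI.1 u; have [k1 k2] := Hinp u; apply/vnodeP; split.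
- by rewrite k1 HD.
- exact: k2.
- by rewrite size_map h4 k1.
- move=> x; rewrite k1 => xl; rewrite -F mem_vports h4 xl /= /hang (nth_map 0) ?h4 //.
  have [//|pv] := boolP (p_virt (nth 0 (r_ports (recs u)) x)).
  case: (HI.2 u au x xl) => [[? [? [? [? /link_virt]]]]|[S [l' [E SX]]]]; first by rewrite /pt (negbTE pv).
  have lr : p_lev (pt recs u x) <= rlev (recs u) by apply: rlevP => //; rewrite mem_nth ?h4.
  rewrite -[nth _ _ _]/(pt recs u x) E; move: lr; rewrite E; have [_ -> ->] := deadpE S l' => lr.
  by apply: Xmono SX; apply: leq_trans lr rl.
Qed.

Lemma vports_link v j u q rho len : alive recs v -> j < size (nb v) -> link recs i v j u q rho len ->
  q \in vports (recs u).
Proof.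
move=> av jl L; rewrite mem_vports; have [_ _ au ql _] := L; have [_ _ _ ->] := HI.1 u.
by rewrite ql; exact: (link_virt (link_sym HI av jl L)).
Qed.

(** The neighbour [c] beyond [u] is not [v], since the two walks concatenate to one without
    backtracking, which cannot close up in a tree. *)
Lemma compress v j u q rho len : alive recs v -> j < size (nb v) -> link recs i v j u q rho len ->
  rmv u -> 1 < size (vports (recs u)) -> exists c q2 rho2 len2,
  [/\ link recs i u (oport (recs u) q) c q2 rho2 len2, oport (recs u) q != q, c != v, kap &
     [/\ isnode m (X i) (noderel m (inp u) (hang m (recs u)) q (oport (recs u) q)),
      oport (recs u) q < size (nb u), oport (recs u) (oport (recs u) q) = q &
      walk v j c q2 (len + len2).+2]].
Proof.
move=> av jl L ru sv; have qv := vports_link av jl L.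
have [cu au] := rem_col ru; have [_ hinp hcol hsz] := HI.1 u.
move: (ru) => /and3P[_ _ /orP[|/and3P[hk /eqP s2 rl]]]; first by rewrite leqNgt sv.
have [ov oq oo F] := oportP s2 qv.
have [ol pv] : oport (recs u) q < size (nb u) /\ p_virt (pt recs u (oport (recs u) q)).
  by move: ov; rewrite mem_vports hsz => /andP.
have [c [q2 [rho2 [len2 L2]]]] := struct_virt HI au ol pv.
exists c, q2, rho2, len2.
have [_ _ _ ql [[w [w1 w2 w3 [w4 w5]]] _]] := L.
have [_ _ _ ql2 [[z [z1 z2 z3 [z4 z5]]] _]] := L2.
have N1 : oport (recs u) q != q by [].
have W : nbw None v (w ++ z).
  rewrite nbw_cat w1 w3 /= w5.
  case: z z1 z4 {z2 z3 z5} => //= y z /andP[-> ->] [->]; rewrite andbT /=.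
  by rewrite (inj_eq (@Some_inj _)) nth_uniq // adj_uniq.
have W2 : walk v j c q2 (len + len2).+2.
  exists (w ++ z); split=> //; first by rewrite size_cat w2 z2 addSn addnS.
    by rewrite last_cat w3.
  split; first by case: w w2 w4 {w1 w3 w5 W}.
  rewrite prv_cat w3; case: z z5 {z1 z2 z3 z4 W} => //=.
split=> //; first exact: (walk_neq _ W2).
split=> //; exists (inp u), (hang m (recs u)), q, (oport (recs u) q); split; rewrite ?(Hinp u).1 // 1?eq_sym //.
apply: vnode_rem => // x; by rewrite F !inE.
Qed.

Lemma joinrelE v j u q rho len c q2 rho2 len2 : link recs i v j u q rho len ->
  link recs i u (oport (recs u) q) c q2 rho2 len2 ->
  joinrel m (virtp rho len (id u) q) (recs u) =
    rcomp m rho (rcomp m (noderel m (inp u) (hang m (recs u)) q (oport (recs u) q)) rho2).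
Proof.
move=> L [[E _] _ _ _ _]; have [_ h _ _] := HI.1 u; rewrite /joinrel.
have [_ -> _ _ ->] := virtpE rho len (id u) q.
rewrite -/(pt recs u (oport (recs u) q)) E h; by have [_ -> _ _ _] := virtpE rho2 len2 (id c) q2.
Qed.

(** The two ends of a joined link compute transposed relations without communicating. *)
Lemma joinrel_sym v j u q rho len c q2 rho2 len2 : alive recs v -> j < size (nb v) ->
  link recs i v j u q rho len -> oport (recs u) q < size (nb u) -> oport (recs u) (oport (recs u) q) = q ->
  link recs i u (oport (recs u) q) c q2 rho2 len2 -> alive recs u ->
  joinrel m (virtp (rtr m rho2) len2 (id u) (oport (recs u) q)) (recs u) =
  rtr m (joinrel m (virtp rho len (id u) q) (recs u)).
Proof.
move=> av jl L ol oo L2 au; rewrite (joinrelE L L2).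
have L' := link_sym HI av jl L; have L2' := link_sym HI au ol L2.
have := joinrelE L2'; rewrite oo => /(_ _ _ _ _ L') ->.
by rewrite !rtr_comp rtr_noderel rcompA.
Qed.

Lemma pick_elim j rho n : j < K -> isword m (X j) n rho -> ellm m <= n < 2 * ellm m ->
  [/\ fld (pickrect (X j.+1) rho) 0 \in X j.+1, fld (pickrect (X j.+1) rho) 1 \in X j.+1 &
    rect (unl (fld (pickrect (X j.+1) rho) 0)) (unl (fld (pickrect (X j.+1) rho) 1)) rho].
Proof.
move=> jK W hn; have [s1 [s2 [h1 h2 h3]]] := cutX_elim (Xcut jK) W hn.
rewrite /pickrect; set l := filter _ _.
have : enc_list [:: s1; s2] \in l.
  by rewrite mem_filter !fldE /= h3; apply/pairsuP; exists s1, s2.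
move=> hin; have : nth 0 l 0 \in l by rewrite mem_nth //; case: (l) hin.
rewrite mem_filter => /andP[h /pairsuP[x [y [hx hy Ez]]]].
by split=> //; rewrite Ez fldE.
Qed.

(** Linked nodes are at distance at most [ellm m] and have different colours, so the neighbours of a
    removed node survive the step and the removals of one step do not interfere. *)
Lemma struct_step : struct recs' i.
Proof.
split; first exact: stat'.
move=> v av' j jl; move: (av'); rewrite alive' => /andP[av nr].
case: (HI.2 v av j jl) => [[u [q [rho [len L]]]]|[S [l [E SX]]]]; last first.
  right; exists S, l; split=> //; rewrite pt'E // E; by have [-> _ _] := deadpE S l.
have P' := pt'_link av' jl L; have [[E1 E2] [W1 W2] au ql [wk o]] := L.
have [ru|nru] := boolP (rmv u); last first.
  have au' : alive recs' u by rewrite alive' au.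
  left; exists u, q, rho, len; split; [|exact: conj W1 W2|exact: au'|exact: ql|exact: conj wk o].
  rewrite P' (negbTE nru); split; first by [].
  by rewrite (pt'_link au' ql (link_sym HI av jl L)) (negbTE nr).
rewrite ru in P'; have qv := vports_link av jl L.
have [cu _] := rem_col ru.
have [_ hrel hlen _ hport] := virtpE rho len (id u) q.
move: P'; rewrite /newport hrel hlen hport.
have [sv|sv] := leqP (size (vports (recs u))) 1.
  move=> P'; right; eexists; eexists; split; first exact: P'.
  have [_ hinp _ _] := HI.1 u; set l := if _ then _ else _.
  have il : i <= l /\ rlev (recs u) <= l by rewrite /l; case: ltnP => // /ltnW.
  have [w [_ hw ->]] := W1; rewrite /raked hinp -/(rakedl m (prodrel m w) (inp u) (hang m (recs u)) q).
  apply: raked_closed; [exact: Xcl|by move=> a /hw; apply: isnode_mono; apply: Xmono il.1| |by rewrite (Hinp u).1].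
  by apply: (vnode_rem au il.1 il.2) => x; rewrite (nth_vports0 sv qv).
have [c [q2 [rho2 [len2 [L2 oq cv hk [ND ol oo wk2]]]]]] := compress av jl L ru sv.
have [[F1 F2] [U1 U2] ac ql2 [_ o2]] := L2.
rewrite (F1 : nth 0 (r_ports (recs u)) (oport (recs u) q) = _).
have [_ _ -> -> ->] := virtpE rho2 len2 (id c) q2.
have JE := joinrelE L L2.
have WJ : isword m (X i) (len + len2).+1 (joinrel m (virtp rho len (id u) q) (recs u)).
  by rewrite JE; exact: isword_cat.
have nrc : ~~ rmv c by apply/negP => /rem_col[E _]; apply: (link_col L2); rewrite E cu.
case: ifP => hl P'.
  left; exists c, q2, (joinrel m (virtp rho len (id u) q) (recs u)), (len + len2).+1.
  have ac' : alive recs' c by rewrite alive' ac.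
  split; [|exact: conj WJ hl|exact: ac'|exact: ql2|split; first exact: wk2]; last first.
    (* If [q] is the parent port of the removed node, its other port is not, so the far link has its
       parent port at [c]. *)
    by case: o => [|qu]; [left|case: o2 => [ou|]; [case/eqP: oq; rewrite ou; exact: esym qu|right]].
  split; first exact: P'.
  rewrite (pt'_link ac' ql2 (link_sym HI au ol L2)) ru /newport.
  have [_ hrel' hlen' _ hport'] := virtpE (rtr m rho2) len2 (id u) (oport (recs u) q).
  rewrite leqNgt sv hlen' hport' oo (E2 : nth 0 (r_ports (recs u)) q = _).
  have [_ _ -> -> ->] := virtpE (rtr m rho) len (id v) j.
  by rewrite addnC hl (joinrel_sym av jl L ol oo L2 au).
have hn : ellm m <= (len + len2).+1 < 2 * ellm m.
  by rewrite leqNgt hl /=; have : 0 < ellm m by []; move: W2 U2; rewrite /=; lia.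
right; move: P'; case: ifP => _ P'; eexists; eexists; (split; first exact: P').
  by have [] := pick_elim (HK hk) WJ hn.
by have [] := pick_elim (HK hk) (isword_rtr WJ) hn.
Qed.
End Step.
End Up.

(** * Labelling phase *)

Section Down.
Variables (m k K : nat) (Xs : seq nat) (G : graph) (id col : 'I_(gN G) -> nat) (inp : 'I_(gN G) -> seq nat).
Variable up : 'I_(gN G) -> nat.
Local Notation V := 'I_(gN G).
Local Notation nb := (gadj G).
Local Notation X i := (lay Xs k i).
Hypothesis Xcl : forall i, closedX m (X i).
Hypothesis Xmono : forall i j, i <= j -> {subset X i <= X j}.
Hypothesis Xcut : forall i, i < K -> cutX m (X i) (X i.+1).
Hypothesis Xroot : forall i, rootokX m (X i).
Hypothesis HS : simple_graph G.
Hypothesis HA : acyclic G.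
Hypothesis HD : max_deg_le G (mD m).
Hypothesis Hid : injective id.
Hypothesis Hinp : forall v, size (inp v) = size (nb v) /\ (forall x, x \in inp v -> x < mIn m).
Hypothesis Hcol : forall u v, u != v -> u \in bl (ellm m) v -> col u <> col v.

Local Notation struct := (struct m k Xs id col inp up).
Local Notation link := (link m k Xs id up).

Lemma struct_mono recs i j : i <= j -> struct recs i -> struct recs j.
Proof.
move=> ij [h1 h2]; split=> // v av x xl; case: (h2 v av x xl) => [[u [q [rho [len [E [W1 W2] a l [w o]]]]]]|H]; [left|by right].
exists u, q, rho, len; split; [exact: E|split; last exact: W2|exact: a|exact: l|exact: conj w o].
by apply: isword_mono W1; apply: Xmono.
Qed.

(** Labels of the nodes alive in [recs] keep what the ports of that moment promise: a label from the
    class at a dead port, related labels along a virtual edge. Undoing a removal step turns this for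
    the later records into the same for the earlier ones. *)
Definition labelled (recs lrecs : V -> nat) :=
  forall v, alive recs v ->
    [/\ size (r_labs (lrecs v)) = size (nb v), {subset r_labs (lrecs v) <= nfL m}, nfN m (inp v) (r_labs (lrecs v)),
      (forall j S l, j < size (nb v) -> pt recs v j = deadp S l -> nth 0 (r_labs (lrecs v)) j \in unl S) &
      (forall j u q rho len, j < size (nb v) -> pt recs v j = virtp rho len (id u) q ->
         rin rho (nth 0 (r_labs (lrecs v)) j) (nth 0 (r_labs (lrecs u)) q))].

Section Step.
Variables (s t i : nat) (kap : bool) (recs : V -> nat).
Hypothesis t0 : t != 0.
Hypothesis HK : kap -> i < K.
Hypothesis HI : struct recs i.
Local Notation recs1 := (recs' m k Xs s t i kap recs).
Local Notation rm := (rmv s i kap recs).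
Variable lrecs : V -> nat.
Hypothesis Htime : forall v, (r_time (lrecs v) == t) = rm v.
Hypothesis Hfr : forall v, rm v -> [/\ r_id (lrecs v) = id v, r_inp (lrecs v) = inp v &
  r_ports (lrecs v) = r_ports (recs v)].
Hypothesis Hids : forall v, r_id (lrecs v) = id v.
Hypothesis HL : labelled recs1 lrecs.
Definition lrecs' v := downstep m t (lrecs v) (flood (ellm m) lrecs v).

Let alive1 v : alive recs1 v = alive recs v && ~~ rm v.
Proof. exact: alive'. Qed.

Lemma link_vport v j u q rho len : link recs i v j u q rho len -> j < size (nb v) -> j \in vports (recs v).
Proof.
move=> L jl; rewrite mem_vports; have [_ _ _ ->] := HI.1 v; rewrite jl; exact: link_virt L.
Qed.

Lemma far_alive v j u q rho len : rm v -> link recs i v j u q rho len -> alive recs1 u /\ ~~ rm u.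
Proof.
move=> rv L; have [cv _] := rem_col HI rv.
have nr : ~~ rm u by apply/negP => /(rem_col HI)[cu _]; apply: (link_col HS HA Hcol L); rewrite cu cv.
by rewrite alive1 nr; case: L => _ _ ->.
Qed.

(** Both neighbours of a compressed node are labelled before it. If the joined link was kept, their
    labels are related by assumption; if it was cut, they lie in the two sides of a rectangle
    contained in the relation. *)
Lemma joined v j c q2 rho2 len2 u q rho len : rm v -> 1 < size (vports (recs v)) -> j < size (nb v) ->
  link recs i v j u q rho len -> link recs i v (oport (recs v) j) c q2 rho2 len2 ->
  rin (joinrel m (virtp (rtr m rho) len (id v) j) (recs v)) (nth 0 (r_labs (lrecs u)) q) (nth 0 (r_labs (lrecs c)) q2).
Proof.
move=> rv sv jl L L2.
have [au1 nru] := far_alive rv L; have [ac1 nrc] := far_alive rv L2.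
have [au ac] : alive recs u /\ alive recs c by move: au1 ac1; rewrite !alive1 => /andP[-> _] /andP[-> _].
have av : alive recs v by case: (rem_col HI rv).
have [[E1 E2] [W1 W2] _ ql [wk o]] := L.
have [[F1 F2] [U1 U2] _ ql2 [wk2 o2]] := L2.
have L' := link_sym Hid HI av jl L.
have [c0 [q0 [rho0 [len0 [L0 oq cu hk [ND ol oo wk0]]]]]] := compress Xmono HS HA HD Hid Hinp HI au ql L' rv sv.
have [R1 R2 /Hid R3 R4] : [/\ rho2 = rho0, len2 = len0, id c = id c0 & q2 = q0].
  by case: L0 => -[F0 _] _ _ _ _; apply: virtp_inj; rewrite -F1 -F0.
move: R1 R2 R3 R4 => R1 R2 R3 R4; subst rho0 len0 c0 q0.
have L2' := link_sym Hid HI av ol L2.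
have JE := joinrelE HI L' L2.
have WJ : isword m (X i) (len + len2).+1 (joinrel m (virtp (rtr m rho) len (id v) j) (recs v)).
  by rewrite JE; apply: isword_cat => //; apply: isword_rtr.
have JS := joinrel_sym Hid HI au ql L' ol oo L2 av.
have P1 := pt'_link HS HA Hid t0 HI au1 ql L'.
have P2 := pt'_link HS HA Hid t0 HI ac1 ql2 L2'.
move: P1 P2; rewrite rv /newport !(leqNgt (size _)) sv /=.
have [_ _ -> _ ->] := virtpE (rtr m rho) len (id v) j.
have [_ _ -> _ ->] := virtpE (rtr m rho2) len2 (id v) (oport (recs v) j).
rewrite oo (E1 : nth 0 (r_ports (recs v)) j = _) (F1 : nth 0 (r_ports (recs v)) (oport (recs v) j) = _).
have [_ _ -> -> ->] := virtpE rho2 len2 (id c) q2.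
have [_ _ -> -> ->] := virtpE rho len (id u) q.
rewrite (addnC len2) JS.
have [_ _ _ D1 V1] := HL au1; have [_ _ _ D2 V2] := HL ac1.
case: ifP => hl P1 P2; first exact: (V1 _ _ _ _ _ ql P1).
have hn : ellm m <= (len + len2).+1 < 2 * ellm m.
  by rewrite leqNgt hl /=; move: W2 U2; clear; set e := ellm m; lia.
(* The two orders of the ports correspond to picking a rectangle from the relation or from its
   transpose. *)
move: P1 P2; case: (ltngtP j (oport (recs v) j)) => jo; last by case/eqP: oq.
  rewrite (rtrK (isword_rel WJ)) => P1 P2.
  have M1 := D1 _ _ _ ql P1; have M2 := D2 _ _ _ ql2 P2.
  have [_ _ /allP/(_ _ M1)/allP/(_ _ M2) H] := pick_elim Xcut (HK hk) WJ hn; exact: H.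
move=> P1 P2; have M1 := D1 _ _ _ ql P1; have M2 := D2 _ _ _ ql2 P2.
have [_ _ /allP/(_ _ M2)/allP/(_ _ M1) H] := pick_elim Xcut (HK hk) (isword_rtr WJ) hn.
by move: H; rewrite rin_rtr => /and3P[].
Qed.

(** With two virtual ports the choice comes from [joined]; with one, from the class that the
    neighbour received when [v] was raked and that contains its label; with none, from [rootokX]. *)
Lemma downok_exists v : rm v -> exists2 e, e \in choice m (inp v) (hang m (recs v)) &
  forall j u q rho len, j < size (nb v) -> link recs i v j u q rho len ->
     rin rho (nth 0 (unl e) j) (nth 0 (r_labs (lrecs u)) q).
Proof.
move=> rv; have [cv av] := rem_col HI rv; have [_ hin _ hsz] := HI.1 v.
have [sv|sv] := leqP (size (vports (recs v))) 1; last first.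
  have [x xv] : exists x, x \in vports (recs v).
    by exists (nth 0 (vports (recs v)) 0); apply: mem_nth; apply: ltnW sv.
  have [xl pv] : x < size (nb v) /\ p_virt (pt recs v x) by move: xv; rewrite mem_vports hsz => /andP.
  have [u [q [rho [len L]]]] := struct_virt HI av xl pv.
  have [_ _ au ql _] := L.
  have L' := link_sym Hid HI av xl L.
  have [c [q2 [rho2 [len2 [L2 oq cu hk [ND ol oo wk0]]]]]] := compress Xmono HS HA HD Hid Hinp HI au ql L' rv sv.
  have := joined rv sv xl L L2; rewrite (joinrelE HI L' L2).
  move=> /rcompP[y1 [_ _ _ h1 /rcompP[y2 [_ _ _ + h2]]]]; rewrite rin_relof => /and3P[_ _ /hasP[e eh /andP[/eqP e1 /eqP e2]]].
  exists e => // j u' q' rho' len' jl L''.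
  have jv := link_vport L'' jl.
  have s2 : size (vports (recs v)) = 2.
    by move: rv => /and3P[_ _ /orP[|/and3P[_ /eqP ->]]] //; rewrite leqNgt sv.
  have [_ _ _ F] := oportP s2 xv.
  move: jv; rewrite F // => /orP[/eqP E|/eqP E]; subst j.
    have [[EE _] _ _ _ _] := L; have [[EE' _] _ _ _ _] := L''.
    have [-> _ /Hid -> ->] : [/\ rho' = rho, len' = len, id u' = id u & q' = q] by apply: virtp_inj; rewrite -EE -EE'.
    by move: h1; rewrite rin_rtr e1 => /and3P[].
  have [[EE _] _ _ _ _] := L2; have [[EE' _] _ _ _ _] := L''.
  have [-> _ /Hid -> ->] : [/\ rho' = rho2, len' = len2, id u' = id c & q' = q2] by apply: virtp_inj; rewrite -EE -EE'.
  by rewrite e2.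
(* A layer that contains the classes of all hanging subtrees. *)
pose l := maxn i (rlev (recs v)).
have il : i <= l /\ rlev (recs v) <= l by rewrite leq_maxl leq_maxr.
case E : (vports (recs v)) sv => [|x [|]] // _.
  have V0 : vnode m (X l) (inp v) (hang m (recs v)) [::].
    by apply: (vnode_rem Xmono HD Hinp HI av il.1 il.2) => x; rewrite E.
  have := rootokX_elim (Xroot l) V0; case C : (choice _ _ _) => [|e ch] // _.
  exists e; first by rewrite mem_head.
  by move=> j u q rho len jl L; have := link_vport L jl; rewrite E.
have xv : x \in vports (recs v) by rewrite E mem_head.
have [xl pv] : x < size (nb v) /\ p_virt (pt recs v x) by move: xv; rewrite mem_vports hsz => /andP.
have [u [q [rho [len L]]]] := struct_virt HI av xl pv.
have [_ _ au ql _] := L; have [au1 nru] := far_alive rv L.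
have L' := link_sym Hid HI av xl L.
have := pt'_link HS HA Hid t0 HI au1 ql L'; rewrite rv /newport E /=.
have [_ -> _ _ ->] := virtpE (rtr m rho) len (id v) x.
have [_ _ _ D1 V1] := HL au1 => /(D1 _ _ _ ql); rewrite encK mem_filter hin => /andP[/hasP[e eh h1] _].
exists e => // j u' q' rho' len' jl L''; have := link_vport L'' jl; rewrite E inE => /eqP Ej; subst j.
have [[EE _] _ _ _ _] := L; have [[EE' _] _ _ _ _] := L''.
have [-> _ /Hid -> ->] : [/\ rho' = rho, len' = len, id u' = id u & q' = q] by apply: virtp_inj; rewrite -EE -EE'.
by move: h1; rewrite rin_rtr => /and3P[].
Qed.

Lemma lrecs'_other v : ~~ rm v -> lrecs' v = lrecs v.
Proof. by move=> nr; rewrite /lrecs' /downstep Htime nr. Qed.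

Lemma lookup_lrecs v j u q rho len : link recs i v j u q rho len ->
  lookup (flood (ellm m) lrecs v) (id u) = lrecs u.
Proof.
move=> /(link_near HS HA)[h _]; rewrite -(Hids u).
by apply: lookupE => // x y /=; rewrite !Hids => /Hid.
Qed.

Lemma labelled_step : labelled recs lrecs'.
Proof.
move=> v av; have [_ hin _ hsz] := HI.1 v.
have [rv|nr] := boolP (rm v); last first.
  have av1 : alive recs1 v by rewrite alive1 av.
  rewrite (lrecs'_other nr); have [h1 h2 h3 h4 h5] := HL av1; split=> //.
    move=> j S l jl E; apply: (h4 j S l jl).
    rewrite (pt'E t0 HI av1 jl) E; by have [-> _ _] := deadpE S l.
  move=> j u q rho len jl E.
  have pv : p_virt (pt recs v j) by rewrite E; have [] := virtpE rho len (id u) q.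
  have [u' [q' [rho' [len' L]]]] := struct_virt HI av jl pv.
  have [R1 R2 /Hid R3 R4] : [/\ rho = rho', len = len', id u = id u' & q = q'].
    by case: L => -[F0 _] _ _ _ _; apply: virtp_inj; rewrite -E -F0.
  move: R1 R2 R3 R4 => R1 R2 R3 R4; subst rho' len' u' q'.
  have P' := pt'_link HS HA Hid t0 HI av1 jl L.
  have [ru|nru] := boolP (rm u); last first.
    by rewrite (lrecs'_other nru); apply: h5 jl _; rewrite P' (negbTE nru).
  have L' := link_sym Hid HI av jl L; have [_ _ au ql _] := L.
  have [e eh he] := downok_exists ru.
  have [lid lin lpt] := Hfr ru.
  have [_ hinu _ hszu] := HI.1 u.
  rewrite /lrecs' /downstep (Htime u) ru /=.
  set F := filter _ _; have := set_labsE (lrecs u) (nth 0 F 0) => -[_ _ _ _ [_ ->]].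
  have eF : e \in F.
    rewrite mem_filter lin /hang lpt -/(hang m (recs u)) eh andbT; apply/allP => x; rewrite mem_iota lpt hszu /= => xl.
    rewrite -[nth 0 (r_ports (recs u)) x]/(pt recs u x).
    have [pvx|//] := boolP (p_virt (pt recs u x)) => /=.
    have [y [qy [rhoy [leny Ly]]]] := struct_virt HI au xl pvx.
    have [[Ey _] _ _ _ _] := Ly; have := he _ _ _ _ _ xl Ly.
    by rewrite Ey; have [_ -> _ -> ->] := virtpE rhoy leny (id y) qy; rewrite (lookup_lrecs Ly).
  have : nth 0 F 0 \in F by rewrite mem_nth //; case: (F) eF.
  rewrite mem_filter => /andP[/allP/(_ q) + _]; rewrite mem_iota lpt hszu ql => /(_ isT).
  have [[Eq _] _ _ _ _] := L'; rewrite (Eq : nth 0 (r_ports (recs u)) q = _).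
  have [-> -> _ -> ->] := virtpE (rtr m rho) len (id v) j; rewrite (lookup_lrecs L') /=.
  by rewrite rin_rtr => /and3P[].
have [e eh he] := downok_exists rv.
have [lid lin lpt] := Hfr rv.
rewrite /lrecs' /downstep (Htime v) rv /=.
set F := filter _ _; have := set_labsE (lrecs v) (nth 0 F 0) => -[_ _ _ _ [_ ->]].
have eF : e \in F.
  rewrite mem_filter lin /hang lpt -/(hang m (recs v)) eh andbT; apply/allP => x; rewrite mem_iota lpt hsz /= => xl.
  rewrite -[nth 0 (r_ports (recs v)) x]/(pt recs v x).
  have [pvx|//] := boolP (p_virt (pt recs v x)) => /=.
  have [y [qy [rhoy [leny Ly]]]] := struct_virt HI av xl pvx.
  have [[Ey _] _ _ _ _] := Ly; have := he _ _ _ _ _ xl Ly.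
  by rewrite Ey; have [_ -> _ -> ->] := virtpE rhoy leny (id y) qy; rewrite (lookup_lrecs Ly).
have : nth 0 F 0 \in F by rewrite mem_nth //; case: (F) eF.
rewrite mem_filter lin /hang lpt -/(hang m (recs v)) => /andP[/allP HF /choiceP[z [z1 z2 z3 z4 Ez]]].
move: HF; rewrite Ez encK => HF; have [si _] := Hinp v; split=> //; first by rewrite z1 si.
  move=> j S l jl E; have := z4 j; rewrite si => /(_ jl).
  rewrite /hang (nth_map 0) ?hsz // (E : nth 0 (r_ports (recs v)) j = _).
  by have [-> -> _] := deadpE S l.
move=> j u q rho len jl E.
have pv : p_virt (pt recs v j) by rewrite E; have [] := virtpE rho len (id u) q.
have [u' [q' [rho' [len' L]]]] := struct_virt HI av jl pv.
have [R1 R2 /Hid R3 R4] : [/\ rho = rho', len = len', id u = id u' & q = q'].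
  by case: L => -[F0 _] _ _ _ _; apply: virtp_inj; rewrite -E -F0.
move: R1 R2 R3 R4 => R1 R2 R3 R4; subst rho' len' u' q'.
have [_ nru] := far_alive rv L; rewrite Htime (negbTE nru) /=.
have := HF j; rewrite mem_iota lpt hsz jl => /(_ isT).
rewrite (E : nth 0 (r_ports (recs v)) j = _).
by have [-> -> _ -> ->] := virtpE rho len (id u) q; rewrite (lookup_lrecs L).
Qed.
End Step.
End Down.

(** * Progress of the peeling phase *)

Lemma rlev_leP r b : reflect (forall p, p \in r_ports r -> ~~ p_virt p -> p_lev p <= b) (rlev r <= b).
Proof.
apply: (iffP idP) => [h p hp np|]; first exact: leq_trans (rlevP hp np) h.
rewrite /rlev; elim: (r_ports r) => //= p l IH H.
have {}IH : foldr (fun p a => if p_virt p then a else if p_lev p < a then a else p_lev p) 0 l <= b.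
  by apply: IH => q hq; apply: H; rewrite inE hq orbT.
case: (boolP (p_virt p)) => // np; case: ifP => // _; apply: H => //; exact: mem_head.
Qed.

Section Count.
Variables (m k K : nat) (Xs : seq nat) (G : graph) (id col : 'I_(gN G) -> nat) (inp : 'I_(gN G) -> seq nat).
Variables (up dp : 'I_(gN G) -> nat).
Local Notation V := 'I_(gN G).
Local Notation nb := (gadj G).
Local Notation X i := (lay Xs k i).
Hypothesis Xcl : forall i, closedX m (X i).
Hypothesis Xmono : forall i j, i <= j -> {subset X i <= X j}.
Hypothesis Xcut : forall i, i < K -> cutX m (X i) (X i.+1).
Hypothesis HS : simple_graph G.
Hypothesis HA : acyclic G.
Hypothesis HD : max_deg_le G (mD m).
Hypothesis Hid : injective id.
Hypothesis Hinp : forall v, size (inp v) = size (nb v) /\ (forall x, x \in inp v -> x < mIn m).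
Hypothesis Hcol : forall u v, u != v -> u \in bl (ellm m) v -> col u <> col v.
Hypothesis Hcol2 : forall v, col v < palette m.
Hypothesis Hroot : forall u w, w \in nb u ->
  (index w (nb u) = up u /\ dp u = (dp w).+1 /\ index u (nb w) <> up w) \/
  (index u (nb w) = up w /\ dp w = (dp u).+1 /\ index w (nb u) <> up u).

Local Notation struct := (struct m k Xs id col inp up).
Local Notation link := (link m k Xs id up).

Definition deg (recs : V -> nat) (v : V) := size (vports (recs v)).
Definition nal (recs : V -> nat) := \sum_(v | alive recs v) 1.

Section Step.
Variables (s t i : nat) (kap : bool) (recs : V -> nat).
Hypothesis t0 : t != 0.
Hypothesis HI : struct recs i.
Local Notation recs1 := (recs' m k Xs s t i kap recs).
Local Notation rm := (rmv s i kap recs).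

Lemma alive1 v : alive recs1 v = alive recs v && ~~ rm v. Proof. exact: alive'. Qed.

Lemma sizep v : size (r_ports (recs v)) = size (nb v). Proof. by have [_ _ _ ->] := HI.1 v. Qed.
Lemma sizep1 v : size (r_ports (recs1 v)) = size (nb v). Proof. by have [_ _ _ ->] := stat' s t kap HI v. Qed.

Lemma port_step v j : alive recs1 v -> j < size (nb v) ->
  [\/ pt recs1 v j = pt recs v j,
      p_virt (pt recs v j) /\ p_virt (pt recs1 v j) |
      exists u q rho len, [/\ link recs i v j u q rho len, rm u, ~~ p_virt (pt recs1 v j),
        pt recs1 v j = newport m Xs k i (virtp rho len (id u) q) (recs u) &
        p_lev (pt recs1 v j) = if deg recs u <= 1 then maxn (rlev (recs u)) i else i.+1]].
Proof.
move=> av1 jl; have av : alive recs v by move: av1; rewrite alive1 => /andP[].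
case: (HI.2 v av j jl) => [[u [q [rho [len L]]]]|[S [l [E _]]]]; last first.
  by apply: Or31; rewrite (pt'E t0 HI av1 jl) E; have [-> _ _] := deadpE S l.
have P := pt'_link HS HA Hid t0 HI av1 jl L; have [[E1 _] _ _ _ _] := L.
have [ru|nru] := boolP (rm u); last by apply: Or31; rewrite P (negbTE nru) E1.
rewrite ru in P; have [pv1|npv1] := boolP (p_virt (pt recs1 v j)).
  by apply: Or32; split=> //; exact: link_virt L.
apply: Or33; exists u, q, rho, len; split=> //.
move: npv1; rewrite P /newport /deg; case: (leqP (size (vports (recs u))) 1) => h1.
  move=> _; have [_ _ ->] := deadpE (enc_list (raked m (p_rel (virtp rho len (id u) q)) (recs u) (p_port (virtp rho len (id u) q)))) (if rlev (recs u) < i then i else rlev (recs u)).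
  by rewrite /maxn.
case: ifP => h2.
  by set r := joinrel _ _ _; set l := S _; set a := p_id _; set b := p_port _; have [-> _ _ _ _] := virtpE r l a b.
by case: ifP => _ _; set S := fld _ _; have [_ _ ->] := deadpE S i.+1.
Qed.

Lemma vports_sub v j : alive recs1 v -> j \in vports (recs1 v) -> j \in vports (recs v).
Proof.
move=> av; rewrite !mem_vports sizep1 sizep => /andP[jl pv]; rewrite jl /=.
case: (port_step av jl) => [E|[]//|[u [q [rho [len [_ _ np _ _]]]]]].
  by rewrite -[nth 0 _ j]/(pt recs v j) -E.
by move: np; rewrite /pt pv.
Qed.

Lemma deg_step v : alive recs1 v -> deg recs1 v <= deg recs v.
Proof. by move=> av; apply: uniq_leq_size; [exact: vports_uniq|move=> j; apply: vports_sub]. Qed.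

Lemma deg_lost v : alive recs1 v -> deg recs1 v < deg recs v ->
  exists j u q rho len, [/\ j < size (nb v), link recs i v j u q rho len & rm u].
Proof.
move=> av lt; have : ~~ all (fun j => j \in vports (recs1 v)) (vports (recs v)).
  apply/negP => /allP h; have := uniq_leq_size (vports_uniq (recs v)) h; rewrite leqNgt -/(deg recs1 v) -/(deg recs v) lt //.
move=> /allPn[j]; rewrite !mem_vports sizep sizep1 => /andP[jl pv]; rewrite jl /= => npv.
case: (port_step av jl) => [E|[_ h]|[u [q [rho [len [L ru _ _ _]]]]]].
- by move: npv; rewrite -[nth 0 (r_ports (recs1 v)) j]/(pt recs1 v j) E /pt pv.
- by rewrite -[nth 0 _ j]/(pt recs1 v j) h in npv.
- by exists j, u, q, rho, len.
Qed.

Lemma rlev_step b v : alive recs1 v -> i <= b -> (forall u, alive recs u -> rlev (recs u) <= b) ->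
  (kap -> i < b) -> rlev (recs1 v) <= b.
Proof.
move=> av ib H hk; apply/rlev_leP => p /(nthP 0)[j]; rewrite sizep1 => jl <-.
rewrite -[nth 0 _ j]/(pt recs1 v j) => np; have av0 : alive recs v by move: av; rewrite alive1 => /andP[].
case: (port_step av jl) => [E|[_ h]|[u [q [rho [len [L ru _ _ ->]]]]]].
- rewrite E; have /rlev_leP := H v av0; apply; last by rewrite -E.
  by rewrite mem_nth ?sizep.
- by rewrite h in np.
- have [_ _ au _ _] := L; case: (leqP (deg recs u) 1) => h; first by rewrite geq_max H.
  by apply: hk; move: ru => /and3P[_ _ /orP[|/and3P[]//]]; rewrite leqNgt -/(deg recs u) h.
Qed.

Lemma rlev_same b v : alive recs1 v -> deg recs1 v = deg recs v -> rlev (recs v) <= b -> rlev (recs1 v) <= b.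
Proof.
move=> av E /rlev_leP H; apply/rlev_leP => p /(nthP 0)[j]; rewrite sizep1 => jl <-.
rewrite -[nth 0 _ j]/(pt recs1 v j) => np.
case: (port_step av jl) => [E1|[_ h]|[u [q [rho [len [L ru _ _ _]]]]]].
- by rewrite E1; apply: H; [by rewrite mem_nth ?sizep|by rewrite -E1].
- by rewrite h in np.
- have jv : j \in vports (recs v) by rewrite mem_vports sizep jl; exact: link_virt L.
  have [_ F] := uniq_min_size (vports_uniq (recs1 v)) (fun x => @vports_sub v x av) (eq_leq (esym E)).
  have := F j; rewrite jv mem_vports => /andP[_]; by rewrite -[nth 0 _ j]/(pt recs1 v j) (negbTE np).
Qed.

(* weights of removed leaves are added to their neighbour *)
Lemma rake_step A q (W : V -> nat) : (forall u, rm u -> deg recs u <= 1 /\ q <= W u) ->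
  \sum_(v | alive recs v) W v <= A ->
  exists W' : V -> nat, [/\ \sum_(v | alive recs1 v) W' v <= A, (forall v, W v <= W' v) &
    (forall v, alive recs1 v -> deg recs1 v < deg recs v -> W v + q <= W' v)].
Proof.
move=> Hr HW.
(* A removed leaf has at most one alive neighbour, which inherits its weight. *)
have /fin_all_exists[tgt Ht] : forall u : V, exists w : V, rm u -> forall v j q rho len, link recs i v j u q rho len ->
   j < size (nb v) -> alive recs v -> v = w.
  move=> u; have [ru|] := boolP (rm u); last by exists u.
  have [cu au] := rem_col HI ru.
  case E : (vports (recs u)) => [|x l].
    exists u => _ v j q' rho len L jl av; have := vports_link Hid HI av jl L; by rewrite E.
  have [xl px] : x < size (nb u) /\ p_virt (pt recs u x).
    by have : x \in vports (recs u) by [rewrite E mem_head]; rewrite mem_vports sizep => /andP.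
  have [w [y [rho [len L]]]] := struct_virt HI au xl px; exists w => _ v j q' rho' len' L' jl av.
  have [h1 _] := Hr u ru; have := nth_vports0 h1 (vports_link Hid HI av jl L'); rewrite E => -[E1 _]; subst q'.
  have [[_ F1] _ _ _ _] := L'; have [[F2 _] _ _ _ _] := L; move: F1; rewrite F2.
  by move=> /virtp_inj[_ _ /Hid].
exists (fun v => W v + \sum_(u | rm u && (tgt u == v)) W u); split.
- rewrite big_split /= (exchange_big_dep (fun u => rm u)) /=; last by move=> v u _ /andP[].
  apply: leq_trans HW; rewrite [leqRHS](bigID (fun v => rm v)) /= addnC leq_add //.
    rewrite [leqRHS](_ : _ = \sum_(u | rm u) W u); last first.
      apply: eq_bigl => u; apply/andP/idP => [[]//|ru]; by split=> //; case: (rem_col HI ru).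
    apply: leq_sum => u ru; rewrite (eq_bigl (fun v => alive recs1 v && (tgt u == v))); last first.
      by move=> v; rewrite ru.
    have [h|h] := boolP (alive recs1 (tgt u)).
      rewrite (bigD1 (tgt u)) ?h ?eqxx //= big1 ?addn0 // => v /andP[/andP[_ /eqP ->]]; by rewrite eqxx.
    by rewrite big1 // => v /andP[av /eqP E]; move: h; rewrite E av.
  by apply: eq_leq; apply: eq_bigl => v; rewrite alive1.
- by move=> v; rewrite leq_addr.
- move=> v av lt; rewrite leq_add2l; have [j [u [q' [rho [len [jl L ru]]]]]] := deg_lost av lt.
  have av0 : alive recs v by move: av; rewrite alive1 => /andP[].
  have E := Ht u ru _ _ _ _ _ L jl av0.
  by rewrite (bigD1 u) ?ru -?E ?eqxx //=; apply: leq_trans (leq_addr _ _); case: (Hr u ru).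
Qed.
End Step.

(** A node has at most one parent port. A virtual port that is not a parent port is matched with the
    opposite end of its link, which is one; so each of the two kinds occurs at most once per alive
    node. *)
Lemma handshake recs i : struct recs i -> \sum_(v | alive recs v) deg recs v <= 2 * nal recs.
Proof.
move=> HI; pose B := (mD m).+1.
pose H := [set h : V * 'I_B | alive recs h.1 && ((h.2 : nat) \in vports (recs h.1))].
have szl v j : j \in vports (recs v) -> j < size (nb v) /\ p_virt (pt recs v j).
  by rewrite mem_vports; have [_ _ _ ->] := HI.1 v => /andP.
have jB v j : j \in vports (recs v) -> j < B.
  by move=> /szl[h _]; apply: leq_trans h _; apply: leqW; exact: HD.
have -> : \sum_(v | alive recs v) deg recs v = #|H|.
  rewrite -sum1_card (partition_big (fun h : V * 'I_B => h.1) (alive recs)) /=; last by move=> h; rewrite inE => /andP[].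
  apply: eq_bigr => v av.
  rewrite -[LHS]/(size (vports (recs v))).
  rewrite (reindex_onto (fun j : 'I_B => (v, j)) snd) /=; last by move=> [w j] /= /andP[_ /eqP ->].
  rewrite (eq_bigl (fun j : 'I_B => (j : nat) \in vports (recs v))); last by move=> j; rewrite inE av !eqxx !andbT.
  rewrite -(big_mkord (fun j => j \in vports (recs v)) (fun=> 1)) sum1_count.
  rewrite -size_filter.
  apply: perm_size; apply: uniq_perm; rewrite ?filter_uniq ?vports_uniq ?iota_uniq // => j.
  rewrite [in RHS]mem_filter /index_iota subn0 mem_iota; case h : (j \in vports (recs v)) => //=.
  by have := jB v j h; rewrite add0n => ->.
have /fin_all_exists[pn Hp] : forall h : V * 'I_B, exists h' : V * 'I_B, h \in H ->
    [/\ h' \in H, pt recs h'.1 h'.2 = pt recs h'.1 h'.2,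
      (exists r l, pt recs h'.1 h'.2 = virtp r l (id h.1) h.2) & (h.2 : nat) = up h.1 \/ (h'.2 : nat) = up h'.1].
  move=> [v j]; have [|h] := boolP ((v, j) \in H); last by exists (v, j).
  rewrite inE /= => /andP[av jv]; have [jl pv] := szl v j jv.
  have [u [q [rho [len L]]]] := struct_virt HI av jl pv.
  have qv := vports_link Hid HI av jl L.
  exists (u, Ordinal (jB u q qv)) => _; have [[_ E2] _ au ql [_ o]] := L; split=> //=.
    by rewrite inE /= au.
  by exists (rtr m rho), len.
pose U := [set h : V * 'I_B | (h.2 : nat) == up h.1].
rewrite -(cardsID U H) mul2n -addnn leq_add //.
  rewrite /nal sum1_card -(card_in_imset (f := fst) (D := H :&: U)).
    by apply: subset_leq_card; apply/subsetP => v /imsetP[h]; rewrite !inE => /andP[/andP[av _] _] ->.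
  move=> [v j] [v' j'] /setIP[_ h1] /setIP[_ h2] /= E; subst v'; congr pair.
  by apply: val_inj; move: h1 h2; rewrite !inE /= => /eqP -> /eqP ->.
have I : {in H :\: U &, injective pn}.
  move=> h h' /setDP[/Hp[_ _ [r [l E]] _] _] /setDP[/Hp[_ _ [r' [l' E']] _] _] F.
  move: E; rewrite F E' => /virtp_inj[_ _ /Hid E1 E2].
  by case: h h' E1 E2 {F E'} => [v j] [v' j'] /= -> /val_inj ->.
rewrite -(card_in_imset I) /nal sum1_card.
rewrite -(card_in_imset (f := fst) (D := pn @: (H :\: U))).
  by apply: subset_leq_card; apply/subsetP => v /imsetP[h /imsetP[h' /setDP[/Hp[+ _ _ _] _] ->] ->]; rewrite inE => /andP[].
move=> x x' /imsetP[h /setDP[/Hp[_ _ _ o] nu] ->] /imsetP[h' /setDP[/Hp[_ _ _ o'] nu'] ->] E.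
move: nu nu'; rewrite !inE; case: o => [->|o]; first by rewrite eqxx.
case: o' => [->|o'] _; first by rewrite eqxx.
by move=> _; move: o o' E; case: (pn h) (pn h') => [v j] [v' j'] /= + + E; subst v' => <- /val_inj ->.
Qed.

(** By [handshake] the average degree is at most 2, so the nodes of degree above two are at most
    twice as many as those of degree at most one. The latter are few because each carries weight
    [g]. *)
Lemma few_branch recs i A g W : struct recs i -> \sum_(v | alive recs v) W v <= A ->
  (forall v, alive recs v -> deg recs v <= 1 -> g <= W v) ->
  (\sum_(v | alive recs v && (2 < deg recs v)) 1) * g <= 2 * A.
Proof.
move=> HI HW Hl; have HH := handshake HI.
pose n3 := \sum_(v | alive recs v && (2 < deg recs v)) 1.
pose n1 := \sum_(v | alive recs v && (deg recs v <= 1)) 1.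
pose n2 := \sum_(v | alive recs v && (deg recs v == 2)) 1.
have E : nal recs = n1 + n2 + n3.
  rewrite /nal (bigID (fun v => deg recs v <= 1)) /= -addnA; congr addn.
  rewrite (bigID (fun v => deg recs v == 2)) /=; congr addn; apply: eq_bigl => v; rewrite -andbA; congr andb.
    by case: (deg recs v) => [|[|[|]]].
  by case: (deg recs v) => [|[|[|]]].
have L : 2 * n2 + 3 * n3 <= \sum_(v | alive recs v) deg recs v.
  rewrite (bigID (fun v => deg recs v <= 1)) /=; apply: leq_trans (leq_addl _ _).
  rewrite (bigID (fun v => deg recs v == 2)) /=; apply: leq_add.
    rewrite /n2 big_distrr /= [leqRHS](eq_bigl (fun v => alive recs v && (deg recs v == 2))).
      by apply: leq_sum => v /andP[_ /eqP ->].
    by move=> v; rewrite -andbA; congr andb; case: (deg recs v) => [|[|[|]]].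
  rewrite /n3 big_distrr /= [leqRHS](eq_bigl (fun v => alive recs v && (2 < deg recs v))).
    by apply: leq_sum => v /andP[_ h].
  by move=> v; rewrite -andbA; congr andb; case: (deg recs v) => [|[|[|]]].
have n13 : n3 <= 2 * n1 by move: HH L; rewrite E; lia.
have g1 : n1 * g <= A.
  apply: leq_trans HW; rewrite (bigID (fun v => deg recs v <= 1)) /=; apply: leq_trans (leq_addr _ _).
  by rewrite /n1 big_distrl /=; apply: leq_sum => v /andP[av h]; rewrite mul1n Hl.
by apply: leq_trans (_ : 2 * n1 * g <= _); [rewrite leq_mul2r n13 orbT|rewrite -mulnA leq_mul2l g1].
Qed.

(** At a deepest alive node no link can lead down, so only the parent port can be virtual. *)
Lemma leaf_exists recs i v0 : struct recs i -> alive recs v0 -> exists2 v, alive recs v & deg recs v <= 1.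
Proof.
move=> HI a0; case: (@arg_maxnP _ v0 (alive recs) dp a0) => v av Hm.
exists v => //; apply: (@uniq_leq_size _ _ [:: up v]); first exact: vports_uniq.
move=> j; rewrite mem_vports; have [_ _ _ ->] := HI.1 v => /andP[jl pv]; rewrite inE.
have [u [q [rho [len [_ _ au _ [[s [s1 s2 s3 [s4 _]]] _]]]]]] := struct_virt HI av jl pv.
case: s s1 s2 s3 s4 => //= w s /andP[wv hs] _ E [Ew].
have Ej : index w (nb v) = j by rewrite Ew index_uniq // adj_uniq.
case: (Hroot wv) => [[<- _]|[_ [h2 _]]]; first by rewrite Ej eqxx.
have := dp_walk HS (leq_ltn_trans (leq0n v) (ltn_ord v)) Hroot wv h2 hs; rewrite E => h3.
by have : dp u <= dp v := Hm u au; rewrite leqNgt -h2 h3.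
Qed.

Section Run.
Variables (gam : nat) (recs0 : V -> nat).
Local Notation pal := (palette m).
Definition sl x := x %% pal.
Definition kp x := (x %/ pal) %% gam.+1 == gam.
Definition lv x := (x %/ pal) %/ gam.+1.
Definition ru := iters (fun x recs => recs' m k Xs (sl x) x.+1 (lv x) (kp x) recs) recs0.
Hypothesis HK : forall x, x < tup m gam K -> kp x -> lv x < K.
Hypothesis H0 : struct recs0 0.
Hypothesis L0 : forall v, alive recs0 v -> rlev (recs0 v) <= 0.

Lemma pal_gt0 : 0 < pal. Proof. by rewrite expn_gt0. Qed.
Lemma lv_mono x y : x <= y -> lv x <= lv y.
Proof. by move=> h; apply: leq_div2r; apply: leq_div2r. Qed.

Lemma struct_ru x : x <= tup m gam K -> struct (ru x) (lv x).
Proof.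
elim: x => [|x IH] h; first by rewrite /lv !div0n.
apply: (struct_mono Xmono (lv_mono (leqnSn x))).
by apply: (struct_step Xcl Xmono Xcut HS HA HD Hid Hinp Hcol _ (isT : x.+1 != 0) (HK h)); apply: IH; exact: ltnW.
Qed.

Lemma passE q s : s < pal -> [/\ sl (q * pal + s) = s, kp (q * pal + s) = (q %% gam.+1 == gam) & lv (q * pal + s) = q %/ gam.+1].
Proof.
move=> h; rewrite /sl /kp /lv modnMDl modn_small // divnMDl ?pal_gt0 // divn_small // addn0 //.
Qed.

(** A leaf that survives the pass was not yet a leaf when its colour was processed. It became one by
    absorbing a removed leaf of weight at least [g], on top of its own positive weight. *)
Lemma rake_pass q A g W : (q.+1) * pal <= tup m gam K -> q %% gam.+1 != gam ->
  \sum_(v | alive (ru (q * pal)) v) W v <= A -> (forall v, 0 < W v) ->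
  (forall v, alive (ru (q * pal)) v -> deg (ru (q * pal)) v <= 1 -> g <= W v) ->
  exists W' : V -> nat, [/\ \sum_(v | alive (ru (q.+1 * pal)) v) W' v <= A, (forall v, 0 < W' v) &
  (forall v, alive (ru (q.+1 * pal)) v -> deg (ru (q.+1 * pal)) v <= 1 -> g < W' v)].
Proof.
move=> hq nq HW W0 Hg.
suff S s : s <= pal -> exists W' : V -> nat, [/\ \sum_(v | alive (ru (q * pal + s)) v) W' v <= A, (forall v, 0 < W' v) &
  (forall v, alive (ru (q * pal + s)) v -> deg (ru (q * pal + s)) v <= 1 -> g <= W' v /\ (col v < s -> g < W' v))].
  have [W' [h1 h2 h3]] := S pal (leqnn _); rewrite mulSnr; exists W'; split=> // v av dv.
  by have [_] := h3 v av dv; apply.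
elim: s => [|s IH] hs; first by rewrite addn0; exists W; split=> // v av dv; split=> //; exact: Hg.
have [W1 [h1 h2 h3]] := IH (ltnW hs); have [P1 P2 P3] := passE q hs.
have lt : q * pal + s < tup m gam K by apply: leq_trans hq; rewrite mulSnr ltn_add2l.
have HI := struct_ru (ltnW lt).
have HR u : rmv (sl (q * pal + s)) (lv (q * pal + s)) (kp (q * pal + s)) (ru (q * pal + s)) u ->
    deg (ru (q * pal + s)) u <= 1 /\ g <= W1 u.
  move=> ru1; have [_ au] := rem_col HI ru1; move: ru1; rewrite /rmv /removable P2 (negbTE nq) /= orbF => /and3P[_ _ d1].
  by split=> //; case: (h3 u au d1).
have [W' [k1 k2 k3]] := rake_step (isT : (q * pal + s).+1 != 0) HI HR h1.
rewrite addnS; exists W'; split=> //; first by move=> v; apply: leq_trans (k2 v).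
move=> v av' dv'; have := av'; rewrite [alive _ v](alive1 _ _ _ _ (isT : (q * pal + s).+1 != 0)) => /andP[av nr].
have D := deg_step (isT : (q * pal + s).+1 != 0) HI av'.
have [lt'|ge] := ltnP (deg (ru (q * pal + s).+1) v) (deg (ru (q * pal + s)) v).
  have := k3 v av' lt'; have := h2 v; lia.
have dv : deg (ru (q * pal + s)) v <= 1 by apply: leq_trans ge _.
have [g1 g2] := h3 v av dv; split; first by apply: leq_trans (k2 v).
rewrite ltnS leq_eqVlt => /orP[/eqP E|/g2 h]; last exact: leq_trans (k2 v).
by move: nr; rewrite /rmv /removable P1 -/(deg (ru (q * pal + s)) v) dv; have [_ _ -> _] := HI.1 v; rewrite E eqxx /=; move: av; rewrite /alive => ->.
Qed.

Lemma rake_passes i A j : j <= gam -> (i * gam.+1 + j) * pal <= tup m gam K ->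
  \sum_(v | alive (ru (i * gam.+1 * pal)) v) 1 <= A ->
  exists W : V -> nat, [/\ \sum_(v | alive (ru ((i * gam.+1 + j) * pal)) v) W v <= A, (forall v, 0 < W v) &
  (forall v, alive (ru ((i * gam.+1 + j) * pal)) v -> deg (ru ((i * gam.+1 + j) * pal)) v <= 1 -> j.+1 <= W v)].
Proof.
elim: j => [|j IH] hj ht HA0; first by rewrite addn0; exists (fun=> 1).
have [|W [h1 h2 h3]] := IH (ltnW hj) _ HA0; first by apply: leq_trans ht; rewrite leq_mul2r leq_add2l leqnSn orbT.
rewrite addnS; apply: (rake_pass _ _ h1 h2 h3); first by rewrite -addnS.
by rewrite modnMDl modn_small; [rewrite neq_ltn hj|exact: leqW].
Qed.

Lemma rlev_ru x b : x <= tup m gam K -> (forall y, y < x -> lv y <= b /\ (kp y -> lv y < b)) ->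
  forall v, alive (ru x) v -> rlev (ru x v) <= b.
Proof.
elim: x => [|x IH] hx H v av; first exact: leq_trans (L0 av) _.
have HI := struct_ru (ltnW hx); have [h1 h2] := H x (ltnSn x).
apply: (rlev_step (isT : x.+1 != 0) HI av h1 _ h2) => u au.
by apply: IH => //; [exact: ltnW|move=> y yx; apply: H; apply: leqW].
Qed.

(** After the rake passes every leaf weighs more than [gam], so [few_branch] bounds the nodes of
    degree above two, and no other node survives the compress pass. *)
Lemma compress_pass i A : i < K -> \sum_(v | alive (ru (i * gam.+1 * pal)) v) 1 <= A ->
  (\sum_(v | alive (ru (i.+1 * gam.+1 * pal)) v) 1) * gam <= 2 * A.
Proof.
move=> iK HA0.
pose q := i * gam.+1 + gam.
have q1 : q.+1 = i.+1 * gam.+1 by rewrite /q mulSnr addnS.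
have hq : q.+1 * pal <= tup m gam K.
  by rewrite q1 /tup leq_mul2r; apply/orP; right; apply: leq_trans (leq_addr _ _); rewrite leq_mul2r iK orbT.
have hq0 : q * pal <= tup m gam K by apply: leq_trans hq; rewrite mulSnr leq_addr.
have [W [h1 h2 h3]] := rake_passes (leqnn gam) hq0 HA0.
have HI0 := struct_ru hq0.
have FB := few_branch HI0 h1 h3.
have LV v : alive (ru (q * pal)) v -> rlev (ru (q * pal) v) <= i.
  apply: rlev_ru => // y yq.
  have yq' : y %/ pal < q by rewrite ltn_divLR ?pal_gt0.
  rewrite /lv /kp; split.
    by rewrite -(_ : q %/ gam.+1 = i); [apply: leq_div2r; exact: ltnW|rewrite /q divnMDl // divn_small ?addn0].
  move=> /eqP E; rewrite ltn_divLR //; move: yq'; rewrite /q (divn_eq (y %/ pal) gam.+1) E => h.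
  by rewrite -ltnS; move: h; rewrite ltn_add2r ltn_mul2r /=; set z := _ %/ gam.+1 => h; have : z.+1 * gam.+1 <= i * gam.+1 by [rewrite leq_mul2r]; rewrite mulSnr; lia.
(* A removal nearby may raise the level of a node beyond [i], but then its degree has dropped, and a
   node that had degree two can be raked instead. *)
have S s : s <= pal -> forall v, alive (ru (q * pal + s)) v -> [/\ alive (ru (q * pal)) v,
    (deg (ru (q * pal + s)) v = deg (ru (q * pal)) v /\ rlev (ru (q * pal + s) v) <= i) \/
      deg (ru (q * pal + s)) v < deg (ru (q * pal)) v &
    col v < s -> 2 < deg (ru (q * pal)) v].
  elim: s => [|s IH] hs v; first by rewrite addn0 => av; split=> //; left; split=> //; apply: LV.
  rewrite addnS => av'; have := av'; rewrite [alive _ v](alive1 _ _ _ _ (isT : (q * pal + s).+1 != 0)) => /andP[av nr].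
  have [k1 k2 k3] := IH (ltnW hs) v av; have [P1 P2 P3] := passE q hs.
  have lt : q * pal + s < tup m gam K by apply: leq_trans hq; rewrite mulSnr ltn_add2l.
  have HI := struct_ru (ltnW lt).
  have D := deg_step (isT : (q * pal + s).+1 != 0) HI av'.
  have KP : q %% gam.+1 == gam by rewrite /q modnMDl modn_small.
  have LI : q %/ gam.+1 = i by rewrite /q divnMDl // divn_small ?addn0.
  split=> //.
    case: k2 => [[e1 e2]|]; last by right; apply: leq_ltn_trans D _.
    move: D; rewrite leq_eqVlt => /orP[/eqP E|]; last by rewrite e1; right.
    by left; rewrite -e1; split=> //; apply: (rlev_same (isT : (q * pal + s).+1 != 0) HI av' E).
  rewrite ltnS leq_eqVlt => /orP[/eqP E|/k3//].
  move: nr; rewrite /rmv /removable P1 P2 P3 KP LI -/(deg (ru (q * pal + s)) v); have [_ _ -> _] := HI.1 v.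
  rewrite E eqxx; move: av; rewrite /alive => -> /=; case: k2 => [[<- ->]|]; first by rewrite andbT; case: (deg _ _) => [|[|[|]]].
  by case: (deg (ru (q * pal + s)) v) => [|[|d]] //=; lia.
have F : \sum_(v | alive (ru (i.+1 * gam.+1 * pal)) v) 1 <= \sum_(v | alive (ru (q * pal)) v && (2 < deg (ru (q * pal)) v)) 1.
  rewrite -q1 mulSnr !sum1_card; apply: subset_leq_card; apply/subsetP => v av.
  by have [k1 k2 k3] := S pal (leqnn _) v av; apply/andP; split; [exact: k1|exact: k3].
apply: leq_trans FB; apply: leq_mul => //.
Qed.

(** As [gam = 2 * r], each phase divides the number of alive nodes by [r]. At most [gam] nodes reach
    the final rake passes, after which a remaining leaf would have to weigh more than all of
    them. *)
Lemma all_removed n r : gam = 2 * r -> 0 < r -> gN G <= n -> n < r ^ K * (2 * r).+1 ->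
  forall v, ~~ alive (ru (tup m gam K)) v.
Proof.
move=> Eg r0 hn hr.
have C i : i <= K -> (\sum_(v | alive (ru (i * gam.+1 * pal)) v) 1) * r ^ i <= n.
  elim: i => [|i IH] hi.
    by rewrite muln1; apply: leq_trans hn; rewrite sum1_card -[leqRHS]card_ord; apply: max_card.
  have H x y : x * gam <= 2 * y -> x * r <= y by rewrite Eg mulnCA leq_mul2l.
  have h := H _ _ (compress_pass hi (leqnn _)).
  by rewrite expnS mulnA; apply: leq_trans (IH (ltnW hi)); rewrite leq_mul2r h orbT.
have AK : \sum_(v | alive (ru (K * gam.+1 * pal)) v) 1 <= gam.
  rewrite -ltnS -(ltn_pmul2r (_ : 0 < r ^ K)) ?expn_gt0 ?r0 //.
  by apply: leq_ltn_trans (C K (leqnn _)) _; rewrite {1}Eg mulnC.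
have [W [h1 h2 h3]] := rake_passes (leqnn gam) (leqnn (tup m gam K)) AK.
move=> v; apply/negP => av; have HI := struct_ru (leqnn (tup m gam K)).
have [w aw dw] := leaf_exists HI av; have := h3 w aw dw; apply/negP; rewrite -leqNgt.
by apply: leq_trans h1; rewrite (bigD1 w) //= leq_addr.
Qed.
End Run.
End Count.

(** * The complete schedule on a tree *)

Section Slots.
Variables (m k K gam r c n : nat) (Xs : seq nat) (G : graph) (id : 'I_(gN G) -> nat) (inp : 'I_(gN G) -> seq nat).
Local Notation V := 'I_(gN G).
Local Notation nb := (gadj G).
Local Notation X i := (lay Xs k i).
Hypothesis Xcl : forall i, closedX m (X i).
Hypothesis Xmono : forall i j, i <= j -> {subset X i <= X j}.
Hypothesis Xcut : forall i, i < K -> cutX m (X i) (X i.+1).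
Hypothesis Xroot : forall i, rootokX m (X i).
Hypothesis HT : is_tree G.
Hypothesis HD : max_deg_le G (mD m).
Hypothesis Hid : injective id.
Hypothesis Hidn : forall v, id v < n ^ c.
Hypothesis Hinp : forall v, size (inp v) = size (nb v) /\ (forall x, x \in inp v -> x < mIn m).
Hypothesis Eg : gam = 2 * r.
Hypothesis r0 : 0 < r.
Hypothesis hn : gN G <= n.
Hypothesis hr : n < r ^ K * (2 * r).+1.

Definition slot t (recs : V -> nat) v := phi m Xs k gam K c n t (recs v) (flood (ellm m) recs v).
Variable recs0 : V -> nat.
Hypothesis I0 : forall v, [/\ r_id (recs0 v) = id v, r_inp (recs0 v) = inp v, r_col (recs0 v) = 0, r_time (recs0 v) = 0 &
  r_ports (recs0 v) = [seq virtp (rel0 m) 0 (id u) (index v (nb u)) | u <- nb v]].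
Definition rs := iters slot recs0.
Local Notation tc := (tcol m c n).
Local Notation N := (tup m gam K).

Lemma phase1 : [/\ forall v, [/\ r_id (rs tc v) = id v, r_inp (rs tc v) = inp v, r_time (rs tc v) = 0 &
    r_ports (rs tc v) = [seq virtp (rel0 m) 0 (id u) (index v (nb u)) | u <- nb v]],
   forall v, r_col (rs tc v) < palette m &
   forall u v, u != v -> u \in bl (ellm m) v -> r_col (rs tc u) <> r_col (rs tc v)].
Proof.
have [N0 HS HC HA] := HT.
pose step t (recs : V -> nat) v := cstep (mD m) (ellm m) (t %/ (palette m).+1) (t %% (palette m).+1) recs v.
have E t : t <= tc -> rs t =1 iters step recs0 t.
  rewrite /rs; elim: t => //= t IH h v; rewrite /slot /phi h.
  rewrite /step /cstep /flood (IH (ltnW h)); congr colstep.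
  by apply: eq_map => u; rewrite IH // ltnW.
have Hst b sub recs v : sub <= (mD m).+1 ^ (ellm m) -> step (b * ((mD m).+1 ^ (ellm m)).+1 + sub) recs v = cstep (mD m) (ellm m) b sub recs v.
  move=> hs; rewrite /step /palette; set d := _ ^ _; rewrite divnMDl // divn_small ?addn0 // modnMDl modn_small //.
have HJ v : id v < 2 ^ (c * (trunc_log 2 n).+1).
  apply: leq_trans (Hidn v) _; rewrite mulnC expnM.
  case: (c) => [|c']; first by rewrite !expn0.
  rewrite leq_exp2r //; apply: ltnW; exact: trunc_log_ltn.
have [h1 h2 h3] := colouring HS HD Hid Hst (fun v => let: And5 x _ _ _ _ := I0 v in x) (fun v => let: And5 _ _ x _ _ := I0 v in x) HJ.
split.
- move=> v; rewrite (E tc (leqnn _)); have [-> -> -> -> _] := h2 v.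
  by have [-> -> _ -> ->] := I0 v.
- move=> v; rewrite (E tc (leqnn _)); exact: h1.
- move=> u v; rewrite !(E tc (leqnn _)); exact: h3.
Qed.

Local Notation inpv := inp.
Definition colv v := r_col (rs tc v).
Notation rux := (ru m k Xs gam (rs tc)).

Lemma rs_up x : x <= N -> rs (tc + x) =1 rux x.
Proof.
rewrite /rs /rux; elim: x => [|x IH] h v; first by rewrite addn0.
rewrite addnS /= /slot /phi ltnNge leq_addr /= ltn_add2l h addKn /upat /recs' /flood (IH (ltnW h)).
by congr upstep; apply: eq_map => u; rewrite IH // ltnW.
Qed.

(** A removed node is frozen, so the records kept at the end still show the ports of the moment of
    removal, which the labelling phase needs. *)
Lemma time_const x y v : x <= y -> r_time (rux x v) != 0 -> rux y v = rux x v.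
Proof.
move=> /subnKC <-; elim: (y - x) => [|d IH] h; first by rewrite addn0.
by rewrite addnS /= /recs' /upstep IH // h.
Qed.

Lemma time_after x y v : x <= y -> r_time (rux x v) = 0 -> r_time (rux y v) = 0 \/ x < r_time (rux y v).
Proof.
move=> /subnKC <-; elim: (y - x) => [|d IH] h; first by rewrite addn0; left.
rewrite addnS /= /recs' /upstep; case: (IH h) => [E|lt].
  rewrite E /=; case: ifP => _; last by set ps := map _ _; have [_ _ _ -> _] := set_portsE (rux (x + d) v) ps; left.
  by have [_ _ _ -> _] := set_timeE (rux (x + d) v) (x + d).+1; right; rewrite ltnS leq_addr.
have -> : r_time (rux (x + d) v) != 0 by rewrite -lt0n; apply: leq_ltn_trans lt.
by right.
Qed.

Lemma time_le x v : r_time (rs tc v) = 0 -> r_time (rux x v) <= x.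
Proof.
move=> h; elim: x => [|x IH]; first by rewrite /rux /= h.
rewrite /= /recs' /upstep; case: eqP => E /=; last exact: leqW.
case: ifP => _; first by have [_ _ _ ->] := set_timeE (rux x v) x.+1.
by set ps := map _ _; have [_ _ _ -> _] := set_portsE (rux x v) ps; rewrite E.
Qed.

Lemma kp_lv x : x < N -> kp m gam x -> lv m gam x < K.
Proof.
rewrite /kp /lv /tup => h /eqP E; rewrite ltn_divLR //.
have : x %/ palette m < K * gam.+1 + gam by rewrite ltn_divLR // pal_gt0.
rewrite {1}(divn_eq (x %/ palette m) gam.+1) E ltn_add2r ltn_mul2r /= => h2.
rewrite (divn_eq (x %/ palette m) gam.+1) E; set z := _ %/ gam.+1 in h2 *.
by have : z.+1 * gam.+1 <= K * gam.+1 by [rewrite leq_mul2r]; rewrite mulSnr; lia.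
Qed.

Lemma slots_ok v : let e w := r_labs (rs (tc + 2 * N) w) in
  [/\ size (e v) = size (nb v), {subset e v <= nfL m}, nfN m (inp v) (e v) &
      forall u, u \in nb v -> nth 0 (e u) (index v (nb u)) = flip (nth 0 (e v) (index u (nb v)))].
Proof.
have [N0 HS HC HA] := HT.
have [P1 P2 P3] := phase1.
have [dp [up Hroot]] := rooted HS HA HC N0.
have Hcol : forall u v, u != v -> u \in bl (ellm m) v -> colv u <> colv v := P3.
have nthp w j : j < size (nb w) -> pt (rs tc) w j = virtp (rel0 m) 0 (id (nth w (nb w) j)) (index w (nb (nth w (nb w) j))).
  by move=> jl; rewrite /pt; have [_ _ _ ->] := P1 w; rewrite (nth_map w).
have S0 : struct m k Xs id colv inp up (rs tc) 0.
  split=> [w|w aw j jl]; first by have [-> -> _ ->] := P1 w; rewrite size_map.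
  left; set u := nth w (nb w) j; have uw : u \in nb w by apply: mem_nth.
  have wu : w \in nb u by apply: adj_sym.
  exists u, (index w (nb u)), (rel0 m), 0; split.
  - split; first exact: nthp.
    rewrite rtr_rel0 nthp ?index_mem // nth_index //; congr virtp.
    by rewrite /u index_uniq // adj_uniq.
  - by split=> //; exact: isword0.
  - by rewrite /alive; have [_ _ -> _] := P1 u.
  - by rewrite index_mem.
  split; first by exists [:: u]; rewrite /= uw; split=> //; split=> //; rewrite nth_index.
  have Ej : index u (nb w) = j by rewrite /u index_uniq // adj_uniq.
  by case: (Hroot w u uw) => [[h _]|[h _]]; [left; rewrite -h Ej|right].
have L0 w : alive (rs tc) w -> rlev (rs tc w) <= 0.
  move=> _; apply/rlev_leP => p; have [_ _ _ ->] := P1 w => /mapP[u _ ->].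
  by have [-> _ _ _ _] := virtpE (rel0 m) 0 (id u) (index w (nb u)).
have AR := all_removed Xcl Xmono Xcut HS HA HD Hid Hinp Hcol P2 Hroot kp_lv S0 L0 Eg r0 hn hr.
have SR := struct_ru Xcl Xmono Xcut HS HA HD Hid Hinp Hcol kp_lv S0.
(* Time runs backwards here: [j] steps into the labelling phase the labels fit the records as they
   were before the last [j] peeling steps. *)
have D j : j <= N -> labelled m id inp (rux (N - j)) (rs (tc + N + j)) /\ forall w, [/\ r_id (rs (tc + N + j) w) = id w, r_inp (rs (tc + N + j) w) = inp w,
      r_time (rs (tc + N + j) w) = r_time (rux N w) & r_ports (rs (tc + N + j) w) = r_ports (rux N w)].
  elim: j => [|j IH] hj.
    rewrite subn0 addn0; split; first by move=> w; rewrite (negbTE (AR w)).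
    by move=> w; rewrite rs_up //; have [h1 h2 _ _] := (SR N (leqnn N)).1 w.
  have [IH1 IH2] := IH (ltnW hj).
  set x := N - j.+1; have Ex : N - j = x.+1 by rewrite /x subnSK.
  have xN : x < N by rewrite -Ex leq_subr.
  have tx : tc + 2 * N - (tc + N + j) = x.+1 by rewrite -Ex; lia.
  have EQ w : rs (tc + N + j.+1) w = lrecs' m x.+1 (rs (tc + N + j)) w.
    rewrite addnS /rs /= -/rs /slot /phi ltnNge -addnA leq_addr /= ltn_add2l ltnNge leq_addr /= addnA tx //.
  rewrite Ex in IH1.
  have T w : (r_time (rs (tc + N + j) w) == x.+1) = rmv (sl m x) (lv m gam x) (kp m gam x) (rux x) w.
    have [_ _ -> _] := IH2 w; apply/idP/idP.
      move=> /eqP h; apply: contraT => nr.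
      case: (posnP (r_time (rux x w))) => h2; last first.
        have := time_le x (let: And4 _ _ z _ := P1 w in z).
        by rewrite -(time_const (ltnW xN) (_ : r_time (rux x w) != 0)) -?lt0n // h ltnn.
      have h3 : r_time (rux x.+1 w) = 0.
        rewrite /= /recs' /upstep h2 /=; move: nr; rewrite /rmv => /negbTE ->.
        by set ps := map _ _; have [_ _ _ -> _] := set_portsE (rux x w) ps.
      by case: (time_after xN h3); rewrite h ?ltnn.
    move=> rw; have h : r_time (rux x.+1 w) = x.+1.
      rewrite /= /recs' /upstep -/(rmv (sl m x) (lv m gam x) (kp m gam x) (rux x) w) rw.
      by move: (rw) => /and3P[-> _ _] /=; have [_ _ _ ->] := set_timeE (rux x w) x.+1.
    by rewrite (time_const xN) h.
  have F w : rmv (sl m x) (lv m gam x) (kp m gam x) (rux x) w ->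
     [/\ r_id (rs (tc + N + j) w) = id w, r_inp (rs (tc + N + j) w) = inp w & r_ports (rs (tc + N + j) w) = r_ports (rux x w)].
    move=> rw; have [-> -> _ ->] := IH2 w; split=> //.
    have h : rux x.+1 w = set_time (rux x w) x.+1.
      rewrite /= /recs' /upstep -/(rmv (sl m x) (lv m gam x) (kp m gam x) (rux x) w) rw.
      by move: (rw) => /and3P[-> _ _].
    have [_ _ _ h4 [h5 _]] := set_timeE (rux x w) x.+1.
    by rewrite (time_const xN) h // h4.
  have IDS w : r_id (rs (tc + N + j) w) = id w by have [] := IH2 w.
  have LS := labelled_step Xmono Xcut Xroot HS HA HD Hid Hinp Hcol (isT : x.+1 != 0) (kp_lv xN) (SR x (ltnW xN)) T F IDS IH1.
  split; first by move=> w aw; have := LS w aw; rewrite !EQ => -[h1 h2 h3 h4 h5]; split=> // j0 u q rho len jl E; rewrite EQ; exact: h5 E.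
  move=> w; rewrite EQ /lrecs' /downstep; case: ifP => _; first exact: IH2.
  by set e := nth 0 _ 0; have [-> -> _ -> [-> _]] := set_labsE (rs (tc + N + j) w) e; exact: IH2.
have [L _] := D N (leqnn N); rewrite subnn -addnA addnn -mul2n in L.
have av w : alive (rux 0) w by rewrite /alive /=; have [_ _ -> _] := P1 w.
move=> e; have [h1 h2 h3 _ h5] := L v (av v); split=> // u uv.
have jl : index u (nb v) < size (nb v) by rewrite index_mem.
have := nthp v _ jl; rewrite nth_index // => /(h5 _ _ _ _ _ jl).
by rewrite rin_relof => /and3P[_ _ /eqP].
Qed.
End Slots.

(** * Message-passing implementation *)

Definition palg m Xs k gam K c n : mp_alg (nat * seq nat) nat nat :=
  MPAlg (fun i => ainit i.1 (enc_list i.2)) (fun st i => asend st i)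
        (fun st ms => arecv m Xs k gam K c n st (enc_list ms)) (fun st i => aout st i).

Lemma ellm_gt0 m : 0 < ellm m. Proof. by []. Qed.
Lemma ellmE m : ellm m = (2 ^ (size (nfL m) * size (nfL m))).+1. Proof. by []. Qed.
Opaque ellm.
Section Run.
Variables (m k K gam c n : nat) (Xs : seq nat) (G : graph) (inp : labeling G) (id : 'I_(gN G) -> nat).
Local Notation V := 'I_(gN G).
Local Notation nb := (gadj G).
Local Notation A := (palg m Xs k gam K c n).
Local Notation info := (fun v => (id v, inputs_of G inp v)).
Definition frec (v : V) := firstrec m (enc_list [:: id v; enc_list (inputs_of G inp v)])
  (enc_list [seq enc_list [:: id u; index v (nb u)] | u <- nb v]).
Local Notation recs t := (rs m k K gam c n Xs frec t).

Lemma frecE v : [/\ r_id (frec v) = id v, r_inp (frec v) = inputs_of G inp v, r_col (frec v) = 0, r_time (frec v) = 0 &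
  r_ports (frec v) = [seq virtp (rel0 m) 0 (id u) (index v (nb u)) | u <- nb v]].
Proof.
rewrite /r_id /r_inp /r_col /r_time /r_ports /frec /firstrec !fldE /= !encK; split=> //.
by rewrite -map_comp; apply: eq_map => u /=; rewrite !fldE.
Qed.

Definition st t rec buf := enc_list [:: t; rec; enc_list buf].

Lemma run0 v : run A G info 0 v = ainit (id v) (enc_list (inputs_of G inp v)). Proof. by []. Qed.
Lemma run_step t v : run A G info t.+1 v = arecv m Xs k gam K c n (run A G info t v)
  (enc_list [seq asend (run A G info t u) (index v (nb u)) | u <- nb v]).
Proof. by []. Qed.

Lemma run1 v : run A G info 1 v = st 1 (frec v) [:: frec v].
Proof.
have E0 u : fld (ainit (id u) (enc_list (inputs_of G inp u))) 0 == 0 by rewrite fldE.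
have E1 u : fld (ainit (id u) (enc_list (inputs_of G inp u))) 1 = enc_list [:: id u; enc_list (inputs_of G inp u)] by rewrite fldE.
rewrite run_step run0 /arecv E0 E1 /st.
have -> : [seq asend (run A G info 0 u) (index v (nb u)) | u <- nb v] = [seq enc_list [:: id u; index v (nb u)] | u <- nb v].
  by apply: eq_map => u; rewrite run0 /asend E0 E1 fldE.
by [].
Qed.

Lemma stE t r b : [/\ fld (st t r b) 0 = t, fld (st t r b) 1 = r & fld (st t r b) 2 = enc_list b].
Proof. by rewrite !fldE. Qed.

Lemma flat_sends t rr bb w : (forall u : V, run A G info t.+1 u = st t.+1 (rr u) (bb u)) ->
   flatu [seq asend (run A G info t.+1 u) (index w (nb u)) | u <- nb w] = flatten [seq bb u | u <- nb w].
Proof.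
move=> H; rewrite flatuE -map_comp; congr flatten; apply: eq_map => u.
rewrite [LHS]/comp H /asend; have [-> _ ->] := stE t.+1 (rr u) (bb u); by rewrite encK.
Qed.

Lemma run_next t rr bb v : (forall u : V, run A G info t.+1 u = st t.+1 (rr u) (bb u)) -> t.+1 %% ellm m != 0 ->
  run A G info t.+2 v = st t.+2 (rr v) (rr v :: flatten [seq bb u | u <- nb v]).
Proof.
move=> H nz; rewrite run_step /arecv H; have [-> -> _] := stE t.+1 (rr v) (bb v).
by rewrite [t.+1 == 0]/= (negbTE nz) encK -(flat_sends v H).
Qed.

Lemma run_last t rr bb v : (forall u : V, run A G info t.+1 u = st t.+1 (rr u) (bb u)) -> t.+1 %% ellm m == 0 ->
  let r' := phi m Xs k gam K c n (t.+1 %/ ellm m).-1 (rr v) (rr v :: flatten [seq bb u | u <- nb v]) in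
  run A G info t.+2 v = st t.+2 r' [:: r'].
Proof.
move=> H z; rewrite run_step /arecv H; have [-> -> _] := stE t.+1 (rr v) (bb v).
by rewrite [t.+1 == 0]/= z encK -(flat_sends v H).
Qed.

Lemma floodS j recs0 v : flood j.+1 recs0 v = recs0 v :: flatten [seq flood j recs0 u | u <- nb v].
Proof. by rewrite /flood /= map_flatten -map_comp. Qed.

(** The shift by one round is the initial exchange; within block [tau] the buffer after [j] more
    rounds holds the ball of radius [j]. *)
Lemma runS tau j v : j < ellm m -> run A G info (tau * ellm m + j).+1 v =
  st (tau * ellm m + j).+1 (recs tau v) (flood j (recs tau) v).
Proof.
elim: tau j v => [|tau IHt]; elim=> [|j IHj] v hj.
- by rewrite mul0n addn0 run1.
- rewrite addnS (run_next v (fun u => IHj u (ltnW hj))) ?floodS //.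
  by rewrite -addnS modnMDl modn_small.
- have e0 := ellm_gt0 m.
  have E : tau.+1 * ellm m + 0 = (tau * ellm m + (ellm m).-1).+1 by rewrite addn0 mulSnr -{1}(prednK e0) addnS.
  have h : (ellm m).-1 < ellm m by rewrite prednK.
  rewrite E (run_last v (fun u => IHt _ u h)); last by rewrite -E addn0 modnMl.
  by rewrite -E addn0 (mulnK _ e0) -pred_Sn -floodS (prednK e0).
- rewrite addnS (run_next v (fun u => IHj u (ltnW hj))) ?floodS //.
  by rewrite -addnS modnMDl modn_small.
Qed.

Lemma msg_le tau j v : j < ellm m -> forall i,
  a_send A (run A G info (tau * ellm m + j).+1 v) i = enc_list (flood j (recs tau) v).
Proof.
move=> hj i; rewrite -[LHS]/(asend (run A G info (tau * ellm m + j).+1 v) i) runS // /asend; by have [-> _ ->] := stE (tau * ellm m + j).+1 (recs tau v) (flood j (recs tau) v).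
Qed.
End Run.

(** * Message sizes *)

Fixpoint gexp q e := if q is q'.+1 then 2 * gexp q' e + 2 else e.
Lemma gexp_ge q e : e <= gexp q e. Proof. by elim: q => //= q IH; lia. Qed.
Section Bounds.
Variable P : nat.
Hypothesis P2 : 1 < P.
Lemma npair_lt x y e : x < P ^ e -> y < P ^ e -> (npair x y).+1 < P ^ (2 * e + 2).
Proof.
move=> hx hy; have : (npair x y).+1 <= (x + y).+1 ^ 2.
  rewrite npairE -ltnS; have : tri (x + y) * 2 <= (x + y) * (x + y).+1 by rewrite /tri leq_trunc_div.
  by rewrite expnS expn1; nia.
move=> h; apply: leq_ltn_trans h _.
rewrite mulnC expnD expnM -expnMn ltn_exp2r //.
have : P ^ e * 2 <= P ^ e * P by rewrite leq_mul2l P2 orbT.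
lia.
Qed.
(** Pairing squares the bound up to a constant factor; for lists of constant length the exponent
    stays constant. *)
Lemma enc_lt q e s : size s <= q -> (forall x, x \in s -> x < P ^ e) -> enc_list s < P ^ gexp q e.
Proof.
elim: q s => [|q IH] [|x s] //= h H; try by rewrite expn_gt0; lia.
apply: npair_lt; last by apply: IH => // y ys; apply: H; rewrite inE ys orbT.
apply: leq_trans (H x (mem_head _ _)) _; rewrite leq_exp2l //; exact: gexp_ge.
Qed.
End Bounds.

Lemma mem_le_sumn x l : x \in l -> x <= sumn l.
Proof. elim: l => //= y l IH; rewrite inE => /orP[/eqP->|/IH h]; [exact: leq_addr | apply: leq_trans h (leq_addl _ _)]. Qed.

Lemma fld0 k : fld 0 k = 0. Proof. by rewrite /fld /= nth_nil. Qed.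

Section Bound.
Variables (m k : nat) (Xs : seq nat) (M : nat).
(** Apart from identifiers, levels and removal times, every entry of a record is a code from a
    finite set fixed by the problem. The sum over an enumeration of such a set dominates all its
    codes. *)
Definition cst := [:: sumn (sublists (pairsu (nfL m) (nfL m))); sumn (sublists (nfL m)); sumn (flatu Xs);
  sumn (lists_le (mD m) (nfL m)); sumn (lists_le (mD m) (iota 0 (mIn m))); 2 * palette m; ellm m; mD m; 1].
Hypothesis HM : forall x, x \in cst -> x < M.

Definition okport p := size (unl p) <= 5 /\ forall x, x \in unl p -> x < M.
Definition okports r := size (r_ports r) <= mD m /\ forall p, p \in r_ports r -> okport p.
Definition okrec r := [/\ size (unl r) = 6, fld r 0 < M /\ fld r 1 < M, size (r_inp r) <= mD m, 
  fld r 2 < 2 * palette m & fld r 3 < M /\ fld r 5 < M] /\ okports r.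

Lemma M_gt0 : 0 < M. Proof. by apply: leq_ltn_trans (HM (_ : 1 \in cst)); rewrite ?inE ?eqxx ?orbT. Qed.
Lemma okport_fld p j : okport p -> fld p j < M.
Proof.
move=> [_ h]; rewrite /fld; case: (ltnP j (size (unl p))) => hj; first by apply: h; exact: mem_nth.
by rewrite nth_default // M_gt0.
Qed.
Lemma okport_nth r j : okports r -> okport (nth 0 (r_ports r) j).
Proof. move=> [_ h]; case: (ltnP j (size (r_ports r))) => hj; [by apply: h; exact: mem_nth|by rewrite nth_default]. Qed.
Lemma okports_lookup B u : (forall r, r \in B -> okrec r) -> okports (lookup B u).
Proof.
move=> H; rewrite /lookup; set j := find _ _; case: (ltnP j (size B)) => hj; first by have [_] := H _ (mem_nth 0 hj).
by rewrite nth_default // /okports /r_ports fld0.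
Qed.

Lemma okport_enc s : size s <= 5 -> (forall x, x \in s -> x < M) -> okport (enc_list s).
Proof. by rewrite /okport encK. Qed.

Lemma rel_lt p : enc_list (relof m p) < M.
Proof.
apply: leq_ltn_trans (HM (mem_head _ _)); apply: mem_le_sumn; exact: mem_sublists.
Qed.
Lemma cls_lt p : enc_list (filter p (nfL m)) < M.
Proof.
apply: leq_ltn_trans (HM (_ : sumn (sublists (nfL m)) \in cst)); last by rewrite !inE eqxx orbT.
apply: mem_le_sumn; exact: mem_sublists.
Qed.
Lemma lay_lt i x : x \in lay Xs k i -> x < M.
Proof.
move=> h; apply: leq_ltn_trans (HM (_ : sumn (flatu Xs) \in cst)); last by rewrite !inE eqxx !orbT.
apply: mem_le_sumn; rewrite mem_flatu; apply/hasP.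
move: h; rewrite /lay; set j := if _ then _ else _; case: (ltnP j (size Xs)) => hj h; last by rewrite nth_default in h.
by exists (nth 0 Xs j) => //; apply: mem_nth.
Qed.
Lemma pick_lt i rho j : fld (pickrect (lay Xs k i) rho) j < M.
Proof.
rewrite /pickrect; set l := filter _ _; case: (ltnP 0 (size l)) => h; last by rewrite nth_default // fld0 M_gt0.
have := mem_nth 0 h; rewrite mem_filter => /andP[_ /pairsuP[x [y [hx hy ->]]]]; rewrite fldE.
by case: j => [|[|j]] /=; rewrite ?nth_nil ?M_gt0 //; apply: lay_lt; eassumption.
Qed.
Lemma rlev_lt r : okports r -> rlev r < M.
Proof.
move=> [_ h]; rewrite -(prednK M_gt0) ltnS; apply/rlev_leP => p hp _.
by rewrite -ltnS prednK ?M_gt0 //; apply: okport_fld; exact: h.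
Qed.

Lemma newport_ok i p rb : i.+1 < M -> okport p -> okports rb -> okport (newport m Xs k i p rb).
Proof.
move=> hi hp hr.
have el : ellm m < M by apply: HM; rewrite !inE eqxx !orbT.
have D s l : s < M -> l < M -> okport (deadp s l).
  move=> hs hl; apply: okport_enc => // x; rewrite !inE => /or3P[] /eqP-> //; exact: M_gt0.
rewrite /newport; case: ifP => _; first by apply: D; [exact: cls_lt|case: ifP => _; [exact: ltnW|exact: rlev_lt]].
case: ifP => hl; last by case: ifP => _; apply: D => //; exact: pick_lt.
apply: okport_enc => // x; rewrite !inE => /orP[/eqP->|/or4P[]/eqP->].
- by apply: HM; rewrite !inE eqxx !orbT.
- exact: rel_lt.
- exact: ltn_trans hl el.
- by apply: okport_fld; exact: okport_nth.
- by apply: okport_fld; exact: okport_nth.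
Qed.

Lemma col_lt x : x < 2 * palette m -> x < M.
Proof. by move=> h; apply: ltn_trans h _; apply: HM; rewrite !inE eqxx !orbT. Qed.

Lemma upstep_ok s kap i t r B : i.+1 < M -> t < M -> okrec r -> (forall u, u \in B -> okrec u) ->
  okrec (upstep m Xs k s kap i t r B).
Proof.
move=> hi ht hr HB; rewrite /upstep; case: ifP => // _; case: hr => [[h1 [h2 h3] h4 h5 [h6 h7]] h8].
case: ifP => _.
  by split; [split; rewrite ?/r_inp /set_time ?encK ?fldE //|rewrite /okports /r_ports fldE].
split; first by split; rewrite ?/r_inp /set_ports ?encK ?fldE.
rewrite /okports /r_ports fldE /= encK size_map; case: h8 => h8 h9; split=> // p /mapP[q hq ->].
case: ifP => _; last exact: h9.
  apply: newport_ok => //; [exact: h9|exact: okports_lookup].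
Qed.

Lemma downstep_ok t r B : okrec r -> okrec (downstep m t r B).
Proof.
move=> hr; rewrite /downstep; case: ifP => // _; case: hr => [[h1 [h2 h3] h4 h5 [h6 h7]] h8].
split; last by rewrite /okports /r_ports fldE.
split; rewrite ?/r_inp /set_labs ?encK ?fldE //; split=> //=.
set l := filter _ _; case: (ltnP 0 (size l)) => h; last by rewrite nth_default // M_gt0.
have := mem_nth 0 h; rewrite mem_filter => /andP[_ /choiceP[s [k1 k2 _ _ ->]]].
apply: leq_ltn_trans (HM (_ : sumn (lists_le (mD m) (nfL m)) \in cst)); last by rewrite !inE eqxx !orbT.
by apply: mem_le_sumn; apply/lists_leP; exists s; rewrite k1.
Qed.

Lemma colstep_ok b sub r B : okrec r -> okrec (colstep (palette m) b sub r B).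
Proof.
move=> hr; have C x : x < 2 * palette m -> okrec (set_col r x).
  case: hr => [[h1 [h2 h3] h4 h5 [h6 h7]] h8] hx.
  by split; [split; rewrite ?/r_inp /set_col ?encK ?fldE|rewrite /okports /r_ports fldE].
rewrite /colstep; case: ifP => _; [apply: C|case: ifP => // _; apply: C].
  case: ifP => [/andP[_ h]|_]; first by rewrite mul2n -addnn ltn_add2r.
  by case: hr => [[_ _ _ h _] _].
rewrite /mex; apply: leq_ltn_trans (find_size _ _) _; rewrite size_iota mul2n -addnn -{1}[palette m]addn0 ltn_add2l.
exact: pal_gt0.
Qed.

Lemma phi_ok gam K c n tau r B : tup m gam K + K + 1 < M -> okrec r -> (forall u, u \in B -> okrec u) ->
  okrec (phi m Xs k gam K c n tau r B).
Proof.
move=> h hr HB; rewrite /phi; case: ifP => _; first exact: colstep_ok.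
case: ifP => ht; last exact: downstep_ok.
case: (leqP (tcol m c n) tau) => h1; last first.
  apply: upstep_ok => //; rewrite (_ : tau - _ = 0) ?div0n; lia.
have hx : tau - tcol m c n < tup m gam K by lia.
move: hx; set x := tau - _ => hx; apply: upstep_ok => //; last by lia.
have : (x %/ palette m) %/ gam.+1 <= K; last by move: h; clear; lia.
rewrite -ltnS ltn_divLR //; move: hx; rewrite /tup => hx.
have : x %/ palette m < K * gam.+1 + gam by rewrite ltn_divLR // pal_gt0.
by rewrite mulSn; lia.
Qed.

Lemma okrec_lt P e r : 1 < P -> M <= P ^ e -> okrec r -> r < P ^ gexp 6 (gexp (mD m) (gexp 5 e)).
Proof.
move=> P1 hM [[h1 [h2 h3] h4 h5 [h6 h7]] [h8 h9]].
have E j x : x < M -> x < P ^ gexp (mD m) (gexp j e).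
  move=> h; apply: leq_trans h (leq_trans hM _); rewrite leq_exp2l //.
  exact: leq_trans (gexp_ge j e) (gexp_ge _ _).
rewrite -(unlK r); apply: enc_lt; rewrite ?h1 // => x /(nthP 0)[j hj <-].
move: hj; rewrite h1 -[nth 0 _ j]/(fld r j).
case: j => [|[|[|[|[|[|j]]]]]] // _; try by apply: E.
  by apply: E; apply: col_lt.
rewrite -(unlK (fld r 4)) -/(r_ports r); apply: enc_lt => // p /h9[k1 k2].
rewrite -(unlK p); apply: enc_lt => // y /k2 hy; exact: leq_trans hy hM.
Qed.
End Bound.

(** The base [n + 2] exceeds 1 for every [n], as the bounds above require, and is at most the square
    of the first power of two above [n]. *)
Lemma pow_log n e : 0 < n -> n.+2 ^ e <= 2 ^ (2 * e * (trunc_log 2 n).+1).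
Proof.
move=> n0; rewrite mulnAC expnM.
case: e => [|e]; first by rewrite !expn0.
rewrite leq_exp2r //; have : n < 2 ^ (trunc_log 2 n).+1 by apply: trunc_log_ltn.
rewrite mul2n -addnn expnD; set x := 2 ^ _ => h.
have : 2 <= x by rewrite /x expnS; have : 0 < 2 ^ trunc_log 2 n by [rewrite expn_gt0]; lia.
nia.
Qed.

Definition nfsol m (G : graph) (inp x : labeling G) : Prop :=
  (forall u w, w \in gadj G u -> x u w \in nfL m /\ x w u = flip (x u w)) /\
  forall v, nfN m (inputs_of G inp v) [seq x v w | w <- gadj G v].

Section Core.
Variables (m k c e : nat) (Xs : seq nat) (r K : nat -> nat).
Local Notation X i := (lay Xs k i).
Local Notation gam n := (2 * r n).
Hypothesis Xcl : forall i, closedX m (X i).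
Hypothesis Xmono : forall i j, i <= j -> {subset X i <= X j}.
Hypothesis Xcut : forall n i, i < K n -> cutX m (X i) (X i.+1).
Hypothesis Xroot : forall i, rootokX m (X i).
Hypothesis r0 : forall n, 0 < r n.
Hypothesis hr : forall n, n < r n ^ K n * (2 * r n).+1.
Hypothesis he : forall n, tup m (gam n) (K n) + K n < n.+2 ^ e.

(** A common exponent for all entries of a record: [c] for identifiers, [e + 1] for times and
    levels, the rest for the constants of the problem. *)
Let e0 := c + e.+1 + sumn (cst m Xs).
Let E1 := gexp ((mD m).+1 ^ ellm m) (gexp 6 (gexp (mD m) (gexp 5 e0))).
Definition Bcore := 2 * (E1 + gexp 2 e0).

Theorem congest_core n (G : graph) (inp : labeling G) (id : 'I_(gN G) -> nat) :
  gN G <= n -> is_tree G -> max_deg_le G (mD m) -> (forall u v, adjb G u v -> inp u v < mIn m) ->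
  injective id -> (forall v, id v < n ^ c) ->
  let A := palg m Xs k (gam n) (K n) c n in
  let info := fun v => (id v, inputs_of G inp v) in
  let T := rounds m (gam n) (K n) c n in
  (forall s v i, s < T -> i < size (gadj G v) -> a_send A (run A G info s v) i < 2 ^ (Bcore * (trunc_log 2 n).+1)) /\
  exists x, nfsol m inp x /\ forall v w, w \in gadj G v -> output A G info T v w = fld (x v w) 1.
Proof.
move=> hn HT HD Hin Hid Hidn A info T.
have [N0 HS HC HA] := HT.
have n0 : 0 < n by apply: leq_trans hn.
pose recs t := rs m k (K n) (gam n) c n Xs (frec m inp id) t.
have Q q : 2 ^ q <= n.+2 ^ q by case: q => // q; rewrite leq_exp2r.
have HM : forall x, x \in cst m Xs -> x < n.+2 ^ e0.
  move=> x /mem_le_sumn h; apply: leq_ltn_trans h _; rewrite /e0 expnD.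
  apply: leq_trans (_ : n.+2 ^ sumn (cst m Xs) <= _); first by apply: leq_trans (ltn_expl _ (isT : 1 < 2)) (Q _).
  by rewrite leq_pmull // expn_gt0.
have hp a : a <= e0 -> n.+2 ^ a <= n.+2 ^ e0 by move=> h; rewrite leq_exp2l.
have hc : n ^ c <= n.+2 ^ e0.
  apply: leq_trans (hp c _); last by rewrite /e0 -addnA leq_addr.
  by case: (c) => [|c']; rewrite ?expn0 // leq_exp2r //; lia.
have Hinp : forall v, size (inputs_of G inp v) = size (gadj G v) /\ (forall x, x \in inputs_of G inp v -> x < mIn m).
  by move=> v; rewrite size_map; split=> // x /mapP[u uv ->]; apply: Hin.
have OK0 v : okrec m (n.+2 ^ e0) (frec m inp id v).
  have ID u : id u < n.+2 ^ e0 by apply: leq_trans (Hidn u) hc.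
  have [f1 f2 f3 f4 f5] := frecE m inp id v.
  have Z : 0 < n.+2 ^ e0 by rewrite expn_gt0.
  split; last first.
    rewrite /okports f5 size_map; split=> // p /mapP[u uv ->]; apply: okport_enc => // y.
    rewrite !inE => /orP[/eqP->|/or4P[]/eqP->] //; [by apply: HM; rewrite !inE eqxx !orbT|exact: rel_lt HM _|].
    apply: leq_ltn_trans (HM (mD m) _); last by rewrite !inE eqxx !orbT.
    by apply: leq_trans (HD u); apply: index_size.
  split.
  - by rewrite /frec /firstrec encK.
  - rewrite -/(r_id _) f1; split=> //; rewrite -(unlK (fld _ 1)) -/(r_inp _) f2.
    apply: leq_ltn_trans (HM (sumn (lists_le (mD m) (iota 0 (mIn m)))) _); last by rewrite !inE eqxx !orbT.
    apply: mem_le_sumn; apply/lists_leP; exists (inputs_of G inp v); have [h1 h2] := Hinp v; rewrite h1; split=> //.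
    by move=> x /h2; rewrite mem_iota.
  - by rewrite f2 (Hinp v).1.
  - by rewrite -/(r_col _) f3 muln_gt0 expn_gt0.
  - rewrite -/(r_time _) f4; split=> //; by rewrite /frec /firstrec fldE.
have OK t v : okrec m (n.+2 ^ e0) (recs t v).
  elim: t v => [|t IH] v; first exact: OK0.
  rewrite /recs /= /slot; apply: phi_ok => //; last by move=> u /mapP[w _ ->]; exact: IH.
  rewrite addn1; apply: leq_ltn_trans (he n) _; rewrite ltn_exp2l // /e0; lia.
split.
  move=> s v i hs hi.
  have F q : q <= E1 + gexp 2 e0 -> n.+2 ^ q <= 2 ^ (Bcore * (trunc_log 2 n).+1).
    move=> hq; apply: leq_trans (pow_log _ n0) _; rewrite leq_exp2l // leq_mul2r; apply/orP; right.
    by rewrite /Bcore leq_mul2l hq.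
  case: s hs => [|s] hs.
    apply: leq_trans (F _ (leq_addl E1 _)).
    have -> : a_send A (run A G info 0 v) i = enc_list [:: id v; i] by rewrite /= /asend /ainit !fldE.
    apply: enc_lt => // x; rewrite !inE => /orP[]/eqP->; first exact: leq_trans (Hidn v) hc.
    apply: ltn_trans hi _; apply: leq_ltn_trans (HD v) _; apply: HM; by rewrite !inE eqxx !orbT.
  rewrite (divn_eq s (ellm m)) msg_le ?ltn_mod ?ellm_gt0 //.
  apply: leq_trans (F _ (leq_addr _ E1)); apply: enc_lt => //.
    rewrite size_map; apply: leq_trans (_ : (mD m).+1 ^ (s %% ellm m) <= _).
      by have /andP[] := bl_size (s %% ellm m) v HD.
    by apply: leq_pexp2l => //; apply: ltnW; rewrite ltn_mod ellm_gt0.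
  by move=> x /mapP[u _ ->]; apply: (okrec_lt HM _ _ (OK _ u)).
have SL := slots_ok Xcl Xmono (@Xcut n) Xroot HT HD Hid Hidn Hinp erefl (r0 n) hn (@hr n) (frecE m inp id).
set TT := tcol m c n + 2 * tup m (gam n) (K n).
pose ee v := r_labs (recs TT v).
exists (fun v w => nth 0 (ee v) (index w (gadj G v))); split.
  split=> [u w wu|v].
    have [h1 h2 _ h3] := SL u; split; last exact: (h3 w wu).
    by apply: h2; apply: mem_nth; rewrite h1 index_mem.
  have [h1 _ h3 _] := SL v.
  have -> : [seq nth 0 (ee v) (index w (gadj G v)) | w <- gadj G v] = ee v.
    apply: (@eq_from_nth _ 0); first by rewrite size_map h1.
    by move=> i; rewrite size_map => hi; rewrite (nth_map v) // index_uniq // adj_uniq.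
  exact: h3.
move=> v w wv.
have R : run A G info (ellm m * TT).+1 v = st (ellm m * TT).+1 (recs TT v) (flood 0 (recs TT) v).
  by have := @runS m k (K n) (gam n) c n Xs G inp id TT 0 v (ellm_gt0 m); rewrite addn0 (mulnC TT).
rewrite /output R /= /aout.
by have [_ -> _] := stE (ellm m * TT).+1 (recs TT v) (flood 0 (recs TT) v).
Qed.
End Core.

(** * Equivalence with the normal form *)

Definition olist (o : option (nat * nat)) : seq nat := if o is Some (a, b) then [:: a; b] else [::].
Lemma olist_inj : injective olist.
Proof. by move=> [[a b]|] [[c d]|] //= [-> ->]. Qed.

Lemma hlE H a b : hl (enc_cgraph H) a b = olist (hlab H a b).
Proof.
rewrite /hl /enc_cgraph fldE /= encK /hlab.
elim: (cedges H) => //= -[[[[[a' b'] ia] oa] ib] ob] es IH; rewrite !fldE /= IH.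
by case: ifP => // _; case: ifP.
Qed.

Section NF.
Variables (P : LCL) (G : graph) (inp out : labeling G).
Local Notation V := 'I_(gN G).
Local Notation nb := (gadj G).
Local Notation m := (enc_lcl P).
Hypothesis HT : is_tree G.
Hypothesis HD : max_deg_le G (lDelta P).
Let HS : simple_graph G. Proof. by case: HT. Qed.
Let HA : acyclic G. Proof. by case: HT. Qed.
Let HC : connected G. Proof. by case: HT. Qed.

Definition chd (par : option V) (cur : V) := [seq x <- nb cur | Some x != par].
Fixpoint VV j par cur : nat := if j is j'.+1 then
  enc_list [seq enc_list [:: inp cur x; out cur x; inp x cur; out x cur; VV j' (Some cur) x] | x <- chd par cur] else 0.
Fixpoint adr par cur (s : seq V) : seq nat :=
  if s is x :: s' then index x (chd par cur) :: adr (Some cur) x s' else [::].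

Lemma mem_chd par cur x : (x \in chd par cur) = (x \in nb cur) && (Some x != par).
Proof. by rewrite mem_filter andbC. Qed.
Lemma size_adr par cur s : size (adr par cur s) = size s.
Proof. by elim: s par cur => //= x s IH par cur; rewrite IH. Qed.
Lemma adr_rcons par cur s x : adr par cur (rcons s x) = rcons (adr par cur s) (index x (chd (prv par cur s) (last cur s))).
Proof. by elim: s par cur => //= y s IH par cur; rewrite IH. Qed.
Lemma adr_inj par cur s t : nbw par cur s -> nbw par cur t -> adr par cur s = adr par cur t -> s = t.
Proof.
elim: s par cur t => [|x s IH] par cur [|y t] //= /and3P[h1 h2 h3] /and3P[k1 k2 k3] [E E2].
have xm : x \in chd par cur by rewrite mem_chd h1.
have ym : y \in chd par cur by rewrite mem_chd k1.
have xy : x = y by rewrite -(nth_index x xm) E nth_index.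
by subst y; congr cons; apply: IH E2.
Qed.

Lemma descend0 p : foldl (fun acc i => if acc == 0 then 0 else
           if i < size (unl acc.-1) then (fld (nth 0 (unl acc.-1) i) 4).+1 else 0) 0 p = 0.
Proof. by elim: p. Qed.

Lemma descend_adr j par cur s : nbw par cur s -> size s <= j ->
  descend (VV j par cur) (adr par cur s) = (VV (j - size s) (prv par cur s) (last cur s)).+1.
Proof.
rewrite /descend; elim: s j par cur => [|x s IH] j par cur /=; first by rewrite subn0.
move=> /and3P[h1 h2 h3]; case: j => // j hj.
have xm : x \in chd par cur by rewrite mem_chd h1.
rewrite /= encK size_map index_mem xm (nth_map x) ?index_mem // nth_index // fldE /= subSS; exact: IH.
Qed.

Lemma descend_ex j par cur p : descend (VV j par cur) p != 0 ->
  exists s, nbw par cur s /\ p = adr par cur s.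
Proof.
rewrite /descend; elim: p j par cur => [|i p IH] j par cur /=; first by exists [::].
case: j => [|j]; first by rewrite (encK [::] : unl (VV 0 par cur).+1.-1 = [::]) /= descend0.
rewrite /= encK size_map; case: ltnP; last by rewrite descend0.
case E : (chd par cur) => [|x0 c] //; rewrite -E => hi.
rewrite (nth_map x0) // fldE /= => /IH[s [h1 h2]].
have xm : nth x0 (chd par cur) i \in chd par cur by apply: mem_nth.
have U : uniq (chd par cur) by apply: filter_uniq; apply: adj_uniq.
exists (nth x0 (chd par cur) i :: s); split; last by rewrite /= index_uniq // h2.
by move: xm; rewrite mem_chd /= => /andP[-> ->].
Qed.

Lemma adr_lt par cur s : nbw par cur s -> forall i, i \in adr par cur s -> i < lDelta P.
Proof.
elim: s par cur => //= x s IH par cur /and3P[h1 h2 h3] i; rewrite inE => /orP[/eqP->|]; last exact: IH.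
apply: leq_trans (HD cur); apply: (@leq_trans (size (chd par cur))); last by rewrite size_filter count_size.
by rewrite index_mem mem_chd h1.
Qed.

Section At.
Variable v : V.
Variable wk : V -> seq V.
Hypothesis Hwk : forall w, nbw None v (wk w) /\ last v (wk w) = w.
Local Notation r := (lrad P).
Local Notation T := (VV r None v).
Local Notation ad w := (enc_list (adr None v (wk w))).

Lemma wk_uniq s : nbw None v s -> s = wk (last v s).
Proof. by move=> h; have [h1 h2] := Hwk (last v s); apply: (nbw_inj HS HA h h1). Qed.
Lemma ad_inj w w' : ad w = ad w' -> w = w'.
Proof.
have [h1 h2] := Hwk w; have [k1 k2] := Hwk w'.
by move=> /enc_list_inj /(adr_inj h1 k1) E; rewrite -h2 -k2 E.
Qed.

Lemma mem_adrs z : reflect (exists w, size (wk w) <= r /\ z = ad w) (z \in adrs m T).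
Proof.
rewrite mem_undup mem_filter; apply: (iffP andP) => [[/descend_ex[s [h1 h2]] /lists_leP[s' [h3 _ E]]]|[w [h ->]]].
  subst z; move: h2; rewrite encK => h2; subst s'; exists (last v s); rewrite -(wk_uniq h1); split=> //.
  by move: h3; rewrite /mR fldE /= size_adr.
have [h1 h2] := Hwk w; rewrite encK descend_adr //; split=> //.
apply/lists_leP; exists (adr None v (wk w)); split=> //; first by rewrite /mR fldE size_adr.
by move=> i /(adr_lt h1); rewrite mem_iota /mD fldE.
Qed.

Lemma ischild_adr s t : nbw None v s -> nbw None v t ->
  reflect (exists x, t = rcons s x) (ischild (adr None v s) (adr None v t)).
Proof.
move=> hs ht; rewrite /ischild; case/lastP: t ht => [|t x] ht.
  by rewrite /=; constructor => -[x /(congr1 size)]; rewrite size_rcons.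
have -> : adr None v (rcons t x) != [::] by rewrite -size_eq0 size_adr size_rcons.
rewrite adr_rcons size_rcons /= -[in take _ _]cats1 take_size_cat //=.
have ht' : nbw None v t by move: ht; rewrite nbw_rcons => /andP[].
apply: (iffP eqP) => [/(adr_inj ht' hs) ->|[y]]; first by exists x.
by move/(congr1 (fun z => take (size z).-1 z)); rewrite !size_rcons /= -!cats1 !take_size_cat // => ->.
Qed.

Lemma entry_adr s x : nbw None v (rcons s x) -> size s < r ->
  entry T (adr None v (rcons s x)) = enc_list [:: inp (last v s) x; out (last v s) x; inp x (last v s); out x (last v s);
    VV (r - (size s).+1) (Some (last v s)) x].
Proof.
rewrite nbw_rcons => /and3P[h1 h2 h3] hr.
have xm : x \in chd (prv None v s) (last v s) by rewrite mem_chd h2.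
rewrite /entry adr_rcons size_rcons /= nth_rcons ltnn eqxx -cats1 take_size_cat // descend_adr //; last exact: ltnW.
by rewrite -pred_Sn -(subnSK hr) /= encK (nth_map x) ?index_mem // nth_index.
Qed.

Lemma labpqE w w' : size (wk w) <= r -> size (wk w') <= r ->
  labpq T (adr None v (wk w)) (adr None v (wk w')) = olist (if adjb G w w' then Some (inp w w', out w w') else None).
Proof.
move=> hw hw'; have [h1 h2] := Hwk w; have [k1 k2] := Hwk w'; rewrite /labpq.
case: ischild_adr => // [[x E]|N1].
  have Ex : x = w' by rewrite -k2 E last_rcons.
  have A : adjb G w w' by rewrite /adjb -Ex; move: k1; rewrite E nbw_rcons h2 => /and3P[].
  by rewrite A E entry_adr -?E //; [rewrite !fldE /= h2 Ex|move: hw'; rewrite E size_rcons].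
case: ischild_adr => // [[x E]|N2].
  have Ex : x = w by rewrite -h2 E last_rcons.
  have A : adjb G w' w by rewrite /adjb -Ex; move: h1; rewrite E nbw_rcons k2 => /and3P[].
  rewrite /adjb (adj_sym HS A) E entry_adr -?E //; [by rewrite !fldE /= k2 Ex|by move: hw; rewrite E size_rcons].
case: ifP => // A; exfalso.
have [E|NE] := eqVneq (prv None v (wk w)) (Some w').
  case: N2; case/lastP: (wk w) E h1 h2 => // s x; rewrite prv_rcons last_rcons nbw_rcons => -[E] /and3P[h1 _ _] Ex.
  by exists x; rewrite (wk_uniq h1) E.
case: N1; exists w'; rewrite [rcons _ _]wk_uniq ?last_rcons // nbw_rcons h1 h2 eq_sym NE andbT; exact: A.
Qed.

Lemma withinP w : within (adjb G) r v w <-> size (wk w) <= r.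
Proof.
have mono q q' x : q <= q' -> within (adjb G) q v x -> within (adjb G) q' v x.
  move=> le W; elim: W q' le => [q0 y|q0 y z t W IH A] q' le; first exact: within0.
  by case: q' le => // q' le; apply: withinS (IH _ _) A.
have [h1 h2] := Hwk w; split=> [W|le]; last first.
  apply: (mono _ _ _ le); rewrite -{2}h2; elim/last_ind: (wk w) h1 {le h2} => [|s x IH]; first by move=> _; apply: within0.
  by rewrite nbw_rcons size_rcons last_rcons => /and3P[/IH h2 h3 _]; apply: withinS h2 h3.
suff [s [s1 s2 s3]] : exists s, [/\ nbw None v s, last v s = w & size s <= r] by rewrite -s2 -wk_uniq.
elim: W => [q x|q x y z W [s [s1 s2 s3]] A]; first by exists [::].
have [E|NE] := eqVneq (prv None x s) (Some z).
  case/lastP: s E s1 s2 s3 => // s u; rewrite prv_rcons last_rcons nbw_rcons size_rcons => -[E] /and3P[s1 _ _] _ s3.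
  by exists s; split=> //; lia.
exists (rcons s z); rewrite last_rcons nbw_rcons size_rcons s1 s2 eq_sym NE; split=> //; by rewrite andbT.
Qed.
End At.

Lemma walks v : exists wk : V -> seq V, forall w, nbw None v (wk w) /\ last v (wk w) = w.
Proof.
have /fin_all_exists[wk Hwk] : forall w : V, exists s, nbw None v s /\ last v s = w.
  move=> w; have /connectP[p hp ->] := HC v w.
  by case/shortenP: hp => q hq Uq _; exists q; split=> //; apply: uniq_nbw.
by exists wk.
Qed.

(** A node of the ball corresponds to the address of the unique walk from [v] to it. This turns the
    list [g] of [matchH] into an isomorphism of the ball and back. *)
Lemma match_iff v H : matchH m (VV (lrad P) None v) (enc_cgraph H) <-> ball_iso P G inp out v H.
Proof.
have [wk Hwk] := walks v.
have [ca cb] : fld (enc_cgraph H) 0 = csize H /\ fld (enc_cgraph H) 2 = ccenter H by rewrite /enc_cgraph !fldE.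
set T := VV _ _ _; set A := adrs m T.
have UA : uniq A by apply: undup_uniq.
pose ad w := enc_list (adr None v (wk w)).
have memA z : z \in A -> exists w, size (wk w) <= lrad P /\ z = ad w by move/(mem_adrs Hwk).
have inA w : size (wk w) <= lrad P -> ad w \in A by move=> h; apply/(mem_adrs Hwk); exists w.
have wkv : wk v = [::] by have := wk_uniq Hwk (isT : nbw None v [::]).
have adv : ad v = 0 by rewrite /ad wkv.
rewrite /matchH ca cb -/A; split.
  move=> /andP[/eqP sA /hasP[gz /listsnP[g [sg subg ->]]]]; rewrite encK => /and3P[Ug /eqP g0 /allP gl].
  pose f w := nth 0 g (index (ad w) A); exists f.
  have ix w : within (adjb G) (lrad P) v w -> index (ad w) A < size g.
    by move=> /(withinP Hwk) h; rewrite sg -sA index_mem inA.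
  split=> [|w w' hw hw' E|w hw|j hj|w w' hw hw'].
  - by rewrite /f adv.
  - have /eqP : f w == f w' by apply/eqP.
    rewrite /f => /eqP; rewrite nth_uniq ?ix // => /eqP E2.
    apply: (ad_inj Hwk); apply: etrans (_ : nth 0 A (index (ad w) A) = _).
      by rewrite nth_index // inA //; apply/(withinP Hwk).
    by rewrite E2 nth_index // inA //; apply/(withinP Hwk).
  - by have := subg _ (mem_nth 0 (ix w hw)); rewrite mem_iota.
  - have jg : j \in g.
      have [|_ ->] := uniq_min_size Ug subg; first by rewrite size_iota sg.
      by rewrite mem_iota.
    have /memA[w [h1 h2]] : nth 0 A (index j g) \in A by rewrite mem_nth // sA -sg index_mem.
    exists w; first exact/(withinP Hwk).
    by rewrite /f -h2 index_uniq ?nth_index // sA -sg index_mem.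
  - apply: olist_inj; rewrite -hlE.
    have h1 := ix w hw; have h2 := ix w' hw'; rewrite sg in h1 h2.
    have /allP/(_ (index (ad w') A)) := gl (index (ad w) A) ltac:(by rewrite mem_iota).
    rewrite mem_iota h2 => /(_ isT)/eqP ->.
    have [k1 k2] : size (wk w) <= lrad P /\ size (wk w') <= lrad P by split; apply/(withinP Hwk).
    by rewrite !nth_index ?inA // !encK (labpqE Hwk).
move=> [f [fv fi fl fs fh]].
pose nd z := odflt v [pick w | ad w == z].
have ndE w : nd (ad w) = w.
  by rewrite /nd; case: pickP => [w' /eqP /(ad_inj Hwk)|/(_ w)/eqP].
have inB z : z \in A -> within (adjb G) (lrad P) v (nd z) /\ ad (nd z) = z.
  by move=> /memA[w [h ->]]; rewrite ndE; split=> //; apply/(withinP Hwk).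
pose g := [seq f (nd z) | z <- A].
have Ug : uniq g.
  rewrite map_inj_in_uniq // => z z' /inB[h1 h2] /inB[k1 k2] /(fi _ _ h1 k1) E; by rewrite -h2 -k2 E.
have gi : g =i iota 0 (csize H).
  move=> j; rewrite mem_iota /=; apply/mapP/idP => [[z /inB[h1 h2] ->]|hj]; first exact: fl.
  have [w hw <-] := fs j hj; exists (ad w); rewrite ?ndE // inA //; exact/(withinP Hwk).
have sg : size A = csize H.
  by have /perm_size := uniq_perm Ug (iota_uniq 0 (csize H)) gi; rewrite size_map size_iota.
rewrite sg eqxx /=; apply/hasP; exists (enc_list g).
  apply/listsnP; exists g; split=> //; first by rewrite size_map.
  by move=> y; rewrite gi.
rewrite encK Ug /=; apply/andP; split.
  have A0 : 0 \in A by rewrite -adv inA // wkv.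
  rewrite indexnE (nth_map 0) ?index_mem // nth_index // -adv ndE fv //.
apply/allP => i; rewrite mem_iota => /= hi; apply/allP => j; rewrite mem_iota /= => hj.
rewrite !(nth_map 0) ?sg // hlE.
have [h1 h2] := inB _ (mem_nth 0 (leq_trans hi (eq_leq (esym sg)))).
have [k1 k2] := inB _ (mem_nth 0 (leq_trans hj (eq_leq (esym sg)))).
have Ez z : ad (nd z) = z -> unl z = adr None v (wk (nd z)) by move=> {1}<-; rewrite /ad encK.
rewrite fh // (Ez _ h2) (Ez _ k2) (labpqE Hwk) //; exact/(withinP Hwk).
Qed.
End NF.

Lemma hasInP T (p : pred T) s : has p s <-> exists2 x, List.In x s & p x.
Proof.
elim: s => [|a s IH] /=; first by split=> // -[].
split=> [/orP[h|/IH[x h1 h2]]|[x [<-|h1] h2]].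
- by exists a => //; left.
- by exists x => //; right.
- by rewrite h2.
- by apply/orP; right; apply/IH; exists x.
Qed.

Section NF.
Variables (P : LCL) (G : graph) (inp out : labeling G).
Local Notation V := 'I_(gN G).
Local Notation nb := (gadj G).
Local Notation m := (enc_lcl P).
Local Notation r := (lrad P).
Hypothesis HT : is_tree G.
Hypothesis HD : max_deg_le G (lDelta P).
Hypothesis Hin : forall u v, adjb G u v -> inp u v < lnin P.
Let HS : simple_graph G. Proof. by case: HT. Qed.
Local Notation VV := (@VV G inp out).

Lemma rose_spec (x : labeling G) v skip par j :
  (forall w, w \in nb v -> [/\ fld (x v w) 0 = inp v w, fld (x v w) 1 = out v w, fld (x v w) 2 = inp w v, fld (x v w) 3 = out w v &
     nth 0 (unl (fld (x v w) 4)) j = VV j (Some v) w]) ->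
  (forall k, k < size (nb v) -> (k != skip) = (Some (nth v (nb v) k) != par)) ->
  rose [seq x v w | w <- nb v] j skip = VV j.+1 par v.
Proof.
move=> H Hk; rewrite /rose /=; congr enc_list; rewrite size_map.
have E : nb v = [seq nth v (nb v) k | k <- iota 0 (size (nb v))] by rewrite map_nth_iota0 // take_size.
have -> : chd par v = [seq nth v (nb v) k | k <- iota 0 (size (nb v)) & k != skip].
  rewrite /chd {1}E filter_map; congr map; apply: eq_in_filter => k; rewrite mem_iota => hk /=; by rewrite Hk.
rewrite -map_comp; apply/eq_in_map => k; rewrite mem_filter mem_iota => /andP[_ /= hk].
by rewrite /ent (nth_map v) //; have [-> -> -> -> ->] := H _ (mem_nth v hk).
Qed.

Lemma skip_idx v w k : w \in nb v -> k < size (nb v) -> (k != index w (nb v)) = (Some (nth v (nb v) k) != Some w).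
Proof.
move=> h hk; rewrite (inj_eq (@Some_inj _)); congr negb; rewrite -{2}(nth_index v h) nth_uniq ?index_mem //.
exact: adj_uniq.
Qed.
Lemma skip_none (v : V) k : k < size (nb v) -> (k != size (nb v)) = (Some (nth v (nb v) k) != None).
Proof. by move=> h; rewrite neq_ltn h. Qed.

Definition xlab v w := enc_list [:: inp v w; out v w; inp w v; out w v;
  enc_list [seq VV j (Some v) w | j <- iota 0 r]; enc_list [seq VV j (Some w) v | j <- iota 0 r]].

Lemma flip_xlab v w : flip (xlab v w) = xlab w v.
Proof. by rewrite /flip /xlab !fldE. Qed.

Section A1.
Hypothesis Hout : forall u v, adjb G u v -> out u v < lnout P.

Lemma VV_roses j par cur : j <= r -> VV j par cur \in roses m.
Proof.
rewrite /roses /mR /mD /mIn /mOut !fldE /=; elim: r j par cur => [|q IH] j par cur; first by rewrite leqn0 => /eqP->; rewrite inE.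
rewrite leq_eqVlt ltnS => /orP[/eqP->|h]; last by rewrite iterS mem_cat IH.
rewrite iterS mem_cat; apply/orP; right; apply/lists_leP; eexists; split; last reflexivity.
  rewrite size_map; apply: leq_trans (HD cur); by rewrite size_filter count_size.
move=> y /mapP[x]; rewrite mem_chd => /andP[A _] ->; apply/listsnP; eexists; split; [|move=> z|reflexivity] => //.
have A' := adj_sym HS A; have h1 := Hin A; have h2 := Hin A'; have h3 := Hout A; have h4 := Hout A'.
rewrite !inE mem_cat mem_iota add0n.
by case/orP => [/eqP->|/or4P[] /eqP->]; apply/orP; (left; lia) || (right; apply: (IH q)).
Qed.

Lemma xlab_nfL v w : w \in nb v -> xlab v w \in nfL m.
Proof.
move=> A; have A' := adj_sym HS A; have h1 := Hin A; have h2 := Hin A'; have h3 := Hout A; have h4 := Hout A'.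
rewrite mem_filter; apply/andP; split.
  by rewrite /xlab /mIn /mOut !fldE /= h1 h2 h3 h4.
have S par u q : enc_list [seq VV j par u | j <- iota 0 r] \in iota 0 q ++ lists_le (mR m) (roses m).
  rewrite mem_cat; apply/orP; right; apply/lists_leP; eexists; split; last reflexivity.
    by rewrite size_map size_iota /mR fldE.
  by move=> z /mapP[j]; rewrite mem_iota => /= hj ->; apply: VV_roses; apply: ltnW.
apply/listsnP; eexists; split; [|move=> z|reflexivity] => //.
rewrite !in_cons in_nil orbF; do 4![case/orP => [/eqP->|]; first by rewrite mem_cat mem_iota /mIn /mOut !fldE /= add0n; apply/orP; left; lia].
by case/orP => /eqP->; apply: S.
Qed.

Lemma xlab_fields v w j : j < r -> [/\ fld (xlab v w) 0 = inp v w, fld (xlab v w) 1 = out v w, fld (xlab v w) 2 = inp w v, fld (xlab v w) 3 = out w v &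
     nth 0 (unl (fld (xlab v w) 4)) j = VV j (Some v) w].
Proof. by move=> h; rewrite !fldE /= encK (nth_map 0) ?size_iota // nth_iota. Qed.

Lemma vspec_xlab v i par j : j <= r -> (forall k, k < size (nb v) -> (k != i) = (Some (nth v (nb v) k) != par)) ->
  vspec [seq xlab v w | w <- nb v] i j = VV j par v.
Proof.
case: j => [//|j] h K; rewrite /vspec; apply: rose_spec => // w _; exact: xlab_fields.
Qed.

(* The normal form at a node only looks at the ball of that node. *)
Lemma nfN_xlab v : (exists2 H, List.In H (lC P) & ball_iso P G inp out v H) ->
  nfN m (inputs_of G inp v) [seq xlab v w | w <- nb v].
Proof.
move=> [H H1 H2]; rewrite /nfN !size_map eqxx; apply/and4P; split=> //.
- apply/allP => k; rewrite mem_iota => /= hk; by rewrite !(nth_map v) // fldE.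
- apply/allP => i; rewrite mem_iota => /= hi; rewrite (nth_map v) // fldE /=; apply/eqP; congr enc_list.
  rewrite /mR fldE [nth _ _ 3]/=; apply/eq_in_map => j; rewrite mem_iota /= => hj; rewrite (@vspec_xlab _ _ (Some (nth v (nb v) i))) //; first exact: ltnW.
  move=> k hk; rewrite -(skip_idx _ hk) ?mem_nth // index_uniq //; exact: adj_uniq.
- rewrite (@vspec_xlab _ _ None) /mR ?fldE //=; last by move=> k; apply: skip_none.
  rewrite /mC !fldE /= encK has_map; apply/hasInP; exists H => //=.
  exact/(match_iff inp out HT HD).
Qed.
End A1.

Theorem nfsol_of_valid : valid_output P G inp out -> nfsol m inp xlab.
Proof.
move=> [h1 h2]; split=> [u w A|v]; last exact: nfN_xlab.
by rewrite flip_xlab; split=> //; apply: xlab_nfL.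
Qed.
End NF.

(** The second field is the output. The other fields need not be trusted: the constraints at the
    nodes and the flips along the edges make them equal to the true inputs, outputs and views. *)
Theorem valid_of_nfsol P G (inp x : labeling G) : is_tree G -> max_deg_le G (lDelta P) -> nfsol (enc_lcl P) inp x ->
  valid_output P G inp (fun v w => fld (x v w) 1).
Proof.
move=> HT HD [h1 h2]; set out : labeling G := fun v w => _; set m := enc_lcl P in h1 h2 *.
have HS : simple_graph G by case: HT.
have N v : [/\ size [seq x v w | w <- gadj G v] = size (gadj G v),
   forall w, w \in gadj G v -> fld (x v w) 0 = inp v w,
   forall w, w \in gadj G v -> fld (x v w) 5 = enc_list [seq vspec [seq x v w | w <- gadj G v] (index w (gadj G v)) j | j <- iota 0 (lrad P)] &
   has (matchH m (vspec [seq x v w | w <- gadj G v] (size (gadj G v)) (lrad P))) (mC m)].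
  have := h2 v; rewrite /nfN !size_map => /and4P[_ /allP k1 /allP k2 k3]; split=> //; [move=> w hw|move=> w hw|].
  - have := k1 (index w (gadj G v)); rewrite mem_iota index_mem hw => /(_ isT).
    by rewrite !(nth_map v) ?index_mem // nth_index // => /eqP.
  - have := k2 (index w (gadj G v)); rewrite mem_iota index_mem hw => /(_ isT).
    by rewrite !(nth_map v) ?index_mem // nth_index // => /eqP; rewrite {1}/mR fldE.
  - by move: k3; rewrite /mR fldE.
have F v w : w \in gadj G v -> [/\ fld (x v w) 0 = inp v w, fld (x v w) 1 = out v w, fld (x v w) 2 = inp w v, fld (x v w) 3 = out w v &
   fld (x v w) 4 = enc_list [seq vspec [seq x w u | u <- gadj G w] (index v (gadj G w)) j | j <- iota 0 (lrad P)]].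
  move=> A; have A' := adj_sym HS A; have [_ E] := h1 v w A.
  have [_ a1 _ _] := N v; have [_ b1 b2 _] := N w.
  have G1 : fld (x v w) 2 = fld (x w v) 0 by rewrite E /flip fldE.
  have G2 : fld (x v w) 3 = fld (x w v) 1 by rewrite E /flip fldE.
  have G3 : fld (x v w) 4 = fld (x w v) 5 by rewrite E /flip fldE.
  by rewrite a1 // G1 G2 G3 b1 // b2.
(* The views written by the labelling are the true ones, by induction on the depth. *)
have VS j : forall v i par, j <= lrad P -> (forall k, k < size (gadj G v) -> (k != i) = (Some (nth v (gadj G v) k) != par)) ->
   vspec [seq x v w | w <- gadj G v] i j = VV inp out j par v.
  elim: j => [//|j IH] v i par hj K; rewrite /vspec; apply: rose_spec => // w A.
  have [-> -> -> -> ->] := F v w A; split=> //; rewrite encK (nth_map 0) ?size_iota // nth_iota // add0n.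
  apply: IH; first exact: ltnW.
  by move=> k; apply: skip_idx => //; apply: adj_sym.
split=> [u v A|v].
  have [+ _] := h1 u v A; rewrite mem_filter => /andP[/and4P[_ + _ _] _].
  by rewrite /mOut fldE.
have [_ _ _] := N v; rewrite (VS _ _ _ None) //; last by move=> k; apply: skip_none.
rewrite /mC /m !fldE /= encK has_map => /hasInP[H h3 h4]; exists H => //.
exact/(match_iff inp out HT HD).
Qed.

(** * Gluing trees at a leaf *)

(** On a cycle, a node of maximal depth would have two different neighbours above it. *)
Lemma acyclic_depth (G : graph) (dp : 'I_(gN G) -> nat) : simple_graph G ->
  (forall u w, w \in gadj G u -> dp u = (dp w).+1 \/ dp w = (dp u).+1) ->
  (forall u w w', w \in gadj G u -> w' \in gadj G u -> dp u = (dp w).+1 -> dp u = (dp w').+1 -> w = w') ->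
  acyclic G.
Proof.
move=> HS H1 H2 [c [U sc cy]].
have [v vc vm] : exists2 v, v \in c & forall w, w \in c -> dp w <= dp v.
  have c0 : exists x, x \in c by case: c sc {U cy} => // a s _; exists a; rewrite mem_head.
  case: (@arg_maxnP _ (xchoose c0) (mem c) dp); first exact: (xchooseP c0).
  by move=> v vc vm; exists v => // w /vm.
move: U sc cy vm; case/splitPr: vc => s1 s2 U sc cy vm.
have cy' : cycle (adjb G) (v :: s2 ++ s1) by rewrite -cat_cons -(rot_size_cat s1) rot_cycle.
have U' : uniq (v :: s2 ++ s1) by rewrite -cat_cons -(rot_size_cat s1) rot_uniq.
have sc' : 2 <= size (s2 ++ s1) by move: sc; rewrite !size_cat /=; lia.
have vm' w : w \in s2 ++ s1 -> dp w <= dp v by move=> h; apply: vm; move: h; rewrite !mem_cat inE => /orP[]->; rewrite ?orbT.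
move: (s2 ++ s1) cy' U' sc' vm' => t {s1 s2 U sc cy vm}.
case: t => [|a [|b t]] //; rewrite [cycle _ _]/= rcons_path => /and4P[h1 h2 h3 h4] /andP[h5 h6] _ vm.
set z := last b t in h4.
have zv : z \in gadj G v by have [_ _] := HS z; apply.
have zt : z \in [:: a, b & t] by rewrite inE /z mem_last orbT.
have low x : x \in gadj G v -> x \in [:: a, b & t] -> dp v = (dp x).+1.
  by move=> xv xt; case: (H1 _ _ xv) => // E; have := vm _ xt; rewrite E ltnn.
have := H2 _ _ _ h1 zv (low _ h1 (mem_head _ _)) (low _ zv zt) => E.
by case/andP: h6; rewrite E /z mem_last.
Qed.

Lemma tree_depth (G : graph) (r0 : 'I_(gN G)) : is_tree G -> exists dp : 'I_(gN G) -> nat,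
  [/\ dp r0 = 0, (forall u w, w \in gadj G u -> dp u = (dp w).+1 \/ dp w = (dp u).+1) &
  (forall u w w', w \in gadj G u -> w' \in gadj G u -> dp u = (dp w).+1 -> dp u = (dp w').+1 -> w = w')].
Proof.
move=> [_ HS HC HA].
have /fin_all_exists[wk Hwk] : forall v, exists s, nbw None r0 s /\ last r0 s = v.
  move=> v; have /connectP[p hp ->] := HC r0 v.
  by case/shortenP: hp => q hq Uq _; exists q; split=> //; apply: uniq_nbw.
have U s : nbw None r0 s -> s = wk (last r0 s).
  by move=> h; have [h1 h2] := Hwk (last r0 s); apply: (nbw_inj HS HA h h1).
have K u w : w \in gadj G u -> wk u = rcons (wk w) u \/ wk w = rcons (wk u) w.
  move=> A; have [h1 h2] := Hwk u; have [k1 k2] := Hwk w.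
  have [E|NE] := eqVneq (prv None r0 (wk u)) (Some w).
    left; case/lastP: (wk u) E h1 h2 => // s x; rewrite prv_rcons last_rcons nbw_rcons => -[E] /and3P[h1 _ _] ->.
    by rewrite (U s h1) E.
  by right; rewrite [RHS]U ?last_rcons // nbw_rcons h1 h2 A eq_sym.
exists (fun v => size (wk v)); split.
- by rewrite -(U [::]).
- by move=> u w /K[] ->; rewrite size_rcons; [left|right].
- move=> u w w' A A'; have lw x : last r0 (wk x) = x by case: (Hwk x).
  case: (K _ _ A) => [E1|->]; last by rewrite size_rcons; lia.
  case: (K _ _ A') => [E2 _ _|->]; last by rewrite size_rcons; lia.
  by move: E2; rewrite E1 => /(congr1 (fun s => last r0 (belast r0 s))); rewrite !belast_rcons /= !lw.
Qed.

(* A piece is a tree with a distinguished leaf [pw], which stands for the rest of the world;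
   its only neighbour is [pu]. *)
Record piece := Piece { pG : graph; pI : labeling pG; pw : 'I_(gN pG); pu : 'I_(gN pG) }.
Arguments pI : clear implicits.
Arguments pw : clear implicits.
Arguments pu : clear implicits.
Definition okp (D nin : nat) (K : piece) : Prop :=
  [/\ is_tree (pG K), max_deg_le (pG K) D, (forall a b, b \in gadj (pG K) a -> pI K a b < nin) & gadj (pG K) (pw K) = [:: pu K]].

Section Wedge.
Variables (D nin d : nat) (K : 'I_d -> piece) (ins : seq nat).
Hypothesis HK : forall k, okp D nin (K k).
Hypothesis Hi : size ins = d.
Hypothesis Hd : d <= D.
Hypothesis Hn : forall i, i \in ins -> i < nin.
Local Notation V k := 'I_(gN (pG (K k))).
Local Notation adk k := (gadj (pG (K k))).
Local Notation w k := (pw (K k)).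
Local Notation u k := (pu (K k)).

Lemma uw k : u k != w k.
Proof.
case: (HK k) => -[_ HS _ _] _ _ E; have [_ + _] := HS (w k).
by rewrite E inE eq_sym.
Qed.
Lemma wu k : w k \in adk k (u k).
Proof. by case: (HK k) => -[_ HS _ _] _ _ E; apply: (adj_sym HS); rewrite E inE. Qed.

(** The tree properties are derived from abstract embeddings [io], so that the dependent types of
    the construction stay confined to [wedge_ex]. *)
Section Abs.
Variables (W : graph) (wI : labeling W) (c : 'I_(gN W)) (io : forall k, V k -> 'I_(gN W)).
Hypothesis Hc : gadj W c = [seq @io k (u k) | k <- enum 'I_d].
Hypothesis Hio : forall k, injective (@io k).
Hypothesis Hiw : forall k, @io k (w k) = c.
Hypothesis Had : forall k a, a != w k -> gadj W (@io k a) = [seq @io k b | b <- adk k a].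
Hypothesis Hdis : forall k l a b, @io k a = @io l b -> k != l -> a = w k.
Hypothesis Hex : forall z, z = c \/ exists k a, a != w k /\ z = @io k a.

Lemma wedge_hom k a b : b \in adk k a -> @io k b \in gadj W (@io k a).
Proof.
have [->|ne] := eqVneq a (w k); last by move=> h; rewrite Had //; apply: map_f.
case: (HK k) => _ _ _ ->; rewrite inE Hiw Hc => /eqP->; apply/mapP; exists k => //; by rewrite mem_enum.
Qed.

Lemma io_c k a : a != w k -> @io k a != c.
Proof. by apply: contraNneq => E; apply/eqP; apply: (@Hio k); rewrite Hiw. Qed.

(** Depths measured in each piece from its leaf [pw] agree at the center and together form a depth
    function on [W]. *)
Lemma wedge_tree : is_tree W.
Proof.
have HSk k : simple_graph (pG (K k)) by case: (HK k) => -[].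
have HS : simple_graph W.
  move=> z; case: (Hex z) => [->|[k [a [aw ->]]]].
    split.
    - rewrite Hc map_inj_uniq ?enum_uniq // => k l E; apply/eqP/negPn/negP => kl.
      by have := Hdis E kl; apply/eqP; exact: uw.
    - by rewrite Hc; apply/mapP => -[k _ E]; have := io_c (uw k); rewrite -E eqxx.
    - move=> v; rewrite Hc => /mapP[k _ ->]; rewrite Had ?uw // -(Hiw k); apply: map_f; exact: wu.
  split.
  - by rewrite Had // (map_inj_uniq (@Hio k)); exact: adj_uniq.
  - by rewrite Had // (mem_map (@Hio k)); exact: adj_irr.
  - by move=> v; rewrite Had // => /mapP[b hb ->]; apply: wedge_hom; apply: adj_sym.
have sym : connect_sym (adjb W).
  by apply: sym_connect_sym => x y; apply/idP/idP; apply: (adj_sym HS).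
have toc z : connect (adjb W) c z.
  case: (Hex z) => [->|[k [a [_ ->]]]]; first exact: connect0.
  have [_ _ HC _] : is_tree (pG (K k)) by case: (HK k).
  have /connectP[p hp ->] := HC (w k) a; rewrite -(Hiw k).
  elim: p (w k) hp => [|b p IH] x /=; first by rewrite connect0.
  move=> /andP[h /IH]; apply: connect_trans; apply: connect1; exact: wedge_hom.
split=> //; first by apply: leq_ltn_trans (ltn_ord c).
  by move=> x y; apply: connect_trans (toc y); rewrite sym.
have /fin_all_exists[dk Hdk] : forall k, exists dp : V k -> nat, 
  [/\ dp (w k) = 0, (forall a b, b \in adk k a -> dp a = (dp b).+1 \/ dp b = (dp a).+1) &
  (forall a b b', b \in adk k a -> b' \in adk k a -> dp a = (dp b).+1 -> dp a = (dp b').+1 -> b = b')].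
  by move=> k; apply: tree_depth; case: (HK k).
have /fin_all_exists[dp Hdp] : forall z, exists n : nat, forall k a, z = @io k a -> n = dk k a.
  move=> z; case: (Hex z) => [->|[k [a [aw ->]]]].
    exists 0 => k a; rewrite -(Hiw k) => /Hio <-; by have [-> _ _] := Hdk k.
  exists (dk k a) => l b E; have [kl|kl] := eqVneq k l; first by subst l; rewrite (Hio E).
  by have := Hdis E kl => E2; rewrite E2 eqxx in aw.
have dE k a : dp (@io k a) = dk k a by apply: Hdp.
apply: (@acyclic_depth _ dp) => // z.
  move=> y; case: (Hex z) => [->|[k [a [aw ->]]]].
    rewrite Hc => /mapP[k _ ->]; rewrite -(Hiw k) !dE; have [_ h _] := Hdk k; apply: h.
    by case: (HK k) => _ _ _ ->; rewrite inE.
  by rewrite Had // => /mapP[b hb ->]; rewrite !dE; have [_ h _] := Hdk k; apply: h.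
move=> y y'; case: (Hex z) => [->|[k [a [aw ->]]]].
  by rewrite Hc => /mapP[k _ ->] _; rewrite -{1}(Hiw k) !dE; have [-> _ _] := Hdk k.
rewrite Had // => /mapP[b hb ->] /mapP[b' hb' ->]; rewrite !dE => E E'; congr io.
by have [_ _ h] := Hdk k; apply: (h a).
Qed.

Lemma wedge_deg : max_deg_le W D.
Proof.
move=> z; case: (Hex z) => [->|[k [a [aw ->]]]]; first by rewrite Hc size_map size_enum_ord.
by rewrite Had // size_map; case: (HK k) => _ + _ _; apply.
Qed.
End Abs.

(** The nodes are the center [None] and all nodes of the pieces except the leaves [pw], which
    collapse into the center. *)
Local Notation TT := {k : 'I_d & V k}.
Local Notation PP := (fun p : TT => tagged p != w (tag p)).
Local Notation NN := (option {p : TT | PP p}).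
Let io0 k (a : V k) : NN := insub (Tagged (fun k => V k) a).
Let pr0 k (t : NN) : V k := if t is Some q then tagged_as (Tagged (fun k => V k) (w k)) (val q) else w k.
Let ad0 (t : NN) : seq NN := if t is Some q then [seq io0 b | b <- adk (tag (val q)) (tagged (val q))]
  else [seq io0 (u k) | k <- enum 'I_d].
Let in0 (t t' : NN) : nat := if t is Some q then pI (K (tag (val q))) (tagged (val q)) (pr0 (tag (val q)) t')
  else if t' is Some q then nth 0 ins (tag (val q)) else 0.

Lemma io0w k : io0 (w k) = None.
Proof. by rewrite /io0 insubF //= eqxx. Qed.
Lemma io0n k (a : V k) : a != w k -> exists q, io0 a = Some q /\ val q = Tagged (fun k => V k) a.
Proof. by move=> h; rewrite /io0; case: insubP => [q _ E|]; [exists q|rewrite /= h]. Qed.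
Lemma io0K k (a : V k) : pr0 k (io0 a) = a.
Proof.
have [->|h] := eqVneq a (w k); first by rewrite io0w.
by have [q [-> E]] := io0n h; rewrite /pr0 E tagged_asE.
Qed.

Theorem wedge_ex : exists (W : graph) (wI : labeling W) (c : 'I_(gN W)) (io : forall k, V k -> 'I_(gN W)),
  [/\ is_tree W, max_deg_le W D, (forall a b, b \in gadj W a -> wI a b < nin) & gN W <= (\sum_k gN (pG (K k))).+1] /\
  [/\ gadj W c = [seq io k (u k) | k <- enum 'I_d], inputs_of W wI c = ins, (forall k, io k (w k) = c),
     (forall k l a b, io k a = io l b -> k != l -> a = w k) &
     forall z, z = c \/ exists k a, a != w k /\ z = io k a] /\
  forall k, [/\ injective (io k), (forall a, a != w k -> gadj W (io k a) = [seq io k b | b <- adk k a]) &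
     forall a b, a != w k -> b \in adk k a -> wI (io k a) (io k b) = pI (K k) a b].
Proof.
pose W := @Graph #|{: NN}| (fun v => [seq enum_rank t | t <- ad0 (enum_val v)]).
pose wI : labeling W := fun v v' => in0 (enum_val v) (enum_val v').
pose c : 'I_(gN W) := enum_rank (None : NN).
pose io k (a : V k) : 'I_(gN W) := enum_rank (io0 a).
have Hc : gadj W c = [seq io k (u k) | k <- enum 'I_d] by rewrite /= enum_rankK /= -map_comp.
have Hio k : injective (io k) by move=> a b /enum_rank_inj E; rewrite -(io0K a) E io0K.
have Hiw k : io k (w k) = c by rewrite /io io0w.
have Had k a : a != w k -> gadj W (io k a) = [seq io k b | b <- adk k a].
  move=> h; rewrite /= enum_rankK; have [q [-> E]] := io0n h.
  by rewrite /= -map_comp E.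
have Hdis k l a b : io k a = io l b -> k != l -> a = w k.
  move=> /enum_rank_inj E kl; apply/eqP/negPn/negP => h; have [q [E1 E2]] := io0n h.
  have [h'|h'] := eqVneq b (w l); first by move: E; rewrite h' io0w E1.
  have [q' [E1' E2']] := io0n h'; move: E; rewrite E1 E1' => -[E3].
  by move: kl; have := congr1 (@tag _ _) E2; rewrite E3 E2' /= => ->; rewrite eqxx.
have Hex z : z = c \/ exists k a, a != w k /\ z = io k a.
  rewrite -(enum_valK z); case: (enum_val z) => [q|]; last by left.
  right; exists (tag (val q)), (tagged (val q)); have hq := valP q; split=> //.
  have [q' [E1 E2]] := io0n hq; rewrite /io E1; congr enum_rank; congr Some; apply: val_inj; rewrite E2.
  by case: (val q).
have cin k : wI c (io k (u k)) = nth 0 ins k.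
  rewrite /wI !enum_rankK; have [q [-> E]] := io0n (uw k); by rewrite /= E.
have Hin : inputs_of W wI c = ins.
  rewrite /inputs_of Hc -map_comp; apply: (@eq_from_nth _ 0); first by rewrite size_map size_enum_ord.
  move=> i; rewrite size_map size_enum_ord => hi.
  by rewrite (nth_map (Ordinal hi)) ?size_enum_ord //= cin nth_enum_ord.
have HI k a b : a != w k -> b \in adk k a -> wI (io k a) (io k b) = pI (K k) a b.
  by move=> h _; rewrite /wI !enum_rankK; have [q [-> E]] := io0n h; rewrite /in0 E /= io0K.
exists W, wI, c, io; split; [split|split; split] => //.
- exact: (wedge_tree Hc Hio Hiw Had Hdis Hex).
- exact: (wedge_deg Hc Had Hex).
- move=> z y; case: (Hex z) => [->|[k [a [aw ->]]]].
    by rewrite Hc => /mapP[k _ ->]; rewrite cin; apply: Hn; rewrite mem_nth // Hi.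
  by rewrite Had // => /mapP[b hb ->]; rewrite HI //; case: (HK k) => _ _ + _; apply.
- rewrite /= card_option ltnS card_sub; apply: leq_trans (max_card _) _.
  rewrite card_tagged sumnE big_map big_enum /=; apply: leq_sum => k _; by rewrite card_ord.
- exact: Had.
- exact: HI.
Qed.
End Wedge.

Section K2.
(** A single edge is glued at a port that is to stay open: its node [pu] becomes the leaf of the new
    piece. *)
Definition k2G : graph := @Graph 2 (fun v => [:: rev_ord v]).
Definition k2 : piece := @Piece k2G (fun _ _ => 0) (ord0 : 'I_2) (ord_max : 'I_2).
Lemma k2_ok D nin : 0 < D -> 0 < nin -> okp D nin k2.
Proof.
move=> hD hn; split=> //=; last by congr cons; apply: val_inj.
split=> //=.
- move=> v /=; split=> //; first by rewrite inE; case: v => [[|[|]]].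
  by move=> v'; rewrite !inE => /eqP->; rewrite rev_ordK.
- move=> x y; have [->|ne] := eqVneq x y; first exact: connect0.
  apply: connect1; rewrite /adjb /= inE; apply/eqP; apply: val_inj => /=.
  by move: ne; rewrite -val_eqE /=; case: x y => [[|[|]]] // ? [[|[|]]].
- by move=> [s [U + _]]; rewrite -(card_uniqP U) ltnNge => /negP; apply; apply: leq_trans (max_card _) _; rewrite card_ord.
Qed.
End K2.

(** * Locality and independence *)

(** [bad] marks the nodes at which [psi] may change the neighbourhood. In a gluing this is the leaf
    [pw]; elsewhere even the order of the ports is preserved. *)
Section Emb.
Variables (G G' : graph) (inp : labeling G) (inp' : labeling G').
Local Notation V := 'I_(gN G).
Local Notation V' := 'I_(gN G').
Variables (psi : V -> V') (bad : pred V).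
Hypothesis HS : simple_graph G.
Hypothesis Hinj : injective psi.
Hypothesis Hadj : forall a, ~~ bad a -> gadj G' (psi a) = [seq psi b | b <- gadj G a].
Hypothesis Hinp : forall a b, ~~ bad a -> b \in gadj G a -> inp' (psi a) (psi b) = inp a b.

Lemma bl_emb j a : (forall b, b \in bl j a -> ~~ bad b) -> bl j (psi a) = [seq psi b | b <- bl j a].
Proof.
elim: j a => [//|j IH] a H /=; have ga : ~~ bad a by apply: H; rewrite bl_refl.
rewrite Hadj // map_flatten -!map_comp; congr cons; congr flatten; apply/eq_in_map => b hb /=; apply: IH => y hy.
by apply: H; rewrite /= inE; apply/orP; right; apply/flattenP; exists (bl j b); rewrite ?map_f.
Qed.

Lemma inputs_emb a : ~~ bad a -> inputs_of G' inp' (psi a) = inputs_of G inp a.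
Proof. by move=> h; rewrite /inputs_of Hadj // -map_comp; apply/eq_in_map => b hb /=; rewrite Hinp. Qed.

Lemma nb_bl j a b y : b \in gadj G a -> y \in bl j b -> y \in bl j.+1 a.
Proof.
by move=> hb hy; rewrite /= inE; apply/orP; right; apply/flattenP; exists (bl j b); rewrite ?map_f.
Qed.

Lemma run_emb I S M (A : mp_alg I S M) (info : V -> I) (info' : V' -> I) s a :
  (forall b, b \in bl s a -> ~~ bad b /\ info' (psi b) = info b) -> run A G' info' s (psi a) = run A G info s a.
Proof.
elim: s a => [|s IH] a H /=; first by have [_ ->] := H a (bl_refl 0 a).
have sub b : b \in bl s a -> b \in bl s.+1 a by apply: bl_mono.
rewrite IH; last by move=> b /sub /H.
congr a_recv; have [ga _] := H a (bl_refl _ a); rewrite Hadj // -map_comp; apply/eq_in_map => b hb /=.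
have [gb _] := H b (nb_bl hb (bl_refl _ b)).
rewrite IH; last by move=> y /(nb_bl hb) /H.
by rewrite Hadj // index_map.
Qed.

Lemma output_emb I S M (A : mp_alg I S M) (info : V -> I) (info' : V' -> I) s a b :
  (forall b, b \in bl s a -> ~~ bad b /\ info' (psi b) = info b) ->
  output A G' info' s (psi a) (psi b) = output A G info s a b.
Proof.
by move=> H; rewrite /output (run_emb A H); have [ga _] := H a (bl_refl _ a); rewrite Hadj // index_map.
Qed.

Lemma VV_emb (out : labeling G) (out' : labeling G') j par a :
  (forall b, b \in bl j a -> ~~ bad b /\ forall y, y \in gadj G b -> out' (psi b) (psi y) = out b y) ->
  VV inp' out' j (omap psi par) (psi a) = VV inp out j par a.
Proof.
elim: j par a => [//|j IH] par a H /=; have [ga oa] := H a (bl_refl _ a).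
have -> : chd (omap psi par) (psi a) = [seq psi x | x <- chd par a].
  rewrite /chd Hadj // filter_map; congr map; apply: eq_filter => x /=.
  by case: par => //= p; rewrite !(inj_eq (@Some_inj _)) (inj_eq Hinj).
rewrite -map_comp; congr enc_list; apply/eq_in_map => x; rewrite mem_chd => /andP[xa _] /=.
have [gx ox] := H x (nb_bl xa (bl_refl _ x)); have ax := adj_sym HS xa.
rewrite !Hinp // oa // ox // -[Some (psi a)]/(omap psi (Some a)) IH // => b /(nb_bl xa); exact: H.
Qed.

Variables (P : LCL) (S M : Type) (A : mp_alg (seq bool * seq nat) S M) (t h : nat).
Definition rx (G0 : graph) (inp0 : labeling G0) (rb : {ffun 'I_(gN G0) -> h.-tuple bool}) : labeling G0 :=
  xlab P inp0 (output A G0 (fun v => (val (rb v), inputs_of G0 inp0 v)) t).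

(** The radius consists of [lrad P] for the views, [t] for the run and one for the other end of the
    edge. *)
Lemma rx_emb (rb : {ffun V -> h.-tuple bool}) (rb' : {ffun V' -> h.-tuple bool}) v b :
  (forall y, y \in bl (lrad P + t).+1 v -> ~~ bad y /\ rb' (psi y) = rb y) -> b \in gadj G v ->
  rx inp' rb' (psi v) (psi b) = rx inp rb v b.
Proof.
move=> H hb; rewrite /rx.
set o' := output A G' _ t; set o := output A G _ t.
have O y z : y \in bl (lrad P).+1 v -> z \in gadj G y -> o' (psi y) (psi z) = o y z.
  move=> hy hz; apply: output_emb => u hu.
  have /H[gu ->] : u \in bl (lrad P + t).+1 v by rewrite -addSn; apply: bl_trans hy hu.
  by rewrite inputs_emb.
have g y : y \in bl (lrad P).+1 v -> ~~ bad y.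
  by move=> hy; have /H[] : y \in bl (lrad P + t).+1 v by apply: bl_mono hy; rewrite ltnS leq_addr.
have vb := adj_sym HS hb.
have hv1 : v \in bl (lrad P).+1 v by apply: bl_refl.
have hb1 : b \in bl (lrad P).+1 v by apply: (nb_bl hb); apply: bl_refl.
have E1 j : j < lrad P -> VV inp' o' j (Some (psi v)) (psi b) = VV inp o j (Some v) b.
  move=> hj; rewrite -[Some (psi v)]/(omap psi (Some v)); apply: VV_emb => y /(nb_bl hb) hy.
  have hy' : y \in bl (lrad P).+1 v by apply: bl_mono hy; apply: ltnW.
  by split; [apply: g|move=> z; apply: O].
have E2 j : j < lrad P -> VV inp' o' j (Some (psi b)) (psi v) = VV inp o j (Some b) v.
  move=> hj; rewrite -[Some (psi b)]/(omap psi (Some b)); apply: VV_emb => y hy.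
  have hy' : y \in bl (lrad P).+1 v by apply: bl_mono hy; lia.
  by split; [apply: g|move=> z; apply: O].
rewrite /xlab !O // !Hinp ?g //.
have -> : [seq VV inp' o' j (Some (psi v)) (psi b) | j <- iota 0 (lrad P)] = [seq VV inp o j (Some v) b | j <- iota 0 (lrad P)].
  by apply/eq_in_map => j; rewrite mem_iota => /= /E1.
have -> // : [seq VV inp' o' j (Some (psi b)) (psi v) | j <- iota 0 (lrad P)] = [seq VV inp o j (Some b) v | j <- iota 0 (lrad P)].
by apply/eq_in_map => j; rewrite mem_iota => /= /E2.
Qed.
End Emb.

Section Indep.
Variables (T B : finType).
Local Notation O := {ffun T -> B}.

(* Exchanging the coordinates in [D] is an involution of the pairs of outcomes that maps [(E1 :&: E2) * setT] onto [E2 * E1]. *)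
Lemma indep (D : pred T) (E1 E2 : {set O}) :
  (forall x y : O, (forall v, D v -> x v = y v) -> (x \in E1) = (y \in E1)) ->
  (forall x y : O, (forall v, ~~ D v -> x v = y v) -> (x \in E2) = (y \in E2)) ->
  #|E1 :&: E2| * #|[set: O]| = #|E1| * #|E2|.
Proof.
move=> H1 H2.
pose mix (x y : O) : O := [ffun v => if D v then y v else x v].
pose f (z : O * O) := (mix z.1 z.2, mix z.2 z.1).
have fI : injective f.
  apply: (@can_inj _ _ _ f) => -[x y]; rewrite /f /=; congr pair; apply/ffunP => v; rewrite !ffunE; by case: (D v).
rewrite [RHS]mulnC -!cardsX -(card_preimset (setX E2 E1) fI); apply: eq_card => -[x y].
rewrite !inE /= andbT andbC; congr andb; first by apply: H2 => v /negbTE h; rewrite ffunE h.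
by apply: H1 => v h; rewrite ffunE h.
Qed.

(** An event that depends only on the coordinates in the image of [phi] has the same probability as
    its trace there. As in [indep], exchanging coordinates is an involution of pairs that compares
    the two counts. *)
Lemma pullback (D : finType) (phi : D -> T) (E : {set O}) (m : {set {ffun D -> B}}) : injective phi ->
  (forall x : O, (x \in E) = ([ffun e => x (phi e)] \in m)) ->
  #|E| * #|[set: {ffun D -> B}]| = #|[set: O]| * #|m|.
Proof.
move=> I H.
pose up (x : O) (d : {ffun D -> B}) : O := [ffun v => if [pick e | phi e == v] is Some e then d e else x v].
pose f (z : O * {ffun D -> B}) : O * {ffun D -> B} := (up z.1 z.2, [ffun e => z.1 (phi e)]).
have upE x d e : up x d (phi e) = d e.
  by rewrite ffunE; case: pickP => [e' /eqP/I->//|/(_ e)]; rewrite eqxx.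
have fI : injective f.
  apply: (@can_inj _ _ _ f) => -[x y]; rewrite /f /=; congr pair; apply/ffunP => v; last by rewrite ffunE upE.
  rewrite ffunE; case: pickP => [e /eqP<-|h]; first by rewrite ffunE.
  by rewrite ffunE; case: pickP => [e he|//]; have := h e; rewrite he.
rewrite -!cardsX -(card_preimset (setX [set: O] m) fI); apply: eq_card => -[x y].
by rewrite !inE /= andbT H.
Qed.
End Indep.

Section Transfer.
Variables (G G' : graph) (inp : labeling G) (inp' : labeling G').
Local Notation V := 'I_(gN G).
Local Notation V' := 'I_(gN G').
Variables (psi : V -> V') (bad : pred V).
Hypothesis HS : simple_graph G.
Hypothesis Hinj : injective psi.
Hypothesis Hadj : forall a, ~~ bad a -> gadj G' (psi a) = [seq psi b | b <- gadj G a].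
Hypothesis Hinp : forall a b, ~~ bad a -> b \in gadj G a -> inp' (psi a) (psi b) = inp a b.
Variables (P : LCL) (S M : Type) (A : mp_alg (seq bool * seq nat) S M) (t h : nat).
Local Notation rx := (@rx P S M A t h).

Definition Mk (G0 : graph) (inp0 : labeling G0) (e : 'I_(gN G0) * 'I_(gN G0) * nat) :=
  [set rb : {ffun 'I_(gN G0) -> h.-tuple bool} | rx inp0 rb e.1.1 e.1.2 == e.2].

Lemma Mk_local (G0 : graph) (inp0 : labeling G0) e (x y : {ffun 'I_(gN G0) -> h.-tuple bool}) :
  simple_graph G0 -> e.1.2 \in gadj G0 e.1.1 ->
  (forall v, v \in bl (lrad P + t).+1 e.1.1 -> x v = y v) -> (x \in Mk inp0 e) = (y \in Mk inp0 e).
Proof.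
move=> S0 he H; rewrite !inE; congr (_ == _).
apply: (@rx_emb G0 G0 inp0 inp0 id pred0) => //; first by move=> a _; rewrite map_id.
by move=> z hz; split=> //; apply: H.
Qed.

(** A pinned label is as likely in the glued tree as in its piece, because the ball that determines
    it avoids the [bad] nodes and both events have the same trace on that ball. *)
Lemma transfer e : e.1.2 \in gadj G e.1.1 -> (forall y, y \in bl (lrad P + t).+1 e.1.1 -> ~~ bad y) ->
  #|Mk inp' (psi e.1.1, psi e.1.2, e.2)| * #|[set: {ffun V -> h.-tuple bool}]| =
  #|Mk inp e| * #|[set: {ffun V' -> h.-tuple bool}]|.
Proof.
move=> he hg; set Z := bl _ e.1.1 in hg.
pose D := {y : V | y \in Z}.
pose ext (d : {ffun D -> h.-tuple bool}) : {ffun V -> h.-tuple bool} :=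
  [ffun v => if insub v is Some q then d q else nseq_tuple h true].
pose m := [set d | ext d \in Mk inp e].
have extE (x : {ffun D -> h.-tuple bool}) q : ext x (val q) = x q by rewrite ffunE valK.
have E1 : #|Mk inp e| * #|[set: {ffun D -> h.-tuple bool}]| = #|[set: {ffun V -> h.-tuple bool}]| * #|m|.
  apply: (@pullback _ _ _ (fun q : D => val q)) => [|x]; first exact: val_inj.
  rewrite [RHS]inE; apply: Mk_local => // v hv; by rewrite (extE _ (exist _ v hv)) ffunE.
have E2 : #|Mk inp' (psi e.1.1, psi e.1.2, e.2)| * #|[set: {ffun D -> h.-tuple bool}]| = #|[set: {ffun V' -> h.-tuple bool}]| * #|m|.
  apply: (@pullback _ _ _ (fun q : D => psi (val q))) => [|x]; first by move=> q q' /Hinj /val_inj.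
  rewrite [RHS]inE !inE /=; congr (_ == _).
  apply: (@rx_emb G G' inp inp' psi bad) => // y hy; split; first exact: hg.
  by rewrite (extE _ (exist _ y hy)) ffunE.
have D0 : 0 < #|[set: {ffun D -> h.-tuple bool}]|.
  by rewrite cardsT; apply/card_gt0P; exists [ffun=> nseq_tuple h true].
apply/eqP; rewrite -(eqn_pmul2r D0); apply/eqP.
by rewrite mulnAC E2 [RHS]mulnAC E1; lia.
Qed.
End Transfer.

(** * Failure probability conditioned on pins *)

Section Prob.
Variables (P : LCL) (n : nat) (S M : Type) (A : mp_alg (seq bool * seq nat) S M) (t h : nat).
Local Notation m := (enc_lcl P).
Local Notation rx := (@rx P S M A t h).
Local Notation h0 := (lrad P + t).+1.

Definition solves_upto := forall (G : graph) (inp : labeling G),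
    gN G <= n -> valid_instance P G inp ->
    exists E : {set {ffun 'I_(gN G) -> h.-tuple bool}},
      (forall rb, rb \in E <->
         valid_output P G inp
           (output A G (fun v => (val (rb v), inputs_of G inp v)) t)) /\
      (1 - n%:R^-1 <=
         #|E|%:R / #|{ffun 'I_(gN G) -> h.-tuple bool}|%:R :> rat)%R.
Hypothesis Hsol : solves_upto.

Variables (G : graph) (inp : labeling G).
Local Notation V := 'I_(gN G).
Local Notation Om := {ffun V -> h.-tuple bool}.
Hypothesis HV : valid_instance P G inp.
Hypothesis HN : gN G <= n.
Let HT : is_tree G. Proof. by case: HV. Qed.
Let HS : simple_graph G. Proof. by case: HT. Qed.

Definition okat (x : labeling G) v := nfN m (inputs_of G inp v) [seq x v w | w <- gadj G v] &&
  all (fun w => x v w \in nfL m) (gadj G v).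
Definition Fv v := [set rb : Om | ~~ okat (rx inp rb) v].

Lemma Om_gt0 : 0 < #|[set: Om]|.
Proof. by rewrite cardsT; apply/card_gt0P; exists [ffun=> nseq_tuple h true]. Qed.

Lemma n_gt0 : 0 < n. Proof. by case: HT => h1 _ _ _; apply: leq_trans HN. Qed.

Lemma valid_prob : exists E : {set Om}, (forall rb, rb \in E -> forall v, okat (rx inp rb) v) /\ n.-1 * #|[set: Om]| <= n * #|E|.
Proof.
have [E [h1 h2]] := Hsol HN HV; exists E; split.
  move=> rb /h1 hv v; have [h3 h4] := nfsol_of_valid (proj1 (conj HT I)) (let: And3 _ d _ := HV in d) (let: And3 _ _ i := HV in i) hv.
  by rewrite /okat h4 /=; apply/allP => w hw; case: (h3 v w hw).
have n0 : (0 < n%:R :> rat)%R by rewrite Num.Theory.ltr0n n_gt0.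
have O0 : (0 < #|{: Om}|%:R :> rat)%R by rewrite Num.Theory.ltr0n -cardsT Om_gt0.
rewrite -(Num.Theory.ler_nat rat) !GRing.natrM cardsT -subn1 GRing.natrB ?n_gt0 //.
move: h2; rewrite Num.Theory.ler_pdivlMr // => /(Num.Theory.ler_wpM2l (Order.POrderTheory.ltW n0)).
by rewrite GRing.mulrA GRing.mulrBr GRing.mulr1 GRing.divff ?Order.POrderTheory.gt_eqF.
Qed.

Lemma Fv_card v : #|Fv v| * n <= #|[set: Om]|.
Proof.
have [E [h1 h2]] := valid_prob.
have : #|Fv v| <= #|~: E|.
  apply: subset_leq_card; apply/subsetP => rb; rewrite !inE => hF; apply/negP => /h1 /(_ v) hv; by rewrite hv in hF.
have := cardsC E; rewrite -cardsT => hc hF.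
have n0 := n_gt0; move: h2; rewrite -hc; case: (n) n0 => // q _ /=.
have ar f c e : f <= c -> q * (e + c) <= q.+1 * e -> f * q.+1 <= e + c.
  move=> hf hh; have : f * q.+1 <= c * q.+1 by rewrite leq_mul2r hf orbT.
  by move: hh; rewrite mulnDr mulSn !mulnS; lia.
exact: ar hF.
Qed.

Lemma Fv_local v (x y : Om) : (forall u, u \in bl h0 v -> x u = y u) -> (x \in Fv v) = (y \in Fv v).
Proof.
move=> H; rewrite !inE /okat; congr (~~ _).
have E w : w \in gadj G v -> rx inp x v w = rx inp y v w.
  move=> hw; apply: (@rx_emb G G inp inp id pred0) => //; first by move=> a _; rewrite map_id.
  by move=> z hz; split=> //; apply: H.
have -> : [seq rx inp x v w | w <- gadj G v] = [seq rx inp y v w | w <- gadj G v] by apply/eq_in_map.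
by congr andb; apply: eq_in_all => w /E ->.
Qed.

Definition mark := (V * V * nat)%type.
Definition farb d (e e' : mark) := (e'.1.1 \notin bl d e.1.1).
Local Notation Mk := (@Mk P S M A t h G inp).
Definition Mall (s : seq mark) := [set rb : Om | all (fun e => rb \in Mk e) s].

Lemma farb_sym d e e' : farb d e e' = farb d e' e.
Proof. by rewrite /farb; congr negb; apply/idP/idP; apply: (bl_sym HS). Qed.

Lemma Mall_local s (D : pred V) (x y : Om) : (forall e, e \in s -> e.1.2 \in gadj G e.1.1) ->
  (forall e u, e \in s -> u \in bl h0 e.1.1 -> D u) -> (forall u, D u -> x u = y u) -> (x \in Mall s) = (y \in Mall s).
Proof.
move=> hs hD H; rewrite !inE; apply: eq_in_all => e he; apply: Mk_local => //; first exact: hs.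
by move=> u hu; apply: H; apply: hD hu.
Qed.

Lemma far_split d s1 e s2 : pairwise (farb d) (s1 ++ e :: s2) -> (forall e', e' \in s1 ++ s2 -> farb d e e') /\ pairwise (farb d) (s1 ++ s2).
Proof.
rewrite !pairwise_cat pairwise_cons => /and3P[h1 h2 /andP[h3 h4]]; split.
  move=> e'; rewrite mem_cat => /orP[hh|hh]; last by move/allP: h3 => /(_ _ hh).
  by rewrite farb_sym; move/allrelP: h1; apply; rewrite ?mem_head.
by rewrite h2 h4 andbT /=; move: h1; rewrite allrel_consr => /andP[_ ->].
Qed.

Lemma MallE s1 e s2 : Mall (s1 ++ e :: s2) = Mk e :&: Mall (s1 ++ s2).
Proof. by apply/setP => rb; rewrite in_setI [LHS]inE [X in _ && X]inE !all_cat /= andbCA. Qed.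

Lemma bl_meet d (e e' : mark) u : u \in bl d e.1.1 -> u \in bl d e'.1.1 -> e'.1.1 \in bl (d + d) (e : mark).1.1.
Proof. by move=> h1 /(bl_sym HS) h2; apply: bl_trans h1 h2. Qed.

Lemma Mk_indep (e : mark) s (X : {set Om}) (Y : seq V) :
  e.1.2 \in gadj G e.1.1 -> (forall e', e' \in s -> e'.1.2 \in gadj G e'.1.1) ->
  (forall e', e' \in s -> farb (h0 + h0) e e') ->
  (forall e' u, e' \in s -> u \in Y -> u \notin bl h0 e'.1.1) ->
  (forall x y : Om, (forall u, u \in Y -> x u = y u) -> (x \in X) = (y \in X)) ->
  #|X :&: Mk e :&: Mall s| * #|[set: Om]| = #|X :&: Mk e| * #|Mall s|.
Proof.
move=> he hs hf hY hX; apply: (@indep _ _ (fun u => (u \in bl h0 e.1.1) || (u \in Y))) => x y H.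
  rewrite !inE; congr andb; first by apply: hX => u hu; apply: H; rewrite hu orbT.
  have := @Mk_local P S M A t h _ inp e x y HS he; rewrite !inE; apply.
  by move=> u hu; apply: H; rewrite hu.
apply: (@Mall_local _ (fun u => ~~ ((u \in bl h0 e.1.1) || (u \in Y)))) => //.
move=> e' u he' hu; rewrite negb_or; apply/andP; split; last by apply/negP => /(hY _ _ he'); rewrite hu.
by apply/negP => h'; have := hf _ he'; rewrite /farb (bl_meet h' hu).
Qed.
Lemma Mk_indepT (e : mark) s :
  e.1.2 \in gadj G e.1.1 -> (forall e', e' \in s -> e'.1.2 \in gadj G e'.1.1) ->
  (forall e', e' \in s -> farb (h0 + h0) e e') ->
  #|Mk e :&: Mall s| * #|[set: Om]| = #|Mk e| * #|Mall s|.
Proof.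
by move=> he hs hf; have := @Mk_indep e s setT [::] he hs hf; rewrite !setTI; apply => // x y _; rewrite !inE.
Qed.

Variables (q : nat).
Hypothesis hq : gN G * q < n.

(** Pins are more than [4 * h0] apart, so the ball of a node meets the ball of at most one of them,
    and together these two balls miss all others. Conditioning on the others changes nothing, and
    conditioning on that one multiplies the failure probability 1/n by at most [q]. *)
Lemma all_marks (s : seq mark) : 0 < q ->
  (forall e, e \in s -> e.1.2 \in gadj G e.1.1) -> pairwise (farb (4 * h0)) s ->
  (forall e, e \in s -> #|[set: Om]| <= #|Mk e| * q) ->
  exists rb : Om, (forall e, e \in s -> rx inp rb e.1.1 e.1.2 = e.2) /\ forall v, okat (rx inp rb) v.
Proof.
move=> q0 hs hp hM; have O0 := Om_gt0.
have far2 e e' : farb (4 * h0) e e' -> farb (h0 + h0) e e'.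
  by apply: contraNN; apply: bl_mono; lia.
have pos : 0 < #|Mall s|.
  elim: s hs hp hM => [|e s IH] hs hp hM.
    by have -> : Mall [::] = [set: Om] by apply/setP => rb; rewrite !inE.
  have [h1 h2] := far_split (hp : pairwise _ ([::] ++ e :: s)).
  have p1 : 0 < #|Mall s| by apply: IH => // e' he'; [apply: hs|apply: hM]; rewrite inE he' orbT.
  have := Mk_indepT (hs e (mem_head _ _)) (fun e' he' => hs e' (mem_behead he')) (fun e' he' => far2 _ _ (h1 e' he')).
  rewrite -(MallE [::] e s) /= => E.
  have : 0 < #|Mk e| * #|Mall s| by rewrite muln_gt0 p1 andbT; have := hM e (mem_head _ _); nia.
  by rewrite -E muln_gt0 => /andP[].
have bound v : #|Fv v :&: Mall s| * n <= q * #|Mall s|.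
  have [/hasP[e es /hasP[z z1 z2]]|/hasPn no] := boolP (has (fun e : mark => has (fun u => u \in bl h0 e.1.1) (bl h0 v)) s).
    case/splitPr: es hs hp hM pos => s1 s2 hs hp hM pos.
    have [h1 h2] := far_split hp.
    have hY e' u : e' \in s1 ++ s2 -> u \in bl h0 v -> u \notin bl h0 e'.1.1.
      move=> he' hu; apply/negP => hu'; have := h1 _ he'; rewrite /farb => /negP; apply.
      have -> : 4 * h0 = h0 + (h0 + (h0 + h0)) by lia.
      apply: bl_trans z2 _; apply: bl_trans (bl_sym HS z1) _; apply: bl_trans hu _; exact: bl_sym.
    have far1 e' he' := far2 _ _ (h1 e' he').
    have he : e.1.2 \in gadj G e.1.1 by apply: hs; rewrite mem_cat mem_head orbT.
    have hs' e' : e' \in s1 ++ s2 -> e'.1.2 \in gadj G e'.1.1.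
      by move=> he'; apply: hs; move: he'; rewrite !mem_cat inE => /orP[]->; rewrite ?orbT.
    have E1 := Mk_indep he hs' far1 hY (@Fv_local v).
    have E2 := Mk_indepT he hs' far1.
    rewrite MallE setIA in pos *.
    have b1 : #|Fv v :&: Mk e| <= #|Fv v| by apply: subset_leq_card; apply: subsetIl.
    have b2 := Fv_card v; have b3 := hM e; rewrite mem_cat mem_head orbT in b3; have {}b3 := b3 isT.
    have e0 : 0 < #|Mk e| by nia.
    move: E1 E2; set x1 := #|_ :&: _ :&: Mall _|; set x2 := #|Mk e :&: _|; set x3 := #|Mall _| => E1 E2.
    move: b1 b2 b3 e0 O0 E1 E2; clear; set y := #|Fv v :&: Mk e|; set f := #|Fv v|; set om := #|[set: _]|; set k := #|Mk e| => b1 b2 b3 e0 O0 E1 E2.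
    have E3 : x1 * k = y * x2 by apply/eqP; rewrite -(eqn_pmul2r O0); apply/eqP; nia.
    rewrite -(leq_pmul2r e0).
    have -> : x1 * n * k = y * n * x2 by nia.
    have : y * n <= q * k by nia.
    by nia.
  have E : #|Fv v :&: Mall s| * #|[set: Om]| = #|Fv v| * #|Mall s|.
    apply: (@indep _ _ (fun u => u \in bl h0 v)); first exact: Fv_local.
    move=> x y; apply: Mall_local => // e u he hu; apply/negP => hu2.
    by have := no e he; move/negP; apply; apply/hasP; exists u.
  have b2 := Fv_card v.
  rewrite -(leq_pmul2r O0) mulnAC E.
  have ar f mm o : f * n <= o -> f * mm * n <= q * mm * o.
    move=> hh; have h1 : f * n * mm <= o * mm by rewrite leq_mul2r hh orbT.
    have h2 : o * mm <= q * (o * mm) by rewrite leq_pmull.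
    by move: h1 h2; rewrite mulnAC mulnA; lia.
  exact: ar b2.
have /existsP[rb /andP[h1 /forallP h2]] : [exists rb : Om, (rb \in Mall s) && [forall v, rb \notin Fv v]].
  apply: contraT => /existsPn no.
  have sub : #|Mall s| <= \sum_v #|Fv v :&: Mall s|.
    have le1 : forall r : seq V, #|\bigcup_(v <- r) (Fv v :&: Mall s)| <= \sum_(v <- r) #|Fv v :&: Mall s|.
      elim=> [|v r IH]; first by rewrite big_nil cards0.
      by rewrite !big_cons; apply: leq_trans (leq_card_setU _ _) _; rewrite leq_add2l.
    apply: leq_trans (le1 _); apply: subset_leq_card; apply/subsetP => rb hrb.
    have := no rb; rewrite hrb /= negb_forall => /existsP[v]; rewrite negbK => hv.
    by apply/bigcupP; exists v => //; rewrite inE hv.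
  have : #|Mall s| * n <= gN G * (q * #|Mall s|).
    apply: leq_trans (_ : (\sum_v #|Fv v :&: Mall s|) * n <= _); first by rewrite leq_mul2r sub orbT.
    rewrite big_distrl /=; apply: leq_trans (_ : \sum_(v : V) q * #|Mall s| <= _).
      by apply: leq_sum => v _; apply: bound.
    by rewrite sum_nat_const card_ord.
  by rewrite leqNgt => /negP[]; nia.
exists rb; split=> [e he|v]; last by have := h2 v; rewrite inE negbK.
by move: h1; rewrite inE => /allP /(_ e he); rewrite inE => /eqP.
Qed.
End Prob.

(** * Realizable classes *)

#[global] Arguments bl : simpl never.
Section Real.
Variables (P : LCL) (n : nat) (S M : Type) (A : mp_alg (seq bool * seq nat) S M) (t h q : nat).
Local Notation m := (enc_lcl P).
Local Notation h0 := (lrad P + t).+1.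
Local Notation Mk := (@Mk P S M A t h).
Local Notation Om G := {ffun 'I_(gN G) -> h.-tuple bool}.
Definition HH := 4 * h0.

(* The marks [s] stay away from the nodes [Av] and from each other, and each of them is produced with probability at least [1/q]. *)
Definition markok (G : graph) (inp : labeling G) (s : seq (mark G)) (Av : seq 'I_(gN G)) : Prop :=
  [/\ forall e, e \in s -> e.1.2 \in gadj G e.1.1,
      forall e y, e \in s -> y \in Av -> y \notin bl HH e.1.1,
      pairwise (farb HH) s &
      forall e, e \in s -> #|[set: Om G]| <= #|Mk inp e| * q].
Definition sol (G : graph) (inp : labeling G) (Wo : seq 'I_(gN G)) (s : seq (mark G)) (x : labeling G) : Prop :=
  [/\ forall a b, b \in gadj G a -> x a b \in nfL m /\ x b a = flip (x a b),
      forall v, v \notin Wo -> nfN m (inputs_of G inp v) [seq x v w | w <- gadj G v] &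
      forall e, e \in s -> x e.1.1 e.1.2 = e.2].

(** Only an inclusion is asked for, so realizability is monotone in [X] as well as in the size; this
    is what makes layers grow with the size. *)
Definition Real (X : seq nat) sz : Prop := exists (K : piece) (s : seq (mark (pG K))),
  [/\ okp (mD m) (mIn m) K, gN (pG K) <= sz, markok (pI K) s [:: pw K] &
     forall x, sol (pI K) [:: pw K] s x -> x (pw K) (pu K) \in X].

Lemma pairwise_flatten (T : Type) (I : eqType) (r : rel T) (F : I -> seq T) l : uniq l ->
  (forall k, pairwise r (F k)) -> (forall k k', k != k' -> allrel r (F k) (F k')) -> pairwise r (flatten (map F l)).
Proof.
move=> + H1 H2; elim: l => //= k l IH /andP[kl U]; rewrite pairwise_cat H1 IH // !andbT.
elim: l kl {IH U} => [|k' l IH]; first by rewrite allrel0r.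
by rewrite inE negb_or => /andP[kk kl] /=; rewrite allrel_catr H2 // IH.
Qed.

Section WM.
Variables (d : nat) (K : 'I_d -> piece) (ins : seq nat).
Hypothesis HK : forall k, okp (mD m) (mIn m) (K k).
Hypothesis Hi : size ins = d.
Hypothesis Hd : d <= mD m.
Hypothesis Hn : forall i, i \in ins -> i < mIn m.
Local Notation V k := 'I_(gN (pG (K k))).
Local Notation adk k := (gadj (pG (K k))).
Local Notation w k := (pw (K k)).
Local Notation u k := (pu (K k)).
Variables (s : forall k, seq (mark (pG (K k)))) (Av : forall k, seq (V k)).
Hypothesis HAv : forall k, w k \in Av k.
Hypothesis Hs : forall k, markok (pI (K k)) (s k) (Av k).

(** Solutions of the glued tree restrict to solutions of the pieces. Pins of different pieces remain
    far apart because the ball around a pin avoids the leaf and hence stays inside its piece. *)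
Theorem wedge_marks : exists (W : graph) (wI : labeling W) (c : 'I_(gN W)) (io : forall k, V k -> 'I_(gN W)) (s' : seq (mark W)),
  [/\ is_tree W, max_deg_le W (mD m), (forall a b, b \in gadj W a -> wI a b < mIn m) & gN W <= (\sum_k gN (pG (K k))).+1] /\
  [/\ gadj W c = [seq io k (u k) | k <- enum 'I_d], (forall k, io k (w k) = c),
     (forall k l a b, io k a = io l b -> k != l -> a = w k) &
     forall z, z = c \/ exists k a, a != w k /\ z = io k a] /\
  (forall k, [/\ injective (io k), (forall a, a != w k -> gadj W (io k a) = [seq io k b | b <- adk k a]) &
     forall a b, a != w k -> b \in adk k a -> wI (io k a) (io k b) = pI (K k) a b]) /\
  (forall Av', (forall y, y \in Av' -> y = c \/ exists k a, a \in Av k /\ y = io k a) -> markok wI s' Av') /\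
  forall Wo x, sol wI Wo s' x ->
    (c \notin Wo -> nfN m ins [seq x c (io k (u k)) | k <- enum 'I_d]) /\
    forall k Wk, w k \in Wk -> (forall a, a \notin Wk -> io k a \notin Wo) ->
      sol (pI (K k)) Wk (s k) (fun a b => x (io k a) (io k b)).
Proof.
have [W [wI [c [io [[w1 w2 w3 w4] [[g1 g2 g3 g4 g5] g6]]]]]] := wedge_ex HK Hi Hd Hn.
pose tr k (e : mark (pG (K k))) : mark W := (io k e.1.1, io k e.1.2, e.2).
pose s' := flatten [seq [seq tr k e | e <- s k] | k <- enum 'I_d].
have HSk k : simple_graph (pG (K k)) by case: (HK k) => -[].
have adj k a : a != w k -> gadj W (io k a) = [seq io k b | b <- adk k a] by have [_ h2 _] := g6 k; apply: h2.
have mem e : e \in s' -> exists k e0, e0 \in s k /\ e = tr k e0.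
  by move=> /flattenP[l /mapP[k _ ->] /mapP[e0 he ->]]; exists k, e0.
have ball k e : e \in s k -> forall y, y \in bl HH e.1.1 -> y != w k.
  move=> he y hy; have [_ h2 _ _] := Hs k; have := h2 e _ he (HAv k); apply: contraNneq => <-; exact: hy.
have blE k e : e \in s k -> bl HH (io k e.1.1) = [seq io k b | b <- bl HH e.1.1].
  move=> he; have [_ h2 _] := g6 k; apply: (@bl_emb _ _ _ (fun a => a == w k)) => // y; exact: ball.
have hom k a b : b \in adk k a -> io k b \in gadj W (io k a).
  have [ea|ne] := eqVneq a (w k); last by move=> hb; rewrite adj // map_f.
  by rewrite ea; case: (HK k) => _ _ _ ->; rewrite inE g3 g1 => /eqP->; apply/mapP; exists k; rewrite ?mem_enum.
have cr k k' e e' : k != k' -> e \in s k -> io k' e' \notin bl HH (io k e.1.1).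
  move=> kk he; rewrite blE //; apply/negP => /mapP[b hb E].
  have := g4 _ _ _ _ (esym E) kk; apply/eqP; exact: (ball k e).
exists W, wI, c, io, s'; do 3![split=> //]; split.
  move=> Av' hAv; split.
  - by move=> e /mem[k [e0 [he ->]]] /=; apply: hom; have [h1 _ _ _] := Hs k; apply: h1.
  - move=> e y /mem[k [e0 [he ->]]] /= /hAv hy.
    have cb : c \notin bl HH (io k e0.1.1).
      rewrite blE // -(g3 k); apply/negP => /mapP[b hb]; have [inj _ _] := g6 k => /inj E.
      by have := ball k e0 he b hb; rewrite -E eqxx.
    case: hy => [->//|[k' [a [ha ->]]]].
    have [E|kk] := eqVneq k k'; last exact: cr.
    subst k'; have [inj _ _] := g6 k; rewrite blE // mem_map //; by have [_ h2 _ _] := Hs k; apply: h2.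
  - apply: pairwise_flatten; first exact: enum_uniq.
      move=> k; rewrite pairwise_map; have [_ _ h3 _] := Hs k; have [inj _ _] := g6 k.
      have sb : {in [in s k] &, subrel (farb HH) (relpre (tr k) (farb HH))}.
        by move=> e e' he he'; rewrite /= /farb /= blE // mem_map.
      apply: (sub_in_pairwise sb) h3; exact/allP.
    move=> k k' kk; apply/allrelP => e e' /mapP[e0 he ->] /mapP[e1 he' ->]; rewrite /farb /=; exact: cr.
  - move=> e /mem[k [e0 [he ->]]]; have [h1 _ _ h4] := Hs k; have [inj ad ip] := g6 k.
    have T := @transfer _ _ (pI (K k)) wI (io k) (fun a => a == w k) (HSk k) inj ad ip P S M A t h e0 (h1 _ he).
    have : forall y, y \in bl h0 e0.1.1 -> y != w k by move=> y hy; apply: (ball k e0 he); apply: bl_mono hy; rewrite /HH; lia.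
    move=> /T; have O0 : 0 < #|[set: Om (pG (K k))]| by apply: Om_gt0.
    have := h4 e0 he; rewrite -/(tr k e0) -(leq_pmul2r O0).
    set a1 := #|Mk _ (tr k e0)|; set a2 := #|[set: Om W]|; set a3 := #|[set: Om (pG (K k))]|; set a4 := #|Mk _ e0| => H1 H2.
    rewrite -(leq_pmul2r O0) -/a3 mulnAC H2; move: H1; rewrite leq_pmul2r // => H1.
    by rewrite [a4 * a2]mulnC -mulnA leq_mul2l H1 orbT.
move=> Wo x [x1 x2 x3]; split.
  by move=> cW; have := x2 c cW; rewrite g2 g1 -map_comp.
move=> k Wk wW hW; have [inj ad ip] := g6 k; split.
- by move=> a b /hom; apply: x1.
- move=> v hv; have vw : v != w k by apply: contraNneq hv => ->.
  have := x2 _ (hW v hv); rewrite (@inputs_emb _ _ (pI (K k)) wI (io k) (fun a => a == w k)) //.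
  by rewrite ad // -map_comp.
- move=> e he; have := x3 (tr k e); apply; apply/flattenP; exists [seq tr k e | e <- s k]; last exact: map_f.
  by apply/mapP; exists k; rewrite ?mem_enum.
Qed.
End WM.
End Real.

Lemma piece_family (d : nat) (Q : 'I_d -> forall K : piece, seq (mark (pG K)) -> Prop) :
  (forall k, exists K s, Q k K s) -> exists (K : 'I_d -> piece) (s : forall k, seq (mark (pG (K k)))), forall k, Q k (K k) (s k).
Proof. by move=> /fin_all_exists[K /fin_all_exists[s H]]; exists K, s. Qed.

Section Real.
Variables (P : LCL) (n : nat) (S M : Type) (A : mp_alg (seq bool * seq nat) S M) (t h q : nat).
Local Notation m := (enc_lcl P).
Local Notation h0 := (lrad P + t).+1.
Local Notation Mk := (@Mk P S M A t h).
Local Notation Real := (@Real P S M A t h q).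
Local Notation markok := (@markok P S M A t h q).
Lemma Real_mono (X Y : seq nat) a b : {subset X <= Y} -> a <= b -> Real X a -> Real Y b.
Proof.
move=> h1 h2 [K [s [k1 k2 k3 k4]]]; exists K, s; split=> //; first exact: leq_trans h2.
by move=> x /k4 /h1.
Qed.

Lemma sum_size d (K : 'I_d -> piece) sz : (forall k, gN (pG (K k)) <= sz) -> d <= mD m -> \sum_k gN (pG (K k)) <= mD m * sz.
Proof.
move=> H hd; apply: leq_trans (_ : \sum_(k < d) sz <= _); first by apply: leq_sum.
by rewrite sum_nat_const card_ord leq_mul2r hd orbT.
Qed.

Lemma enum_nth d (T : Type) (x0 : T) (F : 'I_d -> T) (k : 'I_d) : nth x0 [seq F k | k <- enum 'I_d] k = F k.
Proof. by rewrite (nth_map k) ?size_enum_ord // nth_ord_enum. Qed.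

Lemma choice_mem ins Ss (F : 'I_(size ins) -> nat) : (forall k, F k \in nfL m) ->
  nfN m ins [seq F k | k <- enum 'I_(size ins)] -> (forall k, F k \in unl (nth 0 Ss k)) ->
  enc_list [seq F k | k <- enum 'I_(size ins)] \in choice m ins Ss.
Proof.
move=> H1 H2 H3; rewrite mem_filter encK H2 /=; apply/andP; split.
  by apply/allP => k; rewrite mem_iota => /= hk; rewrite -[k]/(val (Ordinal hk)) (enum_nth 0 F).
apply/listsnP; exists [seq F k | k <- enum 'I_(size ins)]; split=> //; first by rewrite size_map size_enum_ord.
by move=> y /mapP[k _ ->].
Qed.

(** The open port receives a single edge whose far end is the new leaf, the other ports receive
    pieces realizing their classes. A solution then shows a choice at the center. *)
Theorem real_closed X ins Ss i sz : (forall z, z \in X -> Real (unl z) sz) -> 2 <= sz ->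
  vnode m X ins Ss [:: i] -> i < size ins -> Real (nodecls m ins Ss i) (mD m * sz).+1.
Proof.
move=> HX sz2 /vnodeP[v1 v2 v3 v4] il; pose i' := Ordinal il.
have D0 : 0 < mD m by apply: leq_trans v1; apply: (leq_ltn_trans _ il).
have I0 : 0 < mIn m by apply: leq_ltn_trans (v2 _ (mem_nth 0 il)).
pose Q (k : 'I_(size ins)) (K : piece) (s : seq (mark (pG K))) :=
  [/\ okp (mD m) (mIn m) K, gN (pG K) <= sz, markok (pI K) s (if k == i' then [:: pw K; pu K] else [:: pw K]),
   (k != i' -> forall x, sol P (pI K) [:: pw K] s x -> x (pw K) (pu K) \in unl (nth 0 Ss k)) &
   (k == i' -> gadj (pG K) (pu K) = [:: pw K])].
have /piece_family[K [s HQ]] : forall k, exists K s, Q k K s.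
  move=> k; have := v4 k (ltn_ord k); rewrite inE -[k == i :> nat]/(k == i'); rewrite /Q.
  case: eqP => _; last by move=> /HX[K [s [h1 h2 h3 h4]]]; exists K, s; split.
  move=> _; exists k2, [::]; split=> //; first exact: k2_ok.
  by move=> _ /=; congr cons; apply: val_inj.
have HK k : okp (mD m) (mIn m) (K k) by case: (HQ k).
have Hm k : markok (pI (K k)) (s k) (if k == i' then [:: pw (K k); pu (K k)] else [:: pw (K k)]) by case: (HQ k).
have Hw k : pw (K k) \in (if k == i' then [:: pw (K k); pu (K k)] else [:: pw (K k)]) by case: ifP => _; rewrite mem_head.
have [W [wI [c [io [s' [[w1 w2 w3 w4] [[g1 g2 g3 g4] [g5 [g6 g7]]]]]]]]] :=
  @wedge_marks P S M A t h q _ K ins HK erefl v1 v2 s _ Hw Hm.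
pose z := io i' (pu (K i')).
have zn : pu (K i') != pw (K i') by apply: (uw HK).
have zc : gadj W z = [:: c].
  have [_ h2 _] := g5 i'; have [_ _ _ _ h5] := HQ i'; by rewrite h2 // h5 ?eqxx //= g2.
have cz : c != z by rewrite -(g2 i') /z; have [inj _ _] := g5 i'; rewrite (inj_eq inj) eq_sym.
exists (@Piece W wI z c), s'; split=> //=.
- by apply: leq_trans w4 _; rewrite ltnS; apply: sum_size => // k; case: (HQ k).
- apply: g6 => y; rewrite inE => /eqP->; right; exists i', (pu (K i')); by rewrite eqxx !inE eqxx orbT.
move=> x hx; have [N1 N2] := g7 _ _ hx.
have {}N1 : nfN m ins [seq x c (io k (pu (K k))) | k <- enum 'I_(size ins)] by apply: N1; rewrite inE.
have xL k : x c (io k (pu (K k))) \in nfL m.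
  have [h1 _ _] := hx; have [] // := h1 c (io k (pu (K k))); by rewrite g1; apply/mapP; exists k; rewrite ?mem_enum.
have Cz : c \in gadj W z by rewrite zc mem_head.
have [h1 _ _] := hx; have [h2 h3] := h1 z c Cz.
rewrite mem_filter h2 andbT; apply/hasP; eexists; first apply: (choice_mem xL N1).
  move=> k; have [_ _ _ h4 _] := HQ k; have := v4 k (ltn_ord k); rewrite inE -[k == i :> nat]/(k == i').
  case: eqP h4 => [_ _ ->|/eqP ki h4 _]; first by rewrite encK.
  rewrite -[c in x c _](g2 k); apply: (h4 isT (fun a b => x (io k a) (io k b))); apply: N2; first by rewrite mem_head.
  move=> a; rewrite !inE; apply: contraNN => /eqP E; apply/eqP; exact: (g3 k i' a _ E ki).
by rewrite encK -[i]/(val i') (enum_nth 0 (fun k => x c (io k (pu (K k))))) -/z h3.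
Qed.

Hypothesis Hsol : solves_upto P n A t h.
Theorem real_root X ins Ss sz : (forall z, z \in X -> Real (unl z) sz) -> 0 < q -> (mD m * sz).+1 * q < n ->
  vnode m X ins Ss [::] -> choice m ins Ss != [::].
Proof.
move=> HX q0 hq /vnodeP[v1 v2 v3 v4].
pose Q (k : 'I_(size ins)) (K : piece) (s : seq (mark (pG K))) :=
  [/\ okp (mD m) (mIn m) K, gN (pG K) <= sz, markok (pI K) s [:: pw K] &
   forall x, sol P (pI K) [:: pw K] s x -> x (pw K) (pu K) \in unl (nth 0 Ss k)].
have /piece_family[K [s HQ]] : forall k, exists K s, Q k K s.
  by move=> k; have := v4 k (ltn_ord k) => /HX[K [s [h1 h2 h3 h4]]]; exists K, s; split.
have HK k : okp (mD m) (mIn m) (K k) by case: (HQ k).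
have Hm k : markok (pI (K k)) (s k) [:: pw (K k)] by case: (HQ k).
have Hw k : pw (K k) \in [:: pw (K k)] by rewrite mem_head.
have [W [wI [c [io [s' [[w1 w2 w3 w4] [[g1 g2 g3 g4] [g5 [g6 g7]]]]]]]]] :=
  @wedge_marks P S M A t h q _ K ins HK erefl v1 v2 s _ Hw Hm.
have sW : gN W <= (mD m * sz).+1.
  by apply: leq_trans w4 _; rewrite ltnS; apply: sum_size => // k; case: (HQ k).
have VI : valid_instance P W wI.
  by move: w2 w3; rewrite /mD /mIn !fldE /= => w2 w3; split.
have hn : gN W <= n by apply: leq_trans sW _; apply: leq_trans (ltnW hq); rewrite leq_pmulr.
have [m1 m2 m3 m4] := g6 [::] (fun y hy => ltac:(by [])).
have [|rb [r1 r2]] := all_marks Hsol VI hn _ q0 m1 m3 m4.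
  by apply: leq_ltn_trans hq; rewrite leq_mul2r sW orbT.
set x := rx _ _ _ _ _ in r1 r2.
have fl a b : x b a = flip (x a b) by rewrite /x /rx flip_xlab.
have hx : sol P wI [::] s' x.
  split=> // [a b hb|v _]; last by have /andP[] := r2 v.
  by have /andP[_ /allP h2] := r2 a; split=> //; apply: h2.
have [N1 N2] := g7 _ _ hx.
have xL k : x c (io k (pu (K k))) \in nfL m.
  have [h1 _ _] := hx; have [] // := h1 c (io k (pu (K k))); by rewrite g1; apply/mapP; exists k; rewrite ?mem_enum.
apply/eqP => E; have : enc_list [seq x c (io k (pu (K k))) | k <- enum 'I_(size ins)] \in choice m ins Ss; last by rewrite E.
apply: choice_mem => //; first exact: N1.
move=> k; have [_ _ _ h4] := HQ k.
rewrite -[c in x c _](g2 k); apply: (h4 (fun a b => x (io k a) (io k b))); apply: N2; by rewrite ?mem_head.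
Qed.
End Real.

Section Real.
Variables (P : LCL) (n : nat) (S M : Type) (A : mp_alg (seq bool * seq nat) S M) (t h q : nat).
Local Notation m := (enc_lcl P).
Local Notation h0 := (lrad P + t).+1.
Local Notation HH := (HH P t).
Local Notation Mk := (@Mk P S M A t h).
Local Notation Real := (@Real P S M A t h q).
Local Notation markok := (@markok P S M A t h q).
Local Notation sol := (sol P).
Local Notation stp R a := (fun s y => exists2 s2, rin a (flip s) s2 & R s2 y).

(* A caterpillar with two open ends [pw K] and [w'], a distinguished half-edge [(a, b)] on its spine,
   and a potential [pos] bounding distances along the spine from below. *)
Definition State (sz len qm : nat) (R1 R2 : nat -> nat -> Prop) : Prop :=
  exists (K : piece) (w' u' a b : 'I_(gN (pG K))) (s : seq (mark (pG K))) (pos : 'I_(gN (pG K)) -> nat) (Av : seq 'I_(gN (pG K))),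
  [/\ okp (mD m) (mIn m) K, gN (pG K) <= sz, gadj (pG K) w' = [:: u'], w' != pw K & b \in gadj (pG K) a] /\
  [/\ pw K \in Av, w' \in Av, a \in Av & markok (pI K) s Av] /\
  [/\ forall x y, y \in gadj (pG K) x -> pos y <= (pos x).+1, pos (pw K) = 0, pos w' = len & pos a = qm] /\
  forall x, sol (pI K) [:: pw K; w'] s x -> R1 (x (pw K) (pu K)) (x a b) /\ R2 (x a b) (x w' u').

Lemma State_base : 0 < mD m -> 0 < mIn m -> State 2 1 0 (fun y z => z = y) (fun y z => z = flip y).
Proof.
move=> hD hI; exists k2, (pu k2), (pw k2), (pw k2), (pu k2), [::], (fun x => val x), [:: pw k2; pu k2].
have E : gadj (pG k2) (pu k2) = [:: pw k2] by rewrite /=; congr cons; apply: val_inj.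
have E2 : gadj (pG k2) (pw k2) = [:: pu k2] by rewrite /=; congr cons; apply: val_inj.
split; [|split; [|split]].
- by split=> //; apply: k2_ok.
- by split; rewrite ?inE ?eqxx ?orbT.
- by split=> // x y _; have := ltn_ord y; rewrite /=; lia.
- move=> x [h1 _ _]; split=> //; have [] // := h1 (pw k2) (pu k2); by rewrite E2 mem_head.
Qed.

(** The distinguished half-edge moves to the open end. Everything built so far lies on its far side,
    and further steps lengthen the near side only. *)
Lemma State_switch sz len qm R1 R2 : State sz len qm R1 R2 ->
  State sz len 0 (fun y z => z = y) (fun y z => exists2 y', R1 y y' & R2 y' z).
Proof.
move=> [K [w' [u' [a [b [s [pos [Av [[k1 k2 k3 k4 k5] [[m1 m2 m3 m4] [[p1 p2 p3 p4] sm]]]]]]]]]]].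
exists K, w', u', (pw K), (pu K), s, pos, Av; split; [|split; [|split]] => //.
- by split=> //; case: k1 => _ _ _ ->; rewrite mem_head.
- by move=> x /sm[h1 h2]; split=> //; exists (x a b).
Qed.

Lemma State_step sz len qm R1 R2 X rel s0 : (forall z, z \in X -> Real (unl z) s0) -> 2 <= s0 -> isnode m X rel ->
  State sz len qm R1 R2 -> State (sz + (mD m * s0).+1) len.+1 qm.+1 (stp R1 rel) R2.
Proof.
move=> HX s02 [ins [Ss [i [j [/vnodeP[v1 v2 v3 v4] ij il jl ->]]]]] HSt; pose i' := Ordinal il; pose j' := Ordinal jl.
have ij' : i' != j' by [].
have D0 : 0 < mD m by apply: leq_trans v1; apply: (leq_ltn_trans _ il).
have I0 : 0 < mIn m by apply: leq_ltn_trans (v2 _ (mem_nth 0 il)).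
(* Port [i] gets the new open end, port [j] the old caterpillar, and the other ports get pieces for
   their classes. The potential is 1 at the center and shifted by one in the caterpillar. *)
pose Q (k : 'I_(size ins)) (K : piece) (s : seq (mark (pG K))) := exists (Av : seq 'I_(gN (pG K))) (p : 'I_(gN (pG K)) -> nat),
  [/\ okp (mD m) (mIn m) K, gN (pG K) <= s0 + (if k == j' then sz else 0), markok (pI K) s Av & pw K \in Av] /\
  [/\ forall x y, y \in gadj (pG K) x -> p y <= (p x).+1, p (pw K) = 1,
   (k != i' -> k != j' -> forall x, sol (pI K) [:: pw K] s x -> x (pw K) (pu K) \in unl (nth 0 Ss k)),
   (k == i' -> [/\ gadj (pG K) (pu K) = [:: pw K], pu K \in Av & p (pu K) = 0]) &
   (k == j' -> exists w' u' a b, [/\ gadj (pG K) w' = [:: u'], w' != pw K, w' \in Av, a \in Av & b \in gadj (pG K) a] /\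
      [/\ p w' = len.+1, p a = qm.+1 & forall x, sol (pI K) [:: pw K; w'] s x -> R1 (x (pw K) (pu K)) (x a b) /\ R2 (x a b) (x w' u')])].
have /piece_family[K [s /fin_all_exists[Av /fin_all_exists[p HQ]]]] : forall k, exists K s, Q k K s.
  move=> k; rewrite /Q; have [->|ki] := eqVneq k i'.
    exists k2, [::], [:: pw k2; pu k2], (fun x => 1 - val x); rewrite (negbTE ij') addn0; split; split=> //.
    - exact: k2_ok.
    - by move=> x y _; lia.
    - by move=> _; split=> //; congr cons; apply: val_inj.
  have [->|kj] := eqVneq k j'.
    move: HSt => [K [w' [u' [a [b [s [pos [Av0 [[k1 k2 k3 k4 k5] [[m1 m2 m3 m4] [[p1 p2 p3 p4] sm]]]]]]]]]]].
    exists K, s, Av0, (fun x => (pos x).+1); split; split=> //; first by lia.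
    - by rewrite p2.
    - by move=> _; exists w', u', a, b; rewrite p3 p4; split; split.
  have := v4 k (ltn_ord k); rewrite !inE -[k == i :> nat]/(k == i') -[k == j :> nat]/(k == j') (negbTE ki) (negbTE kj).
  move=> /HX[K [s [h1 h2 h3 h4]]]; exists K, s, [:: pw K], (fun _ => 1); split; split=> //; first by rewrite addn0.
  by rewrite mem_head.
have HK k : okp (mD m) (mIn m) (K k) by case: (HQ k) => -[].
have Hm k : markok (pI (K k)) (s k) (Av k) by case: (HQ k) => -[].
have Hw k : pw (K k) \in Av k by case: (HQ k) => -[].
have [W [wI [c [io [s' [[w1 w2 w3 w4] [[g1 g2 g3 g4] [g5 [g6 g7]]]]]]]]] :=
  @wedge_marks P S M A t h q _ K ins HK erefl v1 v2 s Av Hw Hm.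
have [_ [_ _ _ Hi _]] := HQ i'; have {Hi}[iA iB iC] := Hi (eqxx _).
have [_ [_ _ _ _ Hj]] := HQ j'; have {Hj}[w' [u' [a [b [[jA jB jC jD jE] [jF jG jH]]]]]] := Hj (eqxx _).
pose z := io i' (pu (K i')).
have zn : pu (K i') != pw (K i') by apply: (uw HK).
have zc : gadj W z = [:: c] by have [_ h2 _] := g5 i'; rewrite h2 // iA /= g2.
have cz : c != z by rewrite -(g2 i') /z; have [inj _ _] := g5 i'; rewrite (inj_eq inj) eq_sym.
have [injj adj' _] := g5 j'.
have cw : c != io j' w' by rewrite -(g2 j') (inj_eq injj) eq_sym.
have zw : io j' w' != z by apply/eqP => E; move: jB; rewrite (g3 _ _ _ _ E) ?eqxx // eq_sym.
have hom k x y : y \in gadj (pG (K k)) x -> io k y \in gadj W (io k x).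
  have [ea|ne] := eqVneq x (pw (K k)); last by have [_ ad _] := g5 k; move=> hb; rewrite ad // map_f.
  by rewrite ea; case: (HK k) => _ _ _ ->; rewrite inE g2 g1 => /eqP->; apply/mapP; exists k; rewrite ?mem_enum.
have /fin_all_exists[pos Hpos] : forall y, exists r : nat, forall k x, y = io k x -> r = p k x.
  have pw1 k : p k (pw (K k)) = 1 by case: (HQ k) => _ [].
  move=> y; case: (g4 y) => [->|[k [x [xw ->]]]].
    by exists 1 => k x E; have [inj _ _] := g5 k; move: E; rewrite -(g2 k) => /inj <-; rewrite pw1.
  exists (p k x) => l x' E; have [kl|kl] := eqVneq k l; last by rewrite (g3 _ _ _ _ E kl) eqxx in xw.
  by subst l; have [inj _ _] := g5 k; rewrite (inj _ _ E).
have posE k x : pos (io k x) = p k x by apply: Hpos.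
exists (@Piece W wI z c), (io j' w'), (io j' u'), (io j' a), (io j' b), s', pos, (z :: [seq io j' y | y <- Av j']).
split; [|split; [|split]].
- split=> //=; last exact: hom.
    apply: leq_trans w4 _; rewrite addnS ltnS; apply: leq_trans (_ : \sum_k (s0 + (if k == j' then sz else 0)) <= _).
      by apply: leq_sum => k _; case: (HQ k) => -[].
    by rewrite big_split /= -big_mkcond big_pred1_eq sum_nat_const card_ord addnC leq_add2l leq_mul2r v1 orbT.
  by rewrite adj' // jA.
- split=> /=; rewrite ?mem_head ?inE ?(map_f (io j') jC) ?(map_f (io j') jD) ?orbT //.
  apply: g6 => y; rewrite inE => /orP[/eqP->|/mapP[y' hy ->]]; right; by [exists i', (pu (K i'))|exists j', y'].
- split; rewrite ?posE //.
  have L k x y : y \in gadj (pG (K k)) x -> p k y <= (p k x).+1 by case: (HQ k) => _ [+ _ _ _ _]; apply.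
  move=> x y /=; case: (g4 x) => [->|[k [x' [xw ->]]]].
    rewrite g1 => /mapP[k _ ->]; rewrite -(g2 k) !posE; apply: L; case: (HK k) => _ _ _ ->; exact: mem_head.
  by have [_ ad _] := g5 k; rewrite ad // => /mapP[y' hy ->]; rewrite !posE; apply: L.
move=> x hx; have [N1 N2] := g7 _ _ hx.
have {}N1 : nfN m ins [seq x c (io k (pu (K k))) | k <- enum 'I_(size ins)].
  by apply: N1; rewrite !inE negb_or cz cw.
have [hA hB hC] := hx.
have xL k : x c (io k (pu (K k))) \in nfL m.
  have [] // := hA c (io k (pu (K k))); by rewrite g1; apply/mapP; exists k; rewrite ?mem_enum.
have [r1 r2] : R1 (x (io j' (pw (K j'))) (io j' (pu (K j')))) (x (io j' a) (io j' b)) /\ R2 (x (io j' a) (io j' b)) (x (io j' w') (io j' u')).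
  apply: (jH (fun a b => x (io j' a) (io j' b))); apply: N2; first by rewrite mem_head.
  move=> y; rewrite !inE !negb_or => /andP[y1 y2]; rewrite (inj_eq injj) y2 andbT.
  by apply: contraNneq y1 => E; apply/eqP; apply: (g3 _ _ _ _ E); rewrite eq_sym.
split=> //; exists (x c (io j' (pu (K j')))); last by rewrite -(g2 j').
have Cz : c \in gadj W z by rewrite zc mem_head.
have [h2 h3] := hA z c Cz; rewrite /= -h3 rin_relof !xL /=.
apply/hasP; eexists; first apply: (choice_mem xL N1).
  move=> k; have [_ [_ _ h4 _ _]] := HQ k; have := v4 k (ltn_ord k).
  rewrite !inE -[k == i :> nat]/(k == i') -[k == j :> nat]/(k == j').
  have [_ ->|ki] := eqVneq k i'; first by rewrite encK.
  have [_ ->|kj _] := eqVneq k j'; first by rewrite encK.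
  rewrite -[c in x c _](g2 k); apply: (h4 ki kj (fun a b => x (io k a) (io k b))); apply: N2; first by rewrite mem_head.
  move=> y; rewrite !inE !negb_or => y1; apply/andP; split; apply: contraNneq y1 => E; apply/eqP; exact: (g3 _ _ _ _ E).
by rewrite encK -[i]/(val i') -[j]/(val j') !(enum_nth 0 (fun k => x c (io k (pu (K k))))) !eqxx.
Qed.

Definition chainR l R1 : nat -> nat -> Prop := foldr (fun a R => stp R a) R1 l.

Lemma State_steps sz len qm R1 R2 X s0 l : (forall z, z \in X -> Real (unl z) s0) -> 2 <= s0 -> (forall a, a \in l -> isnode m X a) ->
  State sz len qm R1 R2 -> State (sz + size l * (mD m * s0).+1) (size l + len) (size l + qm) (chainR l R1) R2.
Proof.
move=> HX h2 + H; elim: l => [|a l IH] hl; first by rewrite mul0n addn0.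
have {}IH := IH (fun b hb => hl b (mem_behead (s := a :: l) hb)).
have := State_step HX h2 (hl a (mem_head _ _)) IH.
by rewrite /= -addnA -mulSnr.
Qed.

Lemma chainR_cat l1 l2 R : chainR (l1 ++ l2) R = chainR l1 (chainR l2 R).
Proof. by rewrite /chainR foldr_cat. Qed.
Lemma chainR_mid l (R1 : nat -> nat -> Prop) s y z : chainR l (fun y z => z = y) s y -> R1 y z -> chainR l R1 s z.
Proof. by elim: l s => [|a l IH] s /=; [move=> ->|move=> [s2 h1 /IH h2] /h2 h3; exists s2]. Qed.
Lemma chainR_prod X l s y : (forall a, a \in l -> isnode m X a) -> s \in nfL m -> chainR l (fun y z => z = y) s y ->
  rin (prodrel m l) s (flip y).
Proof.
elim: l s => [|a l IH] s hl sL /=.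
  by move=> ->; rewrite /rel0 rin_relof sL flipL ?eqxx.
move=> [s2 h1 h2]; have [ins [Ss [i [j [_ _ _ _ Ea]]]]] := hl a (mem_head _ _).
have [f1 f2] : flip s \in nfL m /\ s2 \in nfL m by move: h1; rewrite Ea rin_relof => /and3P[].
have h3 := IH s2 (fun b hb => hl b (mem_behead (s := a :: l) hb)) f2 h2.
have h4 : flip y \in nfL m by have [] := rinL (isrel_prod m l) h3.
apply/rcompP; exists (flip s); split=> //; first by rewrite /rel0 rin_relof sL f1 eqxx.
by apply/rcompP; exists s2.
Qed.

(** By classical logic, a property of the entries of a finite list becomes boolean; the classes and
    layers defined by realizability can then be written as filters. *)
Lemma ex_filter (T : eqType) (Q : T -> Prop) (s : seq T) : exists p : pred T, forall z, z \in s -> (p z <-> Q z).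
Proof.
elim: s => [|a s [p IH]]; first by exists predT.
have [Qa|Qa] := Classical_Prop.classic (Q a).
  exists (fun z => (z == a) || p z) => z; rewrite inE; have [->//|ne] := eqVneq z a; exact: IH.
exists (fun z => (z != a) && p z) => z; rewrite inE; have [->//|ne] := eqVneq z a; exact: IH.
Qed.

Hypothesis Hsol : solves_upto P n A t h.
Hypothesis n2 : 2 <= n.
Hypothesis hq : 2 * size (nfL m) < q.

(** A run succeeds with probability at least 1/2 and then shows one of [size (nfL m)] labels, so one
    of them is shown with probability at least [1/q]. *)
Lemma likely (G : graph) (inp : labeling G) a b : valid_instance P G inp -> gN G <= n -> b \in gadj G a ->
  exists2 y, y \in nfL m & #|[set: {ffun 'I_(gN G) -> h.-tuple bool}]| <= #|Mk inp (a, b, y)| * q.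
Proof.
move=> VI hn hb; have [E [h1 h2]] := valid_prob Hsol VI hn.
have O0 := Om_gt0 h G.
have [/hasP[y yL hy]|/hasPn no] := boolP (has (fun y => #|[set: {ffun 'I_(gN G) -> h.-tuple bool}]| <= #|Mk inp (a, b, y)| * q) (nfL m)).
  by exists y.
exfalso; have sub : #|E| <= \sum_(y <- nfL m) #|Mk inp (a, b, y)|.
  have le1 : forall r : seq nat, #|\bigcup_(v <- r) Mk inp (a, b, v)| <= \sum_(v <- r) #|Mk inp (a, b, v)|.
    elim=> [|v r IH]; first by rewrite big_nil cards0.
    by rewrite !big_cons; apply: leq_trans (leq_card_setU _ _) _; rewrite leq_add2l.
  apply: leq_trans (le1 _); apply: subset_leq_card; apply/subsetP => rb /h1 /(_ a) /andP[_ /allP/(_ b hb) hL].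
  have : rb \in Mk inp (a, b, rx P A t inp rb a b) by rewrite inE.
  elim: (nfL m) hL => // v r IH; rewrite inE big_cons in_setU => /orP[/eqP<- ->//|/IH h3 /h3 ->]; by rewrite orbT.
have bd : (\sum_(y <- nfL m) #|Mk inp (a, b, y)|) * q <= size (nfL m) * (#|[set: {ffun 'I_(gN G) -> h.-tuple bool}]|).-1.
  elim: (nfL m) no => [|y l IH] no; first by rewrite big_nil mul0n.
  rewrite big_cons mulnDl mulSn; apply: leq_add; last by apply: IH => z hz; apply: no; rewrite inE hz orbT.
  by have := no y (mem_head _ _); rewrite -ltnNge; move: O0; lia.
move: h2 sub bd hq O0 n2; clear; generalize (\sum_(y <- nfL m) #|Mk inp (a, b, y)|) (size (nfL m)).
move=> sg l; have ar : forall e o, n.-1 * o <= n * e -> e <= sg -> sg * q <= l * o.-1 -> 2 * l < q -> 0 < o -> 2 <= n -> False.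
  move=> e o h1 h2 h3 h4 h5 h6.
  have h7 : o <= 2 * e.
    have p1 : 0 < n.-1 by lia.
    have p2 : n * e <= n.-1 * 2 * e by rewrite leq_mul2r; apply/orP; right; lia.
    by rewrite -(leq_pmul2l p1); lia.
  have h8 : sg * (2 * l) <= sg * q by rewrite leq_mul2l (ltnW h4) orbT.
  have h9 : e * (2 * l) <= sg * (2 * l) by rewrite leq_mul2r h2 orbT.
  have h10 : o * l <= 2 * e * l by rewrite leq_mul2r h7 orbT.
  have h11 : o * l = l * o.-1 + l by case: (o) h5 => // o' _; rewrite mulnC mulnS addnC.
  have [l0|l0] := posnP l; last by lia.
  have : sg * q <= 0 by move: h3; rewrite l0.
  by rewrite leqn0 muln_eq0 => /orP[]/eqP; lia.
exact: ar.
Qed.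
End Real.

Section Pump.
Variable m : nat.

Lemma prod_congr x y d : prodrel m x = prodrel m y -> prodrel m (x ++ d) = prodrel m (y ++ d).
Proof. by case: d => [|a d]; rewrite ?cats0 // !prodrel_cat => ->. Qed.

(* Some proper infix of a long word can be repeated without changing the product. *)
Lemma pump X l N : ellm m <= size l -> (forall a, a \in l -> isnode m X a) ->
  exists l', [/\ prodrel m l' = prodrel m l, (forall a, a \in l' -> isnode m X a), N <= size l' & size l' <= N.+1 * size l].
Proof.
move=> hl HX; pose prs := pairsu (nfL m) (nfL m).
have sp : size prs = size (nfL m) * size (nfL m).
  rewrite /prs; elim: {1 3}(nfL m) => //= a s IH; by rewrite size_cat size_map IH mulSn.
(* A prefix is coded by the characteristic tuple of its product; there are more prefixes than
   tuples. *)
pose code (i : 'I_(size l).+1) : (size prs).-tuple bool :=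
  [tuple of [seq z \in prodrel m (take i l) | z <- in_tuple prs]].
have [I|] := boolP (injectiveb code).
  have /leq_card := injectiveP _ I; rewrite card_ord card_tuple card_bool sp.
  by move: hl; rewrite ellmE; lia.
move=> /injectivePn[i0 [j0 ne E0]].
wlog ij : i0 j0 ne E0 / i0 < j0 => [W|].
  by case: (ltngtP i0 j0) => [?|?|/val_inj E]; [exact: (W i0 j0)|apply: (W j0 i0); rewrite // eq_sym|rewrite E eqxx in ne].
have E : prodrel m (take i0 l) = prodrel m (take j0 l).
  apply: isrel_eq; try exact: isrel_prod.
  move=> x y xL yL; rewrite /rin; have := congr1 val E0 => /= /eq_in_map; apply.
  by apply/pairsuP; exists x, y.
have jl : j0 <= size l by rewrite -ltnS.
set al := take i0 l in E; set be := drop i0 (take j0 l); set ga := drop j0 l.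
have Eab : al ++ be = take j0 l by rewrite /al -(@take_takel _ i0 j0) ?cat_take_drop // ltnW.
have El : l = al ++ be ++ ga by rewrite catA Eab cat_take_drop.
have sb : 0 < size be by rewrite size_drop size_takel // subn_gt0.
have P1 : prodrel m (al ++ be) = prodrel m al by rewrite Eab E.
have Sz : size (iter N (cat be) (be ++ ga)) = N * size be + (size be + size ga).
  by elim: N => [|N IH] /=; rewrite size_cat // IH mulSn addnA.
have sl : size l = size al + (size be + size ga) by rewrite {1}El !size_cat.
exists (al ++ iter N (cat be) (be ++ ga)); split.
- elim: N {Sz} => [|N IH] /=; first by rewrite -El.
  by rewrite catA (prod_congr _ P1).
- move=> a; rewrite mem_cat => /orP[ha|]; first by apply: HX; rewrite El mem_cat ha.
  elim: N {Sz} => [|N IH] /=; rewrite mem_cat => /orP[ha|ha]; try (by apply: HX; rewrite El !mem_cat ha !orbT).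
  exact: IH.
- rewrite size_cat Sz; move: sb; generalize (size be); nia.
- rewrite size_cat sl Sz mulSn !mulnDr.
  have ar a b c x y z : a + (y + (b + c)) <= a + (b + c) + (x + (y + z)) by clear; lia.
  exact: ar.
Qed.
End Pump.

Section Real.
Variables (P : LCL) (n : nat) (S M : Type) (A : mp_alg (seq bool * seq nat) S M) (t h q : nat).
Local Notation m := (enc_lcl P).
Local Notation h0 := (lrad P + t).+1.
Local Notation HH := (HH P t).
Local Notation Mk := (@Mk P S M A t h).
Local Notation Real := (@Real P S M A t h q).
Local Notation markok := (@markok P S M A t h q).
Hypothesis Hsol : solves_upto P n A t h.
Hypothesis n2 : 2 <= n.
Hypothesis hq : 2 * size (nfL m) < q.

Lemma bl_pos (G : graph) (pos : 'I_(gN G) -> nat) : simple_graph G ->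
  (forall x y, y \in gadj G x -> pos y <= (pos x).+1) -> forall d a y, y \in bl d a -> pos y <= pos a + d /\ pos a <= pos y + d.
Proof.
move=> HS Hp; elim=> [|d IH] a y.
  by rewrite inE => /eqP->; rewrite addn0.
rewrite inE => /orP[/eqP->|/flattenP[l /mapP[b hb ->]] /IH[h1 h2]]; first by split; lia.
by have h3 := Hp _ _ hb; have h4 := Hp _ _ (adj_sym HS hb); split; lia.
Qed.

(** The pinned label [y] decouples the ends: labels related to [y] through [l1] at one end combine
    with all labels related to it through [l2] at the other. One caterpillar with one pin, seen from
    either end, realizes both classes. *)
Lemma real_cut2 X s0 l1 l2 : (forall z, z \in X -> Real (unl z) s0) -> 2 <= s0 -> (forall a, a \in l1 ++ l2 -> isnode m X a) ->
  HH < size l1 -> HH <= size l2 ->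
  2 + size (l1 ++ l2) * (mD m * s0).+1 <= n ->
  exists p1 p2 : pred nat, [/\ Real (filter p1 (nfL m)) (2 + size (l1 ++ l2) * (mD m * s0).+1),
    Real (filter p2 (nfL m)) (2 + size (l1 ++ l2) * (mD m * s0).+1) &
    forall s z, s \in filter p1 (nfL m) -> z \in filter p2 (nfL m) -> rin (prodrel m (l1 ++ l2)) s z].
Proof.
move=> HX s02 Hl hl1 hl2 hn.
have Hl1 a : a \in l1 -> isnode m X a by move=> ha; apply: Hl; rewrite mem_cat ha.
have Hl2 a : a \in l2 -> isnode m X a by move=> ha; apply: Hl; rewrite mem_cat ha orbT.
have [D0 I0] : 0 < mD m /\ 0 < mIn m.
  case: l1 hl1 Hl1 {Hl hn} => // a l1 _ /(_ a (mem_head _ _))[ins [Ss [i [j [/vnodeP[v1 v2 _ _] _ il _ _]]]]].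
  split; first by apply: leq_trans v1; apply: (leq_ltn_trans _ il).
  by apply: leq_ltn_trans (v2 _ (mem_nth 0 il)).
have St1 := State_switch (State_steps HX s02 Hl2 (State_base A t h q D0 I0)).
have := State_steps HX s02 Hl1 St1; rewrite addn0 -addnA -mulnDl [size l2 + size l1]addnC -size_cat.
set sz := 2 + _ in hn *; set RR := fun y z => exists2 y', _ & _.
move=> [K [w' [u' [a [b [s [pos [Av [[k1 k2 k3 k4 k5] [[m1 m2 m3 m4] [[p1 p2 p3 p4] sm]]]]]]]]]]].
have [kT kD kI kw] := k1.
have HS : simple_graph (pG K) by case: kT.
have VI : valid_instance P (pG K) (pI K).
  by move: kD kI; rewrite /mD /mIn !fldE /= => kD kI; split.
have [y yL hy] := likely Hsol n2 hq VI (leq_trans k2 hn) k5.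
have [o1 o2 o3 o4] := m4.
have mk (Av' : seq 'I_(gN (pG K))) : (forall v, v \in Av' -> v \in Av /\ v \notin bl HH a) -> markok (pI K) ((a, b, y) :: s) Av'.
  move=> H; split.
  - by move=> e; rewrite inE => /orP[/eqP->|/o1].
  - move=> e v; rewrite inE => /orP[/eqP->|he] /H[] //=; by move=> hv _; apply: o2.
  - rewrite pairwise_cons o3 andbT; apply/allP => e he; rewrite (farb_sym VI); by apply: o2.
  - by move=> e; rewrite inE => /orP[/eqP->|/o4].
have [q1 hq1] := ex_filter (fun x => chainR l1 (fun y z => z = y) x y) (nfL m).
have [q2 hq2] := ex_filter (fun z => RR y z) (nfL m).
have fw : pw K \notin bl HH a by apply/negP => /(bl_pos HS p1); lia.
have fw' : w' \notin bl HH a by apply/negP => /(bl_pos HS p1); lia.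
have sl Wo x : (forall v, v \in Wo -> v \in [:: pw K; w']) -> sol P (pI K) Wo ((a, b, y) :: s) x ->
   [/\ chainR l1 (fun y z => z = y) (x (pw K) (pu K)) y, RR y (x w' u'), x (pw K) (pu K) \in nfL m & x w' u' \in nfL m].
  move=> H [x1 x2 x3]; have xy : x a b = y by apply: (x3 (a, b, y)); rewrite mem_head.
  have [|c1 c2] := sm x.
    split=> //; last by move=> e he; apply: x3; rewrite inE he orbT.
    by move=> v hv; apply: x2; apply: contraNN hv; apply: H.
  rewrite xy in c1 c2; split=> //.
    by have [] // := x1 (pw K) (pu K); rewrite kw mem_head.
  by have [] // := x1 w' u'; rewrite k3 mem_head.
exists q1, q2; split.
- exists K, ((a, b, y) :: s); split=> //; first by apply: mk => v; rewrite inE => /eqP->.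
  move=> x /sl[|c1 _ c3 _]; first by move=> v; rewrite !inE => ->.
  by rewrite mem_filter c3 andbT; apply/hq1.
- exists (@Piece (pG K) (pI K) w' u'), ((a, b, y) :: s); split=> //=; first by apply: mk => v; rewrite inE => /eqP->.
  move=> x /sl[|_ c1 _ c3]; first by move=> v; rewrite !inE => ->; rewrite orbT.
  by rewrite mem_filter c3 andbT; apply/hq2.
- move=> x z; rewrite mem_filter => /andP[+ xL] => /(hq1 _ xL) c1.
  rewrite mem_filter => /andP[+ zL] => /(hq2 _ zL)[y' c2 c3].
  rewrite c3; apply: (chainR_prod Hl xL); rewrite chainR_cat; exact: chainR_mid c2.
Qed.

(** Pumping beyond length [2 * HH] keeps the relation and makes room for a pin that is farther than
    [HH] from both ends. *)
Theorem real_cut X s0 l : (forall z, z \in X -> Real (unl z) s0) -> 2 <= s0 -> (forall a, a \in l -> isnode m X a) ->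
  ellm m <= size l -> 
  2 + (2 * HH + 2) * size l * (mD m * s0).+1 <= n ->
  exists p1 p2 : pred nat, [/\ Real (filter p1 (nfL m)) (2 + (2 * HH + 2) * size l * (mD m * s0).+1),
    Real (filter p2 (nfL m)) (2 + (2 * HH + 2) * size l * (mD m * s0).+1) &
    forall s z, s \in filter p1 (nfL m) -> z \in filter p2 (nfL m) -> rin (prodrel m l) s z].
Proof.
move=> HX s02 Hl hl hn; have [l' [<- e2 e3 e4]] := pump (2 * HH).+1 hl Hl.
have le : 2 + size l' * (mD m * s0).+1 <= 2 + (2 * HH + 2) * size l * (mD m * s0).+1.
  by rewrite leq_add2l leq_mul2r addn2 e4 orbT.
have E : l' = take HH.+1 l' ++ drop HH.+1 l' by rewrite cat_take_drop.
have [||||p1 [p2 [r1 r2 r3]]] := @real_cut2 X s0 (take HH.+1 l') (drop HH.+1 l') HX s02; rewrite -?E //.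
- by rewrite size_takel //; apply: leq_trans e3; lia.
- move: e3; rewrite size_drop; have ar a b : 2 * a < b -> a <= b - a.+1 by clear; lia.
  exact: ar.
- exact: leq_trans le hn.
exists p1, p2; rewrite -E in r1 r2 r3; split=> //; [exact: (Real_mono (fun _ => id) le r1)|exact: (Real_mono (fun _ => id) le r2)].
Qed.
End Real.

(** * Extraction of a certificate *)

Lemma sub_in_count (T : eqType) (p p' : pred T) s : (forall x, x \in s -> p x -> p' x) -> count p s <= count p' s.
Proof.
elim: s => //= a s IH H; apply: leq_add; last by apply: IH => x xs; apply: H; rewrite inE xs orbT.
by have := H a (mem_head _ _); case: (p a) => // ->.
Qed.
Lemma eq_in_count_sub (T : eqType) (p p' : pred T) s : (forall x, x \in s -> p x -> p' x) -> count p' s <= count p s ->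
  forall x, x \in s -> p' x -> p x.
Proof.
elim: s => //= a s IH H le x.
have H' y : y \in s -> p y -> p' y by move=> ys; apply: H; rewrite inE ys orbT.
have := sub_in_count H'; have := H a (mem_head _ _); rewrite inE; move: le.
case p'a : (p' a) => /=; case pa: (p a) => //= le h1 h2.
- by case/orP => [/eqP->//|xs]; apply: IH.
- by lia.
- by have := h1 isT.
- by case/orP => [/eqP->|xs]; rewrite ?p'a //; apply: IH.
Qed.

Section Chain.
Variables (P : LCL) (n : nat) (S M : Type) (A : mp_alg (seq bool * seq nat) S M) (t h q : nat).
Local Notation m := (enc_lcl P).
Local Notation HH := (HH P t).
Local Notation Real := (@Real P S M A t h q).
Local Notation D := (mD m).
Local Notation U := (sublists (nfL m)).
Hypothesis Hsol : solves_upto P n A t h.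
Hypothesis hq : 2 * size (nfL m) < q.

(** The size bound of [real_closed], increased by [s] to make it monotone. *)
Definition grow s := s + (D * s).+1.
Definition cs0 := D.+2 ^ (size U).+1.
(** The growth per layer without the factor [t.+1]. In [cutsz_le] the pumped path needs 20 of the 23
    units, the rest covers [s + 2]. *)
Definition cs1 := cs0 * (23 * (lrad P).+1 * ellm m * D.+1).
Definition cutsz s := s + 2 + (2 * HH + 2) * (2 * ellm m) * (D * s).+1.

Lemma iter_grow i s : 0 < s -> s <= iter i grow s <= D.+2 ^ i * s.
Proof.
move=> s0; elim: i => [|i /andP[h1 h2]]; first by rewrite mul1n leqnn.
rewrite iterS /grow expnS; set y := iter i grow s in h1 h2 *; apply/andP; split; first by apply: leq_trans h1 _; apply: leq_addr.
apply: leq_trans (_ : D.+2 * y <= _); last by rewrite -mulnA leq_mul2l h2 orbT.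
by rewrite !mulSn; lia.
Qed.

(** As long as growing adds a realizable class, their number increases; it is bounded by [size U],
    so one of the first [size U + 1] sizes is stationary. *)
Lemma stall s : 2 <= s -> exists s' (p : pred nat), [/\ s <= s', s' <= cs0 * s,
  (forall z, z \in U -> (p z <-> Real (unl z) s')) & forall z, z \in U -> Real (unl z) (grow s') -> Real (unl z) s'].
Proof.
move=> s2; have s0 : 0 < s by apply: leq_trans s2.
have [//|no] := Classical_Prop.classic (exists s' (p : pred nat), [/\ s <= s', s' <= cs0 * s,
  (forall z, z \in U -> (p z <-> Real (unl z) s')) & forall z, z \in U -> Real (unl z) (grow s') -> Real (unl z) s']).
have H i : i <= (size U).+1 -> exists p : pred nat, (forall z, z \in U -> (p z <-> Real (unl z) (iter i grow s))) /\ i <= size (filter p U).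
  elim: i => [|i IH] hi.
    by have [p hp] := ex_filter (fun z => Real (unl z) s) U; exists p.
  have [p [hp hs]] := IH (ltnW hi); have [p' hp'] := ex_filter (fun z => Real (unl z) (iter i.+1 grow s)) U.
  exists p'; split=> //.
  have sub' z : z \in U -> p z -> Real (unl z) (iter i.+1 grow s).
    move=> zU /(hp z zU); apply: Real_mono => //; by rewrite iterS leq_addr.
  apply: leq_ltn_trans hs _; rewrite ltnNge; apply/negP => hle; apply: no.
  have /andP[i1 i2] := iter_grow i s0.
  exists (iter i grow s), p; split=> //.
    by apply: leq_trans i2 _; rewrite leq_mul2r; apply/orP; right; rewrite /cs0 leq_exp2l // ltnW.
  move=> z zU /(hp' z zU) pz; apply/(hp z zU); apply: (eq_in_count_sub (p' := p')) zU pz => //.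
    by move=> x xU px; apply/(hp' x xU); apply: sub'.
  by rewrite -!size_filter.
have [p [_ h1]] := H _ (leqnn _).
by exfalso; move: h1; rewrite size_filter ltnNge count_size.
Qed.

Definition bnd i := 2 * cs0 * (cs1 * t.+1) ^ i.

Lemma cutsz_le s : 2 <= s -> cs0 * cutsz s <= cs1 * t.+1 * s.
Proof.
move=> s2; rewrite /cs1 -!mulnA leq_mul2l; apply/orP; right.
have e0 : 0 < ellm m by apply: ellm_gt0.
have a1 : 2 * HH + 2 <= 10 * (lrad P).+1 * t.+1 by rewrite /HH; nia.
have a2 : (D * s).+1 <= D.+1 * s by rewrite mulSn; lia.
apply: leq_trans (_ : s + 2 + 10 * (lrad P).+1 * t.+1 * (2 * ellm m) * (D.+1 * s) <= _).
  by rewrite leq_add2l; apply: leq_mul => //; rewrite leq_mul2r a1 orbT.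
have a3 : s <= (lrad P).+1 * t.+1 * ellm m * (D.+1 * s) by rewrite mulnA leq_pmull // !muln_gt0 e0.
move: a3; set y := _ * _ * _ * _ => a3.
have -> : 23 * ((lrad P).+1 * (ellm m * (D.+1 * (t.+1 * s)))) = 23 * y by rewrite /y; lia.
have -> : 10 * (lrad P).+1 * t.+1 * (2 * ellm m) * (D.+1 * s) = 20 * y by rewrite /y; lia.
by lia.
Qed.

Lemma layers k : exists (sg : nat -> nat) (p : nat -> pred nat),
  (forall i, i <= k -> [/\ 2 <= sg i, sg i <= bnd i, (forall z, z \in U -> (p i z <-> Real (unl z) (sg i))) &
     forall z, z \in U -> Real (unl z) (grow (sg i)) -> Real (unl z) (sg i)]) /\
  (forall i, i < k -> cutsz (sg i) <= sg i.+1).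
Proof.
elim: k => [|k [sg [p [H1 H2]]]].
  have [s [p [h1 h2 h3 h4]]] := stall (leqnn 2).
  exists (fun _ => s), (fun _ => p); split=> // i; rewrite leqn0 => /eqP->; split=> //.
  by rewrite /bnd muln1 mulnC.
have [h1 h2 h3 h4] := H1 k (leqnn k).
have [s [p' [k1 k2 k3 k4]]] := stall (leq_trans (leq_addl _ _) (leq_addr _ _) : 2 <= cutsz (sg k)).
exists (fun i => if i == k.+1 then s else sg i), (fun i => if i == k.+1 then p' else p i); split.
  move=> i; rewrite leq_eqVlt => /orP[/eqP->|hi]; last by rewrite ltn_eqF //; apply: H1.
  rewrite eqxx; split=> //; first by apply: leq_trans k1; rewrite /cutsz; lia.
  apply: leq_trans k2 _; apply: leq_trans (cutsz_le h1) _.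
  by rewrite /bnd expnS mulnCA leq_mul2l h2 orbT.
move=> i hi; rewrite ltn_eqF //; have [->|ne] := eqVneq i k; first by rewrite eqxx.
by rewrite eqSS (negbTE ne); apply: H2; lia.
Qed.

(** Layer [i] consists of all classes realizable with [sg i] nodes. It is closed because [sg i] is
    stationary under [grow], it is cut into the next layer because [sg i.+1] has room for the pumped
    path, and roots exist because a join of trees for layer [k] still has size below [n / q]. *)
Theorem rand_good k : bnd k * D.+1 * q < n -> good m k 0.
Proof.
move=> hn; have [sg [p [H1 H2]]] := layers k.
have q0 : 0 < q by apply: leq_trans hq.
have p0 : 0 < cs0 by rewrite expn_gt0.
have p1 : 0 < cs1 * t.+1 by rewrite !muln_gt0 p0 ellm_gt0.
have n2 : 2 <= n.
  apply: leq_ltn_trans hn; rewrite /bnd !muln_gt0 p0 q0 expn_gt0 p1 //.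
have bmono i : i <= k -> bnd i <= n.
  move=> hi; apply: leq_trans (ltnW hn); rewrite -mulnA; apply: leq_trans (_ : bnd k <= _); last by apply: leq_pmulr; rewrite muln_gt0 q0.
  by rewrite /bnd leq_mul2l leq_pexp2l // orbT.
pose X i := filter (p i) U.
have memX i z : i <= k -> z \in X i -> Real (unl z) (sg i).
  by move=> hi; rewrite mem_filter => /andP[h1 h2]; have [_ _ h3 _] := H1 i hi; apply/(h3 z h2).
have inX i r : i <= k -> Real (filter r (nfL m)) (sg i) -> enc_list (filter r (nfL m)) \in X i.
  move=> hi h1; rewrite mem_filter mem_sublists andbT; have [_ _ h3 _] := H1 i hi.
  by apply/h3; rewrite ?mem_sublists // encK.
pose Xs := [seq enc_list (X i) | i <- iota 0 k.+1].
have layE i : i <= k -> lay Xs k i = X i.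
  move=> hi; rewrite /lay /Xs; case: ltnP => h'; rewrite (nth_map 0) ?size_iota ?nth_iota ?encK //.
  by congr X; lia.
apply/hasP; exists (enc_list Xs).
  apply/listsnP; exists Xs; split=> //; first by rewrite size_map size_iota.
  by move=> z /mapP[i _ ->]; apply: mem_sublists.
rewrite encK; apply/and4P; split.
- apply/allP => i; rewrite mem_iota => /= hi; rewrite layE //.
  apply/allP => ic _; apply/allP => sc _; apply/allP => j; rewrite mem_iota => /= hj.
  case V : (vnode _ _ _ _ _) => //=; apply: inX => //.
  have [h1 h2 h3 h4] := H1 i hi.
  have := real_closed (fun z => memX i z hi) h1 V hj => R.
  have := h4 (enc_list (nodecls m (unl ic) (unl sc) j)) (mem_sublists _ _); rewrite encK; apply.
  by apply: Real_mono R => //; rewrite /grow leq_addl.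
- rewrite addn0; apply/allP => i; rewrite mem_iota => /= hi; rewrite (layE i (ltnW hi)) (layE i.+1 hi).
  have hi' := ltnW hi; have [h1 h2 h3 h4] := H1 i hi'; have hc := H2 i hi.
  apply/allP => ln; rewrite mem_iota => /andP[ln1 ln2]; apply/allP => r /wordsP[rr [[l [l1 l2 ->]] ->]].
  have sz : 2 + (2 * HH + 2) * size l * (D * sg i).+1 <= sg i.+1.
    apply: leq_trans hc; rewrite /cutsz -addnA; apply: leq_trans (leq_addl _ _); rewrite leq_add2l leq_mul2r leq_mul2l l1; apply/orP; right; apply/orP; right; lia.
  have [_ b2 _ _] := H1 i.+1 hi.
  have [||r1 [r2 [g1 g2 g3]]] := real_cut Hsol n2 hq (fun z => memX i z hi') h1 l2; first by rewrite l1.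
    by apply: leq_trans sz _; apply: leq_trans b2 _; apply: bmono.
  apply/hasP; exists (enc_list (filter r1 (nfL m))); first by apply: inX => //; apply: Real_mono g1.
  apply/hasP; exists (enc_list (filter r2 (nfL m))); first by apply: inX => //; apply: Real_mono g2.
  rewrite !encK; apply/allP => x hx; apply/allP => y hy; exact: g3.
- apply/allP => i; rewrite mem_iota => /= hi; rewrite (layE i (ltnW hi)) (layE i.+1 hi); apply/allP => z hz.
  have hi' := ltnW hi; have hR := memX i z hi' hz; have hc := H2 i hi.
  have [_ _ h3 _] := H1 i.+1 hi; move: hz; rewrite !mem_filter => /andP[_ zU]; rewrite zU andbT.
  apply/(h3 z zU); apply: Real_mono hR => //; by apply: leq_trans hc; rewrite /cutsz -addnA leq_addr.
- rewrite layE //; apply/allP => ic _; apply/allP => sc _; case V : (vnode _ _ _ _ _) => //=.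
  have [h1 h2 h3 h4] := H1 k (leqnn k).
  apply: (real_root Hsol (fun z => memX k z (leqnn k)) q0 _ V).
  apply: leq_ltn_trans hn; rewrite leq_mul2r; apply/orP; right.
  have h5 : D * sg k <= bnd k * D by rewrite [bnd k * D]mulnC leq_mul2l h2 orbT.
  by rewrite mulnS; lia.
Qed.
End Chain.

(** * Asymptotic comparisons *)

Section Reals.
Open Scope R_scope.
Lemma INR_expn a k : INR (expn a k) = (INR a ^ k).
Proof. by elim: k => [//|k IH]; rewrite expnS mult_INR IH. Qed.
Lemma INR_leq a b : (a <= b)%N -> INR a <= INR b.
Proof. by move=> h; apply: le_INR; lia. Qed.
Lemma INR_ltn a b : (a < b)%N -> INR a < INR b.
Proof. by move=> h; apply: lt_INR; lia. Qed.
Lemma ltn_INR a b : INR a < INR b -> (a < b)%N.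
Proof. by move=> /INR_lt; lia. Qed.

Lemma Rpower_inv_pow n k : (0 < n)%N -> (0 < k)%N -> (rpowk n k ^ k) = INR n.
Proof.
move=> hn hk; have n0 := INR_ltn hn; have k0 := INR_ltn hk; rewrite /= in n0 k0.
rewrite /rpowk -Rpower_pow; last by apply: exp_pos.
by rewrite Rpower_mult Rinv_l ?Rpower_1 //; lra.
Qed.

Lemma nat_above (x : R) : exists n, x < INR n /\ (0 < n)%N.
Proof.
have [h1 h2] := archimed x; exists (BinInt.Z.to_nat (up x)).+1.
split=> //; rewrite S_INR INR_IZR_INZ; have : BinInt.Z.le (up x) (BinInt.Z.of_nat (BinInt.Z.to_nat (up x))) by lia.
by move/IZR_le; lra.
Qed.

Lemma rpowk_unbounded k B : (0 < k)%N -> exists n1, forall n, (n1 <= n)%N -> (0 < n)%N /\ B <= rpowk n k.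
Proof.
move=> hk; have [n1 [h1 n10]] := nat_above (Rmax B 1 ^ k); exists n1 => n hn.
have n0 : (0 < n)%N by apply: leq_trans hn.
split=> //; apply: Rnot_lt_le => hlt; have h2 := INR_leq hn.
have x0 : 0 < rpowk n k by apply: exp_pos.
have : (rpowk n k ^ k <= Rmax B 1 ^ k).
  by apply: pow_incr; split; [lra|have := Rmax_l B 1; lra].
by rewrite Rpower_inv_pow //; lra.
Qed.

Lemma little_o_large k t C c : (0 < k)%N -> little_o_root k t -> exists n, (C * (c * (t n).+1) ^ k < n)%N.
Proof.
move=> hk ho; have C0 := pos_INR C; have c0 := pos_INR c.
pose eps := / (2 * (INR c + 1) * (INR C + 1)).
have e0 : 0 < eps by apply: Rinv_0_lt_compat; nra.
have [n0 h0] := ho eps e0; have [n1 h1] := rpowk_unbounded (/ eps) hk.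
pose n := maxn n0 n1; exists n; have [np hx] := h1 n (leq_maxr _ _); have ht := h0 n (leq_maxl _ _).
set x := rpowk n k in hx ht.
have x1 : 1 <= eps * x.
  by apply: (Rmult_le_reg_l (/ eps)); [apply: Rinv_0_lt_compat|rewrite -Rmult_assoc Rinv_l; lra].
have h2 : INR (c * (t n).+1) <= x / (INR C + 1).
  rewrite mult_INR S_INR; apply: Rle_trans (_ : (INR c + 1) * (2 * (eps * x)) <= _).
    by apply: Rmult_le_compat; try lra; have := pos_INR (t n); lra.
  by right; rewrite /eps; field; lra.
have p := Rpower_inv_pow np hk; rewrite -/x in p.
have h3 : INR ((c * (t n).+1) ^ k) <= INR n / (INR C + 1).
  rewrite INR_expn; apply: Rle_trans (_ : (x / (INR C + 1)) ^ k <= _).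
    by apply: pow_incr; split=> //; apply: pos_INR.
  rewrite Rpow_mult_distr p; apply: Rmult_le_compat_l; first exact: pos_INR.
  rewrite -[X in _ <= X]Rmult_1_r; case: (k) hk => // k' _ /=.
  apply: Rmult_le_compat_l; first by left; apply: Rinv_0_lt_compat; lra.
  have i1 : / (INR C + 1) <= 1 by rewrite -Rinv_1; apply: Rinv_le_contravar; lra.
  have i0 : 0 < / (INR C + 1) by apply: Rinv_0_lt_compat; lra.
  by elim: k' => /= [|k' IH]; [lra|have := pow_lt _ k' i0; nra].
apply: ltn_INR; rewrite mult_INR; have n0' := INR_ltn np; rewrite /= in n0'.
apply: Rle_lt_trans (_ : INR C * (INR n / (INR C + 1)) < _); first exact: Rmult_le_compat_l.
apply: (Rmult_lt_reg_r (INR C + 1)); first lra.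
have -> : INR C * (INR n / (INR C + 1)) * (INR C + 1) = INR C * INR n by field; lra.
by nra.
Qed.

Lemma subpoly_little_o k t : (0 < k)%N -> subpoly t -> little_o_root k t.
Proof.
move=> hk hs eps e0.
have k0 := INR_ltn hk; rewrite /= in k0.
have k2 : (0 < 2 * k)%N by rewrite muln_gt0.
have [n0 h0] := hs (/ INR (2 * k)) ltac:(apply: Rinv_0_lt_compat; have := INR_ltn k2; rewrite /=; lra).
have [n1 h1] := rpowk_unbounded (/ eps) k2.
exists (maxn n0 n1) => n hn; have [np hx] := h1 n (leq_trans (leq_maxr _ _) hn).
have := h0 n (leq_trans (leq_maxl _ _) hn); rewrite -/(rpowk n (2 * k)); set y := rpowk n (2 * k) in hx *.
have -> : rpowk n k = y * y.
  rewrite /y /rpowk -Rpower_plus; congr Rpower.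
  by rewrite mult_INR; have -> : INR 2 = 2 by []; field; lra.
have y0 : 0 < y by apply: exp_pos.
move=> ht; apply: Rle_trans ht _.
have : 1 <= eps * y by apply: (Rmult_le_reg_l (/ eps)); [apply: Rinv_0_lt_compat|rewrite -Rmult_assoc Rinv_l; lra].
by nra.
Qed.
End Reals.

(** The certificate is read off the algorithm for one [n] that is large enough for [k] layers. *)
Theorem rand_good_root P k t : 0 < k -> little_o_root k t -> rand_local_solves P t -> good (enc_lcl P) k 0.
Proof.
move=> hk ho [S [M [h [A HA]]]]; set m := enc_lcl P; pose q := (2 * size (nfL m)).+1.
have [n hn] := little_o_large (2 * cs0 P * (mD m).+1 * q) (cs1 P) hk ho.
apply: (@rand_good P n (S n) (M n) (A n) (t n) (h n) q) => //; first by move=> G inp; apply: HA.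
by rewrite /bnd; apply: leq_ltn_trans hn; rewrite [X in X * q <= _]mulnAC mulnAC.
Qed.

Lemma rootokX_mono m X Y : {subset X <= Y} -> rootokX m Y -> rootokX m X.
Proof.
move=> sub H; apply/allP => ic _; apply/allP => sc _; case V : (vnode _ _ _ _ _) => //=.
apply: (rootokX_elim H); move/vnodeP: V => [v1 v2 v3 v4]; apply/vnodeP; split=> // k hk; exact: sub (v4 k hk).
Qed.
Lemma cutX_mono m X Y Y' : {subset Y <= Y'} -> cutX m X Y -> cutX m X Y'.
Proof.
move=> sub H; apply/allP => k hk; apply/allP => r hr; have /allP/(_ k hk)/allP/(_ r hr) := H.
by case/hasP => s1 h1 /hasP[s2 h2 h3]; apply/hasP; exists s1; [apply: sub|apply/hasP; exists s2; rewrite ?sub].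
Qed.

Lemma lay_mono m k lp Xs i j : goodc m k lp Xs -> i <= j -> {subset lay Xs k i <= lay Xs k j}.
Proof.
move=> /and4P[_ _ /allP H _] /subnKC <-; elim: (j - i) => [|d IH] z hz; first by rewrite addn0.
have {IH hz}hz := IH z hz; rewrite addnS; have [lt|ge] := ltnP (i + d) k.
  by have /allP := H (i + d) ltac:(by rewrite mem_iota); apply.
by move: hz; rewrite /lay !ltnNge ge (leq_trans ge (leqnSn _)).
Qed.

(** A chain longer than the number of possible layers repeats one. The layer right after the first
    copy is contained in the second copy, so the repeated layer can be cut into itself. *)
Theorem good_subpoly m : (forall k, 0 < k -> good m k 0) -> good m 0 1.
Proof.
move=> H; pose UU := sublists (sublists (nfL m)); pose k := (size UU).+1.
have /hasP[c /listsnP[Xs [sX subX ->]]] := H k isT; rewrite encK => G.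
pose F (i : 'I_k) := index (nth 0 Xs i) UU.
have Flt i : F i < size UU by rewrite index_mem subX // mem_nth // sX ltnS ltnW.
have [I|] := boolP (injectiveb (fun i => Ordinal (Flt i))).
  by have := leq_card _ (injectiveP _ I); rewrite !card_ord ltnn.
move=> /injectivePn[i0 [j0 ne /(congr1 val) /= E0]].
wlog ij : i0 j0 ne E0 / i0 < j0 => [W|].
  by case: (ltngtP i0 j0) => [?|?|/val_inj E]; [exact: (W i0 j0)|apply: (W j0 i0); rewrite // eq_sym|rewrite E eqxx in ne].
have E : nth 0 Xs i0 = nth 0 Xs j0.
  have h1 : nth 0 Xs i0 \in UU by rewrite subX // mem_nth // sX ltnS ltnW.
  have h2 : nth 0 Xs j0 \in UU by rewrite subX // mem_nth // sX ltnS ltnW.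
  by rewrite -(nth_index 0 h1) -[index _ _]/(F i0) E0 nth_index.
have /and4P[/allP g1 /allP g2 _ g4] := G.
apply/hasP; exists (enc_list [:: nth 0 Xs i0]).
  apply/listsnP; exists [:: nth 0 Xs i0]; split=> // z; rewrite inE => /eqP->.
  by rewrite subX // mem_nth // sX ltnS ltnW.
have LE (i : 'I_k) : lay Xs k i = unl (nth 0 Xs i) by rewrite /lay ltn_ord.
have L1 i : lay [:: nth 0 Xs i0] 0 i = lay Xs k i0 by rewrite LE.
rewrite encK /goodc /= !L1 !andbT; apply/and3P; split.
- by apply: g1; rewrite mem_iota /=; have := ltn_ord i0; lia.
- apply: (@cutX_mono _ _ (lay Xs k i0.+1)); last by apply: g2; rewrite mem_iota /=; have := ltn_ord i0; lia.
  move=> z hz; have := lay_mono G ij hz; by rewrite !LE E.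
- by apply: rootokX_mono g4; apply: (lay_mono G); apply: ltnW.
Qed.

Theorem rand_good_class T P t : slow_class_ok T -> in_class T t -> rand_local_solves P t ->
  if T is LittleORoot k then good (enc_lcl P) k 0 else good (enc_lcl P) 0 1.
Proof.
case: T => [|k] ok ht R; last exact: rand_good_root R.
by apply: good_subpoly => k hk; apply: rand_good_root R => //; apply: subpoly_little_o.
Qed.

(** * Identifiers from random bits *)

Section Reals.
Open Scope R_scope.
Lemma Rpower_unbounded a B : 0 < a -> exists n1, forall n, (n1 <= n)%N -> (0 < n)%N /\ B <= Rpower (INR n) a.
Proof.
move=> a0; have [n1 [h1 n10]] := nat_above (exp (ln (Rmax B 1) / a)); exists n1 => n hn.
have n0 : (0 < n)%N by apply: leq_trans hn.
split=> //; have h2 := INR_leq hn; have B1 := Rmax_r B 1; have B0 := Rmax_l B 1.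
apply: Rle_trans B0 _; rewrite -[X in X <= _](exp_ln (Rmax B 1)); last lra.
have h3 : ln (Rmax B 1) / a <= ln (INR n).
  by rewrite -[X in X <= _]ln_exp; left; apply: ln_increasing; [apply: exp_pos|lra].
have h4 : ln (Rmax B 1) <= a * ln (INR n).
  by have := Rmult_le_compat_l a _ _ (Rlt_le _ _ a0) h3; rewrite /Rdiv; have -> : a * (ln (Rmax B 1) * / a) = ln (Rmax B 1) by field; lra.
by rewrite /Rpower; case: h4 => [h4|->]; [left; apply: exp_increasing|right].
Qed.

(** This leads from a deterministic algorithm in [f(T)] back to the hypothesis of the speedup, which
    makes the certificate a necessary condition. *)
Lemma f_class_in_class T t : slow_class_ok T -> in_f_class T t -> in_class T t.
Proof.
case: T => [_ [K [n0 H]]|k hk [K [n0 H]]] eps e0.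
  have e2 : 0 < eps / 2 by lra.
  have [n1 h1] := Rpower_unbounded (Rabs K * (2 / eps)) e2.
  exists (maxn n0 n1) => n hn; have [np hx] := h1 n (leq_trans (leq_maxr _ _) hn).
  have ht := H n (leq_trans (leq_maxl _ _) hn); have n0' := INR_ltn np; rewrite /= in n0'.
  have -> : Rpower (INR n) eps = Rpower (INR n) (eps / 2) * Rpower (INR n) (eps / 2).
    by rewrite -Rpower_plus; congr Rpower; lra.
  set y := Rpower (INR n) (eps / 2) in hx *; have y0 : 0 < y by apply: exp_pos.
  have l0 : 0 <= ln (INR n).
    by rewrite -ln_1; have h := INR_leq np; case: h => [h|<-]; [left; apply: ln_increasing => //; lra|right].
  have l1 : ln (INR n) <= 2 / eps * y.
    have E : ln y = eps / 2 * ln (INR n) by rewrite /y /Rpower ln_exp.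
    have ly : ln y < y.
      have := exp_ineq1_le (ln y); rewrite exp_ln //; lra.
    have -> : ln (INR n) = 2 / eps * ln y by rewrite E; field; lra.
    by apply: Rmult_le_compat_l; [left; apply: Rdiv_lt_0_compat; lra|lra].
  have kk := Rle_abs K; have ka := Rabs_pos K.
  apply: Rle_trans ht _; apply: Rle_trans (_ : Rabs K * ln (INR n) <= _); first by apply: Rmult_le_compat_r.
  apply: Rle_trans (_ : Rabs K * (2 / eps * y) <= _); first by apply: Rmult_le_compat_l.
  by rewrite -Rmult_assoc; apply: Rmult_le_compat_r => //; lra.
have k0 := INR_ltn hk; rewrite /= in k0.
have a0 : 0 < / INR (k * k.+1).
  by apply: Rinv_0_lt_compat; have := @INR_ltn 0 (k * k.+1) ltac:(by rewrite muln_gt0 hk).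
have [n1 h1] := Rpower_unbounded (Rabs K / eps) a0.
exists (maxn n0 n1) => n hn; have [np hx] := h1 n (leq_trans (leq_maxr _ _) hn).
have ht := H n (leq_trans (leq_maxl _ _) hn).
have -> : rpowk n k = rpowk n k.+1 * Rpower (INR n) (/ INR (k * k.+1)).
  rewrite /rpowk -Rpower_plus; congr Rpower; rewrite mult_INR S_INR; field; lra.
set y := Rpower _ _ in hx *; set x := rpowk _ _ in ht *; have x0 : 0 < x by apply: exp_pos.
have kk := Rle_abs K; apply: Rle_trans ht _.
have : Rabs K <= eps * y.
  have := Rmult_le_compat_l eps _ _ (Rlt_le _ _ e0) hx; by have -> : eps * (Rabs K / eps) = Rabs K by field; lra.
by nra.
Qed.
End Reals.

Definition bits_nat (s : seq bool) := foldr (fun (b : bool) a => b + 2 * a) 0 s.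
Lemma bits_lt s : bits_nat s < 2 ^ size s.
Proof. by elim: s => //= b s IH; rewrite expnS; case: b; lia. Qed.
Lemma bits_inj s s' : size s = size s' -> bits_nat s = bits_nat s' -> s = s'.
Proof.
elim: s s' => [|b s IH] [|b' s'] //= [E] E2.
have Eb : b = b' by move: E2; case: b; case: b'; rewrite //=; lia.
by subst b'; congr cons; apply: IH => //; lia.
Qed.

Section Collide.
Variables (T B : finType).
(** On the event, overwriting the value at [v] loses nothing, since it can be read at [u]. *)
Lemma collide (u v : T) : u != v -> #|[set x : {ffun T -> B} | x u == x v]| * #|B| <= #|[set: {ffun T -> B}]|.
Proof.
move=> uv; rewrite -[#|B|]cardsT -cardsX.
pose f (z : {ffun T -> B} * B) : {ffun T -> B} := [ffun w => if w == v then z.2 else z.1 w].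
rewrite -(@card_in_imset _ _ f); first by apply: subset_leq_card; apply/subsetP => z _; rewrite inE.
move=> [x b] [y c]; rewrite !inE /= !andbT => /eqP hx /eqP hy /ffunP E.
have bc : b = c by have := E v; rewrite !ffunE eqxx.
have Ew w : w != v -> x w = y w by move=> h; have := E w; rewrite !ffunE (negbTE h).
congr pair => //; apply/ffunP => w; have [->|h] := eqVneq w v; last exact: Ew.
by rewrite -hx -hy Ew.
Qed.
Lemma not_inj_card : #|[set x : {ffun T -> B} | ~~ injectiveb x]| * #|B| <= #|T| * #|T| * #|[set: {ffun T -> B}]|.
Proof.
apply: leq_trans (_ : (\sum_(p : T * T | p.1 != p.2) #|[set x : {ffun T -> B} | x p.1 == x p.2]|) * #|B| <= _).
  rewrite leq_mul2r; apply/orP; right.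
  apply: leq_trans (_ : #|\bigcup_(p : T * T | p.1 != p.2) [set x : {ffun T -> B} | x p.1 == x p.2]| <= _).
    apply: subset_leq_card; apply/subsetP => x; rewrite inE => /injectivePn[u [v uv E]].
    by apply/bigcupP; exists (u, v); rewrite // inE E.
  elim/big_rec2: _ => [|p s X _ IH]; first by rewrite cards0.
  by apply: leq_trans (leq_card_setU _ _) _; rewrite leq_add2l.
rewrite big_distrl /=; apply: leq_trans (_ : \sum_(p : T * T | p.1 != p.2) #|[set: {ffun T -> B}]| <= _).
  by apply: leq_sum => p; apply: collide.
by rewrite sum_nat_const leq_mul2r; apply/orP; right; rewrite -card_prod max_card.
Qed.
End Collide.

(** With exponent 4, rounding the number of identifiers down to a power of two leaves at least
    [n ^ 3] of them for [n >= 2]. The pairs of nodes number at most [n ^ 2], so a collision has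
    probability at most 1/n. *)
Theorem det_rand P t : det_congest_solves P 4 t -> rand_local_solves P t.
Proof.
move=> [S [A [B HA]]]; pose h n := trunc_log 2 (n ^ 4).
pose A' n : mp_alg (seq bool * seq nat) (S n) nat := MPAlg (fun i => a_init (A n) (bits_nat i.1, i.2)) (a_send (A n)) (a_recv (A n)) (a_out (A n)).
exists S, (fun _ => nat), h, A' => n G inp hn VI.
pose info (rb : {ffun 'I_(gN G) -> (h n).-tuple bool}) v := (val (rb v), inputs_of G inp v).
have [p hp] := ex_filter (fun rb => valid_output P G inp (output (A' n) G (info rb) (t n))) (enum {ffun 'I_(gN G) -> (h n).-tuple bool}).
exists [set rb | p rb]; split.
  by move=> rb; rewrite inE; apply: hp; rewrite mem_enum.
have n0 : 0 < n by case: VI => -[N0 _ _ _] _ _; apply: leq_trans hn.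
have R rb s v : run (A' n) G (info rb) s v = run (A n) G (fun v => (bits_nat (rb v), inputs_of G inp v)) s v.
  elim: s v => //= s IH v; rewrite IH; congr a_recv; apply/eq_in_map => u _; by rewrite IH.
have inj_ok (rb : {ffun 'I_(gN G) -> (h n).-tuple bool}) : injectiveb rb -> p rb.
  move=> /injectiveP I; apply/hp; first by rewrite mem_enum.
  have [||_ V] := HA n G inp (fun v => bits_nat (rb v)) hn VI.
  - by move=> u v /bits_inj E; apply: I; apply: val_inj; apply: E; rewrite !size_tuple.
  - move=> v; apply: leq_trans (bits_lt _) _; rewrite size_tuple; apply: trunc_logP => //; by rewrite expn_gt0 n0.
  have -> // : output (A' n) G (info rb) (t n) = output (A n) G (fun v => (bits_nat (rb v), inputs_of G inp v)) (t n).
  by apply: functional_extensionality => v; apply: functional_extensionality => w; rewrite /output R.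
pose Om := {ffun 'I_(gN G) -> (h n).-tuple bool}.
have O0 : 0 < #|[set: Om]| by apply: Om_gt0.
have key : #|~: [set rb : Om | p rb]| * n <= #|[set: Om]|.
  have s1 : #|~: [set rb : Om | p rb]| <= #|[set rb : Om | ~~ injectiveb rb]|.
    by apply: subset_leq_card; apply/subsetP => rb; rewrite !inE; apply: contraNN; apply: inj_ok.
  have := @not_inj_card 'I_(gN G) ((h n).-tuple bool); rewrite card_ord card_tuple card_bool.
  have [n1|n1] := leqP n 1.
    move=> _; have E1 : n = 1 by lia.
    by rewrite [X in _ * X]E1 muln1 subset_leq_card // subsetT.
  have h3 : n ^ 3 <= 2 ^ h n.
    have : n ^ 4 < 2 ^ (h n).+1 by apply: trunc_log_ltn.
    rewrite !expnS; nia.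
  have gn : gN G * gN G <= n * n by apply: leq_mul.
  move: s1 O0 h3 gn n0; set a := #|~: _|; set b := #|[set rb | _]|; set o := #|[set: _]|; set e := 2 ^ h n; set g := gN G * gN G.
  clear=> s1 o0 h3 gn n0 H.
  have i1 : a * n ^ 3 <= n * n * o.
    apply: leq_trans (_ : b * e <= _); first by apply: leq_mul.
    by apply: leq_trans H _; rewrite leq_mul2r gn orbT.
  have nn : 0 < n * n by rewrite muln_gt0 n0.
  rewrite -(leq_pmul2l nn); apply: leq_trans i1; rewrite !expnS expn0 muln1; apply: eq_leq; lia.
have c := cardsC [set rb : Om | p rb].
have n0' : (0 < n%:R :> rat)%R by rewrite Num.Theory.ltr0n.
have O0' : (0 < #|{: Om}|%:R :> rat)%R by rewrite Num.Theory.ltr0n -cardsT.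
rewrite Num.Theory.ler_pdivlMr //.
rewrite -(Num.Theory.ler_pM2l n0') GRing.mulrA GRing.mulrBr GRing.mulr1 GRing.divff ?Order.POrderTheory.gt_eqF //.
have -> : (n%:R - 1 = n.-1%:R :> rat)%R by rewrite -subn1 GRing.natrB.
rewrite -!GRing.natrM Num.Theory.ler_nat.
move: key c; rewrite cardsT; set a := #|~: _|; set b := #|[set rb | _]|; set o := #|_|.
move=> key c; have : a + b = o by rewrite addnC.
have ar : forall a b o n, 0 < n -> a * n <= o -> a + b = o -> n.-1 * o <= n * b by clear => a b o [|n] //= _; nia.
exact: ar.
Qed.

(** * Parameters and round complexity *)

Definition kcls T := if T is LittleORoot k then k else 0.
Definition lcls T := if T is LittleORoot k then 0 else 1.
(** The root of [n] of order [k + 1], rounded up and at least 1. *)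
Definition kroot k n := (find (fun r => n <= r.+1 ^ k.+1) (iota 0 n)).+1.
(** A chain with [k] cuts allows [k] compress phases, which balance at about n^(1/(k+1)) rake passes
    each. A layer that is cut into itself allows any number of phases, so logarithmically many with
    a constant number of rake passes suffice. *)
Definition Kpar T n := if T is LittleORoot k then k else (trunc_log 2 n).+1.
Definition rpar T n := if T is LittleORoot k then kroot k n else 2.

Lemma kroot_spec k n : [/\ n <= kroot k n ^ k.+1, kroot k n <= n.+1 & (kroot k n).-1 = 0 \/ (kroot k n).-1 ^ k.+1 < n].
Proof.
rewrite /kroot; set p := fun r => _; have sz := find_size p (iota 0 n); rewrite size_iota in sz.
split=> //.
  case: n @p sz => // n p sz; have hs : has p (iota 0 n.+1).
    by apply/hasP; exists n; [rewrite mem_iota /= add0n|rewrite /p expnS leq_pmulr // expn_gt0].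
  by have := nth_find 0 hs; rewrite nth_iota // -[X in _ < X](size_iota 0) -has_find.
rewrite -pred_Sn; case E : (find p (iota 0 n)) => [|f]; [by left|right].
have h : f < find p (iota 0 n) by rewrite E.
have := before_find 0 h; rewrite nth_iota; last by apply: leq_trans h sz.
by rewrite /p /= => /negbT; rewrite -ltnNge.
Qed.

Section Params.
Variable T : slow_class.
Lemma rpar_gt0 n : 0 < rpar T n. Proof. by case: T. Qed.
Lemma param_reach n : n < rpar T n ^ Kpar T n * (2 * rpar T n).+1.
Proof.
case: T => [|k] /=.
  have h : n < 2 ^ (trunc_log 2 n).+1 by apply: trunc_log_ltn.
  by apply: leq_trans h _; rewrite leq_pmulr.
have [h1 _ _] := kroot_spec k n; have h2 : 0 < kroot k n ^ k by rewrite expn_gt0.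
move: h1; rewrite expnSr; nia.
Qed.
Lemma param_poly m : exists e, forall n, tup m (2 * rpar T n) (Kpar T n) + Kpar T n < n.+2 ^ e.
Proof.
pose a := (kcls T).+1; exists (a + 3 + palette m + 2) => n; set N := n.+2.
have N2 : 2 <= N by [].
have pw x : x <= N ^ x.
  by apply: leq_trans (ltnW (ltn_expl x (isT : 1 < 2))) _; case: x => // x; rewrite leq_exp2r.
have mono x y : x <= y -> N ^ x <= N ^ y by move=> h; rewrite leq_exp2l.
have hK : Kpar T n <= N ^ a.
  rewrite /a; case: (T) => [|k] /=; last by apply: leq_trans (pw k) (mono _ _ (leqnSn _)).
  rewrite expn1 /N ltnS; case: n {N N2 pw mono} => // n; apply: ltnW; apply: leq_trans (_ : trunc_log 2 n.+1 < n.+2) _ => //.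
  rewrite ltnS; apply: leq_trans (_ : 2 ^ trunc_log 2 n.+1 <= _); first by apply: ltnW; apply: ltn_expl.
  by apply: trunc_logP.
have hr : (2 * rpar T n).+1 <= N ^ 3.
  have : rpar T n <= N by case: (T) => [|k] //=; have [_ h _] := kroot_spec k n; apply: leq_trans h _.
  rewrite !expnS expn0 muln1; nia.
have p1 : Kpar T n * (2 * rpar T n).+1 * palette m <= N ^ (a + 3 + palette m).
  by rewrite !expnD; apply: leq_mul (pw _); apply: leq_mul.
have p2 : 2 * rpar T n * palette m <= N ^ (a + 3 + palette m).
  apply: leq_trans (_ : N ^ (3 + palette m) <= _); last by apply: mono; lia.
  by rewrite expnD; apply: leq_mul (pw _); apply: ltnW.
have p3 : Kpar T n <= N ^ (a + 3 + palette m) by apply: leq_trans hK _; apply: mono; lia.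
have X0 : 0 < N ^ (a + 3 + palette m) by rewrite expn_gt0.
rewrite /tup mulnDl expnD; move: p1 p2 p3 X0.
generalize (Kpar T n * (2 * rpar T n).+1 * palette m) (2 * rpar T n * palette m) (Kpar T n) (N ^ (a + 3 + palette m)).
have : 4 <= N ^ 2 by rewrite expnS expn1; nia.
clear; generalize (N ^ 2) => M h x y z w h1 h2 h3 h4.
by apply: leq_trans (_ : w * 4 <= _); [lia|rewrite leq_mul2l h orbT].
Qed.

Section Reals.
Open Scope R_scope.
(** The factor 2 comes from ln 2 > 1/2. *)
Lemma trunc_log_ln n : (0 < n)%N -> INR (trunc_log 2 n) <= 2 * ln (INR n).
Proof.
move=> n0; have h : (2 ^ trunc_log 2 n <= n)%N by apply: trunc_logP.
have := INR_leq h; rewrite INR_expn -[INR 2]/(1 + 1) => h1.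
have p0 : 0 < (1 + 1) ^ trunc_log 2 n by apply: pow_lt; lra.
have h2 : ln ((1 + 1) ^ trunc_log 2 n) <= ln (INR n).
  by case: h1 => [h1|<-]; [left; apply: ln_increasing|right].
have l2 := ln_lt_2; move: h2; rewrite ln_pow; last lra.
have := pos_INR (trunc_log 2 n); have -> : (1 + 1 = 2) by lra.
by nra.
Qed.

Lemma rounds_class m c : slow_class_ok T -> in_f_class T (fun n => rounds m (2 * rpar T n) (Kpar T n) c n).
Proof.
pose a := INR (ellm m * (c * (palette m).+1)); pose b := INR (ellm m * (2 * palette m)).
have E n : INR (rounds m (2 * rpar T n) (Kpar T n) c n) =
   a * (INR (trunc_log 2 n) + 1) + b * (INR (Kpar T n) * (2 * INR (rpar T n) + 1) + 2 * INR (rpar T n)) + 1.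
  have gen el pa lo K r : INR (el * (c * lo.+1 * pa.+1 + 2 * ((K * (2 * r).+1 + 2 * r) * pa))).+1 =
     INR (el * (c * pa.+1)) * (INR lo + 1) + INR (el * (2 * pa)) * (INR K * (2 * INR r + 1) + 2 * INR r) + 1.
    by rewrite !(S_INR, mult_INR, plus_INR) -[INR 0]/0; ring.
  exact: gen.
have a0 : 0 <= a by apply: pos_INR.
have b0 : 0 <= b by apply: pos_INR.
move: E; case: (T) => [|k] E hk.
  have {}E n : INR (rounds m (2 * rpar SubPoly n) (Kpar SubPoly n) c n) = a * (INR (trunc_log 2 n) + 1) +
    b * (INR (trunc_log 2 n).+1 * (2 * INR 2 + 1) + 2 * INR 2) + 1 by exact: E.
  exists (3 * a + b * 19 + 1), 3%N => n hn; rewrite E.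
  have n0 : (0 < n)%N by apply: leq_trans hn.
  have hl := trunc_log_ln n0.
  have l1 : 1 <= ln (INR n).
    have h3 := INR_leq hn; have e3 := exp_le_3; rewrite -[X in X <= _]ln_exp.
    have h4 : exp 1 <= INR n by move: h3; rewrite /=; lra.
    by case: h4 => [h4|->]; [left; apply: ln_increasing => //; apply: exp_pos|right].
  set L := ln (INR n) in hl l1 *; set t := INR (trunc_log 2 n) in hl *.
  have -> : INR (trunc_log 2 n).+1 = t + 1 by rewrite S_INR.
  have -> : INR 2 = 2 by [].
  have h1 : a * (t + 1) <= a * (3 * L) by apply: Rmult_le_compat_l => //; lra.
  have h2 : b * ((t + 1) * (2 * 2 + 1) + 2 * 2) <= b * (19 * L) by apply: Rmult_le_compat_l => //; lra.
  by rewrite -/t; lra.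
have {}E n : INR (rounds m (2 * rpar (LittleORoot k) n) (Kpar (LittleORoot k) n) c n) = a * (INR (trunc_log 2 n) + 1) +
  b * (INR k * (2 * INR (kroot k n) + 1) + 2 * INR (kroot k n)) + 1 by exact: E.
exists (a * (2 * INR k.+1 + 1) + b * (INR k * 5 + 4) + 1), 1%N => n hn; rewrite E.
have x0 : 0 < rpowk n k.+1 by apply: exp_pos.
have xp := @Rpower_inv_pow n k.+1 hn isT; set x := rpowk n k.+1 in x0 xp *.
have nR := INR_leq hn; rewrite [INR 1]/= in nR.
have x1 : 1 <= x.
  apply: Rnot_lt_le => hlt; have : x ^ k.+1 < 1.
    have xk : x ^ k <= 1 by rewrite -(pow1 k); apply: pow_incr; lra.
    have xk0 : 0 < x ^ k by apply: pow_lt.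
    by rewrite /=; nra.
  by rewrite xp; lra.
have [_ _ kr] := kroot_spec k n.
have hr : INR (kroot k n) <= 2 * x.
  have -> : INR (kroot k n) = INR (kroot k n).-1 + 1 by rewrite -S_INR prednK.
  suff : INR (kroot k n).-1 <= x by lra.
  case: kr => [->|kr]; first by rewrite /=; lra.
  apply: Rnot_lt_le => hlt; have := INR_ltn kr; rewrite INR_expn -xp.
  have : x ^ k.+1 <= INR (kroot k n).-1 ^ k.+1 by apply: pow_incr; lra.
  by lra.
(* The logarithmic colouring time is absorbed: ln n is [k + 1] times ln x, and ln x <= x. *)
have hl : INR (trunc_log 2 n) <= 2 * (INR k.+1 * x).
  apply: Rle_trans (trunc_log_ln hn) _; apply: Rmult_le_compat_l; first lra.
  rewrite -xp ln_pow //; apply: Rmult_le_compat_l; first exact: pos_INR.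
  have := exp_ineq1_le (ln x); rewrite exp_ln //; lra.
have k0 := pos_INR k.
have h1 : a * (INR (trunc_log 2 n) + 1) <= a * ((2 * INR k.+1 + 1) * x).
  by apply: Rmult_le_compat_l => //; lra.
have h2 : b * (INR k * (2 * INR (kroot k n) + 1) + 2 * INR (kroot k n)) <= b * ((INR k * 5 + 4) * x).
  apply: Rmult_le_compat_l => //.
  have : INR k * (2 * INR (kroot k n) + 1) <= INR k * (5 * x) by apply: Rmult_le_compat_l => //; lra.
  by lra.
by lra.
Qed.
End Reals.

(** The checks of [goodc] stop at index [k], but [lay] is constant from there on. For a chain with
    [lcls T = 1] the single check at layer 0 thus provides the cuts of all phases. *)
Lemma goodc_layers m Xs (k := kcls T) : goodc m k (lcls T) Xs ->
  [/\ forall i, closedX m (lay Xs k i), forall i j, i <= j -> {subset lay Xs k i <= lay Xs k j},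
   forall n i, i < Kpar T n -> cutX m (lay Xs k i) (lay Xs k i.+1) & forall i, rootokX m (lay Xs k i)].
Proof.
move=> G; have /and4P[/allP g1 /allP g2 _ g4] := G.
have big i : k <= i -> lay Xs k i = lay Xs k k by move=> h; rewrite /lay ltnn ltnNge h.
split.
- move=> i; have [h|h] := leqP i k; first by apply: g1; rewrite mem_iota.
  by rewrite big; [apply: g1; rewrite mem_iota /=|apply: ltnW].
- by move=> i j; apply: (lay_mono G).
- move: g2; rewrite /k; clear; case: (T) => [|k'] /= H n i hi; first exact: (H 0 isT).
  by apply: H; rewrite mem_iota /= addn0.
- move=> i; have [h|h] := leqP i k; first by apply: rootokX_mono g4; apply: (lay_mono G).
  by rewrite big // ltnW.
Qed.
End Params.

(** Needed because the output of the algorithm is known on half-edges only, not on all pairs of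
    nodes. *)
Lemma valid_output_ext P G (inp out out' : labeling G) :
  (forall v w, w \in gadj G v -> out v w = out' v w) -> valid_output P G inp out -> valid_output P G inp out'.
Proof.
move=> H [h1 h2]; split=> [u v A|v]; first by rewrite -H //; apply: h1.
have [C c1 [f [f1 f2 f3 f4 f5]]] := h2 v; exists C => //; exists f; split=> // w w' hw hw'.
by rewrite f5 //; case: ifP => // A; rewrite H.
Qed.

Theorem good_det T P Xs c : slow_class_ok T -> goodc (enc_lcl P) (kcls T) (lcls T) Xs ->
  let m := enc_lcl P in
  det_congest_with P c (fun n => rounds m (2 * rpar T n) (Kpar T n) c n) (fun _ => nat)
    (fun n => palg m Xs (kcls T) (2 * rpar T n) (Kpar T n) c n).
Proof.
move=> ok G m; have [g1 g2 g3 g4] := goodc_layers G; have [e he] := param_poly T m.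
exists (Bcore m c e Xs) => n G' inp id hn [HT HD HI] Iid Hid info.
have HD' : max_deg_le G' (mD m) by move: HD; rewrite /mD fldE.
have HI' : forall u v, adjb G' u v -> inp u v < mIn m by move: HI; rewrite /mIn fldE.
have [h1 [x [h2 h3]]] := congest_core g1 g2 g3 g4 (rpar_gt0 T) (param_reach T) he hn HT HD' HI' Iid Hid.
split; first exact: h1.
apply: (valid_output_ext _ (valid_of_nfsol HT HD h2)) => v w hw; by rewrite h3.
Qed.

(** * The program *)

Section R1.
Context {A : Type} {EA : Enc A}.
Lemma c_upat (m : A -> nat) (Xs : A -> seq nat) (k gam s r : A -> nat) (B : A -> seq nat) :
  Comp m -> Comp Xs -> Comp k -> Comp gam -> Comp s -> Comp r -> Comp B ->
  Comp (fun a => upat (m a) (Xs a) (k a) (gam a) (s a) (r a) (B a)).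
Proof. by move=> H K K2 K3 K4 K5 K6; compu upat. Qed.
Lemma c_tcol (m c n : A -> nat) : Comp m -> Comp c -> Comp n -> Comp (fun a => tcol (m a) (c a) (n a)).
Proof. by move=> H K K2; compu tcol. Qed.
Lemma c_tup (m c n : A -> nat) : Comp m -> Comp c -> Comp n -> Comp (fun a => tup (m a) (c a) (n a)).
Proof. by move=> H K K2; compu tup. Qed.
Lemma c_firstrec (m w ms : A -> nat) : Comp m -> Comp w -> Comp ms -> Comp (fun a => firstrec (m a) (w a) (ms a)).
Proof. by move=> H K K2; compu firstrec => //; weak H. Qed.
End R1.
Ltac comp_user21 := fail.
Ltac comp_user20 ::= lazymatch goal with
 | |- Comp (fun a => upat (@?f a) (@?g a) (@?h a) (@?i a) (@?j a) (@?k a) (@?l a)) => apply (@c_upat _ _ f g h i j k l)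
 | |- Comp (fun a => tcol (@?f a) (@?g a) (@?h a)) => apply (@c_tcol _ _ f g h)
 | |- Comp (fun a => tup (@?f a) (@?g a) (@?h a)) => apply (@c_tup _ _ f g h)
 | |- Comp (fun a => firstrec (@?f a) (@?g a) (@?h a)) => apply (@c_firstrec _ _ f g h)
 | _ => comp_user21
 end.
Section R2.
Context {A : Type} {EA : Enc A}.
Lemma c_phi (m : A -> nat) (Xs : A -> seq nat) (k gam K c n tau r : A -> nat) (B : A -> seq nat) :
  Comp m -> Comp Xs -> Comp k -> Comp gam -> Comp K -> Comp c -> Comp n -> Comp tau -> Comp r -> Comp B ->
  Comp (fun a => phi (m a) (Xs a) (k a) (gam a) (K a) (c a) (n a) (tau a) (r a) (B a)).
Proof. by move=> *; compu phi. Qed.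
Lemma c_kroot (k n : A -> nat) : Comp k -> Comp n -> Comp (fun a => kroot (k a) (n a)).
Proof. by move=> H K; compu kroot => //; [weak K|weak H]. Qed.
End R2.
Ltac comp_user22 := fail.
Ltac comp_user21 ::= lazymatch goal with
 | |- Comp (fun a => phi (@?f a) (@?g a) (@?h a) (@?i a) (@?j a) (@?k a) (@?l a) (@?m a) (@?n a) (@?o a)) =>
   apply (@c_phi _ _ f g h i j k l m n o)
 | |- Comp (fun a => kroot (@?f a) (@?g a)) => apply (@c_kroot _ _ f g)
 | _ => comp_user22
 end.
Section R3.
Context {A : Type} {EA : Enc A}.
Lemma c_arecv (m : A -> nat) (Xs : A -> seq nat) (k gam K c n st ms : A -> nat) :
  Comp m -> Comp Xs -> Comp k -> Comp gam -> Comp K -> Comp c -> Comp n -> Comp st -> Comp ms ->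
  Comp (fun a => arecv (m a) (Xs a) (k a) (gam a) (K a) (c a) (n a) (st a) (ms a)).
Proof. by move=> *; compu arecv. Qed.
Lemma c_ainit (f g : A -> nat) : Comp f -> Comp g -> Comp (fun a => ainit (f a) (g a)).
Proof. by move=> H K; compu ainit. Qed.
Lemma c_asend (f g : A -> nat) : Comp f -> Comp g -> Comp (fun a => asend (f a) (g a)).
Proof. by move=> H K; compu asend. Qed.
Lemma c_aout (f g : A -> nat) : Comp f -> Comp g -> Comp (fun a => aout (f a) (g a)).
Proof. by move=> H K; compu aout. Qed.
Lemma c_rounds (m gam K c n : A -> nat) : Comp m -> Comp gam -> Comp K -> Comp c -> Comp n ->
  Comp (fun a => rounds (m a) (gam a) (K a) (c a) (n a)).
Proof. by move=> *; compu rounds. Qed.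
Lemma c_Kpar T (n : A -> nat) : Comp n -> Comp (fun a => Kpar T (n a)).
Proof. by move=> H; case: T => [|k]; rewrite /Kpar; comp. Qed.
Lemma c_rpar T (n : A -> nat) : Comp n -> Comp (fun a => rpar T (n a)).
Proof. by move=> H; case: T => [|k]; rewrite /rpar; comp. Qed.
End R3.
Ltac comp_user23 := fail.
Ltac comp_user22 ::= lazymatch goal with
 | |- Comp (fun a => arecv (@?f a) (@?g a) (@?h a) (@?i a) (@?j a) (@?k a) (@?l a) (@?m a) (@?n a)) =>
   apply (@c_arecv _ _ f g h i j k l m n)
 | |- Comp (fun a => ainit (@?f a) (@?g a)) => apply (@c_ainit _ _ f g)
 | |- Comp (fun a => asend (@?f a) (@?g a)) => apply (@c_asend _ _ f g)
 | |- Comp (fun a => aout (@?f a) (@?g a)) => apply (@c_aout _ _ f g)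
 | |- Comp (fun a => rounds (@?f a) (@?g a) (@?h a) (@?i a) (@?j a)) => apply (@c_rounds _ _ f g h i j)
 | |- Comp (fun a => Kpar ?T (@?f a)) => apply (@c_Kpar _ _ T f)
 | |- Comp (fun a => rpar ?T (@?f a)) => apply (@c_rpar _ _ T f)
 | _ => comp_user23
 end.

(** The certificate is found anew by search in each receive step, so one code serves all problems
    and takes only the description as additional argument. *)
Definition prog T m c n op x y :=
  if op == 0 then ainit x y
  else if op == 1 then asend x y
  else if op == 2 then arecv m (thecert m (kcls T) (lcls T)) (kcls T) (2 * rpar T n) (Kpar T n) c n x y
  else if op == 3 then aout x y
  else rounds m (2 * rpar T n) (Kpar T n) c n.

Lemma c_prog T : Comp (fun a : nat * nat * nat * nat * nat * nat => prog T a.1.1.1.1.1 a.1.1.1.1.2 a.1.1.1.2 a.1.1.2 a.1.2 a.2).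
Proof. by compu prog. Qed.

Lemma prog_code T : exists p : code, forall m xs,
  computes p (m :: xs) (prog T m (nth 0 xs 0) (nth 0 xs 1) (nth 0 xs 2) (nth 0 xs 3) (nth 0 xs 4)).
Proof.
have [d H] := c_prog T.
pose pr a b := CComp cpair [:: a; b].
exists (CComp d [:: pr (pr (pr (pr (pr (CProj 0) (CProj 1)) (CProj 2)) (CProj 3)) (CProj 4)) (CProj 5)]) => m xs.
have P a b ys x y : computes a ys x -> computes b ys y -> computes (pr a b) ys (npair x y).
  by move=> h1 h2; apply: cp_comp2 h1 h2 (cp_pair _ _).
apply: cp_comp1 (H (m, nth 0 xs 0, nth 0 xs 1, nth 0 xs 2, nth 0 xs 3, nth 0 xs 4)).
by repeat first [exact: (cp_proj 0)|exact: cp_proj|apply: (P)].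
Qed.

Lemma good_code T : exists d : code, forall m, computes d [:: m] (good m (kcls T) (lcls T) : nat).
Proof.
have [d H] : Comp (fun m : nat => good m (kcls T) (lcls T)) by comp.
by exists d => m; exact: H.
Qed.

Lemma thecertP m k lp : good m k lp -> goodc m k lp (thecert m k lp).
Proof. by move=> h; apply: (nth_find 0 h). Qed.

Lemma rand_good_cls T P t : slow_class_ok T -> in_class T t -> rand_local_solves P t ->
  good (enc_lcl P) (kcls T) (lcls T).
Proof. by move=> ok ht R; have := rand_good_class ok ht R; case: (T). Qed.

(** The exponent 4 is what [det_rand] needs on the way to a certificate; from the certificate,
    algorithms for all exponents follow. *)
Lemma det_good T P : slow_class_ok T -> det_congest_fT T P <-> good (enc_lcl P) (kcls T) (lcls T).
Proof.
move=> ok; split=> [/(_ 4 isT)[t [h1 h2]]|G c _].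
  exact: (rand_good_cls ok (f_class_in_class ok h1) (det_rand h2)).
exists (fun n => rounds (enc_lcl P) (2 * rpar T n) (Kpar T n) c n); split; first exact: rounds_class.
exists (fun _ => nat); eexists; exact: (good_det c ok (thecertP G)).
Qed.

Theorem mainTheorem1 :
  forall T : slow_class, slow_class_ok T ->
  [/\
   (* speedup: randomized LOCAL in T rounds  ==>  deterministic CONGEST in f(T) *)
   (forall P : LCL, wf_lcl P ->
      (exists t, in_class T t /\ rand_local_solves P t) ->
      det_congest_fT T P),
   (* decidability of "deterministic CONGEST in f(T)" from the description *)
   (exists d : code, forall P : LCL, wf_lcl P ->
      exists b, computes d [:: enc_lcl P] b /\ (b = 1 <-> det_congest_fT T P)) &
   (* an algorithm can be computed from the description *)
   (exists p : code, forall P : LCL, wf_lcl P -> det_congest_fT T P ->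
      exists g : seq nat -> nat,
        (forall xs, computes p (enc_lcl P :: xs) (g xs)) /\
        forall c, 0 < c ->
          in_f_class T (prog_rounds g c) /\
          det_congest_with P c (prog_rounds g c) (fun _ => nat)
            (fun n => prog_alg g c n))].
Proof.
move=> T ok; split.
- by move=> P _ [t [h1 h2]]; apply/det_good => //; apply: rand_good_cls ok h1 h2.
- have [d hd] := good_code T; exists d => P _; exists (good (enc_lcl P) (kcls T) (lcls T)); split; first exact: hd.
  by split=> [|/det_good-> //]; first case G : (good _ _ _) => // _; apply/det_good.
have [p hp] := prog_code T; exists p => P _ /det_good G.
exists (fun xs => prog T (enc_lcl P) (nth 0 xs 0) (nth 0 xs 1) (nth 0 xs 2) (nth 0 xs 3) (nth 0 xs 4)).
split=> [xs|c _]; first exact: hp.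
split; first exact: rounds_class.
exact: (good_det c ok (thecertP (G ok))).
Qed.
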